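(* Let $0<q<1$, $z_-<0<z_+$, and let $(c,d)$ satisfy one of the positivity conditions listed in the context. Then the set $\{P_n\}_{n\in\mathbb N}\cup\{Q_n\}_{n\in\mathbb Z}$ is an orthogonal basis of the Hilbert space $\mathcal H$. In particular, the following orthogonality relations hold. For $m,n\in\mathbb N$, $$\frac{1}{1-q}\int_{\mathbb R_q}P_m(x)P_n(x)\frac{1}{(cx,dx;q)_\infty}\,d_qx=\delta_{mn}\,(q;q)_n(cd)^nq^{-n^2}\,\frac{z_+\,(q;q)_\infty\,\theta(z_-/z_+,cdz_-z_+;q)}{\theta(cz_-,dz_-,cz_+,dz_+;q)};$$ for $m,n\in\mathbb Z$, $$\frac{1}{1-q}\int_{\mathbb R_q}Q_m(x)Q_n(x)\frac{1}{(cx,dx;q)_\infty}\,d_qx=\delta_{mn}\,\frac{(cdz_-z_+q^{-n-1};q)_\infty}{(-z_-z_+)^nq^{\frac12n(n+1)}}\,z_+\,(q;q)_\infty^2\,\theta(z_-/z_+;q);$$ and for $m\in\mathbb N$, $n\in\mathbb Z$, $$\frac{1}{1-q}\int_{\mathbb R_q}P_m(x)Q_n(x)\frac{1}{(cx,dx;q)_\infty}\,d_qx=0.$$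
   Context: $\mathbb N=\{0,1,2,\dots\}$. Notation: $(x;q)_n=\prod_{j=0}^{n-1}(1-xq^j)$, $(x;q)_\infty=\prod_{j\ge 0}(1-xq^j)$, $\theta(x;q)=(x;q)_\infty(q/x;q)_\infty$ for $x\ne0$; several arguments separated by commas denote a product. The confluent $q$-hypergeometric function is $${}_1\varphi_1(a;b;q,z)=\sum_{k\ge0}\frac{(a;q)_k}{(b;q)_k(q;q)_k}(-1)^kq^{\frac12k(k-1)}z^k.$$ $\mathbb R_q=z_-q^{\mathbb Z}\cup z_+q^{\mathbb Z}$, with Jackson $q$-integral $$\int_{\mathbb R_q}f(x)\,d_qx=(1-q)\sum_{k=-\infty}^{\infty}\Big(f(z_+q^k)z_+q^k-f(z_-q^k)z_-q^k\Big).$$ Positivity conditions on $(c,d)$ (one of the following holds; they ensure $\frac{1}{(cx,dx;q)_\infty}>0$ for all $x\in\mathbb R_q$): (1) $c\in\mathbb C\setminus\mathbb R$ and $c=\overline d$; (2) $c,d>0$ and there is $k\in\mathbb Z$ with $q^k<z_+c<q^{k-1}$ and $q^k<z_+d<q^{k-1}$; (3) $c,d<0$ and there is $k\in\mathbb Z$ with $q^k<z_-c<q^{k-1}$ and $q^k<z_-d<q^{k-1}$. $\mathcal H$ is the Hilbert space of functions $f:\mathbb R_q\to\mathbb C$ with finite norm for the inner product $\langle f,g\rangle=\int_{\mathbb R_q}f(x)\overline{g(x)}\frac{1}{(cx,dx;q)_\infty}\,d_qx$. For $n\in\mathbb N$, $$P_n(x)=(-c)^nq^{-\frac12n(n-1)}\sum_{k=0}^{n}\frac{(q^{-n};q)_k(cx;q)_k}{(q;q)_k}(-1)^kq^{-\frac12k(k-1)}\Big(\frac{dq^n}{c}\Big)^k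 ,$$ and for $n\in\mathbb Z$, $$Q_n(x)=(-d)^nq^{-\frac12n(n+1)}\frac{(cx;q)_\infty\,\theta(dz_-,dz_+;q)}{(q/dx,\;q^{n+1}x/dz_-z_+;q)_\infty}\;{}_1\varphi_1\!\left(\frac{q}{cx};\frac{dz_-z_+q^{-n}}{x};q,\frac{cz_-z_+q^{-n}}{x}\right),\qquad x\in\mathbb R_q.$$ Here $q/dx$ means $q/(dx)$, and $q^{n+1}x/dz_-z_+$ means $q^{n+1}x/(dz_-z_+)$. *)

(* Defs.v *)
(* Stdlib reals and Coquelicot (series, limits, complex numbers [C]). *)
From Stdlib Require Import Reals ZArith List.
From Coquelicot Require Import Coquelicot.

Open Scope R_scope.
Open Scope C_scope.

(* Total limit and sum of complex sequences, taken componentwise; as for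
   [Lim_seq] and [Series], the value is meaningful only under convergence. *)
Definition Clim (u : nat -> C) : C :=
  (real (Lim_seq (fun n => Re (u n))), real (Lim_seq (fun n => Im (u n)))).

Definition Cseries (a : nat -> C) : C :=
  (Series (fun k => Re (a k)), Series (fun k => Im (a k))).

Definition Cpowz (x : C) (n : Z) : C :=
  match n with
  | Z0 => 1
  | Zpos p => x ^ Pos.to_nat p
  | Zneg p => / x ^ Pos.to_nat p
  end.

Fixpoint qpoch (x : C) (q : R) (n : nat) : C :=
  match n with
  | O => 1
  | S m => qpoch x q m * (1 - x * q ^ m)
  end.

Definition qpoch_inf (x : C) (q : R) : C := Clim (fun n => qpoch x q n).

Definition theta (x : C) (q : R) : C := qpoch_inf x q * qpoch_inf (q / x) q.

(* In [powerRZ q (n * (n - 1) / 2)] and its variants below, the division in [Z]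
   is exact, including for negative [n]. *)

Definition phi11 (a b : C) (q : R) (z : C) : C :=
  Cseries (fun k : nat =>
    qpoch a q k / (qpoch b q k * qpoch q q k)
    * (-1) ^ k * powerRZ q (Z.of_nat k * (Z.of_nat k - 1) / 2) * z ^ k).

(* A function on R_q = zm q^Z \/ zp q^Z is represented by a function on R; all
   the notions below depend only on its values at the points of R_q. *)

Definition jackson_term (q zm zp : R) (f : R -> C) (k : Z) : C :=
  f (zp * powerRZ q k)%R * (zp * powerRZ q k)%R
  - f (zm * powerRZ q k)%R * (zm * powerRZ q k)%R.

(* Convergence of the sum over Z: both half-sums, over k >= 0 and over k < 0,
   converge. *)
Definition ex_jackson (q zm zp : R) (f : R -> C) : Prop :=
  ex_series (fun k : nat => jackson_term q zm zp f (Z.of_nat k)) /\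
  ex_series (fun k : nat => jackson_term q zm zp f (- Z.of_nat k - 1)).

Definition jackson (q zm zp : R) (f : R -> C) : C :=
  (1 - q) *
  (Cseries (fun k : nat => jackson_term q zm zp f (Z.of_nat k))
   + Cseries (fun k : nat => jackson_term q zm zp f (- Z.of_nat k - 1))).

Definition weight (q : R) (c d : C) (x : R) : C :=
  1 / (qpoch_inf (c * x) q * qpoch_inf (d * x) q).

Definition positivity (q zm zp : R) (c d : C) : Prop :=
  (Im c <> 0%R /\ c = Cconj d)
  \/ (exists c' d' : R, c = c' /\ d = d' /\ (0 < c')%R /\ (0 < d')%R /\
        exists k : Z,
          (powerRZ q k < zp * c' < powerRZ q (k - 1))%R /\
          (powerRZ q k < zp * d' < powerRZ q (k - 1))%R)
  \/ (exists c' d' : R, c = c' /\ d = d' /\ (c' < 0)%R /\ (d' < 0)%R /\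
        exists k : Z,
          (powerRZ q k < zm * c' < powerRZ q (k - 1))%R /\
          (powerRZ q k < zm * d' < powerRZ q (k - 1))%R).

Definition inner (q zm zp : R) (c d : C) (f g : R -> C) : C :=
  jackson q zm zp (fun x => f x * Cconj (g x) * weight q c d x).

(* Under [positivity] the terms of the series for <f, f> are nonnegative, so its
   convergence means that the norm of [f] is finite. *)
Definition inH (q zm zp : R) (c d : C) (f : R -> C) : Prop :=
  ex_jackson q zm zp (fun x => f x * Cconj (f x) * weight q c d x).

Definition normH (q zm zp : R) (c d : C) (f : R -> C) : R :=
  sqrt (Re (inner q zm zp c d f f)).

Definition lincomb {I : Type} (e : I -> R -> C) (l : list (C * I)) (x : R) : C :=
  fold_right (fun p s => fst p * e (snd p) x + s) 0 l.

(* Nonzero, pairwise orthogonal vectors of H whose linear span is dense. *)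
Definition orthogonal_basis (q zm zp : R) (c d : C) {I : Type}
    (e : I -> R -> C) : Prop :=
  (forall i : I, inH q zm zp c d (e i)) /\
  (forall i : I, inner q zm zp c d (e i) (e i) <> 0) /\
  (forall i j : I, i <> j -> inner q zm zp c d (e i) (e j) = 0) /\
  (forall f : R -> C, inH q zm zp c d f ->
     forall eps : R, (0 < eps)%R ->
     exists l : list (C * I),
       (normH q zm zp c d (fun x => (f x - lincomb e l x)%C) < eps)%R).

Definition P (q : R) (c d : C) (n : nat) (x : R) : C :=
  let N := Z.of_nat n in
  (- c) ^ n * powerRZ q (- (N * (N - 1) / 2)) *
  sum_n (fun k : nat =>
    let K := Z.of_nat k in
    qpoch (powerRZ q (- N)) q k * qpoch (c * x) q k / qpoch q q k
    * (-1) ^ k * powerRZ q (- (K * (K - 1) / 2)) * (d * q ^ n / c) ^ k) n.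

Definition Q (q zm zp : R) (c d : C) (n : Z) (x : R) : C :=
  Cpowz (- d) n * powerRZ q (- (n * (n + 1) / 2))
  * (qpoch_inf (c * x) q * (theta (d * zm) q * theta (d * zp) q)
     / (qpoch_inf (q / (d * x)) q
        * qpoch_inf (powerRZ q (n + 1) * x / (d * zm * zp)) q))
  * phi11 (q / (c * x)) (d * zm * zp * powerRZ q (- n) / x) q
      (c * zm * zp * powerRZ q (- n) / x).

Definition PQ (q zm zp : R) (c d : C) (i : nat + Z) : R -> C :=
  match i with
  | inl n => P q c d n
  | inr n => Q q zm zp c d n
  end.

(* Main.v *)
(* Up to scalars and the weight w, P_n and Q_n become p_n = sum_j (-cdx)^j q^(j(j-1)/2) r_(n-j) / (q;q)_j
   and a double theta-like series kappa_n, where r_n are the Rogers-Szego polynomials in c and d; both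
   are symmetric in c and d and satisfy three-term recurrences in n.
   Rows.  The relations for P_n follow from the q-binomial theorem once the total mass of the weight is
   known as a function of (c, d); that mass is found by expanding a product of two 1psi1 sums in one
   auxiliary variable.  The relation kappa_n(qx) = kappa_n(x) - x kappa_(n+1)(x) telescopes the sums
   <P_m, Q_n> and <Q_m, Q_n>: what is left at x = 0 is the same for both halves of R_q and cancels.
   Columns.  For x <> y in R_q the sums over n of P_n(x) P_n(y) / h_n and Q_n(x) Q_n(y) / h_n telescope by
   the recurrences (Christoffel-Darboux); their boundary terms at n = oo are proportional, with a factor
   independent of x and y, and cancel for the right choice of h.
   Conclusion.  When the rows are orthogonal with norms N_i, N_i / h_i is bounded and the columns are
   orthogonal with respect to 1 / h_i, comparison of the two gives N_i = m h_i with one constant m, and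
   Parseval's identity for point masses; this yields both the density and the norm of Q_n. *)

Require Import Defs.
From Stdlib Require Import Reals ZArith List Lra Lia Psatz.
From Stdlib Require Import Classical ClassicalEpsilon FunctionalExtensionality PropExtensionality Permutation.
From Coquelicot Require Import Coquelicot.

Open Scope R_scope.

(** Density is not drawn from a spectral theorem but from explicit sums over n at pairs of points,
    so both families have to be treated together: neither is complete alone. The norms of the P_n
    are computed; those of the Q_n are known from a recurrence only up to one common constant. This
    already bounds the quotients N_i / h_i, and the columns, which tie both families together at
    every point, then force the missing constant. The relative factor between the two parts of h is
    a product of four theta functions, because the leading coefficient of kappa_n as n -> oo is a
    truncated theta series times a full one. Two facts shape the asymptotics. Since c and d may be
    complex conjugates, everything is done over C, and reality is shown only at the end from c + d
    and c d. Since c = d is allowed, the growths c^n and d^n may collapse to c^n and n c^n, and then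
    derivatives of the theta identities enter. The sums run over Z, pairs of integers and disjoint
    unions, and are rearranged throughout; this is the reason for unordered summation. *)

Definition cdec {I : Type} (x y : I) : {x = y} + {x <> y} :=
  excluded_middle_informative (x = y).

Definition lsum {I : Type} (f : I -> R) (l : list I) : R :=
  fold_right (fun i s => f i + s) 0 l.

(* Unordered summation: Fubini and reindexing then hold over arbitrary index types. *)
Definition has_sum {I : Type} (f : I -> R) (s : R) : Prop :=
  forall eps, 0 < eps -> exists l0, forall l, NoDup l -> incl l0 l ->
    Rabs (lsum f l - s) < eps.

Definition summable {I : Type} (f : I -> R) : Prop := exists s, has_sum f s.

(** * Unordered sums *)

Section FiniteSums.
Context {I : Type}.
Implicit Types (f g : I -> R) (l : list I).

Lemma lsum_app f l1 l2 : lsum f (l1 ++ l2) = lsum f l1 + lsum f l2.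
Proof. induction l1; simpl; lra. Qed.

Lemma lsum_perm f l1 l2 : Permutation l1 l2 -> lsum f l1 = lsum f l2.
Proof. induction 1; simpl; lra. Qed.

Lemma lsum_ext_in f g l : (forall i, In i l -> f i = g i) -> lsum f l = lsum g l.
Proof.
  induction l as [|a l IH]; simpl; intros H; [reflexivity|].
  rewrite (H a), IH; auto.
Qed.

Lemma lsum_plus f g l : lsum (fun i => f i + g i) l = lsum f l + lsum g l.
Proof. induction l; simpl; lra. Qed.

Lemma lsum_scal a f l : lsum (fun i => a * f i) l = a * lsum f l.
Proof. induction l as [|b l IH]; simpl; [|rewrite IH]; ring. Qed.

Lemma lsum_le_in f g l : (forall i, In i l -> f i <= g i) -> lsum f l <= lsum g l.
Proof.
  induction l as [|a l IH]; simpl; intros H; [lra|].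
  apply Rplus_le_compat; auto.
Qed.

Lemma lsum_nonneg f l : (forall i, 0 <= f i) -> 0 <= lsum f l.
Proof. intros H; induction l as [|a l IH]; simpl; [|specialize (H a)]; lra. Qed.

Lemma lsum_abs f l : Rabs (lsum f l) <= lsum (fun i => Rabs (f i)) l.
Proof.
  induction l as [|a l IH]; simpl; [rewrite Rabs_R0; lra|].
  eapply Rle_trans; [apply Rabs_triang|lra].
Qed.

Lemma lsum_incl_le f l0 l : (forall i, 0 <= f i) -> NoDup l0 -> incl l0 l ->
  lsum f l0 <= lsum f l.
Proof.
  intros Hf Hn; revert l; induction Hn as [|a l0 Ha Hn IH]; intros l Hi.
  - apply lsum_nonneg; auto.
  - destruct (in_split a l) as [l1 [l2 ->]]; [apply Hi; now left|].
    rewrite lsum_app; simpl.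
    assert (lsum f l0 <= lsum f (l1 ++ l2)); [|rewrite lsum_app in *; lra].
    apply IH. intros x Hx.
    assert (Hx' := Hi x (or_intror Hx)).
    apply in_app_or in Hx'; apply in_or_app; simpl in Hx'.
    destruct Hx' as [|[->|]]; auto; contradiction.
Qed.

Lemma incl_permutation l0 l : NoDup l0 -> NoDup l -> incl l0 l ->
  exists l1, NoDup l1 /\ (forall i, In i l1 -> In i l /\ ~ In i l0) /\
    Permutation l (l0 ++ l1).
Proof.
  intros H0 Hl Hi.
  pose (l1 := filter (fun i => if in_dec cdec i l0 then false else true) l).
  assert (H1 : forall i, In i l1 <-> In i l /\ ~ In i l0).
  { intros i; unfold l1; rewrite filter_In.
    destruct (in_dec cdec i l0); intuition congruence. }
  assert (Hn1 : NoDup l1) by (apply NoDup_filter; auto).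
  exists l1; split; [auto|split; [apply H1|]].
  apply NoDup_Permutation; auto.
  - apply NoDup_app; auto. intros i Hi0 Hi1; apply H1 in Hi1; tauto.
  - intros i; rewrite in_app_iff, H1.
    specialize (Hi i). destruct (classic (In i l0)); tauto.
Qed.

Lemma has_sum_union (l1 l2 : list I) :
  exists l, NoDup l /\ incl l1 l /\ incl l2 l.
Proof.
  exists (nodup cdec (l1 ++ l2)); split; [apply NoDup_nodup|].
  split; intros x Hx; apply nodup_In, in_or_app; auto.
Qed.

End FiniteSums.

Lemma lsum_map {I J : Type} (f : I -> R) (g : J -> I) l :
  lsum f (map g l) = lsum (fun j => f (g j)) l.
Proof. induction l; simpl; congruence. Qed.

Section Sums.
Context {I : Type}.
Implicit Types (f g : I -> R) (l : list I).

Lemma has_sum_unique f s t : has_sum f s -> has_sum f t -> s = t.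
Proof.
  intros Hs Ht. apply NNPP; intros Hne.
  assert (He : 0 < Rabs (s - t) / 2).
  { assert (0 < Rabs (s - t)) by (apply Rabs_pos_lt; lra). lra. }
  destruct (Hs _ He) as [l1 H1], (Ht _ He) as [l2 H2].
  destruct (has_sum_union l1 l2) as [l [Hn [Hl1 Hl2]]].
  specialize (H1 l Hn Hl1); specialize (H2 l Hn Hl2).
  assert (Rabs (s - t) <= Rabs (lsum f l - s) + Rabs (lsum f l - t)).
  { replace (s - t) with (- (lsum f l - s) + (lsum f l - t)) by ring.
    eapply Rle_trans; [apply Rabs_triang|]. rewrite Rabs_Ropp; lra. }
  lra.
Qed.

Lemma has_sum_ext f g s : (forall i, f i = g i) -> has_sum f s -> has_sum g s.
Proof. intros H; replace g with f; auto. now apply functional_extensionality. Qed.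

Lemma has_sum_plus f g s t :
  has_sum f s -> has_sum g t -> has_sum (fun i => f i + g i) (s + t).
Proof.
  intros Hs Ht eps He.
  destruct (Hs (eps / 2)) as [l1 H1], (Ht (eps / 2)) as [l2 H2]; try lra.
  exists (l1 ++ l2); intros l Hn Hi. rewrite lsum_plus.
  apply incl_app_inv in Hi; destruct Hi as [Hi1 Hi2].
  specialize (H1 l Hn Hi1); specialize (H2 l Hn Hi2).
  replace (lsum f l + lsum g l - (s + t)) with ((lsum f l - s) + (lsum g l - t)) by ring.
  eapply Rle_lt_trans; [apply Rabs_triang|lra].
Qed.

Lemma has_sum_zero : has_sum (fun _ : I => 0) 0.
Proof.
  intros eps He; exists nil; intros l _ _.
  replace (lsum (fun _ => 0) l) with 0 by (induction l; simpl; lra).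
  rewrite Rminus_0_r, Rabs_R0; auto.
Qed.

Lemma has_sum_scal a f s : has_sum f s -> has_sum (fun i => a * f i) (a * s).
Proof.
  intros Hs eps He.
  destruct (Hs (eps / (Rabs a + 1))) as [l0 H0].
  { apply Rdiv_lt_0_compat; auto. pose proof (Rabs_pos a); lra. }
  exists l0; intros l Hn Hi; specialize (H0 l Hn Hi).
  rewrite lsum_scal, <- Rmult_minus_distr_l, Rabs_mult.
  assert (Ha := Rabs_pos a).
  apply Rle_lt_trans with ((Rabs a + 1) * Rabs (lsum f l - s)).
  - apply Rmult_le_compat_r; [apply Rabs_pos|lra].
  - apply Rmult_lt_compat_l with (r := Rabs a + 1) in H0; [|lra].
    field_simplify ((Rabs a + 1) * (eps / (Rabs a + 1))) in H0; lra.
Qed.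

Lemma has_sum_minus f g s t :
  has_sum f s -> has_sum g t -> has_sum (fun i => f i - g i) (s - t).
Proof.
  intros Hs Ht.
  apply has_sum_ext with (fun i => f i + -1 * g i); [intros; ring|].
  replace (s - t) with (s + -1 * t) by ring.
  apply has_sum_plus; auto using has_sum_scal.
Qed.

Lemma lsum_le_has_sum f s l : (forall i, 0 <= f i) -> has_sum f s -> NoDup l ->
  lsum f l <= s.
Proof.
  intros Hf Hs Hn. apply Rnot_lt_le; intros Hlt.
  destruct (Hs (lsum f l - s)) as [l0 H0]; [lra|].
  destruct (has_sum_union l0 l) as [l1 [Hn1 [Hi0 Hi1]]].
  specialize (H0 l1 Hn1 Hi0).
  pose proof (lsum_incl_le f l l1 Hf Hn Hi1).
  apply Rabs_lt_between in H0; lra.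
Qed.

(** The sum is the supremum of the finite partial sums. *)
Lemma summable_bounded f M : (forall i, 0 <= f i) ->
  (forall l, NoDup l -> lsum f l <= M) -> summable f.
Proof.
  intros Hf HM.
  destruct (completeness (fun x => exists l, NoDup l /\ x = lsum f l)) as [s [Hub Hlub]].
  - exists M; intros x [l [Hn ->]]; auto.
  - exists 0, nil; split; [constructor|reflexivity].
  - exists s; intros eps He.
    assert (exists l, NoDup l /\ s - eps < lsum f l) as [l0 [Hn0 Hl0]].
    { apply NNPP; intros H. specialize (Hlub (s - eps)).
      assert (s <= s - eps); [|lra]. apply Hlub.
      intros x [l [Hn ->]]. apply Rnot_lt_le; intros Hlt. apply H; eauto. }
    exists l0; intros l Hn Hi.
    pose proof (lsum_incl_le f l0 l Hf Hn0 Hi).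
    assert (lsum f l <= s) by (apply Hub; eauto).
    apply Rabs_def1; lra.
Qed.

(** Both f + g and g are nonnegative with bounded partial sums, and f is their difference. *)
Lemma summable_le f g : (forall i, Rabs (f i) <= g i) -> summable g -> summable f.
Proof.
  intros Hfg [S HS].
  assert (Hg : forall i, 0 <= g i).
  { intros i; eapply Rle_trans; [apply Rabs_pos|apply Hfg]. }
  destruct (summable_bounded (fun i => f i + g i) (2 * S)) as [t Ht].
  - intros i. specialize (Hfg i). apply Rabs_le_between in Hfg; lra.
  - intros l Hn. apply Rle_trans with (lsum (fun i => 2 * g i) l).
    + apply lsum_le_in; intros i _. specialize (Hfg i). apply Rabs_le_between in Hfg; lra.
    + rewrite lsum_scal. pose proof (lsum_le_has_sum g S l Hg HS Hn). lra.
  - exists (t - S). apply has_sum_ext with (fun i => (f i + g i) - g i); [intros; ring|].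
    now apply has_sum_minus.
Qed.

(** Unordered convergence is absolute. Enlarging any finite set by [l0] brings its sum within 1 of
    s, at a cost of at most the absolute sum over [l0], so all finite sums are bounded by B; applied
    to the terms of each sign separately this gives 2 B for the absolute values. *)
Lemma summable_abs f : summable f -> summable (fun i => Rabs (f i)).
Proof.
  intros [s Hs]. destruct (Hs 1) as [l0 H0]; [lra|].
  set (B := Rabs s + 1 + lsum (fun i => Rabs (f i)) l0).
  assert (HB : forall l, NoDup l -> Rabs (lsum f l) <= B).
  { intros l Hn.
    destruct (has_sum_union l l0) as [l1 [Hn1 [Hi Hi0]]].
    set (l2 := nodup cdec (l ++ l0)).
    destruct (incl_permutation l l2) as [l3 [Hn3 [Hin3 Hp]]]; auto.
    { apply NoDup_nodup. }
    { intros x Hx; apply nodup_In, in_or_app; auto. }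
    assert (H2 : Rabs (lsum f l2 - s) < 1).
    { apply H0; [apply NoDup_nodup|]. intros x Hx; apply nodup_In, in_or_app; auto. }
    rewrite (lsum_perm _ _ _ Hp), lsum_app in H2.
    assert (H3 : Rabs (lsum f l3) <= lsum (fun i => Rabs (f i)) l0).
    { eapply Rle_trans; [apply lsum_abs|].
      apply lsum_incl_le; auto; [intros; apply Rabs_pos|].
      intros x Hx. apply Hin3 in Hx. destruct Hx as [Hx Hx'].
      apply nodup_In, in_app_or in Hx; tauto. }
    unfold B. apply Rabs_lt_between in H2. apply Rabs_le_between in H3.
    pose proof (Rabs_le_between s (Rabs s)) as [Hsb _].
    specialize (Hsb (Rle_refl _)). apply Rabs_le_between; lra. }
  apply summable_bounded with (2 * B); [intros; apply Rabs_pos|].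
  intros l Hn.
  set (b := fun i => if Rle_dec 0 (f i) then true else false).
  assert (Hp := HB _ (NoDup_filter b Hn)).
  assert (Hq := HB _ (NoDup_filter (fun i => negb (b i)) Hn)).
  assert (lsum (fun i => Rabs (f i)) l =
    lsum f (filter b l) - lsum f (filter (fun i => negb (b i)) l)) as ->.
  { clear -I. induction l as [|a l IH]; simpl; [lra|].
    destruct (b a) eqn:Eb; simpl; rewrite IH; unfold b in Eb;
      destruct (Rle_dec 0 (f a)) as [Ha|Ha]; try discriminate.
    - rewrite (Rabs_pos_eq (f a)); lra.
    - rewrite (Rabs_left (f a)); lra. }
  apply Rabs_le_between in Hp; apply Rabs_le_between in Hq; lra.
Qed.

Lemma has_sum_le f g s t : (forall i, f i <= g i) -> has_sum f s -> has_sum g t -> s <= t.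
Proof.
  intros H Hs Ht.
  assert (0 <= t - s); [|lra].
  change 0 with (lsum (fun i => g i - f i) nil).
  apply lsum_le_has_sum; [intros i; specialize (H i); lra| |constructor].
  now apply has_sum_minus.
Qed.

(** The remainder after a finite set is dominated by the remainder of the majorant. With l = nil
    this is the bound of the whole sum. *)
Lemma has_sum_tail f g s t l : (forall i, Rabs (f i) <= g i) ->
  has_sum f s -> has_sum g t -> NoDup l -> Rabs (s - lsum f l) <= t - lsum g l.
Proof.
  intros Hfg Hs Ht Hn. apply Rnot_lt_le; intros Hlt.
  assert (Hg : forall i, 0 <= g i).
  { intros i; eapply Rle_trans; [apply Rabs_pos|apply Hfg]. }
  destruct (Hs (Rabs (s - lsum f l) - (t - lsum g l))) as [l0 H0]; [lra|].
  set (l2 := nodup cdec (l ++ l0)).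
  assert (Hn2 : NoDup l2) by apply NoDup_nodup.
  destruct (incl_permutation l l2) as [l3 [Hn3 [Hin3 Hp]]]; auto.
  { intros x Hx; apply nodup_In, in_or_app; auto. }
  assert (Hi0 : incl l0 l2) by (intros x Hx; apply nodup_In, in_or_app; auto).
  specialize (H0 l2 Hn2 Hi0).
  pose proof (lsum_le_has_sum g t l2 Hg Ht Hn2) as Hle.
  rewrite (lsum_perm f _ _ Hp), lsum_app in H0.
  rewrite (lsum_perm g _ _ Hp), lsum_app in Hle.
  assert (Rabs (lsum f l3) <= lsum g l3).
  { eapply Rle_trans; [apply lsum_abs|]. apply lsum_le_in; auto. }
  assert (Rabs (s - lsum f l) <= Rabs (lsum f l + lsum f l3 - s) + Rabs (lsum f l3)).
  { replace (s - lsum f l) with (- (lsum f l + lsum f l3 - s) + lsum f l3) by ring.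
    eapply Rle_trans; [apply Rabs_triang|]. rewrite Rabs_Ropp; lra. }
  lra.
Qed.

Lemma has_sum_tannery (f : nat -> I -> R) (F : I -> R) g s (sF : R) :
  (forall n i, Rabs (f n i) <= g i) -> summable g ->
  (forall i, is_lim_seq (fun n => f n i) (F i)) ->
  (forall n, has_sum (f n) (s n)) -> has_sum F sF -> is_lim_seq s sF.
Proof.
  intros Hfg [t Ht] Hlim Hs HF.
  assert (HFg : forall i, Rabs (F i) <= g i).
  { intros i.
    assert (Rbar_le (Rabs (F i)) (g i)) as H; [|exact H].
    apply is_lim_seq_le with (fun n => Rabs (f n i)) (fun _ => g i); auto.
    - apply (is_lim_seq_abs _ (F i)), Hlim.
    - apply is_lim_seq_const. }
  apply is_lim_seq_spec; intros eps.
  (* The finite set carries all but eps / 3 of the majorant; it serves every [f n] and the limit at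
     once, and on it the convergence is that of a finite sum. *)
  destruct (Ht (eps / 3)) as [l0 H0]; [destruct eps; simpl; lra|].
  set (l := nodup cdec l0). assert (Hn : NoDup l) by apply NoDup_nodup.
  specialize (H0 l Hn). assert (Hi : incl l0 l) by (intros x Hx; now apply nodup_In).
  specialize (H0 Hi). apply Rabs_lt_between in H0.
  assert (Hl : is_lim_seq (fun n => lsum (f n) l) (lsum F l)).
  { clear -Hlim. induction l as [|a l IH]; simpl; [apply is_lim_seq_const|].
    apply is_lim_seq_plus'; auto. }
  apply is_lim_seq_spec in Hl.
  assert (He3 : 0 < eps / 3) by (destruct eps; simpl; lra).
  destruct (Hl (mkposreal _ He3)) as [N HN]; simpl in HN.
  exists N; intros n Hnn. specialize (HN n Hnn).
  pose proof (has_sum_tail (f n) g (s n) t l (Hfg n) (Hs n) Ht Hn) as T1.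
  pose proof (has_sum_tail F g sF t l HFg HF Ht Hn) as T2.
  apply Rabs_lt_between in HN; apply Rabs_le_between in T1; apply Rabs_le_between in T2.
  apply Rabs_lt_between; lra.
Qed.

End Sums.

Section Reindexing.
Context {I J : Type} (g : J -> I) (ginj : forall x y, g x = g y -> x = y).

(** The preimage of i as a list of length at most one, so that [flat_map pre] pulls finite subsets
    of I back to finite subsets of J. *)
Let pre (i : I) : list J :=
  match excluded_middle_informative (exists j, g j = i) with
  | left H => proj1_sig (constructive_indefinite_description _ H) :: nil
  | right _ => nil
  end.

Let pre_spec i j : In j (pre i) <-> g j = i.
Proof.
  unfold pre. destruct (excluded_middle_informative _) as [H|H].
  - destruct (constructive_indefinite_description _ H) as [k Hk]; simpl. split.
    + intros [<-|[]]; auto.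
    + intros H'; left; apply ginj; congruence.
  - simpl; split; [tauto|]. intros H'; apply H; eauto.
Qed.

Let preL_In l j : In j (flat_map pre l) <-> In (g j) l.
Proof.
  rewrite in_flat_map. split.
  - intros [i [Hi Hj]]; apply pre_spec in Hj; congruence.
  - intros H; exists (g j); split; auto; now apply pre_spec.
Qed.

Let preL_NoDup l : NoDup l -> NoDup (flat_map pre l).
Proof.
  induction 1 as [|i l Hi Hn IH]; simpl; [constructor|].
  apply NoDup_app; auto.
  - unfold pre. destruct (excluded_middle_informative _); repeat constructor; simpl; tauto.
  - intros j Hj Hj'. apply pre_spec in Hj. apply preL_In in Hj'. congruence.
Qed.

Lemma summable_inj (f : I -> R) : summable f -> summable (fun j => f (g j)).
Proof.
  intros H. apply summable_abs in H. destruct H as [S HS].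
  assert (summable (fun j => Rabs (f (g j)))) as Ha.
  { apply summable_bounded with S; [intros; apply Rabs_pos|].
    intros l Hn. rewrite <- (lsum_map (fun i => Rabs (f i)) g).
    apply lsum_le_has_sum; auto; [intros; apply Rabs_pos|].
    apply FinFun.Injective_map_NoDup; auto. }
  eapply summable_le; [|apply Ha]. intros; simpl; lra.
Qed.

(** Reindexing along an injection that only has to reach the support of f; this covers bijections,
    extension by zero and the embedding of nat into Z. *)
Lemma has_sum_inj (f : I -> R) s : (forall i, f i <> 0 -> exists j, g j = i) ->
  has_sum (fun j => f (g j)) s -> has_sum f s.
Proof.
  intros Hsupp Hs eps He. destruct (Hs eps He) as [l0 H0].
  exists (map g l0); intros l Hn Hi.
  replace (lsum f l) with (lsum (fun j => f (g j)) (flat_map pre l)).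
  - apply H0; [now apply preL_NoDup|].
    intros j Hj. apply preL_In, Hi. now apply in_map.
  - clear Hn Hi. induction l as [|a l IH]; simpl; auto.
    rewrite lsum_app, IH. f_equal.
    destruct (pre a) as [|j [|k m]] eqn:E; simpl.
    + destruct (Req_dec (f a) 0); auto. destruct (Hsupp a) as [j Hj]; auto.
      apply pre_spec in Hj. rewrite E in Hj; destruct Hj.
    + assert (g j = a) as <- by (apply pre_spec; rewrite E; now left). lra.
    + unfold pre in E; destruct (excluded_middle_informative _); discriminate.
Qed.

Lemma has_sum_inj_rev (f : I -> R) s : (forall i, f i <> 0 -> exists j, g j = i) ->
  has_sum f s -> has_sum (fun j => f (g j)) s.
Proof.
  intros Hsupp Hs. destruct (summable_inj f) as [t Ht]; [now exists s|].
  pose proof (has_sum_inj f t Hsupp Ht) as H.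
  now rewrite (has_sum_unique _ _ _ Hs H).
Qed.

End Reindexing.

Section Products.
Context {I J : Type}.

Lemma lsum_list_prod (f : I * J -> R) l m :
  lsum f (list_prod l m) = lsum (fun i => lsum (fun j => f (i, j)) m) l.
Proof.
  induction l as [|a l IH]; simpl; auto.
  now rewrite lsum_app, IH, lsum_map.
Qed.

(** Given finitely many rows, each row sum is replaced by a finite part of it which also contains
    the entries of [l0] in that row; the union of these parts is a finite set to which the
    convergence of the double sum applies. *)
Lemma has_sum_fubini (f : I * J -> R) (g : I -> R) s :
  has_sum f s -> (forall i, has_sum (fun j => f (i, j)) (g i)) -> has_sum g s.
Proof.
  intros Hf Hg eps He. destruct (Hf (eps / 2)) as [l0 H0]; [lra|].
  exists (map fst l0); intros l Hn Hi.
  assert (Hlen := pos_INR (length l)).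
  (* The error allowed in a single row, such that all the rows of l together stay below eps / 2. *)
  assert (exists d, 0 < d /\ INR (length l) * d < eps / 2) as [d [Hd Hld]].
  { exists (eps / 2 / (INR (length l) + 1)); split.
    - apply Rdiv_lt_0_compat; lra.
    - apply Rmult_lt_reg_r with (INR (length l) + 1); [lra|].
      field_simplify; [|lra]. nra. }
  assert (exists m : I -> list J, forall i, NoDup (m i) /\
    (forall j, In (i, j) l0 -> In j (m i)) /\
    Rabs (lsum (fun j => f (i, j)) (m i) - g i) < d) as [m Hm].
  { apply (ClassicalEpsilon.choice
      (fun i mi => NoDup mi /\ (forall j, In (i, j) l0 -> In j mi) /\
         Rabs (lsum (fun j => f (i, j)) mi - g i) < d)).
    intros i. destruct (Hg i d Hd) as [l1 H1].
    destruct (has_sum_union l1 (map snd l0)) as [l2 [Hn2 [Hi1 Hi2]]].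
    exists l2; repeat split; auto.
    intros j Hj; apply Hi2. now apply (in_map snd) in Hj. }
  set (L := flat_map (fun i => map (pair i) (m i)) l).
  assert (HL : forall i j, In (i, j) L <-> In i l /\ In j (m i)).
  { intros i j; unfold L; rewrite in_flat_map; split.
    - intros [i' [Hi' Hj]]. apply in_map_iff in Hj.
      destruct Hj as [j' [E Hj]]; inversion E; subst; auto.
    - intros [Hil Hj]; exists i; split; auto. now apply in_map. }
  assert (HnL : NoDup L).
  { unfold L. clear -Hn Hm. induction Hn as [|i l Hil Hn IH]; simpl; [constructor|].
    apply NoDup_app; [|exact IH|].
    - apply FinFun.Injective_map_NoDup; [intros x y E; now inversion E|apply Hm].
    - intros p H1 H2. apply in_map_iff in H1. destruct H1 as [j' [E H1]].
      subst p. apply in_flat_map in H2. destruct H2 as [i2 [Hi2 H2]].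
      apply in_map_iff in H2. destruct H2 as [j2 [E2 _]]; inversion E2; subst; auto. }
  assert (HiL : incl l0 L).
  { intros [i j] Hij. apply HL; split; [|now apply Hm].
    apply Hi. now apply (in_map fst) in Hij. }
  specialize (H0 L HnL HiL).
  assert (Hdiff : Rabs (lsum g l - lsum f L) <= INR (length l) * d).
  { unfold L. clear -Hm. induction l as [|i l IH].
    - simpl. rewrite Rminus_0_r, Rabs_R0; lra.
    - change (lsum g (i :: l)) with (g i + lsum g l).
      change (flat_map (fun i => map (pair i) (m i)) (i :: l)) with
        (map (pair i) (m i) ++ flat_map (fun i => map (pair i) (m i)) l).
      rewrite lsum_app, lsum_map.
      change (length (i :: l)) with (S (length l)). rewrite S_INR.
      destruct (Hm i) as [_ [_ Hi]]. rewrite Rabs_minus_sym in Hi.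
      match goal with |- Rabs (g i + ?a - (?b + ?c)) <= _ =>
        replace (g i + a - (b + c)) with ((g i - b) + (a - c)) by ring end.
      eapply Rle_trans; [apply Rabs_triang|]. lra. }
  replace (lsum g l - s) with ((lsum g l - lsum f L) + (lsum f L - s)) by ring.
  eapply Rle_lt_trans; [apply Rabs_triang|lra].
Qed.

(** A finite set of pairs lies in a rectangle, whose sum is bounded through the rows; this gives
    summability, and Fubini then identifies the value. *)
Lemma has_sum_tonelli (f : I * J -> R) (g : I -> R) s :
  (forall p, 0 <= f p) -> (forall i, has_sum (fun j => f (i, j)) (g i)) ->
  has_sum g s -> has_sum f s.
Proof.
  intros Hf Hg Hs.
  destruct (summable_bounded f s) as [t Ht]; auto.
  - intros L Hn.
    set (l := nodup cdec (map fst L)). set (m := nodup cdec (map snd L)).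
    apply Rle_trans with (lsum f (list_prod l m)).
    { apply lsum_incl_le; auto. intros [i j] H. apply in_prod.
      - apply nodup_In. now apply (in_map fst) in H.
      - apply nodup_In. now apply (in_map snd) in H. }
    rewrite lsum_list_prod. apply Rle_trans with (lsum g l).
    + apply lsum_le_in; intros i _.
      apply lsum_le_has_sum; auto. apply NoDup_nodup.
    + apply lsum_le_has_sum; [|auto|apply NoDup_nodup].
      intros i. change 0 with (lsum (fun j => f (i, j)) nil).
      apply lsum_le_has_sum; auto; constructor.
  - now rewrite (has_sum_unique _ _ _ Hs (has_sum_fubini f g t Ht Hg)).
Qed.

(** Tonelli for the absolute values gives summability, Fubini the value. *)
Lemma has_sum_prod (f : I -> R) (g : J -> R) s t : has_sum f s -> has_sum g t ->
  has_sum (fun p => f (fst p) * g (snd p)) (s * t).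
Proof.
  intros Hs Ht.
  destruct (summable_abs f) as [S HS]; [now exists s|].
  destruct (summable_abs g) as [T HT]; [now exists t|].
  destruct (summable_le (fun p => f (fst p) * g (snd p))
    (fun p => Rabs (f (fst p)) * Rabs (g (snd p)))) as [u Hu].
  - intros p; rewrite Rabs_mult; lra.
  - exists (T * S). apply has_sum_tonelli with (fun i => T * Rabs (f i)).
    + intros p; apply Rmult_le_pos; apply Rabs_pos.
    + intros i; simpl. rewrite Rmult_comm. now apply has_sum_scal.
    + now apply has_sum_scal.
  - replace (s * t) with u; auto.
    assert (has_sum (fun i => t * f i) u) as H.
    { apply (has_sum_fubini (fun p => f (fst p) * g (snd p)) (fun i => t * f i) u Hu).
      intros i; simpl. rewrite (Rmult_comm t). now apply has_sum_scal. }
    rewrite (has_sum_unique _ _ _ H (has_sum_scal t _ _ Hs)). ring.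
Qed.

Lemma has_sum_sum (f : I + J -> R) s t : has_sum (fun i => f (inl i)) s ->
  has_sum (fun j => f (inr j)) t -> has_sum f (s + t).
Proof.
  intros Hs Ht.
  apply has_sum_ext with (fun p => match p with inl _ => f p | inr _ => 0 end
    + match p with inl _ => 0 | inr _ => f p end).
  { intros [i|j]; ring. }
  apply has_sum_plus.
  - apply (has_sum_inj inl); [congruence| |auto].
    intros [i|j] H; [eauto|congruence].
  - apply (has_sum_inj inr); [congruence| |auto].
    intros [i|j] H; [congruence|eauto].
Qed.

End Products.

Lemma lsum_seq (f : nat -> R) n : lsum f (seq 0 (S n)) = sum_n f n.
Proof.
  induction n as [|n IH].
  - rewrite sum_O; simpl; lra.
  - rewrite seq_S, lsum_app, IH, sum_Sn. simpl. unfold plus; simpl. lra.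
Qed.

Lemma has_sum_is_series (f : nat -> R) s : has_sum f s -> is_series f s.
Proof.
  intros Hs. enough (H : is_lim_seq (sum_n f) s) by exact H.
  apply is_lim_seq_spec. intros eps.
  destruct (Hs eps) as [l0 H0]; [apply eps|].
  exists (list_max l0). intros n Hn.
  rewrite <- lsum_seq. apply H0; [apply seq_NoDup|].
  intros x Hx. apply in_seq. 
  assert (x <= list_max l0)%nat; [|lia].
  pose proof (proj1 (list_max_le l0 _) (le_n _)) as H.
  rewrite Forall_forall in H; auto.
Qed.

Lemma is_series_has_sum (f : nat -> R) s :
  ex_series (fun n => Rabs (f n)) -> is_series f s -> has_sum f s.
Proof.
  intros [S HS] Hs.
  assert (summable (fun n => Rabs (f n))) as Ha.
  { apply summable_bounded with S; [intros; apply Rabs_pos|].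
    intros l Hn.
    apply Rle_trans with (lsum (fun n => Rabs (f n)) (seq 0 (1 + list_max l))).
    - apply lsum_incl_le; auto; [intros; apply Rabs_pos|].
      intros x Hx. apply in_seq.
      pose proof (proj1 (list_max_le l _) (le_n _)) as H.
      rewrite Forall_forall in H. specialize (H x Hx). lia.
    - change (1 + list_max l)%nat with (Datatypes.S (list_max l)). rewrite lsum_seq.
      apply (is_lim_seq_incr_compare (sum_n (fun n => Rabs (f n)))); auto.
      intros n; rewrite sum_Sn. unfold plus; simpl. pose proof (Rabs_pos (f (Datatypes.S n))); lra. }
  destruct (summable_le f (fun n => Rabs (f n))) as [t Ht]; auto; [intros; lra|].
  replace s with t; auto.
  apply has_sum_is_series in Ht.
  rewrite <- (is_series_unique _ _ Ht). now apply is_series_unique.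
Qed.

(** The splitting into k >= 0 and k < 0 is the one used by [ex_jackson] and [jackson]. *)
Lemma has_sum_Z (f : Z -> R) s t : has_sum (fun n => f (Z.of_nat n)) s ->
  has_sum (fun n => f (- Z.of_nat n - 1)%Z) t -> has_sum f (s + t).
Proof.
  intros Hs Ht.
  pose (g := fun p : nat + nat => match p with
    inl n => Z.of_nat n | inr n => (- Z.of_nat n - 1)%Z end).
  apply (has_sum_inj g).
  - intros [n|n] [m|m]; simpl; intros H; f_equal; lia.
  - intros i _. destruct (Z_le_gt_dec 0 i).
    + exists (inl (Z.to_nat i)); simpl; lia.
    + exists (inr (Z.to_nat (- i - 1))); simpl; lia.
  - now apply has_sum_sum.
Qed.

Lemma summable_Z (f : Z -> R) : summable (fun n => f (Z.of_nat n)) ->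
  summable (fun n => f (- Z.of_nat n - 1)%Z) -> summable f.
Proof. intros [s Hs] [t Ht]; exists (s + t); now apply has_sum_Z. Qed.

Lemma summable_nat_inv (f : Z -> R) : summable f ->
  summable (fun n => f (Z.of_nat n)) /\ summable (fun n => f (- Z.of_nat n - 1)%Z).
Proof.
  intros H; split.
  - apply (summable_inj Z.of_nat); auto; intros; lia.
  - apply (summable_inj (fun n => (- Z.of_nat n - 1)%Z)); auto; intros; lia.
Qed.

Lemma has_sum_telescope (a : Z -> R) (s A B : R) :
  has_sum (fun k => a (k + 1)%Z - a k) s ->
  is_lim_seq (fun n => a (Z.of_nat n)) A ->
  is_lim_seq (fun n => a (- Z.of_nat n)%Z) B -> s = A - B.
Proof.
  intros Hs HA HB.
  destruct (summable_nat_inv _ (ex_intro _ s Hs)) as [[s1 H1] [s2 H2]].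
  rewrite (has_sum_unique _ _ _ Hs (has_sum_Z _ _ _ H1 H2)).
  apply has_sum_is_series in H1. apply has_sum_is_series in H2.
  assert (s1 = A - a 0%Z) as ->.
  { apply is_lim_seq_incr_1 in HA.
    assert (Hl : is_lim_seq (sum_n (fun n => a (Z.of_nat n + 1)%Z - a (Z.of_nat n))) (A - a 0%Z)).
    { eapply is_lim_seq_ext; [|apply is_lim_seq_minus'; [apply HA|apply is_lim_seq_const]].
      intros n. induction n as [|n IH].
      - rewrite sum_O. reflexivity.
      - rewrite sum_Sn, <- IH.
        match goal with |- context [plus ?x ?y] => change (plus x y) with (x + y) end.
        replace (Z.of_nat (S n) + 1)%Z with (Z.of_nat (S (S n))) by lia. lra. }
    assert (H1' : is_lim_seq _ s1) by exact H1.
    apply is_lim_seq_unique in Hl. apply is_lim_seq_unique in H1'.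
    now injection (eq_trans (eq_sym H1') Hl). }
  assert (s2 = a 0%Z - B) as ->.
  { apply is_lim_seq_incr_1 in HB.
    assert (Hl : is_lim_seq (sum_n (fun n => a (- Z.of_nat n - 1 + 1)%Z - a (- Z.of_nat n - 1)%Z)) (a 0%Z - B)).
    { eapply is_lim_seq_ext; [|apply is_lim_seq_minus'; [apply is_lim_seq_const|apply HB]].
      intros n. induction n as [|n IH].
      - rewrite sum_O. reflexivity.
      - rewrite sum_Sn, <- IH.
        match goal with |- context [plus ?x ?y] => change (plus x y) with (x + y) end.
        replace (- Z.of_nat (S n) - 1 + 1)%Z with (- Z.of_nat (S n))%Z by lia.
        replace (- Z.of_nat (S n) - 1)%Z with (- Z.of_nat (S (S n)))%Z by lia. lra. }
    assert (H2' : is_lim_seq _ s2) by exact H2.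
    apply is_lim_seq_unique in Hl. apply is_lim_seq_unique in H2'.
    now injection (eq_trans (eq_sym H2') Hl). }
  lra.
Qed.

Lemma has_sum_finite {I : Type} (f : I -> R) (l : list I) : NoDup l ->
  (forall x, ~ In x l -> f x = 0%R) -> has_sum f (lsum f l).
Proof.
  intros Hn Hz eps He. exists l. intros l' Hn' Hi.
  destruct (incl_permutation l l' Hn Hn' Hi) as [l1 [Hn1 [H1 Hp]]].
  rewrite (lsum_perm _ _ _ Hp), lsum_app.
  replace (lsum f l1) with 0%R.
  - replace (lsum f l + 0 - lsum f l)%R with 0%R by ring. now rewrite Rabs_R0.
  - clear Hp Hn1. induction l1 as [|a l1 IH]; simpl; auto.
    rewrite <- IH, Hz; [ring|apply H1; now left|]. intros i Hi1; apply H1; now right.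
Qed.

(** * Limits and unordered sums of complex families *)

Definition has_limC (u : nat -> C) (l : C) : Prop :=
  is_lim_seq (fun n => Re (u n)) (Re l) /\ is_lim_seq (fun n => Im (u n)) (Im l).

(** Componentwise, as are [Clim] and [Cseries], so that the real results transfer to each
    component. *)
Definition has_sumC {I : Type} (f : I -> C) (s : C) : Prop :=
  has_sum (fun i => Re (f i)) (Re s) /\ has_sum (fun i => Im (f i)) (Im s).

Definition summableC {I : Type} (f : I -> C) : Prop := exists s, has_sumC f s.

(* An arbitrary value when [f] is not summable. *)
Definition csum {I : Type} (f : I -> C) : C :=
  epsilon (inhabits (RtoC 0)) (has_sumC f).

Lemma C_ext (x y : C) : Re x = Re y -> Im x = Im y -> x = y.
Proof. destruct x, y; simpl; congruence. Qed.

Lemma Cmod_le_Re_Im (x : C) : Cmod x <= Rabs (Re x) + Rabs (Im x).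
Proof.
  assert (H : x = (RtoC (Re x) + Ci * RtoC (Im x))%C).
  { destruct x; unfold RtoC, Cplus, Cmult, Ci; simpl; f_equal; ring. }
  rewrite H at 1. eapply Rle_trans; [apply Cmod_triangle|].
  rewrite Cmod_mult, !Cmod_R.
  replace (Cmod Ci) with 1; [lra|].
  unfold Cmod, Ci; simpl. rewrite Rmult_0_l, Rmult_1_r, Rmult_1_r, Rplus_0_l, sqrt_1; lra.
Qed.

Lemma Rabs_Re_le (x : C) : Rabs (Re x) <= Cmod x.
Proof. eapply Rle_trans; [|apply Rmax_Cmod]. apply Rmax_l. Qed.

Lemma Rabs_Im_le (x : C) : Rabs (Im x) <= Cmod x.
Proof. eapply Rle_trans; [|apply Rmax_Cmod]. apply Rmax_r. Qed.

Section Limits.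
Implicit Types (u v : nat -> C) (l m : C).

Lemma has_limC_unique u l m : has_limC u l -> has_limC u m -> l = m.
Proof.
  intros [H1 H2] [H3 H4]. apply C_ext.
  - apply is_lim_seq_unique in H1; apply is_lim_seq_unique in H3.
    rewrite H1 in H3; now inversion H3.
  - apply is_lim_seq_unique in H2; apply is_lim_seq_unique in H4.
    rewrite H2 in H4; now inversion H4.
Qed.

Lemma has_limC_ext u v l : (forall n, u n = v n) -> has_limC u l -> has_limC v l.
Proof. intros H; replace v with u; auto. now apply functional_extensionality. Qed.

Lemma has_limC_const l : has_limC (fun _ => l) l.
Proof. split; apply is_lim_seq_const. Qed.

Lemma has_limC_plus u v l m : has_limC u l -> has_limC v m ->
  has_limC (fun n => u n + v n)%C (l + m)%C.
Proof. intros [H1 H2] [H3 H4]; split; simpl; apply is_lim_seq_plus'; auto. Qed.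

Lemma has_limC_mult u v l m : has_limC u l -> has_limC v m ->
  has_limC (fun n => u n * v n)%C (l * m)%C.
Proof.
  intros [H1 H2] [H3 H4]; split; simpl.
  - apply is_lim_seq_minus'; apply is_lim_seq_mult'; auto.
  - apply is_lim_seq_plus'; apply is_lim_seq_mult'; auto.
Qed.

Lemma has_limC_opp u l : has_limC u l -> has_limC (fun n => - u n)%C (- l)%C.
Proof.
  intros [H1 H2]; split.
  - exact (proj1 (is_lim_seq_opp (fun n => Re (u n)) (Re l)) H1).
  - exact (proj1 (is_lim_seq_opp (fun n => Im (u n)) (Im l)) H2).
Qed.

Lemma has_limC_minus u v l m : has_limC u l -> has_limC v m ->
  has_limC (fun n => u n - v n)%C (l - m)%C.
Proof. intros; apply has_limC_plus; auto using has_limC_opp. Qed.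

Lemma has_limC_le u l (e : nat -> R) : (forall n, Cmod (u n - l) <= e n) ->
  is_lim_seq e 0 -> has_limC u l.
Proof.
  intros H He.
  assert (Hm : is_lim_seq (fun n => - e n) 0).
  { replace (Finite 0) with (Rbar_opp 0) by (simpl; f_equal; ring).
    now apply (is_lim_seq_opp e 0). }
  split.
  - apply is_lim_seq_ext with (fun n => (Re (u n) - Re l) + Re l); [intros; ring|].
    replace (Finite (Re l)) with (Finite (0 + Re l)) by (f_equal; ring).
    apply is_lim_seq_plus'; [|apply is_lim_seq_const].
    apply is_lim_seq_le_le with (fun n => - e n) e; auto.
    intros n. apply Rabs_le_between. eapply Rle_trans; [|apply H]. apply (Rabs_Re_le (u n - l)).
  - apply is_lim_seq_ext with (fun n => (Im (u n) - Im l) + Im l); [intros; ring|].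
    replace (Finite (Im l)) with (Finite (0 + Im l)) by (f_equal; ring).
    apply is_lim_seq_plus'; [|apply is_lim_seq_const].
    apply is_lim_seq_le_le with (fun n => - e n) e; auto.
    intros n. apply Rabs_le_between. eapply Rle_trans; [|apply H]. apply (Rabs_Im_le (u n - l)).
Qed.

Lemma has_limC_Cmod u l : has_limC u l -> is_lim_seq (fun n => Cmod (u n)) (Cmod l).
Proof.
  intros [H1 H2]. unfold Cmod.
  apply (is_lim_seq_continuous sqrt (fun n => (Re (u n)) ^ 2 + (Im (u n)) ^ 2)).
  - apply continuity_pt_sqrt. nra.
  - apply is_lim_seq_plus'; simpl; repeat apply is_lim_seq_mult'; auto; apply is_lim_seq_const.
Qed.

Lemma has_limC_RtoC (u : nat -> R) (l : R) : is_lim_seq u l ->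
  has_limC (fun n => RtoC (u n)) (RtoC l).
Proof. intros H; split; simpl; auto. apply is_lim_seq_const. Qed.

Lemma has_limC_inv u l : l <> 0%C -> has_limC u l -> has_limC (fun n => / u n)%C (/ l)%C.
Proof.
  intros Hl [H1 H2].
  assert (Hne : Re l ^ 2 + Im l ^ 2 <> 0).
  { intros E. apply Hl, C_ext; simpl; nra. }
  assert (Hn : is_lim_seq (fun n => Re (u n) ^ 2 + Im (u n) ^ 2) (Re l ^ 2 + Im l ^ 2)).
  { apply is_lim_seq_plus'; simpl; repeat apply is_lim_seq_mult'; auto; apply is_lim_seq_const. }
  split; simpl; apply is_lim_seq_div'; auto.
  exact (proj1 (is_lim_seq_opp (fun n => Im (u n)) (Im l)) H2).
Qed.

Lemma has_limC_div u v l m : m <> 0%C -> has_limC u l -> has_limC v m ->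
  has_limC (fun n => u n / v n)%C (l / m)%C.
Proof. intros; apply has_limC_mult; auto using has_limC_inv. Qed.

Lemma has_limC_incr u l : has_limC u l <-> has_limC (fun n => u (S n)) l.
Proof.
  split; intros [H1 H2]; split.
  - now apply (is_lim_seq_incr_1 (fun n => Re (u n))).
  - now apply (is_lim_seq_incr_1 (fun n => Im (u n))).
  - now apply (is_lim_seq_incr_1 (fun n => Re (u n))).
  - now apply (is_lim_seq_incr_1 (fun n => Im (u n))).
Qed.

Lemma has_limC_sub u l (phi : nat -> nat) :
  filterlim phi eventually eventually -> has_limC u l -> has_limC (fun n => u (phi n)) l.
Proof.
  intros Hp [H1 H2]; split.
  - now apply (is_lim_seq_subseq (fun n => Re (u n)) _ phi).
  - now apply (is_lim_seq_subseq (fun n => Im (u n)) _ phi).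
Qed.

Lemma has_limC_bounded u l : has_limC u l -> exists M, forall n, Cmod (u n) <= M.
Proof.
  intros H. apply has_limC_Cmod in H.
  destruct (filterlim_bounded (fun n => Cmod (u n))) as [M HM].
  { exists (Cmod l). exact H. }
  exists M; intros n. specialize (HM n).
  unfold norm in HM; simpl in HM. unfold abs in HM; simpl in HM.
  eapply Rle_trans; [apply Rle_abs|exact HM].
Qed.

Lemma Clim_correct u l : has_limC u l -> Clim u = l.
Proof.
  intros [H1 H2]. unfold Clim.
  rewrite (is_lim_seq_unique _ _ H1), (is_lim_seq_unique _ _ H2).
  now destruct l.
Qed.

End Limits.

Section CSums.
Context {I : Type}.
Implicit Types (f g : I -> C).

Lemma has_sumC_unique f s t : has_sumC f s -> has_sumC f t -> s = t.
Proof. intros [H1 H2] [H3 H4]; apply C_ext; eapply has_sum_unique; eauto. Qed.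

Lemma csum_spec f : summableC f -> has_sumC f (csum f).
Proof. intros H. unfold csum. now apply epsilon_spec. Qed.

Lemma csum_unique f s : has_sumC f s -> csum f = s.
Proof. intros H. eapply has_sumC_unique; [|apply H]. apply csum_spec; now exists s. Qed.

Lemma has_sumC_ext f g s : (forall i, f i = g i) -> has_sumC f s -> has_sumC g s.
Proof. intros H; replace g with f; auto. now apply functional_extensionality. Qed.

Lemma csum_ext f g : (forall i, f i = g i) -> csum f = csum g.
Proof. intros H; replace g with f; auto. now apply functional_extensionality. Qed.

Lemma summableC_ext f g : (forall i, f i = g i) -> summableC f -> summableC g.
Proof. intros H; replace g with f; auto. now apply functional_extensionality. Qed.

Lemma has_sumC_plus f g s t : has_sumC f s -> has_sumC g t ->
  has_sumC (fun i => f i + g i)%C (s + t)%C.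
Proof. intros [H1 H2] [H3 H4]; split; simpl; now apply has_sum_plus. Qed.

Lemma has_sumC_minus f g s t : has_sumC f s -> has_sumC g t ->
  has_sumC (fun i => f i - g i)%C (s - t)%C.
Proof. intros [H1 H2] [H3 H4]; split; simpl; now apply has_sum_minus. Qed.

Lemma has_sumC_scal a f s : has_sumC f s -> has_sumC (fun i => a * f i)%C (a * s)%C.
Proof.
  intros [H1 H2]; split; simpl.
  - apply has_sum_minus; now apply has_sum_scal.
  - apply has_sum_plus; now apply has_sum_scal.
Qed.

Lemma has_sumC_zero : has_sumC (fun _ : I => 0%C) 0%C.
Proof. split; apply has_sum_zero. Qed.

Lemma has_sumC_RtoC (f : I -> R) s : has_sum f s -> has_sumC (fun i => RtoC (f i)) (RtoC s).
Proof. intros H; split; simpl; auto. apply has_sum_zero. Qed.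

Lemma summableC_le f (g : I -> R) : (forall i, Cmod (f i) <= g i) -> summable g -> summableC f.
Proof.
  intros H Hg.
  destruct (summable_le (fun i => Re (f i)) g) as [s Hs]; auto.
  { intros i; eapply Rle_trans; [apply Rabs_Re_le|auto]. }
  destruct (summable_le (fun i => Im (f i)) g) as [t Ht]; auto.
  { intros i; eapply Rle_trans; [apply Rabs_Im_le|auto]. }
  exists (s, t); now split.
Qed.

Lemma summableC_Cmod f : summableC f -> summable (fun i => Cmod (f i)).
Proof.
  intros [s [H1 H2]].
  destruct (summable_abs _ (ex_intro _ _ H1)) as [a Ha].
  destruct (summable_abs _ (ex_intro _ _ H2)) as [b Hb].
  apply summable_le with (fun i => Rabs (Re (f i)) + Rabs (Im (f i))).
  - intros i. rewrite Rabs_pos_eq by apply Cmod_ge_0. apply Cmod_le_Re_Im.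
  - exists (a + b); now apply has_sum_plus.
Qed.

(** The factor 2 comes from bounding the real and the imaginary part separately. *)
Lemma has_sumC_bound f (g : I -> R) s t : (forall i, Cmod (f i) <= g i) ->
  has_sumC f s -> has_sum g t -> Cmod s <= 2 * t.
Proof.
  intros H [H1 H2] Ht.
  assert (Rabs (Re s) <= t).
  { apply has_sum_tail with (l := nil) (g := g) (t := t) in H1; auto; [|intros i|constructor].
    - simpl in H1. rewrite !Rminus_0_r in H1; auto.
    - eapply Rle_trans; [apply Rabs_Re_le|auto]. }
  assert (Rabs (Im s) <= t).
  { apply has_sum_tail with (l := nil) (g := g) (t := t) in H2; auto; [|intros i|constructor].
    - simpl in H2. rewrite !Rminus_0_r in H2; auto.
    - eapply Rle_trans; [apply Rabs_Im_le|auto]. }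
  pose proof (Cmod_le_Re_Im s); lra.
Qed.

Lemma has_sumC_tannery (f : nat -> I -> C) F (g : I -> R) s sF :
  (forall n i, Cmod (f n i) <= g i) -> summable g ->
  (forall i, has_limC (fun n => f n i) (F i)) ->
  (forall n, has_sumC (f n) (s n)) -> has_sumC F sF -> has_limC s sF.
Proof.
  intros Hg Hs Hl Hf [HF1 HF2]; split.
  - eapply has_sum_tannery with (f := fun n i => Re (f n i)) (g := g); eauto.
    + intros n i; eapply Rle_trans; [apply Rabs_Re_le|apply Hg].
    + intros i; apply (Hl i).
    + intros n; apply (Hf n).
  - eapply has_sum_tannery with (f := fun n i => Im (f n i)) (g := g); eauto.
    + intros n i; eapply Rle_trans; [apply Rabs_Im_le|apply Hg].
    + intros i; apply (Hl i).
    + intros n; apply (Hf n).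
Qed.

Lemma csum_plus f g : summableC f -> summableC g ->
  csum (fun i => f i + g i)%C = (csum f + csum g)%C.
Proof. intros; apply csum_unique, has_sumC_plus; now apply csum_spec. Qed.

Lemma csum_minus f g : summableC f -> summableC g ->
  csum (fun i => f i - g i)%C = (csum f - csum g)%C.
Proof. intros; apply csum_unique, has_sumC_minus; now apply csum_spec. Qed.

Lemma csum_scal a f : summableC f -> csum (fun i => a * f i)%C = (a * csum f)%C.
Proof. intros; apply csum_unique, has_sumC_scal; now apply csum_spec. Qed.

Lemma summableC_plus f g : summableC f -> summableC g -> summableC (fun i => f i + g i)%C.
Proof. intros [s Hs] [t Ht]; eexists; apply has_sumC_plus; eauto. Qed.

Lemma summableC_scal a f : summableC f -> summableC (fun i => a * f i)%C.
Proof. intros [s Hs]; eexists; apply has_sumC_scal; eauto. Qed.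

End CSums.

Lemma has_sumC_inj {I J} (g : J -> I) (ginj : forall x y, g x = g y -> x = y) (f : I -> C) s :
  (forall i, f i <> 0%C -> exists j, g j = i) ->
  has_sumC (fun j => f (g j)) s -> has_sumC f s.
Proof.
  intros Hs [H1 H2]; split.
  - apply (has_sum_inj g); auto. intros i Hi; apply Hs; intros E; apply Hi; now rewrite E.
  - apply (has_sum_inj g); auto. intros i Hi; apply Hs; intros E; apply Hi; now rewrite E.
Qed.

Lemma has_sumC_inj_rev {I J} (g : J -> I) (ginj : forall x y, g x = g y -> x = y) (f : I -> C) s :
  (forall i, f i <> 0%C -> exists j, g j = i) ->
  has_sumC f s -> has_sumC (fun j => f (g j)) s.
Proof.
  intros Hs [H1 H2]; split.
  - apply (has_sum_inj_rev g ginj (fun i => Re (f i))); auto.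
    intros i Hi; apply Hs; intros E; apply Hi; now rewrite E.
  - apply (has_sum_inj_rev g ginj (fun i => Im (f i))); auto.
    intros i Hi; apply Hs; intros E; apply Hi; now rewrite E.
Qed.

Lemma summableC_inj {I J} (g : J -> I) (ginj : forall x y, g x = g y -> x = y) (f : I -> C) :
  summableC f -> summableC (fun j => f (g j)).
Proof.
  intros [s [H1 H2]].
  destruct (summable_inj g ginj (fun i => Re (f i))) as [a Ha]; [eexists; eauto|].
  destruct (summable_inj g ginj (fun i => Im (f i))) as [b Hb]; [eexists; eauto|].
  exists (a, b); now split.
Qed.

Lemma has_sumC_bij {I J} (g : J -> I) (h : I -> J) (f : I -> C) s :
  (forall j, h (g j) = j) -> (forall i, g (h i) = i) ->
  has_sumC (fun j => f (g j)) s <-> has_sumC f s.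
Proof.
  intros Hg Hh; split; intros H.
  - apply (has_sumC_inj g); eauto. intros x y E; rewrite <- (Hg x), <- (Hg y); congruence.
  - apply (has_sumC_inj_rev g); eauto. intros x y E; rewrite <- (Hg x), <- (Hg y); congruence.
Qed.

(** The predicates [has_sumC] of the two families coincide, so [epsilon] picks the same value for
    both, even where neither is summable. *)
Lemma csum_bij {I J} (g : J -> I) (h : I -> J) (f : I -> C) :
  (forall j, h (g j) = j) -> (forall i, g (h i) = i) ->
  csum (fun j => f (g j)) = csum f.
Proof.
  intros Hg Hh. unfold csum. f_equal. apply functional_extensionality; intros s.
  apply propositional_extensionality. now apply has_sumC_bij with h.
Qed.

Lemma csum_Zshift (m : Z) (f : Z -> C) : csum (fun k => f (k + m)%Z) = csum f.
Proof. apply csum_bij with (fun k => (k - m)%Z); intros; lia. Qed.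

Lemma csum_Zrefl (m : Z) (f : Z -> C) : csum (fun k => f (m - k)%Z) = csum f.
Proof. apply csum_bij with (fun k => (m - k)%Z); intros; lia. Qed.

Section CProducts.
Context {I J : Type}.

Lemma has_sumC_fubini (f : I * J -> C) (g : I -> C) s :
  has_sumC f s -> (forall i, has_sumC (fun j => f (i, j)) (g i)) -> has_sumC g s.
Proof.
  intros [H1 H2] H; split.
  - apply (has_sum_fubini (fun p => Re (f p))); auto. intros i; apply H.
  - apply (has_sum_fubini (fun p => Im (f p))); auto. intros i; apply H.
Qed.

Lemma summableC_row (f : I * J -> C) i : summableC f -> summableC (fun j => f (i, j)).
Proof. intros H; apply (summableC_inj (fun j => (i, j)) (fun x y E => f_equal snd E) f H). Qed.

Lemma csum_fubini (f : I * J -> C) : summableC f ->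
  csum (fun i => csum (fun j => f (i, j))) = csum f.
Proof.
  intros H. apply csum_unique, has_sumC_fubini with f; [now apply csum_spec|].
  intros i; apply csum_spec. now apply summableC_row.
Qed.

Lemma has_sumC_prod (f : I -> C) (g : J -> C) s t : has_sumC f s -> has_sumC g t ->
  has_sumC (fun p : I * J => f (fst p) * g (snd p))%C (s * t)%C.
Proof.
  intros [H1 H2] [H3 H4]; split; simpl.
  - apply has_sum_minus; [apply (has_sum_prod (fun i => Re (f i)) (fun j => Re (g j)))
      |apply (has_sum_prod (fun i => Im (f i)) (fun j => Im (g j)))]; auto.
  - apply has_sum_plus; [apply (has_sum_prod (fun i => Re (f i)) (fun j => Im (g j)))
      |apply (has_sum_prod (fun i => Im (f i)) (fun j => Re (g j)))]; auto.
Qed.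

Lemma has_sumC_sum (f : I + J -> C) s t : has_sumC (fun i => f (inl i)) s ->
  has_sumC (fun j => f (inr j)) t -> has_sumC f (s + t)%C.
Proof.
  intros [H1 H2] [H3 H4]; split; simpl.
  - now apply (has_sum_sum (fun p => Re (f p))).
  - now apply (has_sum_sum (fun p => Im (f p))).
Qed.

End CProducts.

Lemma csum_mult {I J} (f : I -> C) (g : J -> C) : summableC f -> summableC g ->
  (csum f * csum g)%C = csum (fun p : I * J => f (fst p) * g (snd p))%C.
Proof. intros; symmetry; apply csum_unique, has_sumC_prod; now apply csum_spec. Qed.

Lemma summableC_mult {I J} (f : I -> C) (g : J -> C) : summableC f -> summableC g ->
  summableC (fun p : I * J => f (fst p) * g (snd p))%C.
Proof. intros [s Hs] [t Ht]; eexists; apply has_sumC_prod; eauto. Qed.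

Lemma has_sumC_Z (f : Z -> C) s t : has_sumC (fun n => f (Z.of_nat n)) s ->
  has_sumC (fun n => f (- Z.of_nat n - 1)%Z) t -> has_sumC f (s + t)%C.
Proof.
  intros [H1 H2] [H3 H4]; split; simpl.
  - now apply (has_sum_Z (fun k => Re (f k))).
  - now apply (has_sum_Z (fun k => Im (f k))).
Qed.

Lemma has_sumC_nat (f : Z -> C) s : (forall k, (k < 0)%Z -> f k = 0%C) ->
  has_sumC f s <-> has_sumC (fun n => f (Z.of_nat n)) s.
Proof.
  intros H.
  assert (Hs : forall i, f i <> 0%C -> exists j, Z.of_nat j = i).
  { intros i Hi. exists (Z.to_nat i). destruct (Z_lt_le_dec i 0) as [Hl|]; [|lia].
    contradiction (Hi (H i Hl)). }
  split; intros Hf.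
  - apply (has_sumC_inj_rev Z.of_nat); auto; intros; lia.
  - apply (has_sumC_inj Z.of_nat); auto; intros; lia.
Qed.

Lemma has_sumC_telescope (a : Z -> C) (s A B : C) :
  has_sumC (fun k => a (k + 1)%Z - a k)%C s ->
  has_limC (fun n => a (Z.of_nat n)) A ->
  has_limC (fun n => a (- Z.of_nat n)%Z) B -> s = (A - B)%C.
Proof.
  intros [H1 H2] [H3 H4] [H5 H6]; apply C_ext; simpl.
  - now apply (has_sum_telescope (fun k => Re (a k))).
  - now apply (has_sum_telescope (fun k => Im (a k))).
Qed.

Lemma sum_n_C (f : nat -> C) n :
  Re (sum_n f n) = sum_n (fun k => Re (f k)) n /\ Im (sum_n f n) = sum_n (fun k => Im (f k)) n.
Proof.
  induction n as [|n [IH1 IH2]]; [now rewrite !sum_O|].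
  rewrite !sum_Sn, <- IH1, <- IH2. now split.
Qed.

(** Balls in [C] are products of balls in the two components. *)
Lemma is_series_C_iff (f : nat -> C) (s : C) :
  is_series f s <->
  is_series (fun k => Re (f k)) (Re s) /\ is_series (fun k => Im (f k)) (Im s).
Proof.
  unfold is_series. split.
  - intros H.
    assert (forall eps : posreal, eventually (fun n => ball s eps (sum_n f n))) as Hb.
    { apply filterlim_locally; exact H. }
    split; apply filterlim_locally; intros eps; specialize (Hb eps);
      (eapply filter_imp; [|exact Hb]); intros n [B1 B2];
      destruct (sum_n_C f n) as [Euler1 E2];
      [exact (eq_ind _ (fun v => ball (Re s) eps v) B1 _ Euler1)
      |exact (eq_ind _ (fun v => ball (Im s) eps v) B2 _ E2)].
  - intros [H1 H2].
    apply filterlim_locally; intros eps.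
    assert (H1' := proj1 (filterlim_locally _ _) H1 eps).
    assert (H2' := proj1 (filterlim_locally _ _) H2 eps).
    generalize (filter_and _ _ H1' H2').
    apply filter_imp. intros n [B1 B2].
    destruct (sum_n_C f n) as [Euler1 E2].
    split; [exact (eq_ind _ (fun v => ball (Re s) eps v) B1 _ (eq_sym Euler1))
      |exact (eq_ind _ (fun v => ball (Im s) eps v) B2 _ (eq_sym E2))].
Qed.

Lemma has_sumC_series (f : nat -> C) s : has_sumC f s -> is_series f s /\ Cseries f = s.
Proof.
  intros [H1 H2]. apply has_sum_is_series in H1. apply has_sum_is_series in H2.
  split; [now apply is_series_C_iff|].
  unfold Cseries. rewrite (is_series_unique _ _ H1), (is_series_unique _ _ H2). now destruct s.
Qed.

(** * Completeness from orthogonal rows and columns *)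

Section Completeness.
Context {X I : Type}.
Variable W : X -> R.
Variable e : I -> X -> R.
Variables N h : I -> R.
Variable B : R.
Hypothesis W_pos : forall x, 0 < W x.
Hypothesis N_neq0 : forall i, N i <> 0.
Hypothesis h_neq0 : forall i, h i <> 0.
Hypothesis rows_orth : forall i j, i <> j -> has_sum (fun x => W x * (e i x * e j x)) 0.
Hypothesis rows_norm : forall i, has_sum (fun x => W x * (e i x * e i x)) (N i).
Hypothesis ratio_bound : forall i, Rabs (N i / h i) <= B.
(** Conditional on convergence: that the column sums converge is a consequence of Bessel's
    inequality and of [ratio_bound], see [column_summable]. *)
Hypothesis columns_orth : forall x y s, x <> y ->
  has_sum (fun i => e i x * e i y / h i) s -> s = 0.
(** A row without zeros, through which all points are compared; P_0 in the application. *)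
Variable i0 : I.
Hypothesis e_i0 : forall x, e i0 x <> 0.

Definition comb (a : I -> R) (l : list I) (x : X) : R := lsum (fun i => a i * e i x) l.

Lemma N_pos i : 0 < N i.
Proof.
  assert (0 <= N i).
  { eapply (has_sum_le (fun _ => 0)); [|apply has_sum_zero|apply rows_norm].
    intros x; cbv beta. apply Rmult_le_pos; [apply Rlt_le, W_pos|]. nra. }
  pose proof (N_neq0 i). lra.
Qed.

Lemma comb_ip (g : X -> R) (t : I -> R) a l :
  (forall i, has_sum (fun x => W x * (g x * e i x)) (t i)) ->
  has_sum (fun x => W x * (g x * comb a l x)) (lsum (fun i => a i * t i) l).
Proof.
  intros Hg. induction l as [|i l IH].
  - simpl. eapply has_sum_ext; [|apply has_sum_zero]. intros x; cbv beta. unfold comb; simpl. ring.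
  - change (lsum (fun i => a i * t i) (i :: l)) with (a i * t i + lsum (fun i => a i * t i) l).
    eapply has_sum_ext; [|apply has_sum_plus; [apply has_sum_scal, (Hg i)|apply IH]].
    intros x; cbv beta. unfold comb; simpl. ring.
Qed.

Lemma lsum_indicator (f : I -> R) j l : NoDup l ->
  lsum (fun i => if cdec j i then f i else 0) l = if in_dec cdec j l then f j else 0.
Proof.
  induction 1 as [|i l Hi Hl IH]; [reflexivity|].
  change (lsum (fun i => if cdec j i then f i else 0) (i :: l)) with
    ((if cdec j i then f i else 0) + lsum (fun i => if cdec j i then f i else 0) l).
  rewrite IH. destruct (cdec j i) as [->|Hne].
  - destruct (in_dec cdec i l); [contradiction|]. destruct (in_dec cdec i (i :: l)) as [|Hn]; [ring|].
    destruct Hn; now left.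
  - destruct (in_dec cdec j l); destruct (in_dec cdec j (i :: l)) as [Hin|Hn]; try ring.
    + destruct Hn; now right.
    + destruct Hin; [congruence|contradiction].
Qed.

Lemma row_ip i j : has_sum (fun x => W x * (e j x * e i x)) (if cdec j i then N i else 0).
Proof. destruct (cdec j i) as [->|Hne]; [apply rows_norm|now apply rows_orth]. Qed.

Lemma comb_row a l j : NoDup l ->
  has_sum (fun x => W x * (e j x * comb a l x)) (if in_dec cdec j l then a j * N j else 0).
Proof.
  intros Hl. assert (H := comb_ip (e j) _ a l (fun i => row_ip i j)).
  rewrite (lsum_ext_in _ (fun i => if cdec j i then a i * N i else 0)) in H.
  - now rewrite (lsum_indicator (fun i => a i * N i)) in H.
  - intros i _. destruct (cdec j i); ring.
Qed.

Lemma comb_norm a l : NoDup l ->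
  has_sum (fun x => W x * (comb a l x * comb a l x)) (lsum (fun i => a i * a i * N i) l).
Proof.
  intros Hl.
  assert (H := comb_ip (comb a l) (fun j => if in_dec cdec j l then a j * N j else 0) a l).
  rewrite (lsum_ext_in _ (fun i => a i * a i * N i)) in H.
  - apply H. intros i. eapply has_sum_ext; [|apply (comb_row a l i Hl)]. intros x; cbv beta. ring.
  - intros i Hi. destruct (in_dec cdec i l); [ring|contradiction].
Qed.

Lemma has_sum_single (x : X) (f : X -> R) : (forall y, y <> x -> f y = 0) -> has_sum f (f x).
Proof.
  intros H. assert (E := has_sum_finite f (x :: nil)). simpl lsum in E. rewrite Rplus_0_r in E.
  apply E.
  - constructor; [intros []|constructor].
  - intros y Hy. apply H. intros ->. apply Hy. now left.
Qed.

(** The combination of the rows in l with coefficients e_i(x) / N_i has both its value at x and its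
    squared norm equal to S. The point x alone contributes W(x) S^2 to that norm, whence W(x) S^2 <=
    S. *)
Lemma bessel x l : NoDup l -> lsum (fun i => e i x * e i x / N i) l <= / W x.
Proof.
  intros Hl. set (S := lsum (fun i => e i x * e i x / N i) l).
  assert (H := comb_norm (fun i => e i x / N i) l Hl).
  rewrite (lsum_ext_in _ (fun i => e i x * e i x / N i)) in H.
  2:{ intros i _. field. apply N_neq0. }
  fold S in H.
  assert (Ex : comb (fun i => e i x / N i) l x = S).
  { unfold comb, S. apply lsum_ext_in. intros i _. field. apply N_neq0. }
  assert (HS : W x * (S * S) <= S).
  { assert (P := lsum_le_has_sum _ _ (x :: nil)
      (fun y => Rmult_le_pos _ _ (Rlt_le _ _ (W_pos y)) (Rle_0_sqr (comb (fun i => e i x / N i) l y)))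
      H ltac:(constructor; [intros []|constructor])).
    unfold lsum in P; cbn [fold_right] in P. rewrite Ex in P. unfold Rsqr in P. lra. }
  assert (P := W_pos x).
  destruct (Rle_lt_dec S 0) as [H0|H0].
  - apply Rle_trans with 0; auto. now apply Rlt_le, Rinv_0_lt_compat.
  - apply Rmult_le_reg_l with (W x); auto. rewrite Rinv_r by lra.
    apply Rmult_le_reg_r with S; auto. lra.
Qed.

Lemma bessel_summable x : summable (fun i => e i x * e i x / N i).
Proof.
  apply summable_bounded with (/ W x); [|apply bessel].
  intros i. assert (P := N_pos i). apply Rmult_le_pos; [nra|]. now apply Rlt_le, Rinv_0_lt_compat.
Qed.

(** The ratios N_i / h_i are bounded, so Bessel's sums at x and at y dominate the column sum. *)
Lemma column_summable x y : summable (fun i => e i x * e i y / h i).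
Proof.
  destruct (bessel_summable x) as [s Hs]. destruct (bessel_summable y) as [t Ht].
  apply summable_le with (fun i => B * (e i x * e i x / N i + e i y * e i y / N i));
    [|eexists; apply has_sum_scal, has_sum_plus; eauto].
  intros i. assert (P := N_pos i).
  replace (e i x * e i y / h i) with (N i / h i * (e i x * e i y / N i)) by (field; auto).
  rewrite Rabs_mult. apply Rmult_le_compat; auto using Rabs_pos.
  unfold Rdiv. rewrite <- Rmult_plus_distr_r, Rabs_mult, (Rabs_pos_eq (/ N i));
    [|now apply Rlt_le, Rinv_0_lt_compat].
  apply Rmult_le_compat_r; [now apply Rlt_le, Rinv_0_lt_compat|].
  apply Rabs_le. nra.
Qed.

Lemma lsum_close (f : I -> X -> R) (F : X -> R) (l0 : list X) eps : 0 < eps ->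
  (forall y, has_sum (fun i => f i y) (F y)) ->
  exists m0, forall m, NoDup m -> incl m0 m ->
    forall y, In y l0 -> Rabs (lsum (fun i => f i y) m - F y) < eps.
Proof.
  intros Heps Hf. induction l0 as [|x l0 [m0 IH]].
  - exists nil. intros m _ _ y [].
  - destruct (Hf x eps Heps) as [m1 H1]. exists (m0 ++ m1).
    intros m Hm Hi y [<-|Hy].
    + apply H1; auto. eapply incl_tran; [|apply Hi]. apply incl_appr, incl_refl.
    + apply IH; auto. eapply incl_tran; [|apply Hi]. apply incl_appl, incl_refl.
Qed.

(* The partial sums of the column expansion are bounded in norm and converge
   pointwise, hence weakly. *)
Lemma column_weak x s j : has_sum (fun i => e i x * e i x / h i) s ->
  W x * (e j x * s) = N j / h j * e j x.
Proof.
  intros Hs.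
  (* The pointwise limit of the partial column sums: by orthogonality of the columns it is a
     multiple of the point mass at x. *)
  set (K := fun y => if cdec y x then s else 0).
  assert (HK : forall y, has_sum (fun i => e i x / h i * e i y) (K y)).
  { intros y. unfold K. destruct (column_summable x y) as [t Ht].
    assert (Ht' : has_sum (fun i => e i x / h i * e i y) t)
      by (eapply has_sum_ext; [|apply Ht]; intros i; cbv beta; unfold Rdiv; ring).
    destruct (cdec y x) as [->|Hne].
    - eapply has_sum_ext; [|apply Hs]. intros i; cbv beta. unfold Rdiv. ring.
    - replace 0 with t; auto. eapply columns_orth; [|apply Ht]. auto. }
  destruct (bessel_summable x) as [b Hb].
  assert (Hb0 : 0 <= b).
  { eapply (has_sum_le (fun _ => 0)); [|apply has_sum_zero|apply Hb].
    intros i; cbv beta. assert (P := N_pos i). apply Rmult_le_pos; [nra|]. now apply Rlt_le, Rinv_0_lt_compat. }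
  apply cond_eq. intros eps Heps.
  set (M := B * B * b + 1).
  assert (HM : 0 < M) by (unfold M; assert (0 <= B * B) by nra; nra).
  (* M exceeds the squared norm of every partial sum g of the column. Outside a finite set, Young's
     inequality with parameter t bounds the inner product of e_j and g: t makes the share of g at
     most t M / 2 = eps / 4, and [eps1] makes the share of e_j at most eps1 / (2 t) = eps / 8.
     Inside the set, pointwise convergence costs less than eps / 4. *)
  set (t := eps / (2 * M)). assert (Ht : 0 < t) by (unfold t; apply Rdiv_lt_0_compat; lra).
  set (eps1 := eps * t / 4). assert (He1 : 0 < eps1) by (unfold eps1; nra).
  destruct (rows_norm j eps1 He1) as [l0 H0].
  destruct (has_sum_union l0 (x :: nil)) as [l [Hl [Hil Hix]]].
  set (C0 := lsum (fun y => W y * Rabs (e j y)) l).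
  assert (HC0 : 0 <= C0).
  { apply lsum_nonneg. intros y. apply Rmult_le_pos; [apply Rlt_le, W_pos|apply Rabs_pos]. }
  destruct (lsum_close (fun i y => e i x / h i * e i y) K l (eps / (4 * (C0 + 1)))) as [m0 Hm0]; auto.
  { apply Rdiv_lt_0_compat; lra. }
  destruct (has_sum_union m0 (j :: nil)) as [m [Hm [Him Hij]]].
  specialize (Hm0 m Hm Him).
  set (g := comb (fun i => e i x / h i) m).
  assert (Hg := comb_norm (fun i => e i x / h i) m Hm). fold g in Hg.
  set (G := lsum (fun i => e i x / h i * (e i x / h i) * N i) m) in Hg.
  assert (HG : G <= M - 1).
  { unfold M. replace (B * B * b + 1 - 1) with (B * B * b) by ring.
    apply Rle_trans with (lsum (fun i => B * B * (e i x * e i x / N i)) m).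
    - apply lsum_le_in. intros i _. assert (P := N_pos i). assert (R := ratio_bound i).
      replace (e i x / h i * (e i x / h i) * N i) with
        ((N i / h i) * (N i / h i) * (e i x * e i x / N i)) by (field; auto).
      apply Rmult_le_compat_r.
      + apply Rmult_le_pos; [nra|]. now apply Rlt_le, Rinv_0_lt_compat.
      + apply Rsqr_le_abs_1. rewrite (Rabs_pos_eq B); auto. pose proof (Rabs_pos (N i / h i)). lra.
    - rewrite lsum_scal. apply Rmult_le_compat_l; [nra|]. eapply lsum_le_has_sum; eauto.
      intros i. assert (P := N_pos i). apply Rmult_le_pos; [nra|]. now apply Rlt_le, Rinv_0_lt_compat. }
  assert (Hr := comb_row (fun i => e i x / h i) m j Hm). fold g in Hr.
  destruct (in_dec cdec j m) as [_|Hn]; [|destruct Hn; apply Hij; now left].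
  assert (HT2 := has_sum_plus _ _ _ _ (has_sum_scal (/ (2 * t)) _ _ (rows_norm j)) (has_sum_scal (t / 2) _ _ Hg)).
  cbv beta in HT2.
  assert (Hyoung : forall y, Rabs (W y * (e j y * g y)) <=
    / (2 * t) * (W y * (e j y * e j y)) + t / 2 * (W y * (g y * g y))).
  { intros y. assert (P := W_pos y).
    replace (/ (2 * t) * (W y * (e j y * e j y)) + t / 2 * (W y * (g y * g y))) with
      (W y * (/ (2 * t) * (e j y * e j y + t * t * (g y * g y)))) by (field; lra).
    rewrite Rabs_mult, (Rabs_pos_eq (W y)) by lra. apply Rmult_le_compat_l; [lra|].
    assert (Pt : 0 < / (2 * t)) by (apply Rinv_0_lt_compat; lra).
    replace (e j y * g y) with (/ (2 * t) * (2 * (e j y * (t * g y)))) by (field; lra).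
    rewrite Rabs_mult, (Rabs_pos_eq (/ (2 * t))) by lra. apply Rmult_le_compat_l; [lra|].
    assert (P1 := Rle_0_sqr (e j y + t * g y)). assert (P2 := Rle_0_sqr (e j y - t * g y)).
    unfold Rsqr in P1, P2. apply Rabs_le. lra. }
  assert (Htail := has_sum_tail _ _ _ _ l Hyoung Hr HT2 Hl).
  specialize (H0 l Hl Hil). apply Rabs_def2 in H0.
  rewrite lsum_plus, !lsum_scal in Htail.
  assert (Hfin : lsum (fun y => W y * (e j y * K y)) l = W x * (e j x * s)).
  { assert (E := has_sum_single x (fun y => W y * (e j y * K y))).
    cbv beta in E. unfold K in E at 3. destruct (cdec x x) as [_|]; [|congruence].
    eapply has_sum_unique; [apply has_sum_finite; auto|].
    - intros y Hy. unfold K. destruct (cdec y x) as [->|]; [|ring]. destruct Hy. apply Hix. now left.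
    - apply E. intros y Hy. unfold K. destruct (cdec y x); [contradiction|ring]. }
  set (r := eps / (4 * (C0 + 1))) in *.
  assert (Hdiff : Rabs (lsum (fun y => W y * (e j y * g y)) l - lsum (fun y => W y * (e j y * K y)) l)
    <= r * C0).
  { replace (lsum (fun y => W y * (e j y * g y)) l - lsum (fun y => W y * (e j y * K y)) l) with
      (lsum (fun y => W y * (e j y * (g y - K y))) l).
    2:{ rewrite (lsum_ext_in _ (fun y => W y * (e j y * g y) + (-1) * (W y * (e j y * K y)))) by (intros; ring).
        rewrite lsum_plus, lsum_scal. ring. }
    eapply Rle_trans; [apply lsum_abs|]. unfold C0. rewrite <- lsum_scal. apply lsum_le_in.
    intros y Hy. specialize (Hm0 y Hy). assert (P := W_pos y).
    change (lsum (fun i => e i x / h i * e i y) m) with (g y) in Hm0.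
    rewrite (Rabs_mult (W y)), (Rabs_mult (e j y)), (Rabs_pos_eq (W y)) by lra.
    replace (r * (W y * Rabs (e j y))) with (W y * (Rabs (e j y) * r)) by ring.
    apply Rmult_le_compat_l; [lra|]. apply Rmult_le_compat_l; [apply Rabs_pos|lra]. }
  rewrite Hfin in Hdiff.
  assert (E4 : r * C0 < eps / 4).
  { unfold r. replace (eps / 4) with (eps / (4 * (C0 + 1)) * (C0 + 1)) by (field; lra).
    apply Rmult_lt_compat_l; [apply Rdiv_lt_0_compat; lra|lra]. }
  assert (Q1 : / (2 * t) * (N j - lsum (fun y => W y * (e j y * e j y)) l) <= eps / 8).
  { replace (eps / 8) with (/ (2 * t) * eps1) by (unfold eps1; field; lra).
    apply Rmult_le_compat_l; [apply Rlt_le, Rinv_0_lt_compat; lra|lra]. }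
  assert (Q2 : t / 2 * (G - lsum (fun y => W y * (g y * g y)) l) <= eps / 4).
  { replace (eps / 4) with (t / 2 * M) by (unfold t; field; lra).
    apply Rmult_le_compat_l; [lra|].
    assert (0 <= lsum (fun y => W y * (g y * g y)) l).
    { apply lsum_nonneg. intros y. apply Rmult_le_pos; [apply Rlt_le, W_pos|nra]. }
    lra. }
  replace (e j x / h j * N j) with (N j / h j * e j x) in Htail by (unfold Rdiv; ring).
  apply Rabs_le_between in Htail. apply Rabs_le_between in Hdiff.
  apply Rabs_def1; lra.
Qed.

Definition ratio : R := N i0 / h i0.

Lemma ratio_def : ratio = N i0 / h i0.
Proof. reflexivity. Qed.

Lemma ratio_neq0 : ratio <> 0.
Proof. unfold ratio. apply Rmult_integral_contrapositive. split; auto. now apply Rinv_neq_0_compat. Qed.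

(** [column_weak] at j = i0, divided by e_i0(x), which is nonzero; hence the constant is the same
    for all x. *)
Lemma column_diag x : has_sum (fun i => e i x * e i x / h i) (ratio / W x).
Proof.
  destruct (column_summable x x) as [s Hs].
  assert (E := column_weak x s i0 Hs). fold ratio in E.
  assert (P := W_pos x). assert (P0 := e_i0 x).
  replace (ratio / W x) with s; auto.
  apply Rmult_eq_reg_l with (W x * e i0 x).
  - rewrite Rmult_assoc, E. field. lra.
  - apply Rmult_integral_contrapositive. split; [lra|auto].
Qed.

(** [column_weak] at a point where e_j is nonzero, with the column sum now known. Such a point
    exists since N_j is nonzero. *)
Lemma norm_ratio j : N j = ratio * h j.
Proof.
  destruct (classic (exists x, e j x <> 0)) as [[x Hx]|Hn].
  - assert (E := column_weak x _ j (column_diag x)). assert (P := W_pos x).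
    assert (E' : ratio = N j / h j).
    { apply Rmult_eq_reg_r with (e j x); auto. rewrite <- E. field. lra. }
    rewrite E'. field. auto.
  - exfalso. apply (N_neq0 j). eapply has_sum_unique; [apply rows_norm|].
    eapply has_sum_ext; [|apply has_sum_zero]. intros x; cbv beta.
    destruct (Req_dec (e j x) 0) as [->|]; [ring|]. destruct Hn; eauto.
Qed.

(** Equality in Bessel's inequality at x: the point mass at x lies in the closed span of the
    rows. *)
Lemma parseval_delta x : has_sum (fun i => e i x * e i x / N i) (/ W x).
Proof.
  assert (P := W_pos x). assert (R0 := ratio_neq0).
  replace (/ W x) with (/ ratio * (ratio / W x)) by (field; split; lra || auto).
  eapply has_sum_ext; [|apply has_sum_scal, column_diag]. intros i; cbv beta.
  rewrite (norm_ratio i). field. split; auto.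
Qed.

Definition rcomb (l : list (R * I)) (x : X) : R := lsum (fun p => fst p * e (snd p) x) l.

Lemma delta_approx x eps : 0 < eps -> exists l s,
  has_sum (fun y => W y * (((if cdec y x then 1 else 0) - rcomb l y) * ((if cdec y x then 1 else 0) - rcomb l y))) s /\
  s < eps.
Proof.
  intros Heps. assert (P := W_pos x).
  destruct (parseval_delta x (eps / (W x * W x))) as [l0 H0]; [apply Rdiv_lt_0_compat; nra|].
  destruct (has_sum_union l0 nil) as [l [Hl [Hi _]]].
  specialize (H0 l Hl Hi). set (S := lsum (fun i => e i x * e i x / N i) l) in *.
  set (a := fun i => W x * e i x / N i).
  exists (map (fun i => (a i, i)) l), (W x + (-2) * (W x * comb a l x) + lsum (fun i => a i * a i * N i) l).
  assert (Er : forall y, rcomb (map (fun i => (a i, i)) l) y = comb a l y).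
  { intros y. unfold rcomb, comb. now rewrite lsum_map. }
  assert (Ex : comb a l x = W x * S).
  { unfold comb, S, a. rewrite <- lsum_scal. apply lsum_ext_in. intros i _. unfold Rdiv; ring. }
  assert (Es : lsum (fun i => a i * a i * N i) l = W x * W x * S).
  { unfold S, a. rewrite <- lsum_scal. apply lsum_ext_in. intros i _. field. auto. }
  split.
  - eapply has_sum_ext; [|apply has_sum_plus; [apply has_sum_plus|apply (comb_norm a l Hl)]].
    2:{ assert (T := has_sum_single x (fun y => if cdec y x then W y else 0)). cbv beta in T.
        destruct (cdec x x); [|congruence]. apply T. intros y Hy. now destruct (cdec y x). }
    2:{ apply has_sum_scal. assert (T := has_sum_single x (fun y => if cdec y x then W y * comb a l y else 0)). cbv beta in T.
        destruct (cdec x x); [|congruence]. apply T. intros y Hy. now destruct (cdec y x). }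
    intros y; cbv beta. rewrite Er. destruct (cdec y x); ring.
  - rewrite Ex, Es. apply Rabs_def2 in H0.
    assert (W x * W x * (/ W x - S) < eps).
    { replace eps with (W x * W x * (eps / (W x * W x))) by (field; lra).
      apply Rmult_lt_compat_l; [nra|lra]. }
    replace (W x + -2 * (W x * (W x * S)) + W x * W x * S) with (W x * W x * (/ W x - S)) by (field; lra). auto.
Qed.

(** Stands in for the triangle inequality; the factor 2 explains the fractions of eps in the
    approximations that follow. *)
Lemma sq_sum (f g : X -> R) s t : has_sum (fun x => W x * (f x * f x)) s ->
  has_sum (fun x => W x * (g x * g x)) t ->
  exists r, has_sum (fun x => W x * ((f x + g x) * (f x + g x))) r /\ r <= 2 * s + 2 * t.
Proof.
  intros Hs Ht.
  assert (Hb := has_sum_plus _ _ _ _ (has_sum_scal 2 _ _ Hs) (has_sum_scal 2 _ _ Ht)). cbv beta in Hb.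
  assert (Hle : forall x, W x * ((f x + g x) * (f x + g x)) <= 2 * (W x * (f x * f x)) + 2 * (W x * (g x * g x))).
  { intros x. assert (P := W_pos x).
    replace (2 * (W x * (f x * f x)) + 2 * (W x * (g x * g x))) with (W x * (2 * (f x * f x) + 2 * (g x * g x))) by ring.
    apply Rmult_le_compat_l; [lra|]. assert (P1 := Rle_0_sqr (f x - g x)). unfold Rsqr in P1. lra. }
  destruct (summable_le (fun x => W x * ((f x + g x) * (f x + g x))) _
    ltac:(intros x; rewrite Rabs_pos_eq; [apply Hle|]; apply Rmult_le_pos; [apply Rlt_le, W_pos|apply Rle_0_sqr])
    (ex_intro _ _ Hb)) as [r Hr].
  exists r. split; auto. exact (has_sum_le _ _ _ _ Hle Hr Hb).
Qed.

Lemma rcomb_app l m y : rcomb (l ++ m) y = rcomb l y + rcomb m y.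
Proof. apply lsum_app. Qed.

Definition restrict (f : X -> R) (F : list X) (y : X) : R := if in_dec cdec y F then f y else 0.

Lemma finite_approx (f : X -> R) F eps : NoDup F -> 0 < eps -> exists l s,
  has_sum (fun y => W y * ((restrict f F y - rcomb l y) * (restrict f F y - rcomb l y))) s /\ s < eps.
Proof.
  intros HF. revert eps. induction HF as [|x F Hx HF IH]; intros eps Heps.
  - exists nil, 0. split; auto. eapply has_sum_ext; [|apply has_sum_zero].
    intros y; cbv beta. unfold restrict, rcomb; simpl. ring.
  - destruct (IH (eps / 4)) as [l [s [Hs Hse]]]; [lra|].
    assert (P : 0 < f x * f x + 1) by nra.
    destruct (delta_approx x (eps / (4 * (f x * f x + 1)))) as [m [t [Ht Hte]]]; [apply Rdiv_lt_0_compat; lra|].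
    apply (has_sum_scal (f x * f x)) in Ht.
    destruct (sq_sum (fun y => restrict f F y - rcomb l y)
      (fun y => f x * ((if cdec y x then 1 else 0) - rcomb m y)) s (f x * f x * t)) as [r [Hr Hre]]; auto.
    { eapply has_sum_ext; [|apply Ht]. intros y; cbv beta. ring. }
    exists (l ++ map (fun p => (f x * fst p, snd p)) m), r. split.
    + eapply has_sum_ext; [|apply Hr]. intros y; cbv beta. rewrite rcomb_app.
      replace (rcomb (map (fun p => (f x * fst p, snd p)) m) y) with (f x * rcomb m y).
      2:{ unfold rcomb. rewrite lsum_map, <- lsum_scal. apply lsum_ext_in. intros p _. simpl. ring. }
      unfold restrict. destruct (in_dec cdec y F) as [Hin|Hin]; destruct (in_dec cdec y (x :: F)) as [Hin'|Hin'];
        destruct (cdec y x) as [->|Hne]; try contradiction; try ring.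
      * destruct Hin'; now right.
      * destruct Hin'; [congruence|contradiction].
      * destruct Hin'; now left.
    + assert (f x * f x * t <= eps / 4); [|lra].
      assert (Ht0 : 0 <= f x * f x) by nra.
      apply Rle_trans with (f x * f x * (eps / (4 * (f x * f x + 1)))); [apply Rmult_le_compat_l; lra|].
      replace (eps / 4) with ((f x * f x + 1) * (eps / (4 * (f x * f x + 1)))) by (field; lra).
      apply Rmult_le_compat_r; [|lra]. apply Rlt_le, Rdiv_lt_0_compat; lra.
Qed.

(** f is cut off to finitely many points, and the cut-off is a combination of point masses. *)
Lemma dense (f : X -> R) eps : summable (fun x => W x * (f x * f x)) -> 0 < eps -> exists l s,
  has_sum (fun y => W y * ((f y - rcomb l y) * (f y - rcomb l y))) s /\ s < eps.
Proof.
  intros [n Hn] Heps.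
  destruct (Hn (eps / 8)) as [F0 HF0]; [lra|].
  destruct (has_sum_union F0 nil) as [F [HF [Hi _]]]. specialize (HF0 F HF Hi).
  destruct (finite_approx f F (eps / 4) HF) as [l [s [Hs Hse]]]; [lra|].
  assert (Ht : has_sum (fun y => W y * ((f y - restrict f F y) * (f y - restrict f F y)))
    (n - lsum (fun y => W y * (f y * f y)) F)).
  { rewrite (lsum_ext_in _ (fun y => W y * (restrict f F y * restrict f F y))).
    2:{ intros y Hy. unfold restrict. destruct (in_dec cdec y F); [reflexivity|contradiction]. }
    eapply has_sum_ext; [|apply has_sum_minus; [apply Hn|apply has_sum_finite; [apply HF|]]].
    - intros y; cbv beta. unfold restrict. destruct (in_dec cdec y F); ring.
    - intros y Hy; cbv beta. unfold restrict. destruct (in_dec cdec y F); [contradiction|ring]. }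
  destruct (sq_sum _ _ _ _ Ht Hs) as [r [Hr Hre]].
  exists l, r. split.
  - eapply has_sum_ext; [|apply Hr]. intros y; cbv beta. ring.
  - apply Rabs_def2 in HF0. lra.
Qed.

End Completeness.

(** * Integer powers and the exponents n(n-1)/2 *)

Open Scope C_scope.

Lemma Cmod_pow (x : C) n : Cmod (x ^ n) = (Cmod x ^ n)%R.
Proof. induction n; simpl; [apply Cmod_1|]. now rewrite Cmod_mult, IHn. Qed.

Lemma Cpow_neq0 (x : C) n : x <> 0 -> x ^ n <> 0.
Proof. intros H; induction n; simpl; [apply C1_nz|]. now apply Cmult_neq_0. Qed.

Lemma Cmult_reg_l (x y z : C) : x * y = x * z -> x <> 0 -> y = z.
Proof.
  intros E Hx. replace y with (/ x * (x * y)) by (field; auto).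
  rewrite E. field; auto.
Qed.

Lemma Cpowz_nat (x : C) n : Cpowz x (Z.of_nat n) = x ^ n.
Proof.
  destruct n; auto. unfold Cpowz. change (Z.of_nat (S n)) with (Zpos (Pos.of_succ_nat n)).
  cbv iota beta. now rewrite SuccNat2Pos.id_succ.
Qed.

Lemma Cpowz_opp_nat (x : C) n : x <> 0 -> Cpowz x (- Z.of_nat n) = / x ^ n.
Proof.
  intros Hx. destruct n; simpl; [field; apply C1_nz|].
  now rewrite SuccNat2Pos.id_succ.
Qed.

Lemma Cpowz_S (x : C) k : x <> 0 -> Cpowz x (k + 1) = x * Cpowz x k.
Proof.
  intros Hx. destruct (Z_le_gt_dec 0 k).
  - replace k with (Z.of_nat (Z.to_nat k)) by lia.
    replace (Z.of_nat (Z.to_nat k) + 1)%Z with (Z.of_nat (S (Z.to_nat k))) by lia.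
    now rewrite !Cpowz_nat.
  - replace k with (- Z.of_nat (S (Z.to_nat (- k - 1))))%Z by lia.
    replace (- Z.of_nat (S (Z.to_nat (- k - 1))) + 1)%Z with
      (- Z.of_nat (Z.to_nat (- k - 1)))%Z by lia.
    rewrite !Cpowz_opp_nat by auto. simpl. field; split; auto. now apply Cpow_neq0.
Qed.

(** The step is an equivalence because the identities proved with it follow invertible recurrences,
    which are run in both directions from 0. *)
Lemma Z_two_sided_ind (P : Z -> Prop) :
  P 0%Z -> (forall k, P k <-> P (k + 1)%Z) -> forall k, P k.
Proof.
  intros H0 HS k. destruct (Z_le_gt_dec 0 k).
  - replace k with (Z.of_nat (Z.to_nat k)) by lia.
    induction (Z.to_nat k) as [|n IH]; auto. rewrite Nat2Z.inj_succ.
    exact (proj1 (HS _) IH).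
  - replace k with (- Z.of_nat (Z.to_nat (- k)))%Z by lia.
    induction (Z.to_nat (- k)) as [|n IH]; auto. apply (proj2 (HS _)).
    now replace (- Z.of_nat (S n) + 1)%Z with (- Z.of_nat n)%Z by lia.
Qed.

Lemma Cpowz_neq0 (x : C) k : x <> 0 -> Cpowz x k <> 0.
Proof.
  intros Hx; revert k. apply Z_two_sided_ind; [apply C1_nz|].
  intros k; rewrite Cpowz_S by auto. split.
  - intros H; now apply Cmult_neq_0.
  - intros H E; apply H; rewrite E; ring.
Qed.

Lemma Cpowz_add (x : C) j k : x <> 0 -> Cpowz x (j + k) = Cpowz x j * Cpowz x k.
Proof.
  intros Hx; revert k. apply Z_two_sided_ind.
  - rewrite Z.add_0_r. simpl. ring.
  - intros k. rewrite Z.add_assoc, !Cpowz_S by auto. split; intros H.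
    + rewrite H; ring.
    + apply (Cmult_reg_l x); auto. rewrite H; ring.
Qed.

Lemma Cpowz_mult (x y : C) k : x <> 0 -> y <> 0 -> Cpowz (x * y) k = Cpowz x k * Cpowz y k.
Proof.
  intros Hx Hy; revert k. apply Z_two_sided_ind; [simpl; ring|].
  assert (x * y <> 0) by now apply Cmult_neq_0.
  intros k. rewrite !Cpowz_S by auto. split; intros E.
  - rewrite E; ring.
  - apply (Cmult_reg_l (x * y)); auto. rewrite E; ring.
Qed.

Lemma Cpowz_opp (x : C) k : x <> 0 -> Cpowz x (- k) = / Cpowz x k.
Proof.
  intros Hx. apply (Cmult_reg_l (Cpowz x k)); [|now apply Cpowz_neq0].
  rewrite <- Cpowz_add, Z.add_opp_diag_r by auto. simpl. field. now apply Cpowz_neq0.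
Qed.

Lemma Cinv_neq0 (x : C) : x <> 0 -> / x <> 0.
Proof. intros Hx E. apply C1_nz. rewrite <- (Cinv_r x), E by auto. ring. Qed.

Lemma Cdiv_neq0 (x y : C) : x <> 0 -> y <> 0 -> x / y <> 0.
Proof. intros; apply Cmult_neq_0; auto using Cinv_neq0. Qed.

Lemma Cpowz_inv (x : C) k : x <> 0 -> Cpowz (/ x) k = / Cpowz x k.
Proof.
  intros Hx; revert k. apply Z_two_sided_ind; [simpl; field; apply C1_nz|].
  intros k. rewrite !Cpowz_S by auto using Cinv_neq0.
  assert (Hk : Cpowz x k <> 0) by now apply Cpowz_neq0. split; intros E.
  - rewrite E. field; auto.
  - apply (Cmult_reg_l (/ x)); auto using Cinv_neq0. rewrite E. field; auto.
Qed.

Lemma Cpowz_RtoC (x : R) k : x <> 0%R -> Cpowz x k = RtoC (powerRZ x k).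
Proof.
  intros Hx; revert k. apply Z_two_sided_ind; [reflexivity|].
  assert (RtoC x <> 0) by (intros E; apply Hx; now apply RtoC_inj).
  intros k. rewrite Cpowz_S, powerRZ_add by auto.
  replace (powerRZ x 1) with x by (simpl; ring). rewrite RtoC_mult. split; intros E.
  - rewrite E; ring.
  - apply (Cmult_reg_l x); auto. rewrite E; ring.
Qed.

Lemma Cmod_Cpowz (x : C) k : x <> 0 -> Cmod (Cpowz x k) = powerRZ (Cmod x) k.
Proof.
  intros Hx; revert k. apply Z_two_sided_ind; [apply Cmod_1|].
  assert (Cmod x <> 0%R) by (intros E; now apply Hx, Cmod_eq_0).
  intros k. rewrite Cpowz_S, powerRZ_add, Cmod_mult by auto.
  replace (powerRZ (Cmod x) 1) with (Cmod x) by (simpl; ring). split; intros E.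
  - rewrite E; ring.
  - apply (Rmult_eq_reg_l (Cmod x)); auto. rewrite E; ring.
Qed.

Definition tri (n : Z) : Z := (n * (n - 1) / 2)%Z.

Lemma tri_double n : (2 * tri n = n * (n - 1))%Z.
Proof.
  unfold tri. assert ((n * (n - 1)) mod 2 = 0)%Z.
  { rewrite Zmult_mod, Zminus_mod. pose proof (Z.mod_pos_bound n 2).
    assert (n mod 2 = 0 \/ n mod 2 = 1)%Z as [->| ->] by lia; reflexivity. }
  pose proof (Z_div_mod_eq_full (n * (n - 1)) 2). lia.
Qed.

Lemma summable_ratio (f : nat -> R) (l : R) : (forall n, 0 < f n)%R -> (l < 1)%R ->
  is_lim_seq (fun n => f (S n) / f n)%R l -> summable f.
Proof.
  intros Hf Hl Hlim.
  assert (ex_series (fun n => Rabs (f n))) as He.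
  { apply ex_series_DAlembert with l; auto.
    - intros n; specialize (Hf n); lra.
    - eapply is_lim_seq_ext; [|apply Hlim]. intros n; simpl.
      rewrite Rabs_pos_eq; auto. apply Rlt_le, Rdiv_lt_0_compat; auto. }
  exists (Series f). apply is_series_has_sum; auto.
  apply Series_correct. now apply ex_series_Rabs.
Qed.

Lemma summable_nat_ext (f : Z -> R) : (forall k, (k < 0)%Z -> f k = 0%R) ->
  summable (fun n => f (Z.of_nat n)) -> summable f.
Proof.
  intros H [s Hs]. exists s. apply (has_sum_inj Z.of_nat); auto; [intros; lia|].
  intros i Hi. exists (Z.to_nat i). destruct (Z_lt_le_dec i 0) as [Hl|]; [|lia].
  contradiction (Hi (H i Hl)).
Qed.

(** * Products, Euler's series and theta functions *)

Section QAnalysis.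
Variable q : R.
Hypothesis hq : (0 < q < 1)%R.

Section QSeries.

Implicit Types (u v w : C) (i j k m : Z).

Lemma q0 : q <> 0%R.
Proof. lra. Qed.

Local Hint Extern 0 (q <> 0%R) => exact q0 : core.

Definition qz (k : Z) : C := RtoC (powerRZ q k).

Lemma qz_add j k : qz (j + k) = qz j * qz k.
Proof. unfold qz. now rewrite powerRZ_add, RtoC_mult. Qed.

Lemma qz_0 : qz 0 = 1.
Proof. reflexivity. Qed.

Lemma qz_1 : qz 1 = q.
Proof. unfold qz; simpl. now rewrite Rmult_1_r. Qed.

Lemma qz_neq0 k : qz k <> 0.
Proof.
  intros E. apply (powerRZ_NOR q k q0). now apply RtoC_inj.
Qed.

Lemma qz_opp k : qz (- k) = / qz k.
Proof.
  apply (Cmult_reg_l (qz k)); [|apply qz_neq0].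
  rewrite <- qz_add, Z.add_opp_diag_r, qz_0. field. apply qz_neq0.
Qed.

Lemma qz_sub j k : qz (j - k) = qz j / qz k.
Proof. unfold Z.sub. now rewrite qz_add, qz_opp. Qed.

Lemma qz_nat n : qz (Z.of_nat n) = RtoC q ^ n.
Proof. unfold qz. now rewrite <- pow_powerRZ, RtoC_pow. Qed.

Lemma Cmod_qz k : Cmod (qz k) = powerRZ q k.
Proof. unfold qz. rewrite Cmod_R, Rabs_pos_eq; auto. apply powerRZ_le; lra. Qed.

Lemma q_neq0C : RtoC q <> 0.
Proof. rewrite <- qz_1. apply qz_neq0. Qed.

Lemma qz_inj k : qz k = 1 -> k = 0%Z.
Proof.
  intros E. unfold qz in E. apply RtoC_inj in E.
  destruct (Z.lt_trichotomy k 0) as [H|[H|H]]; auto; exfalso.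
  - assert (powerRZ q (- k) = 1%R).
    { rewrite powerRZ_neg', E. field. }
    replace (- k)%Z with (Z.of_nat (S (Z.to_nat (- k - 1)))) in H0 by lia.
    rewrite <- pow_powerRZ in H0.
    pose proof (pow_lt_1_compat q (S (Z.to_nat (- k - 1)))). lra || (destruct H1; [lra|lia|lra]).
  - replace k with (Z.of_nat (S (Z.to_nat (k - 1)))) in E by lia.
    rewrite <- pow_powerRZ in E.
    destruct (pow_lt_1_compat q (S (Z.to_nat (k - 1)))); [lra|lia|lra].
Qed.

Lemma is_lim_pow_q : is_lim_seq (fun n => q ^ n)%R 0%R.
Proof. apply is_lim_seq_geom. rewrite Rabs_pos_eq; lra. Qed.

(** The general term (-u)^k q^(k(k-1)/2) of Jacobi's theta series. *)
Definition ph (u : C) (k : Z) : C := Cpowz (- u) k * qz (tri k).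

Lemma Copp_neq0 (u : C) : u <> 0 -> - u <> 0.
Proof. intros H E; apply H. replace u with (- - u) by ring. rewrite E; ring. Qed.

Lemma ph_def u k : ph u k = Cpowz (- u) k * qz (tri k).
Proof. reflexivity. Qed.

Lemma ph_neq0 u k : u <> 0 -> ph u k <> 0.
Proof.
  intros Hu; unfold ph. apply Cmult_neq_0; [apply Cpowz_neq0|apply qz_neq0].
  exact (Copp_neq0 u Hu).
Qed.

Lemma ph_0 u : ph u 0 = 1.
Proof. unfold ph. change (tri 0) with 0%Z. rewrite qz_0. simpl. ring. Qed.

(** The factor q^(jk) measures the failure to be a character; all quasi-periodicity of the theta
    functions comes from it. *)
Lemma ph_add u j k : u <> 0 -> ph u (j + k) = ph u j * ph u k * qz (j * k).
Proof.
  intros Hu. unfold ph. rewrite Cpowz_add by now apply Copp_neq0.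
  replace (tri (j + k)) with (tri j + tri k + j * k)%Z.
  - rewrite !qz_add. ring.
  - pose proof (tri_double j); pose proof (tri_double k); pose proof (tri_double (j + k)). nia.
Qed.

Lemma ph_1 u : ph u 1 = - u.
Proof. unfold ph. change (tri 1) with 0%Z. rewrite qz_0. simpl. ring. Qed.

Lemma ph_S u k : u <> 0 -> ph u (k + 1) = - u * qz k * ph u k.
Proof. intros. rewrite ph_add, ph_1, Z.mul_1_r by auto. ring. Qed.

Lemma ph_mul u v k : u <> 0 -> v <> 0 -> ph (u * v) k = ph u k * Cpowz v k.
Proof.
  intros. unfold ph. replace (- (u * v)) with (- u * v) by ring.
  rewrite Cpowz_mult by auto using Copp_neq0. ring.
Qed.

Lemma Cpowz_qz m k : Cpowz (qz m) k = qz (m * k).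
Proof.
  revert k. apply Z_two_sided_ind; [now rewrite Z.mul_0_r|].
  intros k. rewrite Cpowz_S, Z.mul_add_distr_l, Z.mul_1_r, qz_add by apply qz_neq0.
  split; intros E.
  - rewrite E; ring.
  - apply (Cmult_reg_l (qz m)); [|apply qz_neq0]. rewrite E; ring.
Qed.

Lemma ph_qz u m k : u <> 0 -> ph (u * qz m) k = ph u k * qz (m * k).
Proof. intros. rewrite ph_mul, Cpowz_qz; auto. apply qz_neq0. Qed.

Lemma ph_opp u k : u <> 0 -> ph u (- k) = ph (q / u) k.
Proof.
  intros Hu. unfold ph.
  assert (Hq := q_neq0C).
  replace (- (q / u)) with (qz 1 * / - u).
  2:{ rewrite qz_1. field. auto. }
  rewrite Cpowz_mult, Cpowz_qz, Cpowz_inv, <- Cpowz_opp by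
    auto using Copp_neq0, Cinv_neq0, qz_neq0.
  replace (tri (- k)) with (1 * k + tri k)%Z.
  - rewrite qz_add. ring.
  - pose proof (tri_double k); pose proof (tri_double (- k)). nia.
Qed.

Lemma qpoch_q_real n : exists r : R, (0 < r)%R /\ qpoch q q n = RtoC r.
Proof.
  induction n as [|n [r [Hr IH]]]; simpl.
  - exists 1%R; split; [lra|reflexivity].
  - exists (r * (1 - q * q ^ n))%R; split.
    + apply Rmult_lt_0_compat; auto.
      assert (q ^ n <= 1)%R; [|nra].
      rewrite <- (pow1 n). apply pow_incr; lra.
    + now rewrite IH, RtoC_mult, RtoC_minus, RtoC_mult, RtoC_pow.
Qed.

Lemma qpoch_q_neq0 n : qpoch q q n <> 0.
Proof.
  destruct (qpoch_q_real n) as [r [Hr ->]]. intros E; apply RtoC_inj in E; lra.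
Qed.

(* 1/(q;q)_m, with the value 0 for [m < 0], so that finite sums become sums over [Z]. *)
Definition iq (m : Z) : C := if (m <? 0)%Z then 0 else / qpoch q q (Z.to_nat m).

Lemma iq_neg m : (m < 0)%Z -> iq m = 0.
Proof. intros H. unfold iq. now destruct (Z.ltb_spec m 0); [|lia]. Qed.

Lemma iq_nat n : iq (Z.of_nat n) = / qpoch q q n.
Proof. unfold iq. destruct (Z.ltb_spec (Z.of_nat n) 0); [lia|]. now rewrite Nat2Z.id. Qed.

Lemma iq_0 : iq 0 = 1.
Proof. change 0%Z with (Z.of_nat 0). rewrite iq_nat. simpl. field. Qed.

Lemma iq_rec m : (1 - qz m) * iq m = iq (m - 1).
Proof.
  destruct (Z.lt_trichotomy m 0) as [H|[->|H]].
  - rewrite !iq_neg by lia. ring.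
  - rewrite (iq_neg (0 - 1)), qz_0 by lia. ring.
  - replace m with (Z.of_nat (S (Z.to_nat (m - 1)))) by lia.
    set (n := Z.to_nat (m - 1)).
    replace (Z.of_nat (S n) - 1)%Z with (Z.of_nat n) by lia.
    rewrite !iq_nat, qz_nat.
    assert (Hn := qpoch_q_neq0 n). assert (Hn1 := qpoch_q_neq0 (S n)). simpl in *.
    assert (1 - q * q ^ n <> 0) by (intros E; rewrite E in Hn1; apply Hn1; ring).
    field; auto.
Qed.

Definition iqR (m : Z) : R := Re (iq m).

Lemma iq_iqR m : iq m = RtoC (iqR m).
Proof.
  unfold iqR, iq. destruct (m <? 0)%Z; [reflexivity|].
  destruct (qpoch_q_real (Z.to_nat m)) as [r [Hr ->]].
  rewrite <- RtoC_inv by lra. reflexivity.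
Qed.

Lemma iqR_pos n : (0 < iqR (Z.of_nat n))%R.
Proof.
  unfold iqR. rewrite iq_nat. destruct (qpoch_q_real n) as [r [Hr ->]].
  rewrite <- RtoC_inv by lra. simpl. now apply Rinv_0_lt_compat.
Qed.

Lemma iqR_neg m : (m < 0)%Z -> iqR m = 0%R.
Proof. intros; unfold iqR; now rewrite iq_neg. Qed.

Lemma iqR_ge0 m : (0 <= iqR m)%R.
Proof.
  destruct (Z_lt_le_dec m 0); [rewrite iqR_neg by auto; lra|].
  replace m with (Z.of_nat (Z.to_nat m)) by lia. apply Rlt_le, iqR_pos.
Qed.

Lemma Cmod_iq m : Cmod (iq m) = iqR m.
Proof. rewrite iq_iqR, Cmod_R. apply Rabs_pos_eq, iqR_ge0. Qed.

Lemma iqR_ratio n : (iqR (Z.of_nat (S n)) / iqR (Z.of_nat n) = / (1 - q * q ^ n))%R.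
Proof.
  assert (H := iq_rec (Z.of_nat (S n))).
  replace (Z.of_nat (S n) - 1)%Z with (Z.of_nat n) in H by lia.
  rewrite !iq_iqR, qz_nat, <- RtoC_pow, <- RtoC_minus, <- RtoC_mult in H.
  apply RtoC_inj in H. simpl pow in H. rewrite <- H.
  assert (H1 := iqR_pos (S n)). assert (H2 := iqR_pos n). rewrite <- H in H2.
  field. split; nra.
Qed.

Lemma is_lim_qn_ratio : is_lim_seq (fun n => / (1 - q * q ^ n))%R 1%R.
Proof.
  replace (Finite 1%R) with (Finite (/ (1 - q * 0))%R) by (f_equal; field).
  apply (is_lim_seq_inv _ (Finite (1 - q * 0)%R)).
  - apply is_lim_seq_minus'; [apply is_lim_seq_const|].
    apply is_lim_seq_mult'; [apply is_lim_seq_const|apply is_lim_pow_q].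
  - intros E; inversion E; lra.
Qed.

(** The modulus of [ph u k] for a = |u|, and the majorant in most of the estimates: it decays faster
    than any geometric sequence in both directions. *)
Definition thR (a : R) (k : Z) : R := (powerRZ a k * powerRZ q (tri k))%R.

Lemma thR_def a k : thR a k = (powerRZ a k * powerRZ q (tri k))%R.
Proof. reflexivity. Qed.

Lemma thR_pos a k : (0 < a)%R -> (0 < thR a k)%R.
Proof. intros; apply Rmult_lt_0_compat; apply powerRZ_lt; lra. Qed.

Lemma tri_S k : tri (k + 1) = (tri k + k)%Z.
Proof. pose proof (tri_double k); pose proof (tri_double (k + 1)). nia. Qed.

Lemma thR_S a k : (0 < a)%R -> (thR a (k + 1) = a * powerRZ q k * thR a k)%R.
Proof.
  intros Ha. unfold thR. rewrite tri_S, !powerRZ_add by lra. simpl. ring.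
Qed.

Lemma thR_summable a : (0 < a)%R -> summable (thR a).
Proof.
  intros Ha. apply summable_Z.
  - apply summable_ratio with 0%R; [intros; now apply thR_pos|lra|].
    apply is_lim_seq_ext with (fun n => a * q ^ n)%R.
    + intros n. replace (Z.of_nat (S n)) with (Z.of_nat n + 1)%Z by lia.
      rewrite thR_S, <- pow_powerRZ by auto. field.
      apply Rgt_not_eq, thR_pos; auto.
    + replace (Finite 0%R) with (Finite (a * 0)%R) by (f_equal; ring).
      apply is_lim_seq_mult'; [apply is_lim_seq_const|apply is_lim_pow_q].
  - apply summable_ratio with 0%R; [intros; now apply thR_pos|lra|].
    apply is_lim_seq_ext with (fun n => (/ a * (q * q)) * q ^ n)%R.
    + intros n. set (k := (- Z.of_nat (S n) - 1)%Z).
      replace (- Z.of_nat n - 1)%Z with (k + 1)%Z by lia.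
      rewrite thR_S by auto.
      replace k with (- Z.of_nat (S (S n)))%Z at 2 by lia.
      rewrite powerRZ_neg', <- pow_powerRZ.
      assert (thR a k <> 0%R) by (apply Rgt_not_eq, thR_pos; auto).
      assert (q ^ S (S n) <> 0)%R by (apply pow_nonzero; auto).
      replace (/ a * (q * q) * q ^ n)%R with (/ a * q ^ S (S n))%R by (simpl; ring).
      field. repeat split; auto; lra.
    + replace (Finite 0%R) with (Finite (/ a * (q * q) * 0)%R) by (f_equal; ring).
      apply is_lim_seq_mult'; [apply is_lim_seq_const|apply is_lim_pow_q].
Qed.

Lemma Cmod_neq0 u : u <> 0 -> (0 < Cmod u)%R.
Proof. apply Cmod_gt_0. Qed.

Lemma Cmod_ph u k : u <> 0 -> Cmod (ph u k) = thR (Cmod u) k.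
Proof.
  intros Hu. unfold ph, thR. rewrite Cmod_mult, Cmod_qz, Cmod_Cpowz, Cmod_opp; auto.
  now apply Copp_neq0.
Qed.

Lemma ph_summable u : u <> 0 -> summableC (ph u).
Proof.
  intros Hu. apply summableC_le with (thR (Cmod u)).
  - intros; rewrite Cmod_ph; auto; lra.
  - now apply thR_summable, Cmod_neq0.
Qed.

(* The terms of Euler's series for (u; q)_oo, extended by 0 to negative indices. *)
Definition ee (u : C) (j : Z) : C := ph u j * iq j.

Lemma ee_def u j : ee u j = ph u j * iq j.
Proof. reflexivity. Qed.

Definition eeR (a : R) (j : Z) : R := (thR a j * iqR j)%R.

Lemma eeR_def (a : R) j : eeR a j = (thR a j * iqR j)%R.
Proof. reflexivity. Qed.

Lemma eeR_summable a : (0 < a)%R -> summable (eeR a).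
Proof.
  intros Ha. apply summable_nat_ext.
  - intros k Hk. unfold eeR. rewrite iqR_neg by auto. ring.
  - apply summable_ratio with 0%R; [|lra|].
    + intros n. apply Rmult_lt_0_compat; [now apply thR_pos|apply iqR_pos].
    + apply is_lim_seq_ext with (fun n => a * q ^ n * / (1 - q * q ^ n))%R.
      * intros n. rewrite <- iqR_ratio. unfold eeR.
        replace (thR a (Z.of_nat (S n))) with (a * q ^ n * thR a (Z.of_nat n))%R.
        -- field. split; apply Rgt_not_eq; solve [now apply thR_pos|apply iqR_pos].
        -- rewrite Nat2Z.inj_succ. unfold Z.succ.
           rewrite thR_S, <- pow_powerRZ by auto. ring.
      * replace (Finite 0%R) with (Finite (a * 0 * 1)%R) by (f_equal; ring).
        apply is_lim_seq_mult'; [|apply is_lim_qn_ratio].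
        apply is_lim_seq_mult'; [apply is_lim_seq_const|apply is_lim_pow_q].
Qed.

Lemma ee_neg u j : (j < 0)%Z -> ee u j = 0.
Proof. intros; unfold ee; rewrite iq_neg; auto. ring. Qed.

Lemma ee_0 u : ee u 0 = 1.
Proof. unfold ee. rewrite ph_0, iq_0. ring. Qed.

Lemma ph_nat u n : ph u (Z.of_nat n) = (- u) ^ n * qz (tri (Z.of_nat n)).
Proof. unfold ph. now rewrite Cpowz_nat. Qed.

Lemma powerRZ_nat_le (a b : R) n : (0 <= a <= b)%R ->
  (powerRZ a (Z.of_nat n) <= powerRZ b (Z.of_nat n))%R.
Proof. intros. rewrite <- !pow_powerRZ. apply pow_incr; lra. Qed.

(** Only j >= 0 contributes, so the bound is monotone in |u|: unlike [thR] it holds uniformly on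
    discs, and at u = 0. *)
Lemma Cmod_ee_le u a j : (Cmod u <= a)%R -> (Cmod (ee u j) <= eeR a j)%R.
Proof.
  intros Hu. destruct (Z_lt_le_dec j 0).
  - rewrite ee_neg by auto. unfold eeR. rewrite iqR_neg, Cmod_0 by auto. lra.
  - unfold ee, eeR, thR. replace j with (Z.of_nat (Z.to_nat j)) by lia.
    rewrite Cmod_mult, Cmod_iq, ph_nat, Cmod_mult, Cmod_qz, Cmod_pow, Cmod_opp, pow_powerRZ.
    apply Rmult_le_compat_r; [apply iqR_ge0|].
    apply Rmult_le_compat_r; [apply powerRZ_le; lra|].
    apply powerRZ_nat_le. split; auto. apply Cmod_ge_0.
Qed.

Lemma ee_summable u : summableC (ee u).
Proof.
  apply summableC_le with (eeR (Cmod u + 1)).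
  - intros j; apply Cmod_ee_le; lra.
  - apply eeR_summable. pose proof (Cmod_ge_0 u); lra.
Qed.

Lemma ee_rec u j : (1 - qz j) * ee u j = - u * qz (j - 1) * ee u (j - 1).
Proof.
  destruct (Z.lt_trichotomy j 0) as [H|[->|H]].
  - rewrite !ee_neg by lia. ring.
  - rewrite (ee_neg u (0 - 1)), qz_0 by lia. ring.
  - unfold ee. replace ((1 - qz j) * (ph u j * iq j)) with (ph u j * ((1 - qz j) * iq j)) by ring.
    rewrite iq_rec.
    replace (ph u j) with (- u * qz (j - 1) * ph u (j - 1)); [ring|].
    replace j with (Z.of_nat (S (Z.to_nat (j - 1)))) by lia.
    set (n := Z.to_nat (j - 1)). replace (Z.of_nat (S n) - 1)%Z with (Z.of_nat n) by lia.
    rewrite !ph_nat. replace (Z.of_nat (S n)) with (Z.of_nat n + 1)%Z by lia.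
    rewrite tri_S, qz_add. simpl. ring.
Qed.

Lemma ee_qz u m j : ee (u * qz m) j = qz (m * j) * ee u j.
Proof.
  destruct (Z_lt_le_dec j 0); [rewrite !ee_neg by auto; ring|].
  unfold ee. replace j with (Z.of_nat (Z.to_nat j)) by lia. rewrite !ph_nat.
  set (n := Z.to_nat j). replace (- (u * qz m)) with (- u * qz m) by ring.
  replace ((- u * qz m) ^ n) with ((- u) ^ n * qz (m * Z.of_nat n)); [ring|].
  rewrite <- Cpowz_qz, Cpowz_nat.
  clear. induction n; simpl; [ring|]. rewrite <- IHn. ring.
Qed.

Definition EE (u : C) : C := csum (ee u).

Lemma EE_def u : EE u = csum (ee u).
Proof. reflexivity. Qed.

Lemma EE_spec u : has_sumC (ee u) (EE u).
Proof. apply csum_spec, ee_summable. Qed.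

(** The functional equation of (u;q)_oo, read off from the recurrence of the coefficients of Euler's
    series. *)
Lemma EE_step u : EE u = (1 - u) * EE (u * q).
Proof.
  assert (E : EE u - EE (u * q) = - u * EE (u * q)).
  { rewrite <- qz_1. unfold EE. rewrite <- csum_minus, <- csum_scal by apply ee_summable.
    rewrite <- (csum_Zshift (-1) (fun k => - u * ee (u * qz 1) k)).
    apply csum_ext; intros j. rewrite !ee_qz.
    replace (ee u j - qz (1 * j) * ee u j) with ((1 - qz j) * ee u j) by (rewrite Z.mul_1_l; ring).
    rewrite ee_rec, Z.mul_1_l. replace (j + -1)%Z with (j - 1)%Z by lia. ring. }
  replace (EE u) with (EE u - EE (u * q) + EE (u * q)) by ring. rewrite E. ring.
Qed.

Lemma EE_qpoch u n : EE u = qpoch u q n * EE (u * q ^ n).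
Proof.
  induction n as [|n IH]; simpl.
  - rewrite Cmult_1_r. ring.
  - rewrite IH, (EE_step (u * q ^ n)). replace (u * q ^ n * q) with (u * (q * q ^ n)) by ring. ring.
Qed.

Lemma has_limC_EE (v : nat -> C) v0 : has_limC v v0 -> has_limC (fun n => EE (v n)) (EE v0).
Proof.
  intros H. destruct (has_limC_bounded _ _ H) as [M HM].
  assert (HM0 : (0 <= M)%R) by (eapply Rle_trans; [apply (Cmod_ge_0 (v 0%nat))|auto]).
  apply has_sumC_tannery with (f := fun n => ee (v n)) (F := ee v0) (g := eeR (M + 1)).
  - intros n j; apply Cmod_ee_le. specialize (HM n); lra.
  - apply eeR_summable; lra.
  - intros j. destruct (Z_lt_le_dec j 0).
    + apply has_limC_ext with (fun _ => 0); [intros; now rewrite ee_neg|].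
      rewrite ee_neg by auto. apply has_limC_const.
    + unfold ee. replace j with (Z.of_nat (Z.to_nat j)) by lia.
      set (n := Z.to_nat j). apply has_limC_mult; [|apply has_limC_const].
      eapply has_limC_ext; [intros; symmetry; apply ph_nat|]. rewrite ph_nat.
      apply has_limC_mult; [|apply has_limC_const].
      clear -H. induction n; simpl; [apply has_limC_const|].
      apply has_limC_mult; auto. now apply has_limC_opp.
  - intros; apply EE_spec.
  - apply EE_spec.
Qed.

Lemma has_limC_qn u : has_limC (fun n => u * q ^ n) 0.
Proof.
  replace (RtoC 0) with (u * RtoC 0) by ring.
  apply has_limC_mult; [apply has_limC_const|].
  eapply has_limC_ext; [intros; apply RtoC_pow|]. apply has_limC_RtoC, is_lim_pow_q.
Qed.

Lemma EE_0 : EE 0 = 1.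
Proof.
  apply csum_unique. 
  apply has_sumC_nat; [intros; now apply ee_neg|].
  apply (has_sumC_inj (fun _ : unit => 0%nat)).
  - intros [] []; auto.
  - intros [|n] Hn; [now exists tt|]. contradiction Hn.
    unfold ee. rewrite ph_nat. simpl. ring.
  - change (Z.of_nat 0) with 0%Z. apply has_sumC_ext with (fun _ => RtoC 1).
    + intros; now rewrite ee_0.
    + apply has_sumC_RtoC. intros eps He. exists (tt :: nil). intros l Hn Hi.
      destruct l as [|[] [|[] l]].
      * destruct (Hi tt); now left.
      * simpl. replace (1 + 0 - 1)%R with 0%R by ring. rewrite Rabs_R0; auto.
      * inversion Hn as [|? ? Hx]; contradiction Hx; now left.
Qed.

(** Euler's identity and the convergence of the infinite product at once: EE(u) = (u;q)_n EE(u q^n),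
    and the last factor tends to EE(0) = 1. *)
Lemma qpoch_lim u : has_limC (fun n => qpoch u q n) (EE u).
Proof.
  assert (Hl : has_limC (fun n => EE (u * q ^ n)) 1).
  { rewrite <- EE_0. apply has_limC_EE, has_limC_qn. }
  (* The quotient EE(u) / EE(u q^n) makes sense only where the denominator is known to be nonzero,
     hence the shift by N. *)
  assert (Hnz : exists N, forall n, (N <= n)%nat -> EE (u * q ^ n) <> 0).
  { assert (Hc := has_limC_Cmod _ _ Hl). rewrite Cmod_1 in Hc.
    apply is_lim_seq_spec in Hc. destruct (Hc (mkposreal 1 Rlt_0_1)) as [N HN].
    exists N; intros n Hn E. specialize (HN n Hn). rewrite E, Cmod_0 in HN. simpl in HN.
    rewrite Rabs_left in HN; lra. }
  destruct Hnz as [N HN].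
  assert (Hs : has_limC (fun n => qpoch u q (n + N)) (EE u)).
  { apply has_limC_ext with (fun n => EE u / EE (u * q ^ (n + N))).
    - intros n. rewrite (EE_qpoch u (n + N)). field. apply HN; lia.
    - assert (H : has_limC (fun n => EE u / EE (u * q ^ (n + N))) (EE u / 1)).
      { apply has_limC_div; [apply C1_nz|apply has_limC_const|].
        apply (has_limC_sub _ _ (fun n => n + N)%nat) in Hl; auto.
        intros P [M HM]. exists M. intros n Hn. apply HM; lia. }
      now replace (EE u / 1) with (EE u) in H by field. }
  clear -Hs. induction N as [|N IH].
  - apply (has_limC_ext _ _ _) with (2 := Hs). intros n; now rewrite Nat.add_0_r.
  - apply IH. apply has_limC_incr. apply (has_limC_ext _ _ _) with (2 := Hs).
    intros n. now rewrite Nat.add_succ_r.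
Qed.

Lemma qpi_EE u : qpoch_inf u q = EE u.
Proof. apply Clim_correct, qpoch_lim. Qed.

Lemma qpi_step u : qpoch_inf u q = (1 - u) * qpoch_inf (u * q) q.
Proof. rewrite !qpi_EE. apply EE_step. Qed.

Lemma qpi_qpoch u n : qpoch_inf u q = qpoch u q n * qpoch_inf (u * q ^ n) q.
Proof. rewrite !qpi_EE. apply EE_qpoch. Qed.

Lemma has_limC_qpi (v : nat -> C) v0 :
  has_limC v v0 -> has_limC (fun n => qpoch_inf (v n) q) (qpoch_inf v0 q).
Proof.
  intros H. rewrite qpi_EE. eapply has_limC_ext; [intros; symmetry; apply qpi_EE|].
  now apply has_limC_EE.
Qed.

End QSeries.

(** * The q-binomial series, zeros of infinite products and Cauchy's sum *)

Section Cauchy.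
Implicit Types (u v w : C) (i j k m : Z).
Local Hint Extern 0 (q <> 0%R) => exact q0 : core.

(** General term of the q-exponential series, whose sum is 1/(u;q)_oo for |u| < 1 by [FF_qpi]. *)
Definition ff (u : C) (n : nat) : C := u ^ n * iq (Z.of_nat n).

Lemma geomR_summable (a : R) : (0 < a < 1)%R -> summable (fun n => a ^ n * iqR (Z.of_nat n))%R.
Proof.
  intros Ha. apply summable_ratio with a; [|lra|].
  - intros n. apply Rmult_lt_0_compat; [apply pow_lt; lra|apply iqR_pos].
  - apply is_lim_seq_ext with (fun n => a * / (1 - q * q ^ n))%R.
    + intros n. rewrite <- iqR_ratio. simpl pow. field.
      split; apply Rgt_not_eq; solve [apply iqR_pos|apply pow_lt; lra].
    + replace (Finite a) with (Finite (a * 1)%R) by (f_equal; ring).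
      apply is_lim_seq_mult'; [apply is_lim_seq_const|apply is_lim_qn_ratio].
Qed.

Lemma Cmod_ff_le u (a : R) n : (Cmod u <= a)%R -> (Cmod (ff u n) <= a ^ n * iqR (Z.of_nat n))%R.
Proof.
  intros H. unfold ff. rewrite Cmod_mult, Cmod_pow, Cmod_iq.
  apply Rmult_le_compat_r; [apply iqR_ge0|]. apply pow_incr. split; auto. apply Cmod_ge_0.
Qed.

Lemma ff_summable u : (Cmod u < 1)%R -> summableC (ff u).
Proof.
  intros H. pose proof (Cmod_ge_0 u).
  apply summableC_le with (fun n => ((Cmod u + 1) / 2) ^ n * iqR (Z.of_nat n))%R.
  - intros n. apply Cmod_ff_le. lra.
  - apply geomR_summable. lra.
Qed.

Lemma has_sumC_single {I : Type} (a : I) (f : I -> C) :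
  (forall x : I, x <> a -> f x = 0) -> has_sumC f (f a).
Proof.
  intros H. apply (has_sumC_inj (fun _ : unit => a)).
  - intros [] []; auto.
  - intros i Hi. exists tt. apply NNPP. intros Hne. apply Hi, H. congruence.
  - assert (forall r : R, has_sum (fun _ : unit => r) r) as Hu.
    { intros r eps He. exists (tt :: nil). intros l Hn Hi.
      destruct l as [|[] [|[] l]].
      - destruct (Hi tt); now left.
      - simpl. replace (r + 0 - r)%R with 0%R by ring. rewrite Rabs_R0; auto.
      - inversion Hn as [|? ? Hx]; contradiction Hx; now left. }
    split; apply Hu.
Qed.

Lemma csum_S (f : nat -> C) : summableC f ->
  csum f = f 0%nat + csum (fun n => f (S n)).
Proof.
  intros Hf. apply csum_unique.
  apply has_sumC_ext with (fun n => match n with O => f 0%nat | S _ => 0 end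
    + match n with O => 0 | S m => f (S m) end).
  { intros [|n]; ring. }
  apply has_sumC_plus.
  - apply (has_sumC_single 0%nat (fun n => match n with O => f 0%nat | S _ => 0 end)).
    intros [|n] Hn; congruence.
  - apply (has_sumC_inj S); [intros; lia| |].
    + intros [|n] Hn; [congruence|eauto].
    + apply csum_spec. apply (summableC_inj S); [intros; lia|auto].
Qed.

Lemma iq_S n : (1 - qz (Z.of_nat (S n))) * iq (Z.of_nat (S n)) = iq (Z.of_nat n).
Proof. rewrite iq_rec. f_equal. lia. Qed.

Definition FF (u : C) : C := csum (ff u).

Lemma FF_step u : (Cmod u < 1)%R -> (1 - u) * FF u = FF (u * q).
Proof.
  intros Hu.
  assert (Huq : (Cmod (u * q) < 1)%R).
  { rewrite Cmod_mult, Cmod_R, Rabs_pos_eq by lra. pose proof (Cmod_ge_0 u). nra. }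
  assert (E : FF u - FF (u * q) = u * FF u); [|replace (FF (u * q)) with (FF u - (FF u - FF (u * q))) by ring; rewrite E; ring].
  unfold FF. rewrite <- csum_minus by now apply ff_summable.
  rewrite csum_S.
  - rewrite <- csum_scal by now apply ff_summable.
    replace (ff u 0 - ff (u * q) 0) with (RtoC 0) by (unfold ff; simpl; ring).
    rewrite Cplus_0_l. apply csum_ext; intros n.
    unfold ff. rewrite <- (iq_S n), qz_nat.
    replace ((u * q) ^ S n) with (u ^ S n * q ^ S n).
    + change (u ^ S n) with (u * u ^ n). ring.
    + generalize (S n). clear. induction n; simpl; [ring|]. rewrite <- IHn. ring.
  - destruct (ff_summable u Hu) as [s Hs], (ff_summable _ Huq) as [t Ht].
    exists (s - t). now apply has_sumC_minus.
Qed.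

Lemma FF_lim (v : nat -> C) (a : R) : (a < 1)%R -> (forall n, Cmod (v n) <= a)%R ->
  has_limC v 0 -> has_limC (fun n => FF (v n)) 1.
Proof.
  intros Ha Hv H.
  assert (H0 : (0 <= a)%R) by (eapply Rle_trans; [apply Cmod_ge_0|apply (Hv 0%nat)]).
  apply has_sumC_tannery with (f := fun n => ff (v n))
    (F := fun l : nat => match l with O => RtoC 1 | S _ => RtoC 0 end)
    (g := (fun n => ((a + 1) / 2) ^ n * iqR (Z.of_nat n))%R).
  - intros n j; apply Cmod_ff_le. specialize (Hv n); lra.
  - apply geomR_summable; lra.
  - intros [|j].
    + apply has_limC_ext with (fun _ => 1); [|apply has_limC_const].
      intros n. unfold ff. simpl Z.of_nat. rewrite iq_0. simpl. ring.
    + replace (RtoC 0) with (0 * 0 ^ j * iq (Z.of_nat (S j))) by ring.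
      unfold ff. apply has_limC_mult; [|apply has_limC_const]. simpl.
      apply has_limC_mult; auto.
      induction j; simpl; [apply has_limC_const|]. now apply has_limC_mult.
  - intros n. apply csum_spec, ff_summable. specialize (Hv n); lra.
  - apply (has_sumC_single 0%nat (fun l : nat => match l with O => RtoC 1 | S _ => RtoC 0 end)).
    intros [|j] Hj; congruence.
Qed.

Lemma FF_qpi u : (Cmod u < 1)%R -> FF u * qpoch_inf u q = 1.
Proof.
  intros Hu.
  assert (Hq : forall n, (Cmod (u * q ^ n) <= Cmod u)%R).
  { intros n. rewrite Cmod_mult, Cmod_pow, Cmod_R, (Rabs_pos_eq q) by lra.
    pose proof (Cmod_ge_0 u). assert (0 <= q ^ n <= 1)%R; [|nra].
    split; [apply pow_le; lra|]. rewrite <- (pow1 n). apply pow_incr; lra. }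
  assert (E : forall n, qpoch u q n * FF u = FF (u * q ^ n)).
  { intros n. induction n as [|n IH]; simpl.
    - rewrite Cmult_1_r. ring.
    - replace (u * (q * q ^ n)) with (u * q ^ n * q) by ring.
      rewrite <- FF_step; [rewrite <- IH; ring|]. eapply Rle_lt_trans; [apply Hq|auto]. }
  rewrite Cmult_comm. eapply has_limC_unique with (u := fun n => qpoch u q n * FF u).
  - apply has_limC_mult; [rewrite qpi_EE; apply qpoch_lim|apply has_limC_const].
  - eapply has_limC_ext; [intros n; symmetry; apply E|].
    apply FF_lim with (Cmod u); auto. apply has_limC_qn.
Qed.

(** Splitting off finitely many factors moves the argument into the unit disc, where [FF] supplies
    an inverse. *)
Lemma qpi_neq0 u : (forall n : nat, u * q ^ n <> 1) -> qpoch_inf u q <> 0.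
Proof.
  intros H.
  assert (exists N, Cmod (u * q ^ N) < 1)%R as [N HN].
  { assert (Hl := has_limC_Cmod _ _ (has_limC_qn u)). rewrite Cmod_0 in Hl.
    apply is_lim_seq_spec in Hl. destruct (Hl (mkposreal 1 Rlt_0_1)) as [N HN].
    exists N. specialize (HN N (le_n _)). simpl in HN. rewrite Rminus_0_r in HN.
    eapply Rle_lt_trans; [apply Rle_abs|apply HN]. }
  rewrite (qpi_qpoch u N). apply Cmult_neq_0.
  - clear HN. induction N as [|N IH]; simpl; [apply C1_nz|].
    apply Cmult_neq_0; auto. intros E. apply (H N).
    replace (u * q ^ N) with (1 - (1 - u * q ^ N)) by ring. rewrite E. ring.
  - intros E. assert (HF := FF_qpi _ HN). rewrite E, Cmult_0_r in HF. now apply C1_nz.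
Qed.

Lemma qpi_eq0 u n : u * q ^ n = 1 -> qpoch_inf u q = 0.
Proof. intros E. rewrite (qpi_qpoch u (S n)). simpl. rewrite E. ring. Qed.

Lemma qpi_q_neq0 : qpoch_inf q q <> 0.
Proof.
  apply qpi_neq0. intros n E. rewrite <- qz_nat, <- qz_1, <- qz_add in E.
  apply qz_inj in E. lia.
Qed.

Lemma iq_lim : has_limC (fun n => iq (Z.of_nat n)) (/ qpoch_inf q q).
Proof.
  eapply has_limC_ext; [intros n; symmetry; apply iq_nat|].
  apply has_limC_inv; [apply qpi_q_neq0|]. rewrite qpi_EE. apply qpoch_lim.
Qed.

Lemma iq_bounded : exists B, (0 < B)%R /\ forall m, (Cmod (iq m) <= B)%R.
Proof.
  destruct (has_limC_bounded _ _ iq_lim) as [M HM]. exists (Rabs M + 1)%R.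
  pose proof (Rabs_pos M). pose proof (Rle_abs M). split; [lra|]. intros m.
  destruct (Z_lt_le_dec m 0).
  - rewrite iq_neg, Cmod_0 by auto. lra.
  - specialize (HM (Z.to_nat m)). rewrite Z2Nat.id in HM by lia. lra.
Qed.

Lemma has_limC_Z (f : Z -> C) (l : C) m :
  has_limC (fun n => f (Z.of_nat n)) l -> has_limC (fun n => f (Z.of_nat n + m)%Z) l.
Proof.
  intros H. revert m. apply (Z_two_sided_ind).
  - eapply has_limC_ext; [|apply H]. intros; cbv beta; f_equal; lia.
  - intros k. rewrite (has_limC_incr (fun n => f (Z.of_nat n + k)%Z)).
    split; intros Hk; (eapply has_limC_ext; [|apply Hk]); intros n; cbv beta; f_equal; lia.
Qed.

(* [cauchyS m] is independent of [m]: this is the limit of the q-Vandermonde sum, by Cauchy. *)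
Definition cauchyt m (l : Z) : C := qz (l * l + m * l) * iq l * iq (l + m).
Definition cauchyS m : C := csum (cauchyt m).

Lemma qz_sq_summable : summable (fun n => powerRZ q (Z.of_nat n * Z.of_nat n)).
Proof.
  apply summable_le with (fun n => q ^ n)%R.
  - intros n. rewrite Rabs_pos_eq by (apply powerRZ_le; lra).
    replace (Z.of_nat n * Z.of_nat n)%Z with (Z.of_nat (n * n)) by lia.
    rewrite <- pow_powerRZ. destruct n as [|n]; [simpl; lra|].
    replace (S n * S n)%nat with (S n + n * S n)%nat by lia. rewrite pow_add.
    assert (0 < q ^ S n)%R by (apply pow_lt; lra).
    assert (q ^ (n * S n) <= 1)%R; [|nra].
    rewrite <- (pow1 (n * S n)). apply pow_incr; lra.
  - apply summable_ratio with q; [intros; apply pow_lt; lra|lra|].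
    apply is_lim_seq_ext with (fun _ => q); [|apply is_lim_seq_const].
    intros n; simpl. field. apply pow_nonzero; auto.
Qed.

Lemma cauchyt_def m (l : Z) : cauchyt m l = qz (l * l + m * l) * iq l * iq (l + m).
Proof. reflexivity. Qed.

Lemma cauchyS_def m : cauchyS m = csum (cauchyt m).
Proof. reflexivity. Qed.

Lemma cauchyt_neg m (l : Z) : (l < 0)%Z -> cauchyt m l = 0.
Proof. intros H. unfold cauchyt. rewrite (iq_neg l) by auto. ring. Qed.

Lemma powerRZ_q_le1 k : (0 <= k)%Z -> (powerRZ q k <= 1)%R.
Proof.
  intros H. replace k with (Z.of_nat (Z.to_nat k)) by lia. rewrite <- pow_powerRZ.
  rewrite <- (pow1 (Z.to_nat k)). apply pow_incr; lra.
Qed.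

Lemma cauchyt_bound : exists g : Z -> R, summable g /\
  forall m (l : Z), (0 <= m)%Z -> (Cmod (cauchyt m l) <= g l)%R.
Proof.
  destruct iq_bounded as [B [HB HBm]].
  exists (fun l => if (l <? 0)%Z then 0%R else B * B * powerRZ q (l * l))%R. split.
  - apply summable_nat_ext.
    + intros k Hk. now destruct (Z.ltb_spec k 0); [|lia].
    + destruct qz_sq_summable as [s Hs]. exists (B * B * s)%R.
      eapply has_sum_ext; [|apply (has_sum_scal (B * B)%R _ _ Hs)].
      intros n; simpl. destruct (Z.ltb_spec (Z.of_nat n) 0); [lia|auto].
  - intros m l Hm. destruct (Z.ltb_spec l 0).
    + rewrite cauchyt_neg, Cmod_0 by auto. lra.
    + unfold cauchyt. rewrite !Cmod_mult, Cmod_qz, powerRZ_add by auto.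
      assert (0 < powerRZ q (l * l))%R by (apply powerRZ_lt; lra).
      assert (0 < powerRZ q (m * l) <= 1)%R.
      { split; [apply powerRZ_lt; lra|apply powerRZ_q_le1; nia]. }
      assert (H2 := HBm l). assert (H3 := HBm (l + m)%Z).
      assert (H4 := Cmod_ge_0 (iq l)). assert (H5 := Cmod_ge_0 (iq (l + m))).
      assert (Cmod (iq l) * Cmod (iq (l + m)) <= B * B)%R by (apply Rmult_le_compat; lra).
      assert (0 <= Cmod (iq l) * Cmod (iq (l + m)))%R by (apply Rmult_le_pos; lra).
      apply Rle_trans with (powerRZ q (l * l) * (Cmod (iq l) * Cmod (iq (l + m))))%R; [|nra].
      replace (powerRZ q (l * l) * powerRZ q (m * l) * Cmod (iq l) * Cmod (iq (l + m)))%R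
        with (powerRZ q (m * l) * (powerRZ q (l * l) * (Cmod (iq l) * Cmod (iq (l + m)))))%R by ring.
      assert (0 <= powerRZ q (l * l) * (Cmod (iq l) * Cmod (iq (l + m))))%R
        by (apply Rmult_le_pos; lra).
      nra.
Qed.

Lemma cauchyS_opp m : cauchyS (- m) = cauchyS m.
Proof.
  unfold cauchyS. rewrite <- (csum_Zshift m (cauchyt (- m))). apply csum_ext; intros l.
  unfold cauchyt. replace (l + m + - m)%Z with l by lia.
  replace ((l + m) * (l + m) + - m * (l + m))%Z with (l * l + m * l)%Z by ring. ring.
Qed.

Lemma cauchyt_summable m : (0 <= m)%Z -> summableC (cauchyt m).
Proof.
  intros Hm. destruct cauchyt_bound as [g [Hg H]].
  apply summableC_le with g; auto.
Qed.

(** With S(m+2) shifted by one index the relation holds term by term, from the two forms of (1 -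
    q^j)/(q;q)_j = 1/(q;q)_(j-1) for j = l and j = l + m + 1. *)
Lemma cauchyS_rec m : (0 <= m)%Z ->
  cauchyS m - cauchyS (m + 1) = - qz (m + 1) * (cauchyS (m + 1) - cauchyS (m + 2)).
Proof.
  intros Hm.
  assert (H0 := cauchyt_summable m Hm).
  assert (H1 := cauchyt_summable (m + 1) ltac:(lia)).
  assert (H2 := cauchyt_summable (m + 2) ltac:(lia)).
  assert (Hsh : csum (fun l => cauchyt (m + 2) (l + -1)) = cauchyS (m + 2)).
  { apply (csum_Zshift (-1) (cauchyt (m + 2))). }
  assert (H3 : summableC (fun l => cauchyt (m + 2) (l + -1))).
  { apply (summableC_inj (fun l => l + -1)%Z); auto; intros; lia. }
  replace (- qz (m + 1) * (cauchyS (m + 1) - cauchyS (m + 2))) with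
    (qz (m + 1) * cauchyS (m + 2) - qz (m + 1) * cauchyS (m + 1)) by ring.
  rewrite <- Hsh. unfold cauchyS. rewrite <- !csum_scal, <- csum_minus, <- csum_minus;
    auto using summableC_scal.
  apply csum_ext; intros l. unfold cauchyt.
  replace (iq (l + m)) with ((1 - qz (l + m + 1)) * iq (l + m + 1)).
  2:{ rewrite iq_rec. f_equal; lia. }
  replace (l + -1 + (m + 2))%Z with (l + m + 1)%Z by lia.
  replace (l + (m + 1))%Z with (l + m + 1)%Z by lia.
  replace (l + -1)%Z with (l - 1)%Z by lia. rewrite <- (iq_rec l).
  replace ((l - 1) * (l - 1) + (m + 2) * (l - 1))%Z with (l * l + m * l - (m + 1))%Z by ring.
  replace (l * l + (m + 1) * l)%Z with (l * l + m * l + l)%Z by ring.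
  replace (l + m + 1)%Z with (l + (m + 1))%Z by ring.
  rewrite qz_sub, !(qz_add _ l), (qz_add l). field. apply qz_neq0.
Qed.

Lemma cauchyS_lim : has_limC (fun n => cauchyS (Z.of_nat n)) (/ qpoch_inf q q).
Proof.
  destruct cauchyt_bound as [g [Hg H]].
  apply has_sumC_tannery with (f := fun n => cauchyt (Z.of_nat n)) (g := g)
    (F := fun l => if (l =? 0)%Z then / qpoch_inf q q else 0).
  - intros n l; apply H; lia.
  - auto.
  - intros l. destruct (Z.eqb_spec l 0) as [->|Hl].
    + eapply has_limC_ext; [|apply iq_lim]. intros n. unfold cauchyt.
      replace (0 * 0 + Z.of_nat n * 0)%Z with 0%Z by lia. rewrite qz_0, iq_0, Z.add_0_l. ring.
    + destruct (Z_lt_le_dec l 0).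
      * eapply has_limC_ext; [intros; symmetry; apply cauchyt_neg; auto|]. apply has_limC_const.
      * destruct iq_bounded as [B [HB HBm]].
        apply has_limC_le with (e := fun n => (B * B * q ^ n)%R).
        -- intros n. replace (cauchyt (Z.of_nat n) l - 0) with (cauchyt (Z.of_nat n) l) by ring.
           unfold cauchyt. rewrite !Cmod_mult, Cmod_qz.
           assert (powerRZ q (l * l + Z.of_nat n * l) <= q ^ n)%R.
           { rewrite pow_powerRZ. replace (l * l + Z.of_nat n * l)%Z with
               (Z.of_nat n + (l * l + Z.of_nat n * (l - 1)))%Z by ring.
             rewrite powerRZ_add by auto.
             assert (0 < powerRZ q (Z.of_nat n))%R by (apply powerRZ_lt; lra).
             assert (powerRZ q (l * l + Z.of_nat n * (l - 1)) <= 1)%R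
               by (apply powerRZ_q_le1; nia). nra. }
           assert (0 < powerRZ q (l * l + Z.of_nat n * l))%R by (apply powerRZ_lt; lra).
           assert (H2 := HBm l). assert (H3 := HBm (l + Z.of_nat n)%Z).
           assert (H4 := Cmod_ge_0 (iq l)). assert (H5 := Cmod_ge_0 (iq (l + Z.of_nat n))).
           rewrite Rmult_assoc, Rmult_comm.
           apply Rmult_le_compat; try lra; [apply Rmult_le_pos; lra|].
           apply Rmult_le_compat; lra.
        -- replace (Finite 0%R) with (Finite (B * B * 0)%R) by (f_equal; ring).
           apply is_lim_seq_mult'; [apply is_lim_seq_const|apply is_lim_pow_q].
  - intros n. apply csum_spec, cauchyt_summable; lia.
  - apply (has_sumC_single 0%Z (fun l => if (l =? 0)%Z then / qpoch_inf q q else 0)).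
    intros l Hl. now destruct (Z.eqb_spec l 0).
Qed.

(** By [cauchyS_rec] the modulus of the difference of consecutive values does not decrease with m,
    while the differences tend to 0; so they all vanish and every value equals the limit. *)
Lemma cauchyS_val m : cauchyS m = / qpoch_inf q q.
Proof.
  assert (Hpos : forall n, cauchyS (Z.of_nat n) - cauchyS (Z.of_nat n + 1) = 0).
  { intros n.
    assert (Hle : forall j : nat, (Cmod (cauchyS (Z.of_nat n) - cauchyS (Z.of_nat n + 1)) <=
      Cmod (cauchyS (Z.of_nat (n + j)) - cauchyS (Z.of_nat (n + j) + 1)))%R).
    { induction j as [|j IH]; [rewrite Nat.add_0_r; lra|].
      eapply Rle_trans; [apply IH|]. rewrite cauchyS_rec by lia.
      replace (Z.of_nat (n + S j)) with (Z.of_nat (n + j) + 1)%Z by lia.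
      replace (Z.of_nat (n + j) + 1 + 1)%Z with (Z.of_nat (n + j) + 2)%Z by lia.
      rewrite Cmod_mult, Cmod_opp, Cmod_qz.
      assert (0 < powerRZ q (Z.of_nat (n + j) + 1))%R by (apply powerRZ_lt; lra).
      assert (powerRZ q (Z.of_nat (n + j) + 1) <= 1)%R by (apply powerRZ_q_le1; lia).
      pose proof (Cmod_ge_0 (cauchyS (Z.of_nat (n + j) + 1) - cauchyS (Z.of_nat (n + j) + 2))).
      nra. }
    assert (Hl : has_limC (fun j : nat => cauchyS (Z.of_nat (n + j)) - cauchyS (Z.of_nat (n + j) + 1)) 0).
    { replace (RtoC 0) with (/ qpoch_inf q q - / qpoch_inf q q) by ring.
      apply has_limC_minus.
      - eapply has_limC_ext; [|apply (has_limC_Z cauchyS _ (Z.of_nat n) cauchyS_lim)].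
        intros j; simpl; f_equal; lia.
      - eapply has_limC_ext; [|apply (has_limC_Z cauchyS _ (Z.of_nat n + 1) cauchyS_lim)].
        intros j; simpl; f_equal; lia. }
    apply has_limC_Cmod in Hl. rewrite Cmod_0 in Hl.
    apply Cmod_eq_0. apply Rle_antisym; [|apply Cmod_ge_0].
    assert (Rbar_le (Cmod (cauchyS (Z.of_nat n) - cauchyS (Z.of_nat n + 1))) 0%R) as H; [|exact H].
    eapply is_lim_seq_le; [apply Hle|apply is_lim_seq_const|apply Hl]. }
  assert (Hc : forall n, cauchyS (Z.of_nat n) = cauchyS 0).
  { induction n as [|n IH]; auto. rewrite <- IH.
    replace (Z.of_nat (S n)) with (Z.of_nat n + 1)%Z by lia.
    specialize (Hpos n).
    replace (cauchyS (Z.of_nat n)) with (cauchyS (Z.of_nat n) - cauchyS (Z.of_nat n + 1)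
      + cauchyS (Z.of_nat n + 1)) by ring. rewrite Hpos. ring. }
  assert (H0 : cauchyS 0 = / qpoch_inf q q).
  { eapply has_limC_unique; [|apply cauchyS_lim].
    eapply has_limC_ext; [intros; symmetry; apply Hc|]. apply has_limC_const. }
  destruct (Z_le_gt_dec 0 m).
  - replace m with (Z.of_nat (Z.to_nat m)) by lia. now rewrite Hc.
  - replace m with (- Z.of_nat (Z.to_nat (- m)))%Z by lia. now rewrite cauchyS_opp, Hc.
Qed.

End Cauchy.

Lemma has_sumC_finite (f : Z -> C) n :
  (forall k, f k <> 0 -> (0 <= k <= Z.of_nat n)%Z) ->
  has_sumC f (sum_n (fun k => f (Z.of_nat k)) n).
Proof.
  intros H.
  assert (Hz : forall k, ~ In k (map Z.of_nat (seq 0 (S n))) -> f k = 0).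
  { intros k Hk. apply NNPP. intros Hf. apply Hk. apply H in Hf.
    apply in_map_iff. exists (Z.to_nat k). split; [lia|]. apply in_seq. lia. }
  assert (Hn : NoDup (map Z.of_nat (seq 0 (S n)))).
  { apply FinFun.Injective_map_NoDup; [intros x y; lia|apply seq_NoDup]. }
  destruct (sum_n_C (fun k => f (Z.of_nat k)) n) as [Euler1 E2].
  assert (E1' := lsum_seq (fun k => Re (f (Z.of_nat k))) n).
  assert (E2' := lsum_seq (fun k => Im (f (Z.of_nat k))) n).
  rewrite <- (lsum_map (fun k => Re (f k)) Z.of_nat) in E1'.
  rewrite <- (lsum_map (fun k => Im (f k)) Z.of_nat) in E2'.
  split.
  - replace (Re (sum_n (fun k => f (Z.of_nat k)) n)) with
      (lsum (fun k => Re (f k)) (map Z.of_nat (seq 0 (S n)))).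
    + apply has_sum_finite; auto. intros k Hk; now rewrite Hz.
    + exact (eq_trans E1' (eq_sym Euler1)).
  - replace (Im (sum_n (fun k => f (Z.of_nat k)) n)) with
      (lsum (fun k => Im (f k)) (map Z.of_nat (seq 0 (S n)))).
    + apply has_sum_finite; auto. intros k Hk; now rewrite Hz.
    + exact (eq_trans E2' (eq_sym E2)).
Qed.

Lemma summableC_finite (f : Z -> C) (n : Z) :
  (forall k, f k <> 0 -> (0 <= k <= n)%Z) -> summableC f.
Proof.
  intros H. eexists. apply has_sumC_finite with (n := Z.to_nat n).
  intros k Hk. specialize (H k Hk). lia.
Qed.

Lemma conv_bij (f g : Z -> C) : summableC f -> summableC g ->
  summableC (fun p : Z * Z => f (fst p - snd p)%Z * g (snd p)).
Proof.
  intros Hf Hg. apply (summableC_inj (fun p : Z * Z => (fst p - snd p, snd p)%Z)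
    ltac:(intros [a b] [a' b']; simpl; intros E; inversion E; f_equal; lia)
    (fun p : Z * Z => f (fst p) * g (snd p))).
  now apply summableC_mult.
Qed.

Lemma csum_conv (f g : Z -> C) : summableC f -> summableC g ->
  csum f * csum g = csum (fun i => csum (fun j => f (i - j)%Z * g j)).
Proof.
  intros Hf Hg. rewrite csum_mult by auto.
  transitivity (csum (fun p : Z * Z => f (fst p - snd p)%Z * g (snd p)));
    [|symmetry; exact (csum_fubini (fun p : Z * Z => f (fst p - snd p)%Z * g (snd p))
        (conv_bij f g Hf Hg))].
  symmetry.
  apply (csum_bij (fun p : Z * Z => (fst p - snd p, snd p)%Z)
    (fun p : Z * Z => (fst p + snd p, snd p)%Z) (fun p : Z * Z => f (fst p) * g (snd p)));
    intros [a b]; simpl; f_equal; lia.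
Qed.

(** * Theta functions and the three-term recurrence behind P_n *)

Section Theta.
Implicit Types (a c d u v w : C) (i j k m : Z).
Local Hint Extern 0 (q <> 0%R) => exact q0 : core.

Lemma ph_iq_summable u k : u <> 0 -> summableC (fun i => ph u i * iq (k - i)).
Proof.
  intros Hu. destruct iq_bounded as [B [HB HBm]].
  apply summableC_le with (fun i => B * thR (Cmod u) i)%R.
  - intros i. rewrite Cmod_mult, Cmod_ph, Rmult_comm by auto.
    apply Rmult_le_compat_r; auto. apply Rlt_le, thR_pos, Cmod_neq0; auto.
  - destruct (thR_summable _ (Cmod_neq0 u Hu)) as [s Hs].
    eexists; apply has_sum_scal; eauto.
Qed.

(** The sum over i stops at k since 1/(q;q)_(k-i) is 0 beyond. Multiplying by Euler's series of (u
    q^k;q)_oo gives the coefficient [ph u i] times Cauchy's sum at k - i, which does not depend on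
    i. The case k = 0 is the triple product; general k later gives the asymptotics of kappa_n. *)
Lemma trunc_theta u k : u <> 0 ->
  csum (fun i => ph u i * iq (k - i)) * qpoch_inf (u * qz k) q * qpoch_inf q q = csum (ph u).
Proof.
  intros Hu. rewrite qpi_EE. unfold EE.
  rewrite csum_conv by (apply ph_iq_summable || apply ee_summable; auto).
  rewrite (csum_ext _ (fun i => / qpoch_inf q q * ph u i)).
  - rewrite csum_scal by now apply ph_summable. field. apply qpi_q_neq0.
  - intros i. rewrite <- (cauchyS_val (k - i)). unfold cauchyS.
    rewrite (Cmult_comm (csum _) (ph u i)), <- csum_scal.
    (* Summability is available for a nonnegative parameter only; a negative one is reduced to it by
       shifting l. *)
    2:{ apply NNPP; intros Hn. 
        assert (E : cauchyS (k - i) <> 0) by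
          (rewrite cauchyS_val; apply Cinv_neq0, qpi_q_neq0).
        destruct (Z_le_gt_dec 0 (k - i)); [apply Hn; now apply cauchyt_summable|].
        apply Hn. replace (k - i)%Z with (- (i - k))%Z by lia.
        assert (Hs := cauchyt_summable (i - k) ltac:(lia)).
        apply (summableC_inj (fun l => l - (i - k))%Z
          ltac:(intros x y; cbv beta; lia)) in Hs.
        eapply summableC_ext; [|apply Hs]. intros l. unfold cauchyt.
        replace (l - (i - k) + (i - k))%Z with l by lia.
        replace (l + - (i - k))%Z with (l - (i - k))%Z by lia.
        replace ((l - (i - k)) * (l - (i - k)) + (i - k) * (l - (i - k)))%Z with
          (l * l + - (i - k) * l)%Z by ring. ring. }
    apply csum_ext; intros j. unfold cauchyt, ee.
    rewrite ph_qz by auto.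
    replace (ph u i) with (ph u (i - j) * ph u j * qz ((i - j) * j)).
    2:{ rewrite <- ph_add by auto. f_equal; lia. }
    replace (j * j + (k - i) * j)%Z with (k * j - (i - j) * j)%Z by ring.
    rewrite qz_sub. replace (k - (i - j))%Z with (j + (k - i))%Z by lia.
    field. apply qz_neq0.
Qed.

(** Jacobi's triple product: for k = 0 the truncated series is Euler's series of (q/u;q)_oo read
    backwards. *)
Lemma theta_sum u : u <> 0 -> csum (ph u) = qpoch_inf q q * theta u q.
Proof.
  intros Hu. rewrite <- (trunc_theta u 0) by auto. unfold theta.
  rewrite qz_0, Cmult_1_r.
  replace (csum (fun i => ph u i * iq (0 - i))) with (qpoch_inf (q / u) q); [ring|].
  rewrite qpi_EE. unfold EE.
  rewrite <- (csum_Zrefl 0 (fun i => ph u i * iq (0 - i))). apply csum_ext; intros i.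
  replace (0 - (0 - i))%Z with i by lia. replace (0 - i)%Z with (- i)%Z by lia.
  rewrite ph_opp by auto. reflexivity.
Qed.

Lemma theta_qz u m : u <> 0 -> theta (u * qz m) q * ph u m = theta u q.
Proof.
  intros Hu. apply (Cmult_reg_l (qpoch_inf q q)); [|apply qpi_q_neq0].
  rewrite <- theta_sum by auto.
  rewrite Cmult_assoc, <- theta_sum by (apply Cmult_neq_0; auto; apply qz_neq0).
  rewrite Cmult_comm, <- csum_scal by (apply ph_summable, Cmult_neq_0; auto; apply qz_neq0).
  rewrite <- (csum_Zshift m (ph u)). apply csum_ext; intros i.
  rewrite ph_add, ph_qz, Z.mul_comm by auto. ring.
Qed.

Lemma theta_inv u : u <> 0 -> theta (/ u) q = - theta u q / u.
Proof.
  intros Hu. unfold theta. rewrite (qpi_step (/ u)), (qpi_step u).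
  replace (q / / u) with (u * q) by (field; auto).
  replace (/ u * q) with (q / u) by (field; auto). field; auto.
Qed.

Lemma theta_refl u : u <> 0 -> theta (q / u) q = theta u q.
Proof.
  intros Hu. unfold theta. replace (q / (q / u)) with u; [ring|].
  field; auto. split; auto. apply q_neq0C.
Qed.

(** For u <> 0 this says that theta does not vanish at u, see [theta_neq0] and [theta_qz_eq0]. *)
Definition notqz u := forall k, u <> qz k.

Lemma qpi_neq0' u : notqz u -> qpoch_inf u q <> 0.
Proof.
  intros H. apply qpi_neq0. intros n E. apply (H (- Z.of_nat n)%Z).
  rewrite qz_opp, qz_nat. rewrite <- qz_nat in E |- *.
  replace u with (u * qz (Z.of_nat n) * / qz (Z.of_nat n)) by (field; apply qz_neq0).
  rewrite E. ring.
Qed.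

Lemma theta_neq0 u : u <> 0 -> notqz u -> theta u q <> 0.
Proof.
  intros Hu H. apply Cmult_neq_0; apply qpi_neq0'; auto.
  intros k E. apply (H (1 - k)%Z). rewrite qz_sub, <- E, qz_1. field.
  split; auto. apply q_neq0C.
Qed.

Lemma theta_qz_eq0 k : theta (qz k) q = 0.
Proof.
  unfold theta. destruct (Z_le_gt_dec k 0).
  - rewrite (qpi_eq0 (qz k) (Z.to_nat (- k))); [ring|].
    rewrite <- qz_nat, <- qz_add. replace (k + _)%Z with 0%Z by lia. apply qz_0.
  - rewrite (qpi_eq0 (q / qz k) (Z.to_nat (k - 1))); [ring|].
    rewrite <- qz_nat, <- qz_1, <- qz_sub, <- qz_add.
    replace (1 - k + _)%Z with 0%Z by lia. apply qz_0.
Qed.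

Lemma notqz_qz u m : notqz u -> notqz (u * qz m).
Proof.
  intros H k E. apply (H (k - m)%Z). rewrite qz_sub, <- E. field. apply qz_neq0.
Qed.

Definition qpz (a : C) k : C := if (k <? 0)%Z then 0 else qpoch a q (Z.to_nat k).

Lemma qpz_neg a k : (k < 0)%Z -> qpz a k = 0.
Proof. intros H. unfold qpz. now destruct (Z.ltb_spec k 0); [|lia]. Qed.

Lemma qpz_nat a n : qpz a (Z.of_nat n) = qpoch a q n.
Proof. unfold qpz. destruct (Z.ltb_spec (Z.of_nat n) 0); [lia|]. now rewrite Nat2Z.id. Qed.

(** Coefficients of (adt;q)_oo / (dt;q)_oo in powers of t; [enA] below has those of 1/(ct;q)_oo. *)
Definition tnA (a d : C) k : C := qpz a k * Cpowz d k * iq k.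

Lemma tnA_def a d k : tnA a d k = qpz a k * Cpowz d k * iq k.
Proof. reflexivity. Qed.

Lemma tnA_neg a d k : (k < 0)%Z -> tnA a d k = 0.
Proof. intros; unfold tnA; rewrite iq_neg by auto; ring. Qed.

Lemma tnA_rec a d k : d <> 0 ->
  (1 - qz k) * tnA a d k = (1 - a * qz (k - 1)) * d * tnA a d (k - 1).
Proof.
  intros Hd. destruct (Z.lt_trichotomy k 0) as [H|[->|H]].
  - rewrite !tnA_neg by lia. ring.
  - rewrite qz_0, (tnA_neg a d (0 - 1)) by lia. ring.
  - unfold tnA.
    replace ((1 - qz k) * (qpz a k * Cpowz d k * iq k)) with
      (qpz a k * Cpowz d k * ((1 - qz k) * iq k)) by ring.
    rewrite iq_rec. replace k with (k - 1 + 1)%Z at 2 by lia. rewrite Cpowz_S by auto.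
    replace (qpz a k) with (qpz a (k - 1) * (1 - a * qz (k - 1))); [ring|].
    replace k with (Z.of_nat (S (Z.to_nat (k - 1)))) by lia.
    set (n := Z.to_nat (k - 1)). replace (Z.of_nat (S n) - 1)%Z with (Z.of_nat n) by lia.
    rewrite !qpz_nat, qz_nat. reflexivity.
Qed.

Definition enA (c : C) k : C := Cpowz c k * iq k.

Lemma enA_def c k : enA c k = Cpowz c k * iq k.
Proof. reflexivity. Qed.

Lemma enA_neg c k : (k < 0)%Z -> enA c k = 0.
Proof. intros; unfold enA; rewrite iq_neg by auto; ring. Qed.

Lemma enA_rec c k : c <> 0 -> (1 - qz k) * enA c k = c * enA c (k - 1).
Proof.
  intros Hc. unfold enA.
  replace ((1 - qz k) * (Cpowz c k * iq k)) with (Cpowz c k * ((1 - qz k) * iq k)) by ring.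
  rewrite iq_rec. replace k with (k - 1 + 1)%Z at 1 by lia. rewrite Cpowz_S by auto. ring.
Qed.

(* Coefficients of (adt;q)_oo / ((ct;q)_oo (dt;q)_oo). *)
Definition tn (a c d : C) (n : Z) : C := csum (fun k => tnA a d k * enA c (n - k)).

Lemma tn_def a c d n : tn a c d n = csum (fun k => tnA a d k * enA c (n - k)).
Proof. reflexivity. Qed.

Lemma tn_support a c d n k : tnA a d k * enA c (n - k) <> 0 -> (0 <= k <= n)%Z.
Proof.
  intros H. destruct (Z_lt_le_dec k 0).
  - rewrite tnA_neg in H by auto. contradiction H; ring.
  - destruct (Z_lt_le_dec n k); [|lia]. rewrite enA_neg in H by lia. contradiction H; ring.
Qed.

Lemma tn_summable a c d n : summableC (fun k => tnA a d k * enA c (n - k)).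
Proof. eapply summableC_finite. apply tn_support. Qed.

Lemma tn_summable' a c d n (g : Z -> C) :
  summableC (fun k => g k * (tnA a d k * enA c (n - k))).
Proof.
  eapply summableC_finite. intros k H. apply (tn_support a c d n k).
  intros E; apply H; rewrite E; ring.
Qed.

(** [h] inserts q^(m-k) into the convolution. The factor 1 - q^(n-k) acts on the coefficients in c,
    and q^(n-k) (1 - q^k) on those in d; eliminating h from the two first-order relations leaves the
    three-term one. *)
Lemma tn_rec a c d n : c <> 0 -> d <> 0 ->
  (1 - qz n) * tn a c d n =
  (c + d - a * d * qz (n - 1)) * tn a c d (n - 1) - c * d * tn a c d (n - 2).
Proof.
  intros Hc Hd.
  set (h := fun m => csum (fun k => qz (m - k) * (tnA a d k * enA c (m - k)))).
  assert (Hh : forall m, tn a c d m - h m = c * tn a c d (m - 1)).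
  { intros m. unfold tn, h. rewrite <- csum_scal, <- csum_minus by
      (apply tn_summable || apply tn_summable').
    apply csum_ext; intros k.
    replace (tnA a d k * enA c (m - k) - qz (m - k) * (tnA a d k * enA c (m - k)))
      with (tnA a d k * ((1 - qz (m - k)) * enA c (m - k))) by ring.
    rewrite enA_rec by auto. replace (m - 1 - k)%Z with (m - k - 1)%Z by lia. ring. }
  assert (E : h n - qz n * tn a c d n = d * h (n - 1)%Z - a * d * qz (n - 1) * tn a c d (n - 1)).
  { rewrite <- (Cmult_1_l (tn a c d (n - 1))).
    unfold h, tn. rewrite <- !csum_scal by (apply tn_summable || apply tn_summable').
    rewrite <- csum_minus by (apply tn_summable' || apply summableC_scal, tn_summable).
    rewrite <- csum_minus.
    2:{ apply summableC_scal, tn_summable'. }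
    2:{ apply summableC_scal, summableC_scal, tn_summable. }
    rewrite <- (csum_Zshift (-1) (fun i => d * _ - _)).
    apply csum_ext; intros k. replace (k + -1)%Z with (k - 1)%Z by lia.
    replace (n - 1 - (k - 1))%Z with (n - k)%Z by lia.
    replace n with (n - k + k)%Z at 3 by lia. rewrite qz_add.
    transitivity (qz (n - k) * enA c (n - k) * ((1 - qz k) * tnA a d k)); [ring|].
    rewrite tnA_rec by auto.
    replace (n - 1)%Z with (n - k + (k - 1))%Z by lia. rewrite qz_add. ring. }
  replace ((1 - qz n) * tn a c d n) with ((tn a c d n - h n) + (h n - qz n * tn a c d n)) by ring.
  rewrite E, Hh.
  replace (h (n - 1)%Z) with (tn a c d (n - 1) - (tn a c d (n - 1) - h (n - 1)%Z)) by ring.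
  rewrite Hh. replace (n - 1 - 1)%Z with (n - 2)%Z by lia. ring.
Qed.

Lemma tn_neg a c d n : (n < 0)%Z -> tn a c d n = 0.
Proof.
  intros Hn. unfold tn. rewrite <- (csum_unique _ _ (@has_sumC_zero Z)).
  apply csum_ext; intros k. apply NNPP; intros H. apply tn_support in H. lia.
Qed.

Lemma tn_0 a c d : tn a c d 0 = 1.
Proof.
  unfold tn. apply csum_unique.
  replace (RtoC 1) with (tnA a d 0 * enA c (0 - 0)).
  - apply (has_sumC_single 0%Z (fun k => tnA a d k * enA c (0 - k))).
    intros k Hk. apply NNPP; intros H. apply tn_support in H. lia.
  - unfold tnA, enA. rewrite Z.sub_diag, iq_0. change 0%Z with (Z.of_nat 0) at 1.
    rewrite qpz_nat. simpl. ring.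
Qed.

Lemma rec_unique (A B f g : Z -> C) : f 0%Z = g 0%Z -> f (-1)%Z = g (-1)%Z ->
  (forall n, (1 - qz n) * f n = A n * f (n - 1)%Z - B n * f (n - 2)%Z) ->
  (forall n, (1 - qz n) * g n = A n * g (n - 1)%Z - B n * g (n - 2)%Z) ->
  forall n, (0 <= n)%Z -> f n = g n.
Proof.
  intros H0 H1 Hf Hg n Hn.
  assert (H : forall j : nat, f (Z.of_nat j) = g (Z.of_nat j) /\
    f (Z.of_nat j - 1)%Z = g (Z.of_nat j - 1)%Z).
  { induction j as [|j [IH1 IH2]]; [now split|].
    replace (Z.of_nat (S j) - 1)%Z with (Z.of_nat j) by lia. split; auto.
    apply (Cmult_reg_l (1 - qz (Z.of_nat (S j)))).
    - rewrite Hf, Hg. replace (Z.of_nat (S j) - 1)%Z with (Z.of_nat j) by lia.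
      replace (Z.of_nat (S j) - 2)%Z with (Z.of_nat j - 1)%Z by lia. now rewrite IH1, IH2.
    - intros E. assert (E' : qz (Z.of_nat (S j)) = 1).
      { replace (qz (Z.of_nat (S j))) with (1 - (1 - qz (Z.of_nat (S j)))) by ring.
        rewrite E; ring. }
      apply qz_inj in E'. lia. }
  replace n with (Z.of_nat (Z.to_nat n)) by lia. apply H.
Qed.

(* Homogeneous Rogers-Szego polynomials divided by (q;q)_n. *)
Definition rn (c d : C) (n : Z) : C := tn 0 c d n.

Lemma rn_def c d n : rn c d n = tn 0 c d n.
Proof. reflexivity. Qed.

Lemma rn_rec c d n : c <> 0 -> d <> 0 ->
  (1 - qz n) * rn c d n = (c + d) * rn c d (n - 1) - c * d * rn c d (n - 2).
Proof. intros. unfold rn. rewrite tn_rec by auto. ring. Qed.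

Lemma rn_neg c d n : (n < 0)%Z -> rn c d n = 0.
Proof. apply tn_neg. Qed.

Lemma rn_0 c d : rn c d 0 = 1.
Proof. apply tn_0. Qed.

Lemma rn_sym c d n : c <> 0 -> d <> 0 -> rn c d n = rn d c n.
Proof.
  intros Hc Hd. destruct (Z_lt_le_dec n 0); [now rewrite !rn_neg|].
  apply (rec_unique (fun _ => c + d) (fun _ => c * d)); auto.
  - now rewrite !rn_0.
  - now rewrite !rn_neg by lia.
  - intros; now apply rn_rec.
  - intros; rewrite rn_rec by auto. ring.
Qed.

(* Coefficients of (ut;q)_oo / ((ct;q)_oo (dt;q)_oo), hence symmetric in [c] and [d]. *)
Definition sN (c d u : C) (n : Z) : C := csum (fun j => ee u j * rn c d (n - j)).

Lemma sN_def c d u n : sN c d u n = csum (fun j => ee u j * rn c d (n - j)).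
Proof. reflexivity. Qed.

Lemma sN_support c d u n k : ee u k * rn c d (n - k) <> 0 -> (0 <= k <= n)%Z.
Proof.
  intros H. destruct (Z_lt_le_dec k 0).
  - rewrite ee_neg in H by auto. contradiction H; ring.
  - destruct (Z_lt_le_dec n k); [|lia]. rewrite rn_neg in H by lia. contradiction H; ring.
Qed.

Lemma sN_summable' c d u n (g : Z -> C) :
  summableC (fun k => g k * (ee u k * rn c d (n - k))).
Proof.
  eapply summableC_finite. intros k H. apply (sN_support c d u n k).
  intros E; apply H; rewrite E; ring.
Qed.

Lemma sN_summable c d u n : summableC (fun k => ee u k * rn c d (n - k)).
Proof. eapply summableC_finite. apply sN_support. Qed.

(** Splitting 1 - q^n = (1 - q^(n-k)) + q^(n-k) (1 - q^k) lets the first part act on [rn] and the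
    second on [ee]. *)
Lemma sN_rec c d u n : c <> 0 -> d <> 0 ->
  (1 - qz n) * sN c d u n =
  (c + d - u * qz (n - 1)) * sN c d u (n - 1) - c * d * sN c d u (n - 2).
Proof.
  intros Hc Hd.
  assert (Euler1 : csum (fun k => (1 - qz (n - k)) * (ee u k * rn c d (n - k))) =
    (c + d) * sN c d u (n - 1) - c * d * sN c d u (n - 2)).
  { unfold sN. rewrite <- !csum_scal, <- csum_minus by
      (try apply summableC_scal; apply sN_summable).
    apply csum_ext; intros k.
    replace ((1 - qz (n - k)) * (ee u k * rn c d (n - k))) with
      (ee u k * ((1 - qz (n - k)) * rn c d (n - k))) by ring.
    rewrite rn_rec by auto. replace (n - 1 - k)%Z with (n - k - 1)%Z by lia.
    replace (n - 2 - k)%Z with (n - k - 2)%Z by lia. ring. }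
  assert (E2 : csum (fun k => (qz (n - k) * (1 - qz k)) * (ee u k * rn c d (n - k))) =
    - u * qz (n - 1) * sN c d u (n - 1)).
  { unfold sN. rewrite <- csum_scal by apply sN_summable.
    rewrite <- (csum_Zshift (-1) (fun k => - u * qz (n - 1) * _)).
    apply csum_ext; intros k. replace (k + -1)%Z with (k - 1)%Z by lia.
    transitivity (qz (n - k) * ((1 - qz k) * ee u k) * rn c d (n - k)); [ring|].
    rewrite ee_rec. replace (n - 1 - (k - 1))%Z with (n - k)%Z by lia.
    replace (n - 1)%Z with (n - k + (k - 1))%Z by lia. rewrite qz_add. ring. }
  replace ((1 - qz n) * sN c d u n) with
    (csum (fun k => (1 - qz (n - k)) * (ee u k * rn c d (n - k))) +
     csum (fun k => (qz (n - k) * (1 - qz k)) * (ee u k * rn c d (n - k)))).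
  - rewrite Euler1, E2. ring.
  - rewrite <- csum_plus by apply sN_summable'. unfold sN.
    rewrite <- csum_scal by apply sN_summable. apply csum_ext; intros k.
    replace (qz n) with (qz (n - k) * qz k) by (rewrite <- qz_add; f_equal; lia). ring.
Qed.

Lemma sN_neg c d u n : (n < 0)%Z -> sN c d u n = 0.
Proof.
  intros Hn. unfold sN. rewrite <- (csum_unique _ _ (@has_sumC_zero Z)).
  apply csum_ext; intros k. apply NNPP; intros H. apply sN_support in H. lia.
Qed.

Lemma sN_0 c d u : sN c d u 0 = 1.
Proof.
  unfold sN. apply csum_unique.
  replace (RtoC 1) with (ee u 0 * rn c d (0 - 0)).
  - apply (has_sumC_single 0%Z (fun k => ee u k * rn c d (0 - k))).
    intros k Hk. apply NNPP; intros H. apply sN_support in H. lia.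
  - rewrite Z.sub_diag, ee_0, rn_0. ring.
Qed.

(** Both are the coefficients of (adt;q)_oo / ((ct;q)_oo (dt;q)_oo), grouped differently; the proof
    compares recurrences. With a = cx the right side depends on c and d symmetrically. *)
Lemma sN_tn a c d n : c <> 0 -> d <> 0 -> tn a c d n = sN c d (a * d) n.
Proof.
  intros Hc Hd. destruct (Z_lt_le_dec n 0); [now rewrite tn_neg, sN_neg|].
  apply (rec_unique (fun n => c + d - a * d * qz (n - 1)) (fun _ => c * d)); auto.
  - now rewrite tn_0, sN_0.
  - now rewrite tn_neg, sN_neg by lia.
  - intros; now apply tn_rec.
  - intros; now apply sN_rec.
Qed.

Lemma sN_sym c d u n : c <> 0 -> d <> 0 -> sN c d u n = sN d c u n.
Proof.
  intros. unfold sN. apply csum_ext; intros k. now rewrite rn_sym.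
Qed.

(* P_n(x) up to a scalar, see [P_pn]. *)
Definition pn (c d : C) (x : C) (n : Z) : C := sN c d (c * d * x) n.

Lemma qpoch_qneg (n k : nat) : (k <= n)%nat ->
  qpoch (qz (- Z.of_nat n)) q k =
  (-1) ^ k * qz (tri (Z.of_nat k) - Z.of_nat n * Z.of_nat k) * qpoch q q n
    * iq (Z.of_nat n - Z.of_nat k).
Proof.
  induction k as [|k IH]; intros Hk.
  - simpl Z.of_nat. rewrite Z.mul_0_r, !Z.sub_0_r. change (tri 0) with 0%Z.
    rewrite qz_0, iq_nat. simpl. field. apply qpoch_q_neq0.
  - simpl qpoch. rewrite IH by lia.
    replace (Z.of_nat n - Z.of_nat (S k))%Z with (Z.of_nat n - Z.of_nat k - 1)%Z by lia.
    rewrite <- iq_rec, <- qz_nat.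
    replace (Z.of_nat (S k)) with (Z.of_nat k + 1)%Z by lia. rewrite tri_S.
    set (a := Z.of_nat n). set (b := Z.of_nat k).
    replace (tri b + b - a * (b + 1))%Z with (tri b - a * b + (- a + b))%Z by ring.
    rewrite (qz_add (tri b - a * b)). replace (a - b)%Z with (- (- a + b))%Z by ring.
    rewrite (qz_opp (- a + b)), (qz_add (- a)).
    change ((-1) ^ S k) with (-1 * (-1) ^ k). field. split; apply qz_neq0.
Qed.

Lemma Cpow_mult (x y : C) (n : nat) : (x * y) ^ n = x ^ n * y ^ n.
Proof. induction n as [|n IH]; simpl; [ring|]. rewrite IH; ring. Qed.

Lemma sum_n_scalC (a : C) (f : nat -> C) n : sum_n (fun l => a * f l) n = a * sum_n f n.
Proof.
  induction n as [|n IH]; [now rewrite !sum_O|]. rewrite !sum_Sn, IH.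
  unfold plus; simpl. ring.
Qed.

Lemma pn_def c d x n : pn c d x n = sN c d (c * d * x) n.
Proof. reflexivity. Qed.

(** The defining sum of P_n is, term by term, the convolution [tn (c x) c d n], once (q^(-n);q)_k is
    written as a quotient of factorials. *)
Lemma P_pn c d n (x : R) : c <> 0 -> d <> 0 ->
  P q c d n x = (-1) ^ n * qz (- tri (Z.of_nat n)) * qpoch q q n * pn c d x (Z.of_nat n).
Proof.
  intros Hc Hd. unfold pn. replace (c * d * x) with (c * x * d) by ring.
  rewrite <- sN_tn by auto.
  unfold tn. rewrite (csum_unique _ _ (has_sumC_finite _ n (tn_support _ _ _ _))).
  unfold P. cbv zeta. fold (tri (Z.of_nat n)).
  change (RtoC (powerRZ q (- tri (Z.of_nat n)))) with (qz (- tri (Z.of_nat n))).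
  rewrite <- !sum_n_scalC. apply sum_n_ext_loc. intros k Hk.
  change (RtoC (powerRZ q (- Z.of_nat n))) with (qz (- Z.of_nat n)).
  rewrite qpoch_qneg by auto.
  fold (tri (Z.of_nat k)).
  change (RtoC (powerRZ q (- tri (Z.of_nat k)))) with (qz (- tri (Z.of_nat k))).
  unfold tnA, enA. rewrite qpz_nat, iq_nat.
  replace (Cpowz c (Z.of_nat n - Z.of_nat k)) with (c ^ n / c ^ k).
  2:{ unfold Z.sub. now rewrite Cpowz_add, Cpowz_opp, !Cpowz_nat. }
  rewrite Cpowz_nat, qz_sub, qz_opp, (qz_opp (tri (Z.of_nat k))).
  replace ((d * q ^ n / c) ^ k) with (d ^ k * qz (Z.of_nat n * Z.of_nat k) / c ^ k).
  2:{ unfold Cdiv. rewrite <- qz_nat, !Cpow_mult, <- !Cpowz_nat, Cpowz_inv by auto.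
      now rewrite Cpowz_qz. }
  replace ((- c) ^ n) with ((-1) ^ n * c ^ n)
    by (rewrite <- Cpow_mult; f_equal; ring).
  assert (Hs : (-1) ^ k * (-1) ^ k = 1).
  { rewrite <- Cpow_mult. replace (-1 * -1) with (RtoC 1) by ring.
    clear; induction k; simpl; [auto|]. rewrite IHk; ring. }
  assert (c ^ k <> 0) by now apply Cpow_neq0.
  assert (H2 := qpoch_q_neq0 k).
  assert (H3 := qz_neq0 (tri (Z.of_nat n))).
  assert (H4 := qz_neq0 (tri (Z.of_nat k))).
  assert (H5 := qz_neq0 (Z.of_nat n * Z.of_nat k)).
  match goal with |- ?a = ?b => change (@eq C a b) end.
  transitivity ((-1) ^ n * / qz (tri (Z.of_nat n)) * qpoch q q n *
    (qpoch (c * x) q k * d ^ k * / qpoch q q k *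
     (c ^ n / c ^ k * iq (Z.of_nat n - Z.of_nat k))) * ((-1) ^ k * (-1) ^ k)).
  - field. auto.
  - rewrite Hs. ring.
Qed.

End Theta.

Lemma csum_Z2shift (a b : Z) (f : Z * Z -> C) :
  csum (fun p => f (fst p + a, snd p + b)%Z) = csum f.
Proof.
  apply (csum_bij (fun p : Z * Z => (fst p + a, snd p + b)%Z)
    (fun p : Z * Z => (fst p - a, snd p - b)%Z)); intros [x y]; simpl; f_equal; lia.
Qed.

Lemma csum_Z2swap (f : Z * Z -> C) : csum (fun p => f (snd p, fst p)) = csum f.
Proof.
  apply (csum_bij (fun p : Z * Z => (snd p, fst p)) (fun p : Z * Z => (snd p, fst p)));
    intros [x y]; auto.
Qed.

(** * The functions P_n and Q_n *)

Section Kappa.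
Implicit Types (a c d u v w z x : C) (i j k m : Z).
Local Hint Extern 0 (q <> 0%R) => exact q0 : core.

Lemma thR_scal (a b : R) k : (0 < a)%R -> (0 < b)%R ->
  (thR a k * powerRZ b k = thR (a * b) k)%R.
Proof. intros. rewrite !thR_def, powerRZ_mult. ring. Qed.

(** Geometric growth is all that is required: every series that contains [rn] also has a factor
    decaying like a theta series, and [thR] absorbs a geometric factor into its argument. *)
Lemma rn_bound c d : c <> 0 -> d <> 0 ->
  exists rho, (1 <= rho)%R /\ forall n, (Cmod (rn c d n) <= powerRZ rho n)%R.
Proof.
  intros Hc Hd.
  set (s := (Cmod c + Cmod d)%R).
  assert (Hs : (0 <= s)%R) by (unfold s; pose proof (Cmod_ge_0 c); pose proof (Cmod_ge_0 d); lra).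
  (* Chosen so that s rho^n + s^2 rho^(n-1) <= 2 s rho^n <= (1 - q) rho^(n+1), which closes the
     induction, 1 - q being a lower bound of 1 - q^(n+1). *)
  set (rho := (2 * (s + 1) / (1 - q))%R).
  assert (Hrq : (rho * (1 - q) = 2 * (s + 1))%R) by (unfold rho; field; lra).
  assert (Hr : (1 <= rho)%R).
  { apply Rmult_le_reg_r with (1 - q)%R; [lra|]. rewrite Hrq. lra. }
  exists rho; split; auto.
  assert (H : forall n : nat, (Cmod (rn c d (Z.of_nat n)) <= rho ^ n)%R /\
    (Cmod (rn c d (Z.of_nat n - 1)) * rho <= rho ^ n)%R).
  { induction n as [|n [IH1 IH2]].
    - simpl Z.of_nat. rewrite rn_0, rn_neg, Cmod_1, Cmod_0 by lia. simpl; lra.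
    - replace (Z.of_nat (S n) - 1)%Z with (Z.of_nat n) by lia. split; [|simpl; nra].
      assert (E := rn_rec c d (Z.of_nat (S n)) Hc Hd).
      replace (Z.of_nat (S n) - 1)%Z with (Z.of_nat n) in E by lia.
      replace (Z.of_nat (S n) - 2)%Z with (Z.of_nat n - 1)%Z in E by lia.
      apply (f_equal Cmod) in E. rewrite Cmod_mult in E.
      assert (Hle : (Cmod (1 - qz (Z.of_nat (S n))) >= 1 - q)%R).
      { rewrite qz_nat, <- RtoC_pow, <- RtoC_minus, Cmod_R.
        assert (q ^ S n <= q)%R.
        { simpl. assert (q ^ n <= 1)%R; [|nra]. rewrite <- (pow1 n). apply pow_incr; lra. }
        rewrite Rabs_pos_eq; lra. }
      assert (Hu : (Cmod ((c + d) * rn c d (Z.of_nat n) - c * d * rn c d (Z.of_nat n - 1))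
        <= s * rho ^ n + s * s * (rho ^ n / rho))%R).
      { eapply Rle_trans; [apply Cmod_triangle|]. rewrite Cmod_opp, !Cmod_mult.
        apply Rplus_le_compat.
        - apply Rmult_le_compat; auto using Cmod_ge_0. apply Cmod_triangle.
        - apply Rmult_le_compat; auto using Cmod_ge_0.
          + apply Rmult_le_pos; apply Cmod_ge_0.
          + apply Rmult_le_compat; auto using Cmod_ge_0; unfold s;
              pose proof (Cmod_ge_0 c); pose proof (Cmod_ge_0 d); lra.
          + apply Rmult_le_reg_r with rho; [lra|].
            replace (rho ^ n / rho * rho)%R with (rho ^ n)%R by (field; lra). auto. }
      rewrite <- E in Hu.
      assert (Hp : (0 < rho ^ n)%R) by (apply pow_lt; lra).
      apply Rmult_le_reg_l with (1 - q)%R; [lra|].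
      assert (HC := Cmod_ge_0 (rn c d (Z.of_nat (S n)))).
      apply Rle_trans with (s * rho ^ n + s * s * (rho ^ n / rho))%R; [nra|].
      simpl. replace ((1 - q) * (rho * rho ^ n))%R with (2 * (s + 1) * rho ^ n)%R
        by (rewrite <- Hrq; ring).
      assert (s * s * (rho ^ n / rho) <= s * rho ^ n)%R; [|nra].
      assert (s <= rho)%R by nra.
      apply Rmult_le_reg_r with rho; [lra|].
      replace (s * s * (rho ^ n / rho) * rho)%R with (s * rho ^ n * s)%R by (field; lra).
      apply Rmult_le_compat_l; auto. apply Rmult_le_pos; lra. }
  intros n. destruct (Z_lt_le_dec n 0).
  - rewrite rn_neg, Cmod_0 by auto. apply powerRZ_le; lra.
  - replace n with (Z.of_nat (Z.to_nat n)) by lia. rewrite <- pow_powerRZ. apply H.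
Qed.

(** A theta series in z1 truncated at i <= k and a full theta series in z2, coupled through
    r_(n+i+j). *)
Definition kt z1 z2 c d k n (p : Z * Z) : C :=
  ph z1 (fst p) * iq (k - fst p) * (ph z2 (snd p) * rn c d (n + fst p + snd p)).

Lemma kt_def z1 z2 c d k n p : kt z1 z2 c d k n p =
  ph z1 (fst p) * iq (k - fst p) * (ph z2 (snd p) * rn c d (n + fst p + snd p)).
Proof. reflexivity. Qed.

(* Q_n(x) times the weight, up to a scalar, at x = z1 q^k where {z1, z2} = {zm, zp}; see [Q_kap]. *)
Definition kap z1 z2 c d k n : C := csum (kt z1 z2 c d k n).

Lemma kap_def z1 z2 c d k n : kap z1 z2 c d k n = csum (kt z1 z2 c d k n).
Proof. reflexivity. Qed.

Lemma kt_bound z1 z2 c d : z1 <> 0 -> z2 <> 0 -> c <> 0 -> d <> 0 ->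
  forall n, exists g, summable g /\
    (forall k p, (Cmod (kt z1 z2 c d k n p) <= g p)%R) /\
    forall p, (Cmod (ph z1 (fst p) * (ph z2 (snd p) * rn c d (n + fst p + snd p))) <= g p)%R.
Proof.
  intros H1 H2 Hc Hd n.
  destruct iq_bounded as [B [HB HBm]].
  destruct (rn_bound c d Hc Hd) as [rho [Hr HR]].
  assert (P1 := Cmod_neq0 _ H1). assert (P2 := Cmod_neq0 _ H2).
  exists (fun p => ((B + 1) * powerRZ rho n * (thR (Cmod z1 * rho) (fst p) * thR (Cmod z2 * rho) (snd p)))%R).
  assert (Hpn : (0 < powerRZ rho n)%R) by (apply powerRZ_lt; lra).
  assert (Hb : forall p, (Cmod (ph z1 (fst p) * (ph z2 (snd p) * rn c d (n + fst p + snd p)))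
    <= powerRZ rho n * (thR (Cmod z1 * rho) (fst p) * thR (Cmod z2 * rho) (snd p)))%R).
  { intros [i j]; simpl. rewrite !Cmod_mult, !Cmod_ph by auto.
    rewrite <- !thR_scal by lra.
    assert (T1 := thR_pos (Cmod z1) i P1). assert (T2 := thR_pos (Cmod z2) j P2).
    specialize (HR (n + i + j)%Z). rewrite !powerRZ_add in HR by lra.
    assert (0 < thR (Cmod z1) i * thR (Cmod z2) j)%R by now apply Rmult_lt_0_compat.
    replace (powerRZ rho n * (thR (Cmod z1) i * powerRZ rho i * (thR (Cmod z2) j * powerRZ rho j)))%R
      with (thR (Cmod z1) i * thR (Cmod z2) j * (powerRZ rho n * powerRZ rho i * powerRZ rho j))%R by ring.
    rewrite <- Rmult_assoc. apply Rmult_le_compat_l; lra. }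
  assert (Hnn : forall p : Z * Z, (0 <= thR (Cmod z1 * rho) (fst p) * thR (Cmod z2 * rho) (snd p))%R).
  { intros p. apply Rmult_le_pos; apply Rlt_le, thR_pos; apply Rmult_lt_0_compat; auto; lra. }
  split; [|split].
  - destruct (thR_summable (Cmod z1 * rho) ltac:(apply Rmult_lt_0_compat; auto; lra)) as [s Hs].
    destruct (thR_summable (Cmod z2 * rho) ltac:(apply Rmult_lt_0_compat; auto; lra)) as [t Ht].
    eexists. apply has_sum_scal. apply has_sum_prod; eauto.
  - intros k p. specialize (Hb p). specialize (Hnn p). specialize (HBm (k - fst p)%Z).
    unfold kt.
    replace (ph z1 (fst p) * iq (k - fst p) * (ph z2 (snd p) * rn c d (n + fst p + snd p)))
      with (iq (k - fst p) * (ph z1 (fst p) * (ph z2 (snd p) * rn c d (n + fst p + snd p)))) by ring.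
    rewrite Cmod_mult, Rmult_assoc.
    apply Rmult_le_compat; auto using Cmod_ge_0; lra.
  - intros p. specialize (Hb p). specialize (Hnn p).
    eapply Rle_trans; [apply Hb|]. rewrite Rmult_assoc.
    assert (0 <= powerRZ rho n * (thR (Cmod z1 * rho) (fst p) * thR (Cmod z2 * rho) (snd p)))%R
      by (apply Rmult_le_pos; lra). nra.
Qed.

Lemma kt_summable z1 z2 c d k n : z1 <> 0 -> z2 <> 0 -> c <> 0 -> d <> 0 ->
  summableC (kt z1 z2 c d k n).
Proof.
  intros H1 H2 Hc Hd. destruct (kt_bound z1 z2 c d H1 H2 Hc Hd n) as [g [Hg [H _]]].
  apply summableC_le with g; auto.
Qed.

(** Only 1/(q;q)_(k-i) depends on k. Its increment is q^(k+1-i)/(q;q)_(k+1-i), and the shift of i by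
    one that restores the truncation at k turns n into n + 1. *)
Lemma kap_step z1 z2 c d k n : z1 <> 0 -> z2 <> 0 -> c <> 0 -> d <> 0 ->
  kap z1 z2 c d (k + 1) n = kap z1 z2 c d k n - z1 * qz k * kap z1 z2 c d k (n + 1).
Proof.
  intros H1 H2 Hc Hd.
  assert (E : kap z1 z2 c d (k + 1) n - kap z1 z2 c d k n
    = - (z1 * qz k) * kap z1 z2 c d k (n + 1)).
  { unfold kap. rewrite <- csum_minus, <- csum_scal by now apply kt_summable.
    rewrite <- (csum_Z2shift 1 0). apply csum_ext; intros [i j]. unfold kt; simpl fst; simpl snd.
    replace (k + 1 - (i + 1))%Z with (k - i)%Z by lia.
    rewrite Z.add_0_r.
    replace (k - (i + 1))%Z with (k - i - 1)%Z by lia. rewrite <- iq_rec, ph_S, qz_sub by auto.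
    replace (n + (i + 1) + j)%Z with (n + 1 + i + j)%Z by lia. field. apply qz_neq0. }
  replace (kap z1 z2 c d (k + 1) n) with
    (kap z1 z2 c d (k + 1) n - kap z1 z2 c d k n + kap z1 z2 c d k n) by ring.
  rewrite E. ring.
Qed.

(** The recurrence of r_(n+i+j) leaves the factor q^(n+i+j). A shift of j removes q^j through
    [ph z2]; the remaining q^i is expressed by the truncation factor as q^k plus a shift of i. The
    sum [S1] collects the terms with q^i. *)
Lemma kap_rec z1 z2 c d k n : z1 <> 0 -> z2 <> 0 -> c <> 0 -> d <> 0 ->
  kap z1 z2 c d k n =
  (c + d - qz n * (z1 * qz k) / (z1 * z2)) * kap z1 z2 c d k (n - 1)
  - (c * d - qz n / (z1 * z2)) * kap z1 z2 c d k (n - 2).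
Proof.
  intros H1 H2 Hc Hd.
  assert (Hs : forall m, summableC (kt z1 z2 c d k m)) by (intros; now apply kt_summable).
  set (S1 := csum (fun p => qz (fst p) * kt z1 z2 c d k (n - 1) p)).
  assert (HS1 : forall p, qz (fst p) * kt z1 z2 c d k (n - 1) p =
    qz k * kt z1 z2 c d k (n - 1) p + (- / z1) * kt z1 z2 c d k (n - 2) (fst p + 1, snd p + 0)%Z).
  { intros [i j]. unfold kt; simpl fst; simpl snd. rewrite Z.add_0_r.
    replace (k - (i + 1))%Z with (k - i - 1)%Z by lia. rewrite <- iq_rec, ph_S, qz_sub by auto.
    replace (n - 2 + (i + 1) + j)%Z with (n - 1 + i + j)%Z by lia. field.
    split; auto. apply qz_neq0. }
  assert (Hsh : summableC (fun p => kt z1 z2 c d k (n - 2) (fst p + 1, snd p + 0)%Z)).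
  { apply (summableC_inj (fun p : Z * Z => (fst p + 1, snd p + 0)%Z)
      ltac:(intros [x y] [x' y']; simpl; intros E; inversion E; f_equal; lia)); auto. }
  assert (ES1 : S1 = qz k * kap z1 z2 c d k (n - 1) - / z1 * kap z1 z2 c d k (n - 2)).
  { unfold S1. rewrite (csum_ext _ _ HS1).
    rewrite csum_plus, !csum_scal by (try apply summableC_scal; auto).
    rewrite csum_Z2shift. unfold kap. ring. }
  assert (Hs1 : summableC (fun p => qz (fst p) * kt z1 z2 c d k (n - 1) p)).
  { apply (summableC_ext _ _ (fun p => eq_sym (HS1 p))).
    apply summableC_plus; apply summableC_scal; auto. }
  assert (Hs2 : summableC (fun p => qz (fst (fst p + 0, snd p + 1)%Z)
     * kt z1 z2 c d k (n - 1) (fst p + 0, snd p + 1)%Z)).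
  { apply (summableC_inj (fun p : Z * Z => (fst p + 0, snd p + 1)%Z)
      ltac:(intros [x y] [x' y']; simpl; intros E; inversion E; f_equal; lia)
      (fun p => qz (fst p) * kt z1 z2 c d k (n - 1) p)); auto. }
  assert (E : kap z1 z2 c d k n - (c + d) * kap z1 z2 c d k (n - 1)
    + c * d * kap z1 z2 c d k (n - 2) = - (qz n / z2) * S1).
  { unfold S1. rewrite <- (csum_Z2shift 0 1 (fun p => qz (fst p) * kt z1 z2 c d k (n - 1) p)).
    rewrite <- csum_scal by auto.
    unfold kap. rewrite <- !csum_scal, <- csum_minus, <- csum_plus by
      (repeat first [apply summableC_scal | apply Hs |
        (destruct (Hs n) as [s1 Q1]; destruct (summableC_scal (c + d) _ (Hs (n - 1)%Z)) as [s2 Q2];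
         eexists; apply has_sumC_minus; eassumption)]).
    apply csum_ext; intros [i j]. unfold kt; simpl fst; simpl snd. rewrite Z.add_0_r.
    assert (ER := rn_rec c d (n + i + j) Hc Hd).
    replace (n - 1 + i + j)%Z with (n + i + j - 1)%Z by lia.
    replace (n - 2 + i + j)%Z with (n + i + j - 2)%Z by lia.
    replace (n - 1 + i + (j + 1))%Z with (n + i + j)%Z by lia.
    rewrite ph_S by auto.
    rewrite !qz_add in ER.
    replace (c * d * (ph z1 i * iq (k - i) * (ph z2 j * rn c d (n + i + j - 2)))) with
      (ph z1 i * iq (k - i) * ph z2 j * ((c + d) * rn c d (n + i + j - 1)
        - ((c + d) * rn c d (n + i + j - 1) - c * d * rn c d (n + i + j - 2)))) by ring.
    rewrite <- ER. field. auto. }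
  rewrite ES1 in E.
  replace (kap z1 z2 c d k n) with
    (kap z1 z2 c d k n - (c + d) * kap z1 z2 c d k (n - 1)
    + c * d * kap z1 z2 c d k (n - 2) + (c + d) * kap z1 z2 c d k (n - 1)
    - c * d * kap z1 z2 c d k (n - 2)) by ring.
  rewrite E. field. auto.
Qed.

Lemma kap_formA_term z1 z2 c d k n (N l : Z) : z1 <> 0 -> z2 <> 0 ->
  ph z1 k * (ph z2 (N - n - k) * (ee (q / (z1 * qz k)) l * rn c d (N - l))) =
  kt z1 z2 c d k n (k - l, N - n - k)%Z.
Proof.
  intros H1 H2. unfold kt; simpl fst; simpl snd. rewrite ee_def.
  replace (k - (k - l))%Z with l by lia.
  replace (n + (k - l) + (N - n - k))%Z with (N - l)%Z by lia.
  replace (ph z1 (k - l)) with (ph z1 k * ph (q / (z1 * qz k)) l); [ring|].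
  unfold Z.sub. rewrite ph_add, ph_opp by auto.
  replace (q / (z1 * qz k)) with (q / z1 * qz (- k)).
  - rewrite ph_qz by (apply Cdiv_neq0; auto; apply q_neq0C).
    replace (k * - l)%Z with (- k * l)%Z by ring. ring.
  - rewrite qz_opp. field. split; auto. apply qz_neq0.
Qed.

Lemma formA_summable z1 z2 c d k n : z1 <> 0 -> z2 <> 0 -> c <> 0 -> d <> 0 ->
  summableC (fun p : Z * Z => ph z2 (fst p - n - k) *
    (ee (q / (z1 * qz k)) (snd p) * rn c d (fst p - snd p))).
Proof.
  intros H1 H2 Hc Hd.
  assert (Hs : summableC (fun p : Z * Z => kt z1 z2 c d k n (k - snd p, fst p - n - k)%Z)).
  { apply (summableC_inj (fun p : Z * Z => (k - snd p, fst p - n - k)%Z)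
      ltac:(intros [x y] [x' y']; simpl; intros E; inversion E; f_equal; lia)).
    now apply kt_summable. }
  apply (summableC_scal (/ ph z1 k)) in Hs. eapply summableC_ext; [|apply Hs].
  intros [N l]; simpl. rewrite <- kap_formA_term by auto. field. now apply ph_neq0.
Qed.

(** Reflecting i = k - l turns the truncated theta series into Euler's series in q/x with x = z1
    q^k, and summing over l at fixed N = n + k + j produces [sN]. The resulting series has no terms
    with N < 0 and starts with 1 at N = 0; this makes it the form for estimates at -oo and for the
    comparison with 1phi1. *)
Lemma kap_formA z1 z2 c d k n : z1 <> 0 -> z2 <> 0 -> c <> 0 -> d <> 0 ->
  summableC (fun N => ph z2 (N - n - k) * sN c d (q / (z1 * qz k)) N) /\
  kap z1 z2 c d k n =
  ph z1 k * csum (fun N => ph z2 (N - n - k) * sN c d (q / (z1 * qz k)) N).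
Proof.
  intros H1 H2 Hc Hd.
  assert (Hs := formA_summable z1 z2 c d k n H1 H2 Hc Hd).
  assert (Hrow : forall N, csum (fun l => ph z2 (N - n - k) *
    (ee (q / (z1 * qz k)) l * rn c d (N - l))) =
    ph z2 (N - n - k) * sN c d (q / (z1 * qz k)) N).
  { intros N. rewrite csum_scal by apply sN_summable. reflexivity. }
  split.
  - eapply summableC_ext; [intros N; apply (Hrow N)|].
    eexists. eapply has_sumC_fubini; [apply csum_spec, Hs|].
    intros N; simpl. apply csum_spec. apply (summableC_row _ N Hs).
  - rewrite (csum_ext _ _ (fun N => eq_sym (Hrow N))).
    change (fun i => csum (fun l => ph z2 (i - n - k) * (ee (q / (z1 * qz k)) l * rn c d (i - l))))
      with (fun i => csum (fun j => (fun p : Z * Z => ph z2 (fst p - n - k) *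
        (ee (q / (z1 * qz k)) (snd p) * rn c d (fst p - snd p))) (i, j))).
    rewrite csum_fubini, <- csum_scal by auto.
    unfold kap. symmetry.
    rewrite <- (csum_bij (fun p : Z * Z => (k - snd p, fst p - n - k)%Z)
      (fun p : Z * Z => (snd p + n + k, k - fst p)%Z) (kt z1 z2 c d k n));
      [|intros [x y]; simpl; f_equal; lia..].
    apply csum_ext; intros [N l]. now apply kap_formA_term.
Qed.

End Kappa.

(** * Bounds and limits of kappa_n and its identification with Q_n *)

Section KappaBounds.
Implicit Types (a c d u v w z x : C) (i j k m : Z).
Local Hint Extern 0 (q <> 0%R) => exact q0 : core.

Lemma powerRZ_exp_mul (b : R) i j : b <> 0%R -> powerRZ b (i * j) = powerRZ (powerRZ b i) j.
Proof.
  intros Hb. assert (H := powerRZ_NOR b i Hb). revert j. apply Z_two_sided_ind.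
  - now rewrite Z.mul_0_r.
  - intros j. rewrite Z.mul_add_distr_l, Z.mul_1_r, !powerRZ_add by auto.
    replace (powerRZ (powerRZ b i) 1) with (powerRZ b i) by (simpl; ring). split; intros E; [now rewrite E|].
    apply (Rmult_eq_reg_r (powerRZ b i)); auto.
Qed.

Lemma sN_bound c d (a : R) : c <> 0 -> d <> 0 -> (0 < a)%R ->
  exists rho S, (1 <= rho)%R /\ (0 <= S)%R /\ forall u n, (Cmod u <= a)%R ->
    (Cmod (sN c d u n) <= S * powerRZ rho n)%R.
Proof.
  intros Hc Hd Ha. destruct (rn_bound c d Hc Hd) as [rho [Hr HR]].
  destruct (eeR_summable (a / rho)) as [S HS]; [apply Rdiv_lt_0_compat; lra|].
  exists rho, (2 * S)%R. split; auto. split.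
  - apply Rmult_le_pos; [lra|].
    assert (H0 : (0 <= S)%R); [|lra].
    eapply (has_sum_le (fun _ => 0%R)); [|apply has_sum_zero|apply HS].
    intros i. rewrite eeR_def. apply Rmult_le_pos; [|apply iqR_ge0].
    apply Rlt_le, thR_pos. apply Rdiv_lt_0_compat; lra.
  - intros u n Hu.
    replace (2 * S * powerRZ rho n)%R with (2 * (powerRZ rho n * S))%R by ring.
    apply (has_sumC_bound (fun j => ee u j * rn c d (n - j))
      (fun j => powerRZ rho n * eeR (a / rho) j)%R).
    + intros j. rewrite Cmod_mult.
      assert (H1 := Cmod_ee_le u a j Hu). assert (H2 := HR (n - j)%Z).
      replace (powerRZ rho n * eeR (a / rho) j)%R with (eeR a j * powerRZ rho (n - j))%R.
      * apply Rmult_le_compat; auto using Cmod_ge_0.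
      * rewrite !eeR_def. unfold Rdiv. rewrite <- thR_scal; [|auto|apply Rinv_0_lt_compat; lra].
        unfold Z.sub. rewrite powerRZ_add, powerRZ_neg', powerRZ_inv' by lra. ring.
    + apply csum_spec, sN_summable.
    + now apply has_sum_scal.
Qed.

(** The size of the term N = 0 of [kap_formA], uniformly for |q/x| <= a and n + k <= m0: relative to
    it the N-th term has a factor q^(N (-n-k)) <= q^(-m0 N), which costs only a geometric factor.
    Two regimes are covered, k -> -oo with n fixed and n -> -oo with k fixed. *)
Lemma kap_bound z1 z2 c d (a : R) (m0 : Z) : z1 <> 0 -> z2 <> 0 -> c <> 0 -> d <> 0 ->
  (0 < a)%R -> (0 <= m0)%Z ->
  exists K, (0 <= K)%R /\ forall k n, (Cmod (q / (z1 * qz k)) <= a)%R -> (n + k <= m0)%Z ->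
    (Cmod (kap z1 z2 c d k n) <= K * (Cmod (ph z1 k) * Cmod (ph z2 (- n - k))))%R.
Proof.
  intros H1 H2 Hc Hd Ha Hm0.
  destruct (sN_bound c d a Hc Hd Ha) as [rho [S [Hr [HS0 HS]]]].
  assert (P2 := Cmod_neq0 _ H2).
  set (b := (Cmod z2 * powerRZ q (- m0) * rho)%R).
  assert (Hqm : (0 < powerRZ q (- m0))%R) by (apply powerRZ_lt; lra).
  assert (Hb : (0 < b)%R) by (unfold b; repeat apply Rmult_lt_0_compat; lra).
  destruct (thR_summable b Hb) as [T HT].
  assert (HT0 : (0 <= T)%R).
  { eapply (has_sum_le (fun _ => 0%R)); [|apply has_sum_zero|apply HT].
    intros i. apply Rlt_le, thR_pos; auto. }
  exists (2 * (S * T))%R. split; [repeat apply Rmult_le_pos; lra|].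
  intros k n Hx Hnk.
  destruct (kap_formA z1 z2 c d k n H1 H2 Hc Hd) as [Hsum ->].
  rewrite Cmod_mult.
  set (M := Cmod (ph z2 (- n - k))).
  assert (HM : (0 <= M)%R) by apply Cmod_ge_0.
  assert (Hle : (Cmod (csum (fun N => ph z2 (N - n - k) * sN c d (q / (z1 * qz k)) N)%C)
    <= 2 * (M * S * T))%R).
  { eapply has_sumC_bound; [|apply csum_spec, Hsum|apply has_sum_scal, HT].
    intros N. cbv beta. destruct (Z_lt_le_dec N 0).
    - rewrite sN_neg, Cmult_0_r, Cmod_0 by auto.
      apply Rmult_le_pos; [apply Rmult_le_pos; auto|]. apply Rlt_le, thR_pos; auto.
    - replace (N - n - k)%Z with (N + (- n - k))%Z by lia.
      rewrite ph_add by auto. rewrite !Cmod_mult. fold M.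
      rewrite Cmod_ph, Cmod_qz by auto.
      replace (M * S * thR b N)%R with
        (thR (Cmod z2) N * M * powerRZ q (- m0 * N) * (S * powerRZ rho N))%R.
      + apply Rmult_le_compat; auto using Cmod_ge_0.
        * apply Rmult_le_pos; [|apply powerRZ_le; lra].
          apply Rmult_le_pos; auto. apply Rlt_le, thR_pos; auto.
        * apply Rmult_le_compat_l.
          { apply Rmult_le_pos; auto. apply Rlt_le, thR_pos; auto. }
          replace (N * (- n - k))%Z with (- m0 * N + N * (m0 - n - k))%Z by ring.
          rewrite powerRZ_add by auto.
          assert (0 < powerRZ q (- m0 * N))%R by (apply powerRZ_lt; lra).
          assert (powerRZ q (N * (m0 - n - k)) <= 1)%R by (apply powerRZ_q_le1; nia).
          nra.
      + unfold b. rewrite <- thR_scal by (try apply Rmult_lt_0_compat; lra).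
        rewrite <- thR_scal by lra.
        rewrite (powerRZ_exp_mul q (- m0) N) by auto. ring. }
  eapply Rle_trans; [apply Rmult_le_compat_l; [apply Cmod_ge_0|apply Hle]|].
  apply Req_le. ring.
Qed.

(** Up to 1/(q;q)_oo the value of kappa_n at x = 0, obtained by removing the truncation; its
    symmetry in z1 and z2 makes the boundary terms of the two halves agree. *)
Definition kapK z1 z2 c d n : C :=
  csum (fun p : Z * Z => ph z1 (fst p) * (ph z2 (snd p) * rn c d (n + fst p + snd p))).

Lemma kapK_sym z1 z2 c d n : kapK z1 z2 c d n = kapK z2 z1 c d n.
Proof.
  unfold kapK. rewrite <- csum_Z2swap. apply csum_ext; intros [i j]; simpl.
  replace (n + j + i)%Z with (n + i + j)%Z by lia. ring.
Qed.

Lemma kap_lim z1 z2 c d n : z1 <> 0 -> z2 <> 0 -> c <> 0 -> d <> 0 ->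
  has_limC (fun k : nat => kap z1 z2 c d (Z.of_nat k) n) (/ qpoch_inf q q * kapK z1 z2 c d n).
Proof.
  intros H1 H2 Hc Hd.
  destruct (kt_bound z1 z2 c d H1 H2 Hc Hd n) as [g [Hg [Hk HK]]].
  apply has_sumC_tannery with (f := fun k : nat => kt z1 z2 c d (Z.of_nat k) n) (g := g)
    (F := fun p : Z * Z => / qpoch_inf q q *
      (ph z1 (fst p) * (ph z2 (snd p) * rn c d (n + fst p + snd p)))); auto.
  - intros [i j].
    apply has_limC_ext with (fun k : nat => iq (Z.of_nat k + - i) *
      (ph z1 i * (ph z2 j * rn c d (n + i + j)))).
    + intros k. rewrite kt_def; simpl fst; simpl snd. unfold Z.sub. ring.
    + apply has_limC_mult; [|apply has_limC_const].
      apply (has_limC_Z iq), iq_lim.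
  - intros k. now apply csum_spec, kt_summable.
  - apply has_sumC_scal, csum_spec. now apply summableC_le with g.
Qed.

(** If all kappa_n vanished at x, then [kap_formA] at n = -M - k would give a power series in q^M
    with constant term 1 that is 0 for every M; letting M tend to oo is absurd. *)
Lemma kap_nonzero z1 z2 c d k : z1 <> 0 -> z2 <> 0 -> c <> 0 -> d <> 0 ->
  exists n, kap z1 z2 c d k n <> 0.
Proof.
  intros H1 H2 Hc Hd. apply NNPP. intros Hno.
  assert (Hz : forall n, kap z1 z2 c d k n = 0).
  { intros n. apply NNPP. intros Hn. apply Hno; eauto. }
  set (u := q / (z1 * qz k)).
  destruct (sN_bound c d (Cmod u + 1) Hc Hd) as [rho [S [Hr [HS0 HS]]]].
  { pose proof (Cmod_ge_0 u); lra. }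
  assert (P2 := Cmod_neq0 _ H2).
  assert (Hb : (0 < Cmod z2 * rho)%R) by (apply Rmult_lt_0_compat; lra).
  assert (Hlim : has_limC (fun _ : nat => 0) 1).
  { apply has_sumC_tannery with
      (f := fun (M : nat) (N : Z) => qz (N * Z.of_nat M) * (ph z2 N * sN c d u N))
      (g := (fun N => S * thR (Cmod z2 * rho) N)%R)
      (F := fun N => if (N =? 0)%Z then RtoC 1 else RtoC 0).
    - intros M N. destruct (Z_lt_le_dec N 0).
      + rewrite sN_neg, !Cmult_0_r, Cmod_0 by auto.
        apply Rmult_le_pos; auto. apply Rlt_le, thR_pos; auto.
      + rewrite !Cmod_mult, Cmod_ph, Cmod_qz, <- thR_scal by (auto; lra).
        assert (H3 := HS u N ltac:(lra)).
        assert (H4 := thR_pos (Cmod z2) N P2).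
        assert (H5 : (powerRZ q (N * Z.of_nat M) <= 1)%R) by (apply powerRZ_q_le1; nia).
        assert (H6 : (0 <= powerRZ q (N * Z.of_nat M))%R) by (apply powerRZ_le; lra).
        assert (H7 := Cmod_ge_0 (sN c d u N)).
        replace (S * (thR (Cmod z2) N * powerRZ rho N))%R with
          (1 * (thR (Cmod z2) N * (S * powerRZ rho N)))%R by ring.
        apply Rmult_le_compat; auto; [apply Rmult_le_pos; lra|].
        apply Rmult_le_compat_l; lra.
    - destruct (thR_summable _ Hb) as [T HT]. eexists; apply has_sum_scal, HT.
    - intros N. destruct (Z.eqb_spec N 0) as [->|HN].
      + eapply has_limC_ext; [|apply has_limC_const]. intros M; cbv beta.
        rewrite Z.mul_0_l, qz_0, ph_0, sN_0. ring.
      + destruct (Z_lt_le_dec N 0).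
        * eapply has_limC_ext; [|apply has_limC_const]. intros M; cbv beta.
          rewrite sN_neg by auto. ring.
        * replace (RtoC 0) with (0 * (ph z2 N * sN c d u N)) by ring.
          apply has_limC_mult; [|apply has_limC_const].
          apply has_limC_le with (fun M => q ^ M)%R; [|apply is_lim_pow_q].
          intros M. replace (qz (N * Z.of_nat M) - 0) with (qz (N * Z.of_nat M)) by ring.
          rewrite Cmod_qz.
          replace (N * Z.of_nat M)%Z with (Z.of_nat M + (N - 1) * Z.of_nat M)%Z by ring.
          rewrite powerRZ_add, <- pow_powerRZ by auto.
          assert (0 < q ^ M)%R by (apply pow_lt; lra).
          assert (powerRZ q ((N - 1) * Z.of_nat M) <= 1)%R by (apply powerRZ_q_le1; nia).
          nra.
    - intros M. 
      destruct (kap_formA z1 z2 c d k (- Z.of_nat M - k) H1 H2 Hc Hd) as [Hsum E].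
      fold u in Hsum, E. rewrite Hz in E.
      assert (E0 : csum (fun N => ph z2 (N - (- Z.of_nat M - k) - k) * sN c d u N) = 0).
      { apply (Cmult_reg_l (ph z1 k)); [rewrite <- E; ring|now apply ph_neq0]. }
      apply csum_spec in Hsum. rewrite E0 in Hsum.
      apply (has_sumC_scal (/ ph z2 (Z.of_nat M))) in Hsum. rewrite Cmult_0_r in Hsum.
      eapply has_sumC_ext; [|apply Hsum]. intros N; cbv beta.
      replace (N - (- Z.of_nat M - k) - k)%Z with (N + Z.of_nat M)%Z by lia.
      rewrite ph_add by auto. field. now apply ph_neq0.
    - apply (has_sumC_single 0%Z (fun N => if (N =? 0)%Z then RtoC 1 else RtoC 0)).
      intros N HN. now destruct (Z.eqb_spec N 0). }
  apply C1_nz. eapply has_limC_unique; [apply Hlim|apply has_limC_const].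
Qed.

Lemma qpoch_bounded a : exists B, (0 <= B)%R /\ forall k, (Cmod (qpz a k) <= B)%R.
Proof.
  destruct (has_limC_bounded _ _ (qpoch_lim a)) as [M HM].
  exists (Rabs M). split; [apply Rabs_pos|]. intros k.
  destruct (Z_lt_le_dec k 0).
  - replace (qpz a k) with (RtoC 0); [rewrite Cmod_0; apply Rabs_pos|].
    symmetry; apply qpz_neg; auto.
  - replace k with (Z.of_nat (Z.to_nat k)) by lia. rewrite qpz_nat.
    eapply Rle_trans; [apply HM|apply Rle_abs].
Qed.

(* The denominator parameter is absorbed: (dy)_oo 1phi1(a; dy; q, cy) is symmetric in c and d
   when ac = q/x. *)
Lemma phi11_sN a c d (y : C) : c <> 0 -> d <> 0 -> y <> 0 -> notqz (d * y) ->
  summableC (fun N => ph y N * sN c d (a * c) N) /\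
  qpoch_inf (d * y) q * phi11 a (d * y) q (c * y) =
  csum (fun N => ph y N * sN c d (a * c) N).
Proof.
  intros Hc Hd Hy Hn.
  assert (HE : forall N, sN c d (a * c) N = tn a d c N).
  { intros N. rewrite sN_tn by auto. now apply sN_sym. }
  set (T := fun p : Z * Z => ph y (fst p + snd p) * (tnA a c (fst p) * enA d (snd p))).
  destruct iq_bounded as [B [HB HBm]]. destruct (qpoch_bounded a) as [A [HA HAm]].
  assert (Py := Cmod_neq0 _ Hy). assert (Pc := Cmod_neq0 _ Hc). assert (Pd := Cmod_neq0 _ Hd).
  assert (P1 : (0 < Cmod y * Cmod c)%R) by now apply Rmult_lt_0_compat.
  assert (P2 : (0 < Cmod y * Cmod d)%R) by now apply Rmult_lt_0_compat.
  assert (HT : summableC T).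
  { apply summableC_le with (fun p => A * B * B *
      (thR (Cmod y * Cmod c) (fst p) * thR (Cmod y * Cmod d) (snd p)))%R.
    - intros [k j]. unfold T; simpl fst; simpl snd.
      assert (H3 := thR_pos _ k P1). assert (H4 := thR_pos _ j P2).
      assert (Hpos : (0 <= A * B * B * (thR (Cmod y * Cmod c) k * thR (Cmod y * Cmod d) j))%R)
        by (apply Rmult_le_pos; [apply Rmult_le_pos; [apply Rmult_le_pos|]|apply Rmult_le_pos]; lra).
      destruct (Z_lt_le_dec k 0); [rewrite tnA_neg, Cmult_0_l, Cmult_0_r, Cmod_0 by auto; auto|].
      destruct (Z_lt_le_dec j 0); [rewrite enA_neg, !Cmult_0_r, Cmod_0 by auto; auto|].
      rewrite tnA_def, enA_def, ph_add, !Cmod_mult, !Cmod_ph, !Cmod_Cpowz, Cmod_qz,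
        <- !thR_scal by auto.
      assert (H5 := HAm k). assert (H6 := HBm k). assert (H7 := HBm j).
      assert (H8 : (powerRZ q (k * j) <= 1)%R) by (apply powerRZ_q_le1; nia).
      assert (H9 : (0 <= powerRZ q (k * j))%R) by (apply powerRZ_le; lra).
      assert (G1 := thR_pos (Cmod y) k Py). assert (G2 := thR_pos (Cmod y) j Py).
      assert (G3 := powerRZ_lt (Cmod c) k Pc). assert (G4 := powerRZ_lt (Cmod d) j Pd).
      set (X := (thR (Cmod y) k * thR (Cmod y) j * powerRZ (Cmod c) k * powerRZ (Cmod d) j)%R).
      assert (HX : (0 <= X)%R) by (unfold X; apply Rmult_le_pos; [apply Rmult_le_pos; [apply Rmult_le_pos|]|]; lra).
      replace (thR (Cmod y) k * thR (Cmod y) j * powerRZ q (k * j) *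
        (Cmod (qpz a k) * powerRZ (Cmod c) k * Cmod (iq k) * (powerRZ (Cmod d) j * Cmod (iq j))))%R
        with (X * (powerRZ q (k * j) * (Cmod (qpz a k) * (Cmod (iq k) * Cmod (iq j)))))%R
        by (unfold X; ring).
      replace (A * B * B * (thR (Cmod y) k * powerRZ (Cmod c) k * (thR (Cmod y) j * powerRZ (Cmod d) j)))%R
        with (X * (1 * (A * (B * B))))%R by (unfold X; ring).
      apply Rmult_le_compat_l; auto.
      repeat (apply Rmult_le_compat; auto using Cmod_ge_0;
        try (repeat apply Rmult_le_pos; auto using Cmod_ge_0)).
    - destruct (thR_summable _ P1) as [s Hs]. destruct (thR_summable _ P2) as [t Ht].
      eexists. apply has_sum_scal. apply has_sum_prod; eauto. }
  assert (HT2 : summableC (fun p : Z * Z => T (snd p, fst p - snd p)%Z)).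
  { apply (summableC_inj (fun p : Z * Z => (snd p, fst p - snd p)%Z)
      ltac:(intros [u v] [u' v']; simpl; intros E; inversion E; f_equal; lia)); auto. }
  assert (Hrow : forall N, csum (fun k => T (k, N - k)%Z) = ph y N * sN c d (a * c) N).
  { intros N. rewrite HE. rewrite tn_def, <- csum_scal by apply tn_summable.
    apply csum_ext; intros k. unfold T; simpl fst; simpl snd.
    now replace (k + (N - k))%Z with N by lia. }
  assert (Hcol : forall k, csum (fun j => T (k, j)) =
    ph y k * tnA a c k * qpoch_inf (d * y * qz k) q).
  { intros k. rewrite qpi_EE, EE_def.
    rewrite <- csum_scal by apply ee_summable. apply csum_ext; intros j.
    unfold T; simpl fst; simpl snd. rewrite ee_def, enA_def, ph_add, ph_qz by
      (auto; now apply Cmult_neq_0).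
    replace (d * y) with (y * d) by ring. rewrite ph_mul by auto. ring. }
  (* Summed along diagonals the double series T gives [sN]; summed over j first it gives the 1phi1,
     because Euler's series produces (d y q^k;q)_oo. *)
  assert (Hsum : csum T = csum (fun N => ph y N * sN c d (a * c) N)).
  { rewrite <- (csum_ext _ _ Hrow).
    symmetry.
    transitivity (csum (fun p : Z * Z => T (snd p, fst p - snd p)%Z));
      [exact (csum_fubini (fun p : Z * Z => T (snd p, fst p - snd p)%Z) HT2)|].
    apply (csum_bij (fun p : Z * Z => (snd p, fst p - snd p)%Z)
      (fun p : Z * Z => (fst p + snd p, fst p)%Z)); intros [u v]; simpl; f_equal; lia. }
  split.
  - eapply summableC_ext; [intros N; apply (Hrow N)|].
    eexists. eapply has_sumC_fubini; [apply csum_spec, HT2|].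
    intros N; simpl. apply csum_spec. apply (summableC_row _ N HT2).
  - rewrite <- Hsum.
    assert (Hb : qpoch_inf (d * y) q <> 0) by now apply qpi_neq0'.
    assert (HC : has_sumC (fun k => ph y k * tnA a c k * qpoch_inf (d * y * qz k) q) (csum T)).
    { apply has_sumC_fubini with T; [now apply csum_spec|].
      intros k. rewrite <- Hcol. apply csum_spec. now apply summableC_row. }
    apply has_sumC_nat in HC; [|intros k Hk; rewrite tnA_neg by auto; ring].
    apply (has_sumC_scal (/ qpoch_inf (d * y) q)) in HC.
    apply (Cmult_reg_l (/ qpoch_inf (d * y) q)); [|now apply Cinv_neq0].
    rewrite Cmult_assoc, Cinv_l, Cmult_1_l by auto.
    unfold phi11. apply has_sumC_series.
    eapply has_sumC_ext; [|apply HC]. intros k; cbv beta.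
    fold (tri (Z.of_nat k)).
    change (RtoC (powerRZ q (tri (Z.of_nat k)))) with (qz (tri (Z.of_nat k))).
    rewrite (qpi_qpoch (d * y) k), tnA_def, qpz_nat, iq_nat, ph_nat, qz_nat, Cpowz_nat.
    assert (Hb1 : qpoch (d * y) q k <> 0 /\ qpoch_inf (d * y * q ^ k) q <> 0).
    { rewrite (qpi_qpoch (d * y) k) in Hb. split; intros E; apply Hb; rewrite E; ring. }
    destruct Hb1 as [Hb1 Hb2]. assert (Hq := qpoch_q_neq0 k).
    replace ((- y) ^ k) with ((-1) ^ k * y ^ k) by (rewrite <- Cpow_mult; f_equal; ring).
    rewrite Cpow_mult. field. auto.
Qed.

Lemma Q_swap (z1 z2 : R) c d n (x : R) : Q q z1 z2 c d n x = Q q z2 z1 c d n x.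
Proof.
  unfold Q. replace (d * z1 * z2) with (d * z2 * z1) by ring.
  replace (c * z1 * z2) with (c * z2 * z1) by ring. do 3 f_equal. ring.
Qed.

(** Quasi-periodicity moves theta(d z1) and theta(d z2) to theta(dx) and theta(dy). Of their four
    factors, two cancel the denominator of Q_n, (dy;q)_oo regularizes the 1phi1, and (dx;q)_oo joins
    (cx;q)_oo to form the reciprocal weight. *)
Lemma Q_kap (z1 z2 : R) c d k n : RtoC z1 <> 0 -> RtoC z2 <> 0 -> c <> 0 -> d <> 0 ->
  notqz (d * z1) -> notqz (d * z2) ->
  Q q z1 z2 c d n (z1 * powerRZ q k) =
  Cpowz (-1) n * qz (- tri (n + 1)) *
    (qpoch_inf (c * (z1 * powerRZ q k)%R) q * qpoch_inf (d * (z1 * powerRZ q k)%R) q) *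
    kap z1 z2 c d k n.
Proof.
  intros H1 H2 Hc Hd Hn1 Hn2.
  destruct (kap_formA z1 z2 c d k n H1 H2 Hc Hd) as [_ ->].
  (* y = z1 z2 q^(-n) / x, so that d y and c y are the denominator parameter and the argument of the
     1phi1. *)
  set (y := z2 * qz (- n - k)).
  assert (Hqk : RtoC (z1 * powerRZ q k) = z1 * qz k) by apply RtoC_mult.
  assert (Hy : y <> 0) by (apply Cmult_neq_0; auto; apply qz_neq0).
  assert (Hzk := qz_neq0 k). assert (Hzn := qz_neq0 n). assert (Hq := q_neq0C).
  assert (Hdy : notqz (d * y)).
  { unfold y. rewrite Cmult_assoc. now apply notqz_qz. }
  assert (Hdx : notqz (d * (z1 * qz k))) by (rewrite Cmult_assoc; now apply notqz_qz).
  unfold Q. rewrite Hqk. cbv zeta.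
  change (RtoC (powerRZ q (- n))) with (qz (- n)).
  change (RtoC (powerRZ q (n + 1))) with (qz (n + 1)).
  replace (n * (n + 1) / 2)%Z with (tri (n + 1)).
  2:{ unfold tri. f_equal. ring. }
  change (RtoC (powerRZ q (- tri (n + 1)))) with (qz (- tri (n + 1))).
  assert (Ey : qz (- n - k) = / qz n * / qz k).
  { unfold Z.sub. now rewrite qz_add, !qz_opp. }
  replace (d * z1 * z2 * qz (- n) / (z1 * qz k)) with (d * y).
  2:{ unfold y. rewrite Ey, qz_opp. field. auto. }
  replace (c * z1 * z2 * qz (- n) / (z1 * qz k)) with (c * y).
  2:{ unfold y. rewrite Ey, qz_opp. field. auto. }
  replace (qz (n + 1) * (z1 * qz k) / (d * z1 * z2)) with (q / (d * y)).
  2:{ unfold y. rewrite Ey, qz_add, qz_1. field. auto 6. }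
  destruct (phi11_sN (q / (c * (z1 * qz k))) c d y Hc Hd Hy Hdy) as [HsN HE].
  assert (Hqdy : qpoch_inf (d * y) q <> 0) by now apply qpi_neq0'.
  replace (phi11 (q / (c * (z1 * qz k))) (d * y) q (c * y)) with
    (/ qpoch_inf (d * y) q * csum (fun N => ph y N * sN c d (q / (z1 * qz k)) N)).
  2:{ replace (q / (z1 * qz k)) with (q / (c * (z1 * qz k)) * c) by (field; auto).
      rewrite <- HE. field. auto. }
  replace (q / (c * (z1 * qz k)) * c) with (q / (z1 * qz k)) in HsN by (field; auto).
  assert (Hd1 : d * z1 <> 0) by now apply Cmult_neq_0.
  assert (Hd2 : d * z2 <> 0) by now apply Cmult_neq_0.
  rewrite <- (theta_qz (d * z1) k), <- (theta_qz (d * z2) (- n - k)) by auto.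
  replace (d * z1 * qz k) with (d * (z1 * qz k)) by ring.
  replace (d * z2 * qz (- n - k)) with (d * y) by (unfold y; ring).
  unfold theta.
  assert (Hn3 : qpoch_inf (q / (d * (z1 * qz k))) q <> 0).
  { apply qpi_neq0'. intros m E. apply (Hdx (1 - m)%Z). rewrite qz_sub, <- E, qz_1.
    field. auto. }
  assert (Hn4 : qpoch_inf (q / (d * y)) q <> 0).
  { apply qpi_neq0'. intros m E. apply (Hdy (1 - m)%Z). rewrite qz_sub, <- E, qz_1.
    field. auto. }
  replace (d * z1) with (z1 * d) by ring. replace (d * z2) with (z2 * d) by ring.
  rewrite !ph_mul by auto.
  replace (csum (fun N => ph z2 (N - n - k) * sN c d (q / (z1 * qz k)) N)) with
    (ph z2 (- n - k) * csum (fun N => ph y N * sN c d (q / (z1 * qz k)) N)).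
  2:{ rewrite <- csum_scal by auto. apply csum_ext; intros N. unfold y.
      replace (N - n - k)%Z with (N + (- n - k))%Z by lia.
      rewrite ph_qz, ph_add by auto. rewrite (Z.mul_comm N). ring. }
  replace (Cpowz (- d) n) with (Cpowz (-1) n * Cpowz d n).
  2:{ rewrite <- Cpowz_mult; [f_equal; ring| |auto].
      intros E. apply C1_nz. replace (RtoC 1) with (- -1) by ring. rewrite E; ring. }
  replace (Cpowz d (- n - k)) with (/ Cpowz d n * / Cpowz d k).
  2:{ unfold Z.sub. now rewrite Cpowz_add, !Cpowz_opp. }
  assert (Hdn := Cpowz_neq0 d n Hd). assert (Hdk := Cpowz_neq0 d k Hd).
  field. auto 10.
Qed.

End KappaBounds.

Lemma has_sumC_conv (f g : Z -> C) : summableC f -> summableC g ->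
  has_sumC (fun i => csum (fun j => f (i - j)%Z * g j)) (csum f * csum g).
Proof.
  intros Hf Hg. rewrite csum_conv by auto. apply csum_spec.
  assert (H := conv_bij f g Hf Hg).
  eexists. eapply has_sumC_fubini; [apply csum_spec, H|].
  intros i; simpl. apply csum_spec, (summableC_row _ i H).
Qed.

(** * Orthogonality relations *)

Section Integral.
Implicit Types (a b c d u v w z x t : C) (i j k m : Z).
Local Hint Extern 0 (q <> 0%R) => exact q0 : core.

Definition wt z a b k : C := / (qpoch_inf (a * (z * qz k)) q * qpoch_inf (b * (z * qz k)) q).

Lemma wt_def z a b k :
  wt z a b k = / (qpoch_inf (a * (z * qz k)) q * qpoch_inf (b * (z * qz k)) q).
Proof. reflexivity. Qed.

(** Excludes zeros of (ax;q)_oo on z q^Z and of theta(az); stable under a -> a q^k. *)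
Definition admissible z a : Prop := z <> 0 /\ a <> 0 /\ notqz (a * z).

Lemma admissible_qz z a k : admissible z a -> admissible z (a * qz k).
Proof.
  intros [Hz [Ha Hn]]. split; [auto|split].
  - apply Cmult_neq_0; auto. apply qz_neq0.
  - replace (a * qz k * z) with (a * z * qz k) by ring. now apply notqz_qz.
Qed.

Lemma adm_neq0 z a k : admissible z a -> qpoch_inf (a * (z * qz k)) q <> 0.
Proof. intros [_ [_ H]]. rewrite Cmult_assoc. now apply qpi_neq0', notqz_qz. Qed.

Lemma adm_factor z a k : admissible z a -> 1 - a * (z * qz k) <> 0.
Proof.
  intros [_ [_ H]] E. apply (H (- k)%Z). rewrite qz_opp.
  replace (a * z) with ((1 - (1 - a * (z * qz k))) * / qz k) by (field; apply qz_neq0).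
  rewrite E. ring.
Qed.

Lemma qpi_qz_step z a k : qpoch_inf (a * (z * qz k)) q =
  (1 - a * (z * qz k)) * qpoch_inf (a * (z * qz (k + 1))) q.
Proof. rewrite qpi_step, qz_add, qz_1. do 2 f_equal. ring. Qed.

Lemma wt_S z a b k : admissible z a -> admissible z b ->
  wt z a b (k + 1) = (1 - a * (z * qz k)) * (1 - b * (z * qz k)) * wt z a b k.
Proof.
  intros Ha Hb. unfold wt. rewrite (qpi_qz_step z a k), (qpi_qz_step z b k).
  assert (H1 := adm_neq0 z a (k + 1) Ha). assert (H2 := adm_neq0 z b (k + 1) Hb).
  assert (H3 := adm_factor z a k Ha). assert (H4 := adm_factor z b k Hb).
  field. auto.
Qed.

Lemma wt_neq0 z a b k : admissible z a -> admissible z b -> wt z a b k <> 0.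
Proof. intros. apply Cinv_neq0, Cmult_neq_0; now apply adm_neq0. Qed.

Lemma has_limC_qz_nat u : has_limC (fun n => u * qz (Z.of_nat n)) 0.
Proof.
  eapply has_limC_ext; [|apply (has_limC_qn u)]. intros n; cbv beta. now rewrite qz_nat.
Qed.

Lemma wt_lim z a b : admissible z a -> admissible z b ->
  has_limC (fun n => wt z a b (Z.of_nat n)) 1.
Proof.
  intros Ha Hb.
  replace (RtoC 1) with (/ (qpoch_inf 0 q * qpoch_inf 0 q)).
  - apply has_limC_inv.
    + rewrite qpi_EE, EE_0, Cmult_1_r. apply C1_nz.
    + apply has_limC_mult; apply has_limC_qpi;
        (eapply has_limC_ext; [|apply has_limC_qz_nat]); intros n; cbv beta; apply eq_sym, Cmult_assoc.
  - rewrite qpi_EE, EE_0. field.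
Qed.

Lemma lim_one_minus u : is_lim_seq (fun n => Cmod (1 - u * qz (Z.of_nat n))) 1%R.
Proof.
  replace (Finite 1%R) with (Finite (Cmod (1 - 0))).
  - apply has_limC_Cmod, has_limC_minus; [apply has_limC_const|apply has_limC_qz_nat].
  - f_equal. replace (1 - 0) with (RtoC 1) by ring. apply Cmod_1.
Qed.

Lemma lim_inv_one_minus u : u <> 0 -> (forall k, 1 - u * qz k <> 0) ->
  has_limC (fun n => / (1 - u * qz (- Z.of_nat n - 2))) 0.
Proof.
  intros Hu Hk.
  assert (Hu' : 0 - u <> 0) by (replace (0 - u) with (- u) by ring; now apply Copp_neq0).
  replace (RtoC 0) with (0 / (0 - u)) by (field; auto).
  assert (Hl : has_limC (fun n => qz (Z.of_nat n + 2)) 0).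
  { apply (has_limC_Z qz). eapply has_limC_ext; [|apply (has_limC_qz_nat 1)].
    intros n; cbv beta; ring. }
  apply has_limC_ext with (fun n => qz (Z.of_nat n + 2) / (qz (Z.of_nat n + 2) - u)).
  - intros n. replace (- Z.of_nat n - 2)%Z with (- (Z.of_nat n + 2))%Z by lia.
    assert (H := Hk (- (Z.of_nat n + 2))%Z). rewrite qz_opp in H |- *.
    assert (Hz := qz_neq0 (Z.of_nat n + 2)).
    set (y := qz (Z.of_nat n + 2)) in *.
    assert (y - u <> 0).
    { intros E. apply H. replace u with (y - (y - u)) by ring. rewrite E. field. auto. }
    field. auto.
  - apply has_limC_div; auto. apply has_limC_minus; auto. apply has_limC_const.
Qed.

(** Ratio test at both ends: outwards to k = oo the ratio tends to q, and to k = -oo it tends to 0,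
    since the quadratic (1 - ax)(1 - bx) is in the denominator. *)
Lemma IS_summable z a b : admissible z a -> admissible z b ->
  summableC (fun k => z * qz k * wt z a b k).
Proof.
  intros Ha Hb.
  assert (Hz : z <> 0) by apply Ha.
  set (f := fun k => z * qz k * wt z a b k).
  assert (Hf0 : forall k, f k <> 0).
  { intros k. unfold f. repeat apply Cmult_neq_0; auto; [apply qz_neq0|now apply wt_neq0]. }
  assert (Hratio : forall k, f (k + 1)%Z = q * (1 - a * z * qz k) * (1 - b * z * qz k) * f k).
  { intros k. unfold f. rewrite wt_S, qz_add, qz_1 by auto. ring. }
  apply summableC_le with (fun k => Cmod (f k)); [intros; apply Rle_refl|].
  apply summable_Z.
  - apply summable_ratio with q; [intros; now apply Cmod_gt_0|lra|].
    apply is_lim_seq_ext with (fun n => q * Cmod (1 - a * z * qz (Z.of_nat n))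
      * Cmod (1 - b * z * qz (Z.of_nat n)))%R.
    + intros n. rewrite Nat2Z.inj_succ. unfold Z.succ. rewrite Hratio, !Cmod_mult, Cmod_R.
      rewrite (Rabs_pos_eq q) by lra. field.
      apply Rgt_not_eq, Cmod_gt_0; auto.
    + replace (Finite q) with (Finite (q * 1 * 1)%R) by (f_equal; ring).
      apply is_lim_seq_mult'; [apply is_lim_seq_mult'; [apply is_lim_seq_const|]|];
        apply lim_one_minus.
  - apply summable_ratio with 0%R; [intros; now apply Cmod_gt_0|lra|].
    assert (Hl : has_limC (fun n => / q * (/ (1 - a * z * qz (- Z.of_nat n - 2)) *
      / (1 - b * z * qz (- Z.of_nat n - 2)))) (/ q * (0 * 0))).
    { apply has_limC_mult; [apply has_limC_const|].
      apply has_limC_mult; apply lim_inv_one_minus;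
        try (apply Cmult_neq_0; [apply Ha || apply Hb|auto]);
        intros k; rewrite <- Cmult_assoc; now apply adm_factor. }
    apply has_limC_Cmod in Hl.
    replace (Cmod (/ q * (0 * 0))) with 0%R in Hl.
    2:{ replace (/ q * (0 * 0)) with (RtoC 0) by ring. now rewrite Cmod_0. }
    eapply is_lim_seq_ext; [|apply Hl]. intros n; cbv beta.
    set (k := (- Z.of_nat n - 2)%Z).
    replace (- Z.of_nat (S n) - 1)%Z with k by lia.
    replace (- Z.of_nat n - 1)%Z with (k + 1)%Z by lia.
    rewrite Hratio.
    assert (H1 := adm_factor z a k Ha). assert (H2 := adm_factor z b k Hb).
    rewrite !Cmult_assoc in H1, H2.
    assert (Hq := q_neq0C).
    replace (/ q * (/ (1 - a * z * qz k) * / (1 - b * z * qz k))) with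
      (f k / (q * (1 - a * z * qz k) * (1 - b * z * qz k) * f k)) by (field; auto 6).
    rewrite Cmod_div; auto. apply Cmult_neq_0; [|apply Hf0]. repeat apply Cmult_neq_0; auto.
Qed.

Definition IS z a b : C := csum (fun k => z * qz k * wt z a b k).

Lemma wt_lim_neg z a b : admissible z a -> admissible z b ->
  has_limC (fun n => wt z a b (- Z.of_nat n)) 0.
Proof.
  intros Ha Hb. assert (Hz : z <> 0) by apply Ha.
  destruct (summableC_Cmod _ (IS_summable z a b Ha Hb)) as [s Hs].
  assert (Hle : forall k, (Cmod (z * qz k * wt z a b k) <= s)%R).
  { intros k. assert (H := lsum_le_has_sum _ _ (k :: nil) (fun k => Cmod_ge_0 _) Hs).
    cbn [lsum fold_right] in H. rewrite Rplus_0_r in H. apply H. repeat constructor; auto. }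
  apply has_limC_le with (fun n => s / Cmod z * q ^ n)%R.
  - intros n. replace (wt z a b (- Z.of_nat n) - 0) with (wt z a b (- Z.of_nat n)) by ring.
    specialize (Hle (- Z.of_nat n)%Z). rewrite !Cmod_mult, Cmod_qz, powerRZ_neg', <- pow_powerRZ in Hle.
    assert (0 < q ^ n)%R by (apply pow_lt; lra).
    assert (0 < Cmod z)%R by now apply Cmod_gt_0.
    apply Rmult_le_reg_l with (Cmod z * / q ^ n)%R.
    + apply Rmult_lt_0_compat; auto. now apply Rinv_0_lt_compat.
    + eapply Rle_trans; [apply Hle|]. apply Req_le. field. lra.
  - replace (Finite 0%R) with (Finite (s / Cmod z * 0)%R) by (f_equal; ring).
    apply is_lim_seq_mult'; [apply is_lim_seq_const|apply is_lim_pow_q].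
Qed.

(** The weight with parameters (aq, b) is (1 - ax) w, and b x (1 - ax) + a x = 1 - (1 - ax)(1 - bx),
    so the terms add up to w(x) - w(qx). What remains is the value 1 of w at x = 0; being
    independent of z it drops out of [Iab]. *)
Lemma IS_rec z a b : admissible z a -> admissible z b ->
  b * IS z (a * q) b + a * IS z a b = -1.
Proof.
  intros Ha Hb.
  assert (Haq : admissible z (a * q)) by (rewrite <- qz_1; now apply admissible_qz).
  assert (Hs1 := IS_summable z (a * q) b Haq Hb). assert (Hs2 := IS_summable z a b Ha Hb).
  assert (H : has_sumC (fun k => b * (z * qz k * wt z (a * q) b k) + a * (z * qz k * wt z a b k))
    (b * IS z (a * q) b + a * IS z a b)).
  { apply has_sumC_plus; apply has_sumC_scal; now apply csum_spec. }
  apply (has_sumC_scal (-1)) in H.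
  assert (E : -1 * (b * IS z (a * q) b + a * IS z a b) = 1 - 0).
  { apply (has_sumC_telescope (wt z a b)); [|now apply wt_lim|now apply wt_lim_neg].
    eapply has_sumC_ext; [|apply H]. intros k; cbv beta.
    rewrite (wt_S z a b k) by auto.
    replace (wt z (a * q) b k) with ((1 - a * (z * qz k)) * wt z a b k); [ring|].
    unfold wt. rewrite (qpi_qz_step z a k), qz_add, qz_1.
    replace (a * q * (z * qz k)) with (a * (z * (qz k * q))) by ring.
    assert (H1 := adm_neq0 z a (k + 1) Ha). assert (H2 := adm_neq0 z b k Hb).
    assert (H3 := adm_factor z a k Ha). rewrite qz_add, qz_1 in H1.
    field. auto. }
  replace (b * IS z (a * q) b + a * IS z a b) with
    (-1 * (-1 * (b * IS z (a * q) b + a * IS z a b))) by ring.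
  rewrite E. ring.
Qed.

(* The total mass of the weight 1/(ax,bx;q)_oo on z1 q^Z and z2 q^Z, divided by 1 - q. *)
Definition Iab z1 z2 a b : C := IS z1 a b - IS z2 a b.

Lemma Iab_def z1 z2 a b : Iab z1 z2 a b = IS z1 a b - IS z2 a b.
Proof. reflexivity. Qed.

Lemma Iab_rec z1 z2 a b : admissible z1 a -> admissible z2 a -> admissible z1 b -> admissible z2 b ->
  Iab z1 z2 (a * q) b = - (a / b) * Iab z1 z2 a b.
Proof.
  intros H1 H2 H3 H4. assert (Hb : b <> 0) by apply H3.
  apply (Cmult_reg_l b); auto. unfold Iab.
  assert (Euler1 := IS_rec z1 a b H1 H3). assert (E2 := IS_rec z2 a b H2 H4).
  replace (b * (IS z1 (a * q) b - IS z2 (a * q) b)) with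
    ((b * IS z1 (a * q) b + a * IS z1 a b) - (b * IS z2 (a * q) b + a * IS z2 a b)
     - a * (IS z1 a b - IS z2 a b)) by ring.
  rewrite Euler1, E2. field. auto.
Qed.

(** As a function of k the mass is the general term of a theta series; a generating function in k
    therefore determines it. *)
Lemma Iab_qz z1 z2 a b k : admissible z1 a -> admissible z2 a -> admissible z1 b -> admissible z2 b ->
  Iab z1 z2 (a * qz k) b = ph (a / b) k * Iab z1 z2 a b.
Proof.
  intros H1 H2 H3 H4. assert (Ha : a <> 0) by apply H1. assert (Hb : b <> 0) by apply H3.
  assert (Hab : a / b <> 0) by now apply Cdiv_neq0.
  revert k. apply Z_two_sided_ind.
  - rewrite qz_0, ph_0, Cmult_1_r. ring.
  - intros k. rewrite qz_add, qz_1, ph_S by auto.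
    replace (a * (qz k * q)) with (a * qz k * q) by ring.
    rewrite Iab_rec by auto using admissible_qz.
    split; intros E.
    + rewrite E. field. auto.
    + apply (Cmult_reg_l (- (a * qz k / b))).
      * rewrite E. field. auto.
      * apply Copp_neq0, Cdiv_neq0; auto. apply Cmult_neq_0; auto. apply qz_neq0.
Qed.

Lemma Iab_sym z1 z2 a b : Iab z1 z2 a b = Iab z1 z2 b a.
Proof.
  assert (H : forall z, IS z a b = IS z b a).
  { intros z. apply csum_ext; intros k. unfold wt. do 2 f_equal. ring. }
  unfold Iab. now rewrite !H.
Qed.

Lemma enA_summable t : t <> 0 -> (Cmod t < 1)%R -> summableC (enA t) /\
  csum (enA t) = / qpoch_inf t q.
Proof.
  intros Ht H.
  assert (HF := FF_qpi t H).
  assert (Hn : qpoch_inf t q <> 0) by (intros E; rewrite E, Cmult_0_r in HF; now apply C1_nz).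
  assert (Hs : has_sumC (enA t) (/ qpoch_inf t q)).
  { apply has_sumC_nat; [intros; now apply enA_neg|].
    replace (/ qpoch_inf t q) with (FF t).
    - eapply has_sumC_ext; [|apply csum_spec, ff_summable, H].
      intros n. rewrite enA_def, Cpowz_nat. reflexivity.
    - apply (Cmult_reg_l (qpoch_inf t q)); auto. rewrite Cmult_comm, HF. field. auto. }
  split; [eexists; apply Hs|now apply csum_unique].
Qed.

(* Ramanujan's 1psi1 sum with vanishing denominator parameter. *)
Lemma psi_sum (A t : C) : A <> 0 -> notqz A -> t <> 0 -> (Cmod t < 1)%R ->
  has_sumC (fun k => Cpowz t k / qpoch_inf (A * qz k) q)
    (qpoch_inf q q * theta (A * t) q / (theta A q * qpoch_inf t q)).
Proof.
  intros HA Hn Ht H1.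
  destruct (enA_summable t Ht H1) as [Hs He].
  assert (HAt : A * t <> 0) by now apply Cmult_neq_0.
  assert (HC := has_sumC_conv (ph (A * t)) (enA t) (ph_summable _ HAt) Hs).
  rewrite He, theta_sum in HC by auto.
  assert (HthA := theta_neq0 A HA Hn).
  assert (Hqt : qpoch_inf t q <> 0).
  { intros E. assert (HF := FF_qpi t H1). rewrite E, Cmult_0_r in HF. now apply C1_nz. }
  apply (has_sumC_scal (/ theta A q)) in HC.
  replace (qpoch_inf q q * theta (A * t) q / (theta A q * qpoch_inf t q)) with
    (/ theta A q * (qpoch_inf q q * theta (A * t) q * / qpoch_inf t q)) by (field; auto).
  eapply has_sumC_ext; [|apply HC]. intros k; cbv beta.
  assert (Hk : notqz (A * qz k)) by now apply notqz_qz.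
  assert (HAk : A * qz k <> 0) by (apply Cmult_neq_0; auto; apply qz_neq0).
  assert (Hth := theta_qz A k HA). assert (Hq := q_neq0C). assert (Hzk := qz_neq0 k).
  assert (Hq1 := qpi_neq0' _ Hk).
  assert (Hq2 : qpoch_inf (q / (A * qz k)) q <> 0).
  { intros E. apply (theta_neq0 _ HAk Hk). unfold theta. rewrite E. ring. }
  (* The powers of t combine to t^k, and the remaining sum over j is Euler's series of (q/(A
     q^k);q)_oo. *)
  assert (Hsum : csum (fun j => ph (A * t) (k - j) * enA t j) =
    Cpowz t k * ph A k * qpoch_inf (q / (A * qz k)) q).
  { rewrite qpi_EE, EE_def, <- csum_scal by apply ee_summable.
    apply csum_ext; intros j. rewrite enA_def, ee_def, ph_mul by auto.
    unfold Z.sub. rewrite ph_add, ph_opp, Cpowz_add, Cpowz_opp by auto.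
    replace (q / (A * qz k)) with (q / A * qz (- k)) by (rewrite qz_opp; field; auto).
    rewrite ph_qz by now apply Cdiv_neq0.
    replace (k * - j)%Z with (- k * j)%Z by ring. field. now apply Cpowz_neq0. }
  rewrite Hsum, <- Hth. unfold theta.
  assert (Hph := ph_neq0 A k HA). field. auto.
Qed.

(** The product of two 1psi1 sums with arguments t and q/t, whose common domain is this annulus. In
    the term with indices j + l and l, the powers combine to t^j q^l, and q^l is the Jackson factor
    of the integral over z q^Z. *)
Lemma IS_gen z a b t : admissible z a -> admissible z b -> (q < Cmod t < 1)%R ->
  has_sumC (fun j => Cpowz t j * IS z (a * qz j) b)
    (z * (qpoch_inf q q * theta (a * z * t) q / (theta (a * z) q * qpoch_inf t q)) *
     (qpoch_inf q q * theta (b * z * (q / t)) q / (theta (b * z) q * qpoch_inf (q / t) q))).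
Proof.
  intros Ha Hb Ht.
  assert (Hz : z <> 0) by apply Ha. assert (Hq := q_neq0C).
  assert (Ht0 : t <> 0) by (intros E; rewrite E, Cmod_0 in Ht; lra).
  assert (Hqt : q / t <> 0) by now apply Cdiv_neq0.
  assert (Hqt1 : (Cmod (q / t) < 1)%R).
  { rewrite Cmod_div, Cmod_R, Rabs_pos_eq by (auto; lra).
    apply Rmult_lt_reg_r with (Cmod t); [lra|]. field_simplify; lra. }
  assert (HA : a * z <> 0) by (apply Cmult_neq_0; [apply Ha|auto]).
  assert (HB : b * z <> 0) by (apply Cmult_neq_0; [apply Hb|auto]).
  assert (P1 := psi_sum (a * z) t HA (proj2 (proj2 Ha)) Ht0 (proj2 Ht)).
  assert (P2 := psi_sum (b * z) (q / t) HB (proj2 (proj2 Hb)) Hqt Hqt1).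
  assert (HP := has_sumC_prod _ _ _ _ P1 P2).
  apply (has_sumC_scal z) in HP. rewrite Cmult_assoc in HP.
  apply (has_sumC_bij (fun p : Z * Z => (fst p + snd p, snd p)%Z)
    (fun p : Z * Z => (fst p - snd p, snd p)%Z)) in HP;
    [|intros [x y]; simpl; f_equal; lia..].
  eapply has_sumC_fubini; [apply HP|]. intros j; simpl fst; simpl snd.
  assert (Hs := csum_spec _ (IS_summable z (a * qz j) b (admissible_qz z a j Ha) Hb)).
  fold (IS z (a * qz j) b) in Hs.
  apply (has_sumC_scal (Cpowz t j)) in Hs. eapply has_sumC_ext; [|apply Hs].
  intros l; cbn [fst snd]. unfold wt.
  assert (H1 := adm_neq0 z (a * qz j) l (admissible_qz z a j Ha)).
  assert (H2 := adm_neq0 z b l Hb).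
  replace (a * z * qz (j + l)) with (a * qz j * (z * qz l)) by (rewrite qz_add; ring).
  replace (b * z * qz l) with (b * (z * qz l)) by ring.
  replace (Cpowz (q / t) l) with (qz l * / Cpowz t l).
  - rewrite Cpowz_add by auto. field. repeat split; auto. now apply Cpowz_neq0.
  - unfold Cdiv. rewrite Cpowz_mult, Cpowz_inv by auto using Cinv_neq0.
    rewrite <- qz_1, Cpowz_qz, Z.mul_1_l. ring.
Qed.

(** The generating function of [Iab] in the shifts of a, evaluated twice: by [Iab_qz] it is the mass
    times a theta function, by [IS_gen] a difference of two products over the common denominator
    (t;q)_oo (q/t;q)_oo = theta(t). *)
Lemma Iab_gen z1 z2 a b t : admissible z1 a -> admissible z1 b ->
  admissible z2 a -> admissible z2 b -> (q < Cmod t < 1)%R ->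
  Iab z1 z2 a b * theta (a / b * t) q * theta t q =
  qpoch_inf q q *
    (z1 * theta (a * z1 * t) q * theta (t / (b * z1)) q / (theta (a * z1) q * theta (b * z1) q)
     - z2 * theta (a * z2 * t) q * theta (t / (b * z2)) q / (theta (a * z2) q * theta (b * z2) q)).
Proof.
  intros H1 H2 H3 H4 Ht.
  assert (Ha : a <> 0) by apply H1. assert (Hb : b <> 0) by apply H2.
  assert (Hz1 : z1 <> 0) by apply H1. assert (Hz2 : z2 <> 0) by apply H3.
  assert (Hq := q_neq0C).
  assert (Ht0 : t <> 0) by (intros E; rewrite E, Cmod_0 in Ht; lra).
  assert (Hab : a / b <> 0) by now apply Cdiv_neq0.
  assert (Habt : a / b * t <> 0) by now apply Cmult_neq_0.
  assert (G := has_sumC_minus _ _ _ _ (IS_gen z1 a b t H1 H2 Ht) (IS_gen z2 a b t H3 H4 Ht)).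
  assert (G' : has_sumC (fun j => Cpowz t j * IS z1 (a * qz j) b - Cpowz t j * IS z2 (a * qz j) b)
    (Iab z1 z2 a b * (qpoch_inf q q * theta (a / b * t) q))).
  { rewrite <- theta_sum by auto.
    assert (S := has_sumC_scal (Iab z1 z2 a b) _ _ (csum_spec _ (ph_summable _ Habt))).
    eapply has_sumC_ext; [|apply S]. intros j; cbv beta.
    rewrite ph_mul by auto.
    assert (E := Iab_qz z1 z2 a b j H1 H3 H2 H4). unfold Iab at 1 in E.
    replace (Cpowz t j * IS z1 (a * qz j) b - Cpowz t j * IS z2 (a * qz j) b) with
      (Cpowz t j * (IS z1 (a * qz j) b - IS z2 (a * qz j) b)) by ring.
    rewrite E. ring. }
  assert (E := has_sumC_unique _ _ _ G' G).
  assert (Hqi := qpi_q_neq0).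
  assert (Hn1 := theta_neq0 (a * z1) ltac:(now apply Cmult_neq_0) (proj2 (proj2 H1))).
  assert (Hn2 := theta_neq0 (b * z1) ltac:(now apply Cmult_neq_0) (proj2 (proj2 H2))).
  assert (Hn3 := theta_neq0 (a * z2) ltac:(now apply Cmult_neq_0) (proj2 (proj2 H3))).
  assert (Hn4 := theta_neq0 (b * z2) ltac:(now apply Cmult_neq_0) (proj2 (proj2 H4))).
  assert (F1 : theta (b * z1 * (q / t)) q = theta (t / (b * z1)) q).
  { rewrite <- (theta_refl (t / (b * z1))) by (apply Cdiv_neq0; auto; now apply Cmult_neq_0).
    f_equal. field. auto. }
  assert (F2 : theta (b * z2 * (q / t)) q = theta (t / (b * z2)) q).
  { rewrite <- (theta_refl (t / (b * z2))) by (apply Cdiv_neq0; auto; now apply Cmult_neq_0).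
    f_equal. field. auto. }
  rewrite F1, F2 in E.
  assert (Htn : qpoch_inf t q <> 0).
  { intros E0. assert (HF := FF_qpi t (proj2 Ht)). rewrite E0, Cmult_0_r in HF. now apply C1_nz. }
  assert (Hqt1 : (Cmod (q / t) < 1)%R).
  { rewrite Cmod_div, Cmod_R, Rabs_pos_eq by (auto; lra).
    apply Rmult_lt_reg_r with (Cmod t); [lra|]. field_simplify; lra. }
  assert (Hqtn : qpoch_inf (q / t) q <> 0).
  { intros E0. assert (HF := FF_qpi (q / t) Hqt1). rewrite E0, Cmult_0_r in HF. now apply C1_nz. }
  apply (Cmult_reg_l (qpoch_inf q q)); auto.
  replace (qpoch_inf q q * (Iab z1 z2 a b * theta (a / b * t) q * theta t q)) with
    (Iab z1 z2 a b * (qpoch_inf q q * theta (a / b * t) q) * theta t q) by ring.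
  rewrite E. change (theta t q) with (qpoch_inf t q * qpoch_inf (q / t) q). field. auto 10.
Qed.

Lemma has_limC_theta (v : nat -> C) (v0 : C) : v0 <> 0 -> has_limC v v0 ->
  has_limC (fun n => theta (v n) q) (theta v0 q).
Proof.
  intros H0 H. apply has_limC_mult; apply has_limC_qpi; auto.
  apply has_limC_div; auto. apply has_limC_const.
Qed.

Lemma exists_qz_annulus (r : R) : (0 < r)%R -> exists j, (q < r * powerRZ q j <= 1)%R.
Proof.
  intros Hr.
  assert (Hln : (ln q < 0)%R) by (rewrite <- ln_1; apply ln_increasing; lra).
  set (y := (- ln r / ln q)%R).
  destruct (archimed y) as [A1 A2]. 
  assert (Hy : (ln r = - (y * ln q))%R) by (unfold y; field; lra).
  (* The least integer not below y: [up] is strictly larger than its argument, hence the case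
     distinction when y is an integer. *)
  exists (up y - 1 + if Req_EM_T (IZR (up y - 1)) y then 0 else 1)%Z.
  set (j := (up y - 1 + if Req_EM_T (IZR (up y - 1)) y then 0 else 1)%Z).
  assert (Hj : (y <= IZR j < y + 1)%R).
  { unfold j. rewrite plus_IZR. destruct (Req_EM_T (IZR (up y - 1)) y) as [E|E];
      rewrite minus_IZR in *; lra. }
  assert (Hp : powerRZ q j = exp (IZR j * ln q)).
  { rewrite powerRZ_Rpower by lra. reflexivity. }
  rewrite Hp, <- (exp_ln r), <- exp_plus, Hy by auto.
  split.
  - rewrite <- (exp_ln q) at 1 by lra. apply exp_increasing. nra.
  - rewrite <- exp_0. destruct (Rle_lt_or_eq_dec y (IZR j)) as [Hl|He]; [lra| |].
    + apply Rlt_le, exp_increasing. nra.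
    + rewrite <- He. right. f_equal. ring.
Qed.

(** The point t needed in [Iab_val] is fixed up to a power of q and may fall on the circle |t| = 1,
    which is reached by continuity along the radius. *)
Lemma Iab_gen_closed z1 z2 a b t : admissible z1 a -> admissible z1 b ->
  admissible z2 a -> admissible z2 b -> (q < Cmod t <= 1)%R ->
  Iab z1 z2 a b * theta (a / b * t) q * theta t q =
  qpoch_inf q q *
    (z1 * theta (a * z1 * t) q * theta (t / (b * z1)) q / (theta (a * z1) q * theta (b * z1) q)
     - z2 * theta (a * z2 * t) q * theta (t / (b * z2)) q / (theta (a * z2) q * theta (b * z2) q)).
Proof.
  intros H1 H2 H3 H4 Ht.
  assert (Ha : a <> 0) by apply H1. assert (Hb : b <> 0) by apply H2.
  assert (Hz1 : z1 <> 0) by apply H1. assert (Hz2 : z2 <> 0) by apply H3.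
  assert (Ht0 : t <> 0) by (intros E; rewrite E, Cmod_0 in Ht; lra).
  destruct (Rle_lt_or_eq_dec _ _ (proj2 Ht)) as [Hlt|Heq]; [apply Iab_gen; auto; lra|].
  set (s := fun n : nat => (1 - (1 - q) / 2 * q ^ n)%R).
  assert (Hs : forall n, (q < s n < 1)%R).
  { intros n. unfold s. assert (0 < q ^ n)%R by (apply pow_lt; lra).
    assert (q ^ n <= 1)%R by (rewrite <- (pow1 n); apply pow_incr; lra). nra. }
  assert (Hl : has_limC (fun n => RtoC (s n) * t) t).
  { assert (Hl : has_limC (fun n => RtoC (s n) * t) (RtoC (1 - (1 - q) / 2 * 0) * t)).
    { apply has_limC_mult; [|apply has_limC_const]. apply has_limC_RtoC.
      apply is_lim_seq_minus'; [apply is_lim_seq_const|].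
      apply is_lim_seq_mult'; [apply is_lim_seq_const|apply is_lim_pow_q]. }
    replace (RtoC (1 - (1 - q) / 2 * 0) * t) with t in Hl; auto.
    rewrite Rmult_0_r, Rminus_0_r. ring. }
  assert (Hth : forall u, u <> 0 -> has_limC (fun n => theta (u * (RtoC (s n) * t)) q) (theta (u * t) q)).
  { intros u Hu. apply has_limC_theta; [now apply Cmult_neq_0|].
    apply has_limC_mult; auto. apply has_limC_const. }
  eapply has_limC_unique with (u := fun n => Iab z1 z2 a b * theta (a / b * (RtoC (s n) * t)) q
    * theta (1 * (RtoC (s n) * t)) q).
  - replace (theta t q) with (theta (1 * t) q) by (f_equal; ring).
    apply has_limC_mult; [apply has_limC_mult; [apply has_limC_const|]|]; apply Hth.
    + now apply Cdiv_neq0.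
    + apply C1_nz.
  - apply has_limC_ext with (fun n => qpoch_inf q q *
      (z1 * theta (a * z1 * (RtoC (s n) * t)) q * theta (/ (b * z1) * (RtoC (s n) * t)) q
         * / (theta (a * z1) q * theta (b * z1) q)
       - z2 * theta (a * z2 * (RtoC (s n) * t)) q * theta (/ (b * z2) * (RtoC (s n) * t)) q
         * / (theta (a * z2) q * theta (b * z2) q))).
    + intros n. replace (1 * (RtoC (s n) * t)) with (RtoC (s n) * t) by ring.
      rewrite (Iab_gen z1 z2 a b (RtoC (s n) * t)); auto.
      * unfold Cdiv. rewrite !(Cmult_comm (/ (b * _)) (RtoC (s n) * t)). reflexivity.
      * rewrite Cmod_mult, Heq, Rmult_1_r, Cmod_R, Rabs_pos_eq; specialize (Hs n); lra.
    + unfold Cdiv. rewrite !(Cmult_comm t).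
      apply has_limC_mult; [apply has_limC_const|].
      apply has_limC_minus; (apply has_limC_mult; [|apply has_limC_const]);
        (apply has_limC_mult; [apply has_limC_mult; [apply has_limC_const|]|]); apply Hth;
        try apply Cinv_neq0; now apply Cmult_neq_0.
Qed.

Lemma ph_prod u v k : u <> 0 -> v <> 0 -> ph u k * ph v k = Cpowz (u * v) k * qz (2 * tri k).
Proof.
  intros Hu Hv.
  replace (u * v) with (- u * - v) by ring.
  rewrite !ph_def, Cpowz_mult by now apply Copp_neq0.
  replace (2 * tri k)%Z with (tri k + tri k)%Z by lia. rewrite qz_add. ring.
Qed.

(** At t = q^j / (a z2) the factor theta(a z2 t) kills the second product, and the theta functions
    on the left are nonzero by admissibility, so the mass can be solved for. The quasi-periodicity
    factors cancel because (a z2)(b z2) = (z2/z1)(a b z2 z1). *)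
Lemma Iab_val z1 z2 a b : admissible z1 a -> admissible z1 b ->
  admissible z2 a -> admissible z2 b ->
  Iab z1 z2 a b = z1 * qpoch_inf q q * (theta (z2 / z1) q * theta (a * b * z2 * z1) q) /
    (theta (a * z2) q * theta (b * z2) q * theta (a * z1) q * theta (b * z1) q).
Proof.
  intros H1 H2 H3 H4.
  assert (Ha : a <> 0) by apply H1. assert (Hb : b <> 0) by apply H2.
  assert (Hz1 : z1 <> 0) by apply H1. assert (Hz2 : z2 <> 0) by apply H3.
  assert (A1 : a * z1 <> 0) by now apply Cmult_neq_0.
  assert (A2 : a * z2 <> 0) by now apply Cmult_neq_0.
  assert (B1 : b * z1 <> 0) by now apply Cmult_neq_0.
  assert (B2 : b * z2 <> 0) by now apply Cmult_neq_0.
  assert (AB : a * b * z2 * z1 <> 0) by (repeat apply Cmult_neq_0; auto).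
  assert (ZZ : z2 / z1 <> 0) by now apply Cdiv_neq0.
  destruct (exists_qz_annulus (/ Cmod (a * z2))) as [j Hj].
  { apply Rinv_0_lt_compat. now apply Cmod_gt_0. }
  set (t := / (a * z2) * qz j).
  assert (Ht : (q < Cmod t <= 1)%R).
  { unfold t. rewrite Cmod_mult, Cmod_inv, Cmod_qz; auto. }
  assert (G := Iab_gen_closed z1 z2 a b t H1 H2 H3 H4 Ht).
  replace (a * z2 * t) with (qz j) in G by (unfold t; field; auto).
  rewrite theta_qz_eq0 in G.
  replace (a / b * t) with (/ (b * z2) * qz j) in G by (unfold t; field; auto).
  replace (a * z1 * t) with (/ (z2 / z1) * qz j) in G by (unfold t; field; auto).
  replace (t / (b * z1)) with (/ (a * b * z2 * z1) * qz j) in G by (unfold t; field; auto).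
  unfold t in G.
  assert (Hth : forall u, u <> 0 -> theta (/ u * qz j) q = - theta u q / u / ph (/ u) j).
  { intros u Hu. rewrite <- theta_inv by auto. assert (Hu' : / u <> 0) by now apply Cinv_neq0.
    rewrite <- (theta_qz (/ u) j Hu'). field. now apply ph_neq0. }
  rewrite !Hth in G by auto.
  assert (Hph : ph (/ (b * z2)) j * ph (/ (a * z2)) j = ph (/ (z2 / z1)) j * ph (/ (a * b * z2 * z1)) j).
  { rewrite !ph_prod by (now apply Cinv_neq0). do 2 f_equal. field. auto. }
  assert (P1 := ph_neq0 (/ (b * z2)) j (Cinv_neq0 _ B2)).
  assert (P2 := ph_neq0 (/ (a * z2)) j (Cinv_neq0 _ A2)).
  assert (P3 := ph_neq0 (/ (z2 / z1)) j (Cinv_neq0 _ ZZ)).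
  assert (P4 := ph_neq0 (/ (a * b * z2 * z1)) j (Cinv_neq0 _ AB)).
  assert (T1 := theta_neq0 _ A1 (proj2 (proj2 H1))). assert (T2 := theta_neq0 _ A2 (proj2 (proj2 H3))).
  assert (T3 := theta_neq0 _ B1 (proj2 (proj2 H2))). assert (T4 := theta_neq0 _ B2 (proj2 (proj2 H4))).
  set (p1 := ph (/ (b * z2)) j) in *. set (p2 := ph (/ (a * z2)) j) in *.
  set (p3 := ph (/ (z2 / z1)) j) in *. set (p4 := ph (/ (a * b * z2 * z1)) j) in *.
  apply (Cmult_reg_l (- theta (b * z2) q / (b * z2) / p1 * (- theta (a * z2) q / (a * z2) / p2))).
  - transitivity (Iab z1 z2 a b * (- theta (b * z2) q / (b * z2) / p1) * (- theta (a * z2) q / (a * z2) / p2));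
      [ring|].
    rewrite G.
    replace p2 with (p3 * p4 / p1) by (rewrite <- Hph; field; auto).
    field. auto 12.
  - assert (forall u v w, u <> 0 -> v <> 0 -> w <> 0 -> - u / v / w <> 0).
    { intros u v w Hu Hv Hw. apply Cdiv_neq0; auto. apply Cdiv_neq0; auto. now apply Copp_neq0. }
    apply Cmult_neq_0; auto.
Qed.

End Integral.

(** * Orthogonality and norms of the P_n *)

Lemma has_sumC_sum_n {I : Type} (f : nat -> I -> C) (s : nat -> C) n :
  (forall l, (l <= n)%nat -> has_sumC (f l) (s l)) ->
  has_sumC (fun x => sum_n (fun l => f l x) n) (sum_n s n).
Proof.
  induction n as [|n IH]; intros H.
  - rewrite sum_O. apply has_sumC_ext with (f 0%nat); [|apply H; lia].
    intros; now rewrite sum_O.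
  - rewrite sum_Sn. apply has_sumC_ext with (fun x => sum_n (fun l => f l x) n + f (S n) x).
    + intros x. now rewrite sum_Sn.
    + apply has_sumC_plus; [apply IH; intros; apply H; lia|apply H; lia].
Qed.

Lemma sum_n_zeroC (f : nat -> C) n : (forall l, (l <= n)%nat -> f l = 0) -> sum_n f n = RtoC 0.
Proof.
  induction n as [|n IH]; intros H; [rewrite sum_O; apply H; lia|].
  rewrite sum_Sn, IH, (H (S n)); [|lia|intros; apply H; lia]. unfold plus; simpl. ring.
Qed.

Lemma sum_n_lastC (f : nat -> C) n : (forall l, (l < n)%nat -> f l = 0) -> sum_n f n = f n.
Proof.
  destruct n as [|n]; intros H; [now rewrite sum_O|].
  rewrite sum_Sn, sum_n_zeroC; [|intros; apply H; lia]. unfold plus; simpl. ring.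
Qed.

Lemma sum_n_minusC (f g : nat -> C) n :
  sum_n (fun l => f l - g l) n = sum_n f n - sum_n g n.
Proof.
  induction n as [|n IH]; [now rewrite !sum_O|]. rewrite !sum_Sn, IH.
  unfold plus; simpl. ring.
Qed.

Section Orthogonality.
Implicit Types (a b c d u v w z x t : C) (i j k m : Z).
Local Hint Extern 0 (q <> 0%R) => exact q0 : core.

Lemma ee_iq_support u m k : ee u k * iq (m - k) <> 0 -> (0 <= k <= m)%Z.
Proof.
  intros H. destruct (Z_lt_le_dec k 0).
  - rewrite ee_neg in H by auto. contradiction H; ring.
  - destruct (Z_lt_le_dec m k); [|lia]. rewrite iq_neg in H by lia. contradiction H; ring.
Qed.

(** The finite q-binomial theorem, through the first-order recurrence in the upper index; the
    splitting of 1 - q^m is the one of [sN_rec]. *)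
Lemma q_binomial u n : csum (fun i => ee u i * iq (Z.of_nat n - i)) = qpoch u q n * iq (Z.of_nat n).
Proof.
  assert (Hsupp := ee_iq_support u).
  set (A := fun m => csum (fun i => ee u i * iq (m - i))).
  assert (Hsum : forall m, summableC (fun i => ee u i * iq (m - i))).
  { intros m. eapply summableC_finite, Hsupp. }
  assert (Hsum' : forall m (g : Z -> C), summableC (fun i => g i * (ee u i * iq (m - i)))).
  { intros m g. eapply summableC_finite. intros k H. apply (Hsupp m k).
    intros E; apply H; rewrite E; ring. }
  assert (Hrec : forall m, (1 - qz m) * A m = (1 - u * qz (m - 1)) * A (m - 1)%Z).
  { intros m.
    assert (Euler1 : csum (fun i => (1 - qz (m - i)) * (ee u i * iq (m - i))) = A (m - 1)%Z).
    { unfold A. apply csum_ext; intros i.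
      replace ((1 - qz (m - i)) * (ee u i * iq (m - i))) with
        (ee u i * ((1 - qz (m - i)) * iq (m - i))) by ring.
      rewrite iq_rec. do 2 f_equal. lia. }
    assert (E2 : csum (fun i => qz (m - i) * (1 - qz i) * (ee u i * iq (m - i))) =
      - u * qz (m - 1) * A (m - 1)%Z).
    { unfold A. rewrite <- csum_scal by apply Hsum.
      rewrite <- (csum_Zshift (-1) (fun i => - u * qz (m - 1) * _)).
      apply csum_ext; intros i. replace (i + -1)%Z with (i - 1)%Z by lia.
      transitivity (qz (m - i) * ((1 - qz i) * ee u i) * iq (m - i)); [ring|].
      rewrite ee_rec. replace (m - 1 - (i - 1))%Z with (m - i)%Z by lia.
      replace (m - 1)%Z with (m - i + (i - 1))%Z by lia. rewrite qz_add. ring. }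
    transitivity (csum (fun i => (1 - qz (m - i)) * (ee u i * iq (m - i))) +
      csum (fun i => qz (m - i) * (1 - qz i) * (ee u i * iq (m - i)))).
    - rewrite <- csum_plus by apply Hsum'. unfold A. rewrite <- csum_scal by apply Hsum.
      apply csum_ext; intros i.
      replace (qz m) with (qz (m - i) * qz i) by (rewrite <- qz_add; f_equal; lia). ring.
    - rewrite Euler1, E2. ring. }
  change (A (Z.of_nat n) = qpoch u q n * iq (Z.of_nat n)).
  induction n as [|n IH].
  - simpl Z.of_nat. rewrite iq_0. simpl. unfold A. apply csum_unique.
    replace (1 * 1) with (ee u 0 * iq (0 - 0)) by (rewrite ee_0, Z.sub_diag, iq_0; ring).
    apply (has_sumC_single 0%Z (fun i => ee u i * iq (0 - i))).
    intros i Hi. apply NNPP. intros H. apply Hsupp in H. lia.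
  - assert (Hq1 : 1 - qz (Z.of_nat (S n)) <> 0).
    { intros E. assert (E' : qz (Z.of_nat (S n)) = 1).
      { replace (qz (Z.of_nat (S n))) with (1 - (1 - qz (Z.of_nat (S n)))) by ring.
        rewrite E; ring. }
      apply qz_inj in E'. lia. }
    apply (Cmult_reg_l (1 - qz (Z.of_nat (S n)))); auto.
    rewrite Hrec. replace (Z.of_nat (S n) - 1)%Z with (Z.of_nat n) by lia.
    rewrite IH. replace ((1 - qz (Z.of_nat (S n))) * (qpoch u q (S n) * iq (Z.of_nat (S n))))
      with (qpoch u q (S n) * ((1 - qz (Z.of_nat (S n))) * iq (Z.of_nat (S n)))) by ring.
    rewrite iq_S, qz_nat. simpl. ring.
Qed.

Lemma pn_expand_c c d x n : c <> 0 -> d <> 0 ->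
  pn c d x (Z.of_nat n) =
  sum_n (fun l => tnA (c * x) d (Z.of_nat l) * enA c (Z.of_nat n - Z.of_nat l)) n.
Proof.
  intros Hc Hd. rewrite pn_def. replace (c * d * x) with (c * x * d) by ring.
  rewrite <- sN_tn, tn_def by auto.
  exact (csum_unique _ _ (has_sumC_finite _ n (tn_support _ _ _ _))).
Qed.

Lemma pn_sym c d x n : c <> 0 -> d <> 0 -> pn c d x n = pn d c x n.
Proof.
  intros. rewrite !pn_def, sN_sym by auto. f_equal. ring.
Qed.

Lemma pn_expand_d c d x n : c <> 0 -> d <> 0 ->
  pn c d x (Z.of_nat n) =
  sum_n (fun l => tnA (d * x) c (Z.of_nat l) * enA d (Z.of_nat n - Z.of_nat l)) n.
Proof. intros. rewrite pn_sym by auto. now apply pn_expand_c. Qed.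

(** The coefficient of (cx;q)_l in P_n; with c and d exchanged, that of (dx;q)_l. *)
Definition binom_coef c d n (l : nat) : C :=
  Cpowz d (Z.of_nat l) * iq (Z.of_nat l) * enA c (Z.of_nat n - Z.of_nat l).

Lemma qpi_qpoch_wt u z (l : nat) k : qpoch_inf (u * (z * qz k)) q =
  qpoch (u * (z * qz k)) q l * qpoch_inf (u * qz (Z.of_nat l) * (z * qz k)) q.
Proof. rewrite (qpi_qpoch _ l), qz_nat. do 2 f_equal. ring. Qed.

(** P_n is expanded in the (cx;q)_l and P_m in the (dx;q)_l', because these factors only shift the
    parameters of the weight to c q^l and d q^l'. The integral becomes a double sum of known
    masses. *)
Lemma PP_side z c d (n m : nat) : admissible z c -> admissible z d ->
  has_sumC (fun k => z * qz k * (pn c d (z * qz k) (Z.of_nat n) *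
      pn c d (z * qz k) (Z.of_nat m) * wt z c d k))
    (sum_n (fun l => sum_n (fun l' => binom_coef c d n l * binom_coef d c m l' *
       IS z (c * qz (Z.of_nat l)) (d * qz (Z.of_nat l'))) m) n).
Proof.
  intros Hc Hd. assert (c0 : c <> 0) by apply Hc. assert (d0 : d <> 0) by apply Hd.
  apply has_sumC_ext with (fun k => sum_n (fun l => sum_n (fun l' => binom_coef c d n l * binom_coef d c m l' *
    (z * qz k * wt z (c * qz (Z.of_nat l)) (d * qz (Z.of_nat l')) k)) m) n).
  - intros k. rewrite (pn_expand_c c d _ n), (pn_expand_d c d _ m) by auto.
    set (F := fun l : nat => tnA (c * (z * qz k)) d (Z.of_nat l) * enA c (Z.of_nat n - Z.of_nat l)).
    set (G := fun l : nat => tnA (d * (z * qz k)) c (Z.of_nat l) * enA d (Z.of_nat m - Z.of_nat l)).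
    transitivity ((z * qz k * wt z c d k * sum_n G m) * sum_n F n); [|ring].
    rewrite <- sum_n_scalC. apply sum_n_ext; intros l.
    match goal with |- ?a = ?b => change (@eq C a b) end.
    transitivity ((z * qz k * wt z c d k * F l) * sum_n G m); [|ring].
    rewrite <- sum_n_scalC. apply sum_n_ext; intros l'.
    match goal with |- ?a = ?b => change (@eq C a b) end.
    unfold F, G, binom_coef. rewrite !tnA_def, !qpz_nat, !wt_def.
    assert (H1 := adm_neq0 z c k Hc). assert (H2 := adm_neq0 z d k Hd).
    rewrite (qpi_qpoch_wt c z l k) in H1 |- *. rewrite (qpi_qpoch_wt d z l' k) in H2 |- *.
    assert (H3 : qpoch (c * (z * qz k)) q l <> 0) by (intros E; apply H1; rewrite E; ring).
    assert (H4 : qpoch (d * (z * qz k)) q l' <> 0) by (intros E; apply H2; rewrite E; ring).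
    assert (H5 := adm_neq0 _ _ k (admissible_qz z c (Z.of_nat l) Hc)).
    assert (H6 := adm_neq0 _ _ k (admissible_qz z d (Z.of_nat l') Hd)).
    field. auto.
  - apply has_sumC_sum_n; intros l _. apply has_sumC_sum_n; intros l' _.
    apply has_sumC_scal. apply csum_spec, IS_summable; now apply admissible_qz.
Qed.

Lemma Iab_qz2 z1 z2 c d (i j : Z) : admissible z1 c -> admissible z2 c ->
  admissible z1 d -> admissible z2 d ->
  Iab z1 z2 (c * qz i) (d * qz j) = ph (c / d) i * qz (- j * i) * ph (d / c) j * Iab z1 z2 c d.
Proof.
  intros H1 H2 H3 H4. assert (c0 : c <> 0) by apply H1. assert (d0 : d <> 0) by apply H3.
  rewrite Iab_qz, Iab_sym, Iab_qz, (Iab_sym z1 z2 d c) by (repeat apply admissible_qz; auto).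
  replace (c / (d * qz j)) with (c / d * qz (- j)).
  - rewrite ph_qz by now apply Cdiv_neq0. ring.
  - rewrite qz_opp. field. split; auto. apply qz_neq0.
Qed.

(** Shifting both parameters of the mass leaves a cross factor q^(-l l'), so the sum over l is a
    finite q-binomial sum at q^(-l'). Its value contains (q^(-l');q)_n, which vanishes for l' <
    n. *)
Lemma PP_total z1 z2 c d (n m : nat) : admissible z1 c -> admissible z2 c ->
  admissible z1 d -> admissible z2 d ->
  sum_n (fun l => sum_n (fun l' => binom_coef c d n l * binom_coef d c m l' *
       IS z1 (c * qz (Z.of_nat l)) (d * qz (Z.of_nat l'))) m) n -
  sum_n (fun l => sum_n (fun l' => binom_coef c d n l * binom_coef d c m l' *
       IS z2 (c * qz (Z.of_nat l)) (d * qz (Z.of_nat l'))) m) n =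
  sum_n (fun l' => binom_coef d c m l' * ph (d / c) (Z.of_nat l') * Iab z1 z2 c d *
    (c ^ n * (qpoch (qz (- Z.of_nat l')) q n * iq (Z.of_nat n)))) m.
Proof.
  intros H1 H2 H3 H4. assert (c0 : c <> 0) by apply H1. assert (d0 : d <> 0) by apply H3.
  rewrite <- sum_n_minusC.
  transitivity (sum_n (fun l => sum_n (fun l' => binom_coef c d n l * binom_coef d c m l' *
    Iab z1 z2 (c * qz (Z.of_nat l)) (d * qz (Z.of_nat l'))) m) n).
  { apply sum_n_ext; intros l. match goal with |- ?a = ?b => change (@eq C a b) end.
    rewrite <- sum_n_minusC. apply sum_n_ext; intros l'.
    match goal with |- ?a = ?b => change (@eq C a b) end. rewrite Iab_def. ring. }
  rewrite sum_n_switch. apply sum_n_ext; intros l'.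
  match goal with |- ?a = ?b => change (@eq C a b) end.
  rewrite <- q_binomial.
  rewrite (csum_unique _ _ (has_sumC_finite (fun i => ee (qz (- Z.of_nat l')) i * iq (Z.of_nat n - i)) n
    (ee_iq_support (qz (- Z.of_nat l')) (Z.of_nat n)))).
  rewrite <- sum_n_scalC, <- sum_n_scalC. apply sum_n_ext; intros l.
  match goal with |- ?a = ?b => change (@eq C a b) end.
  rewrite Iab_qz2 by auto. unfold binom_coef at 1. rewrite enA_def, ee_def.
  replace (qz (- Z.of_nat l')) with (1 * qz (- Z.of_nat l')) by ring.
  rewrite ph_qz by apply C1_nz.
  replace (ph (c / d) (Z.of_nat l)) with (ph 1 (Z.of_nat l) * (c ^ l / d ^ l)).
  - unfold Z.sub. rewrite Cpowz_add, Cpowz_opp, !Cpowz_nat by auto.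
    field. split; now apply Cpow_neq0.
  - replace (c / d) with (1 * (c / d)) by (field; auto).
    rewrite ph_mul by (apply C1_nz || now apply Cdiv_neq0). f_equal.
    unfold Cdiv. rewrite Cpowz_mult, Cpowz_inv, !Cpowz_nat by auto using Cinv_neq0. ring.
Qed.

Lemma qpoch_qneg0 (l n : nat) : (l < n)%nat -> qpoch (qz (- Z.of_nat l)) q n = 0.
Proof.
  intros H. induction n as [|n IH]; [lia|]. simpl.
  destruct (Nat.eq_dec l n) as [->|Hne].
  - rewrite <- qz_nat, <- qz_add. replace (- Z.of_nat n + Z.of_nat n)%Z with 0%Z by lia.
    rewrite qz_0. ring.
  - rewrite IH by lia. ring.
Qed.

Lemma PP_orth_lt z1 z2 c d (n m : nat) : admissible z1 c -> admissible z2 c ->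
  admissible z1 d -> admissible z2 d -> (m < n)%nat ->
  sum_n (fun l' => binom_coef d c m l' * ph (d / c) (Z.of_nat l') * Iab z1 z2 c d *
    (c ^ n * (qpoch (qz (- Z.of_nat l')) q n * iq (Z.of_nat n)))) m = RtoC 0.
Proof.
  intros _ _ _ _ H. apply sum_n_zeroC. intros l Hl. rewrite qpoch_qneg0 by lia. ring.
Qed.

(** For m = n only the term l' = n is left. *)
Lemma PP_norm z1 z2 c d (n : nat) : c <> 0 -> d <> 0 ->
  sum_n (fun l' => binom_coef d c n l' * ph (d / c) (Z.of_nat l') * Iab z1 z2 c d *
    (c ^ n * (qpoch (qz (- Z.of_nat l')) q n * iq (Z.of_nat n)))) n =
  Iab z1 z2 c d * ((c * d) ^ n * qz (- Z.of_nat n) * iq (Z.of_nat n)).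
Proof.
  intros Hc Hd. rewrite sum_n_lastC; [|intros l Hl; rewrite qpoch_qneg0 by lia; ring].
  rewrite qpoch_qneg by lia. unfold binom_coef. rewrite Z.sub_diag, enA_def, iq_0, ph_nat, Cpowz_nat.
  simpl Cpowz. set (N := Z.of_nat n).
  replace (tri N - N * N)%Z with (- N - tri N)%Z by (pose proof (tri_double N); nia).
  rewrite qz_sub.
  replace ((- (d / c)) ^ n) with ((-1) ^ n * d ^ n / c ^ n).
  2:{ replace (- (d / c)) with (-1 * d * / c) by (field; auto).
      rewrite !Cpow_mult, <- (Cpowz_nat (/ c)), Cpowz_inv, Cpowz_nat by auto. reflexivity. }
  assert (Hs : (-1) ^ n * (-1) ^ n = 1).
  { rewrite <- Cpow_mult. replace (-1 * -1) with (RtoC 1) by ring.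
    clear; induction n; simpl; [auto|]. rewrite IHn; ring. }
  rewrite Cpow_mult. unfold N. rewrite iq_nat.
  assert (c ^ n <> 0) by now apply Cpow_neq0. assert (H2 := qpoch_q_neq0 n).
  assert (H3 := qz_neq0 (tri (Z.of_nat n))).
  match goal with |- ?a = ?b => change (@eq C a b) end.
  transitivity (Iab z1 z2 c d * (c ^ n * d ^ n * qz (- Z.of_nat n) * / qpoch q q n)
    * ((-1) ^ n * (-1) ^ n)); [field; auto|rewrite Hs; ring].
Qed.

End Orthogonality.

(** * Sums of P_m Q_n and Q_m Q_n over the points *)

Section KappaSums.
Implicit Types (a b c d u v w z x t : C) (i j k m : Z).
Local Hint Extern 0 (q <> 0%R) => exact q0 : core.

Lemma thR_bounded (a : R) : (0 < a)%R -> exists T, (0 < T)%R /\ forall k, (thR a k <= T)%R.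
Proof.
  intros Ha. destruct (thR_summable a Ha) as [T HT].
  assert (H : forall k, (thR a k <= T)%R).
  { intros k. assert (H := lsum_le_has_sum _ _ (k :: nil) (fun k => Rlt_le _ _ (thR_pos a k Ha)) HT).
    cbn [lsum fold_right] in H. rewrite Rplus_0_r in H. apply H. repeat constructor; auto. }
  exists T; split; auto. eapply Rlt_le_trans; [|apply (H 0%Z)]. now apply thR_pos.
Qed.

Lemma kap_bound_neg z1 z2 c d n : z1 <> 0 -> z2 <> 0 -> c <> 0 -> d <> 0 ->
  exists K, (0 <= K)%R /\ forall k, (k <= 0)%Z ->
    (Cmod (kap z1 z2 c d k n) <= K * (thR (Cmod z1) k * thR (Cmod z2) (- n - k)))%R.
Proof.
  intros H1 H2 Hc Hd.
  assert (P1 := Cmod_neq0 _ H1).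
  destruct (kap_bound z1 z2 c d (q / Cmod z1)%R (Z.abs n) H1 H2 Hc Hd) as [K [HK0 HK]].
  { apply Rdiv_lt_0_compat; lra. }
  { lia. }
  exists K; split; auto. intros k Hk. rewrite <- !Cmod_ph by auto. apply HK; [|lia].
  assert (Hz : z1 * qz k <> 0) by (apply Cmult_neq_0; auto; apply qz_neq0).
  rewrite Cmod_div, Cmod_mult, Cmod_qz, Cmod_R, Rabs_pos_eq by (auto; lra).
  assert (1 <= powerRZ q k)%R.
  { replace k with (- - k)%Z by lia. rewrite powerRZ_neg'.
    rewrite <- Rinv_1. apply Rinv_le_contravar; [apply powerRZ_lt; lra|].
    apply powerRZ_q_le1; lia. }
  unfold Rdiv. apply Rmult_le_compat_l; [lra|]. apply Rinv_le_contravar; nra.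
Qed.

Lemma thR_add (a : R) j k : (0 < a)%R ->
  (thR a (j + k) = thR a j * thR a k * powerRZ q (j * k))%R.
Proof.
  intros Ha. rewrite !thR_def.
  replace (tri (j + k)) with (tri j + tri k + j * k)%Z.
  - rewrite !powerRZ_add by (auto; lra). ring.
  - pose proof (tri_double j); pose proof (tri_double k); pose proof (tri_double (j + k)). nia.
Qed.

Lemma thR_opp (a : R) k : (0 < a)%R -> thR a (- k) = thR (q / a) k.
Proof.
  intros Ha. rewrite !thR_def.
  replace (tri (- k)) with (1 * k + tri k)%Z.
  - unfold Rdiv. rewrite powerRZ_mult, powerRZ_neg', powerRZ_inv', powerRZ_add, Z.mul_1_l by auto. ring.
  - pose proof (tri_double k); pose proof (tri_double (- k)). nia.
Qed.

Lemma thR_refl_summable (a b : R) n : (0 < a)%R -> (0 < b)%R ->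
  summable (fun k => powerRZ b k * thR a (- n - k))%R.
Proof.
  intros Ha Hb.
  assert (Hqa : (0 < q / a)%R) by (apply Rdiv_lt_0_compat; lra).
  assert (Hqn : (0 < powerRZ q n)%R) by (apply powerRZ_lt; lra).
  destruct (thR_summable (q / a * b * powerRZ q n)) as [s Hs].
  { apply Rmult_lt_0_compat; auto. now apply Rmult_lt_0_compat. }
  exists (thR a (- n) * s)%R. eapply has_sum_ext; [|apply has_sum_scal, Hs].
  intros k; cbv beta. unfold Z.sub. rewrite thR_add, thR_opp by auto.
  assert (Hqab : (0 < q / a * b)%R) by now apply Rmult_lt_0_compat.
  rewrite <- !thR_scal by auto.
  replace (- n * - k)%Z with (n * k)%Z by ring. rewrite powerRZ_exp_mul by auto.
  rewrite (thR_opp a k) by auto. ring.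
Qed.

Lemma kap_nonneg_bounded z1 z2 c d n : z1 <> 0 -> z2 <> 0 -> c <> 0 -> d <> 0 ->
  exists M, (0 <= M)%R /\ forall l : nat, (Cmod (kap z1 z2 c d (Z.of_nat l) n) <= M)%R.
Proof.
  intros H1 H2 Hc Hd.
  destruct (has_limC_bounded _ _ (kap_lim z1 z2 c d n H1 H2 Hc Hd)) as [M HM].
  exists M; split; auto. eapply Rle_trans; [apply Cmod_ge_0|apply (HM 0%nat)].
Qed.

Lemma geom_pow_summable (p : nat) : (0 < p)%nat -> summable (fun l => (q ^ l) ^ p)%R.
Proof.
  intros Hp. apply summable_le with (fun l => q ^ l)%R.
  - intros l. rewrite Rabs_pos_eq by (repeat apply pow_le; lra).
    destruct p as [|p]; [lia|]. simpl. assert (0 < q ^ l)%R by (apply pow_lt; lra).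
    assert (q ^ l <= 1)%R by (rewrite <- (pow1 l); apply pow_incr; lra).
    assert ((q ^ l) ^ p <= 1)%R by (rewrite <- (pow1 p); apply pow_incr; lra). nra.
  - apply summable_ratio with q; [intros; apply pow_lt; lra|lra|].
    apply is_lim_seq_ext with (fun _ => q); [|apply is_lim_seq_const].
    intros n; simpl. field. apply pow_nonzero; auto.
Qed.

Lemma summable_half (f g : Z -> R) :
  (forall l : nat, (Rabs (f (- Z.of_nat l - 1)%Z) <= g (- Z.of_nat l - 1)%Z)%R) -> summable g ->
  summable (fun l : nat => f (- Z.of_nat l - 1)%Z).
Proof.
  intros H Hg. apply summable_le with (fun l => g (- Z.of_nat l - 1)%Z); auto.
  now apply (summable_nat_inv g).
Qed.

Lemma xkap_summable z1 z2 c d (p : nat) n : z1 <> 0 -> z2 <> 0 -> c <> 0 -> d <> 0 ->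
  summableC (fun k => (z1 * qz k) ^ S p * kap z1 z2 c d k n).
Proof.
  intros H1 H2 Hc Hd.
  assert (P1 := Cmod_neq0 _ H1). assert (P2 := Cmod_neq0 _ H2).
  apply summableC_le with (fun k => Cmod ((z1 * qz k) ^ S p * kap z1 z2 c d k n));
    [intros; apply Rle_refl|].
  apply summable_Z.
  - destruct (kap_nonneg_bounded z1 z2 c d n H1 H2 Hc Hd) as [M [HM0 HM]].
    destruct (geom_pow_summable (S p) ltac:(lia)) as [s Hs].
    apply summable_le with (fun l => Cmod z1 ^ S p * M * (q ^ l) ^ S p)%R;
      [|eexists; apply has_sum_scal, Hs].
    intros l. rewrite Rabs_pos_eq by apply Cmod_ge_0.
    rewrite Cmod_mult, Cmod_pow, Cmod_mult, Cmod_qz, <- pow_powerRZ, Rpow_mult_distr.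
    replace (Cmod z1 ^ S p * M * (q ^ l) ^ S p)%R with (Cmod z1 ^ S p * (q ^ l) ^ S p * M)%R by ring.
    apply Rmult_le_compat_l; auto.
    apply Rmult_le_pos; apply pow_le; [lra|apply pow_le; lra].
  - destruct (kap_bound_neg z1 z2 c d n H1 H2 Hc Hd) as [K [HK0 HK]].
    destruct (thR_bounded (Cmod z2) P2) as [T [HT0 HT]].
    assert (Hqp : (0 < powerRZ q (Z.of_nat (S p)))%R) by (apply powerRZ_lt; lra).
    destruct (thR_summable (Cmod z1 * powerRZ q (Z.of_nat (S p)))) as [s Hs];
      [now apply Rmult_lt_0_compat|].
    apply summable_half with (f := fun k => Cmod ((z1 * qz k) ^ S p * kap z1 z2 c d k n))
      (g := (fun k => Cmod z1 ^ S p * K * T * thR (Cmod z1 * powerRZ q (Z.of_nat (S p))) k)%R);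
      [|eexists; apply has_sum_scal, Hs].
    intros l. set (k := (- Z.of_nat l - 1)%Z). rewrite Rabs_pos_eq by apply Cmod_ge_0.
    specialize (HK k ltac:(lia)). specialize (HT (- n - k)%Z).
    rewrite Cmod_mult, Cmod_pow, Cmod_mult, Cmod_qz, Rpow_mult_distr.
    replace (powerRZ q k ^ S p)%R with (powerRZ (powerRZ q (Z.of_nat (S p))) k).
    2:{ rewrite <- powerRZ_exp_mul, Z.mul_comm, powerRZ_exp_mul, <- pow_powerRZ by auto. reflexivity. }
    rewrite <- thR_scal by auto.
    set (Y := powerRZ (powerRZ q (Z.of_nat (S p))) k).
    assert (HY : (0 < Y)%R) by (apply powerRZ_lt; auto).
    assert (HX : (0 < Cmod z1 ^ S p)%R) by (apply pow_lt; auto).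
    assert (Ht1 := thR_pos (Cmod z1) k P1). assert (Ht2 := thR_pos (Cmod z2) (- n - k) P2).
    replace (Cmod z1 ^ S p * K * T * (thR (Cmod z1) k * Y))%R with
      (Cmod z1 ^ S p * Y * (K * (thR (Cmod z1) k * T)))%R by ring.
    apply Rmult_le_compat_l; [apply Rmult_le_pos; lra|].
    eapply Rle_trans; [apply HK|]. apply Rmult_le_compat_l; auto.
    apply Rmult_le_compat_l; lra.
Qed.

(** Summable terms are bounded, and here they contain the factor z q^(-n); hence f(-n) = O(q^n).
    This disposes of the boundary terms at infinity. *)
Lemma summable_terms_lim (z : C) (f : Z -> C) : z <> 0 ->
  summableC (fun k => z * qz k * f k) -> has_limC (fun n => f (- Z.of_nat n)%Z) 0.
Proof.
  intros Hz Hsum.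
  destruct (summableC_Cmod _ Hsum) as [s Hs].
  assert (Hle : forall k, (Cmod (z * qz k * f k) <= s)%R).
  { intros k. assert (H := lsum_le_has_sum _ _ (k :: nil) (fun k => Cmod_ge_0 _) Hs).
    cbn [lsum fold_right] in H. rewrite Rplus_0_r in H. apply H. repeat constructor; auto. }
  apply has_limC_le with (fun n => s / Cmod z * q ^ n)%R.
  - intros n. replace (f (- Z.of_nat n)%Z - 0) with (f (- Z.of_nat n)%Z) by ring.
    specialize (Hle (- Z.of_nat n)%Z). rewrite !Cmod_mult, Cmod_qz, powerRZ_neg', <- pow_powerRZ in Hle.
    assert (0 < q ^ n)%R by (apply pow_lt; lra).
    assert (0 < Cmod z)%R by now apply Cmod_gt_0.
    apply Rmult_le_reg_l with (Cmod z * / q ^ n)%R.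
    + apply Rmult_lt_0_compat; auto. now apply Rinv_0_lt_compat.
    + eapply Rle_trans; [apply Hle|]. apply Req_le. field. lra.
  - replace (Finite 0%R) with (Finite (s / Cmod z * 0)%R) by (f_equal; ring).
    apply is_lim_seq_mult'; [apply is_lim_seq_const|apply is_lim_pow_q].
Qed.

Lemma kap_step' z1 z2 c d k n : z1 <> 0 -> z2 <> 0 -> c <> 0 -> d <> 0 ->
  z1 * qz k * kap z1 z2 c d k n = kap z1 z2 c d k (n - 1) - kap z1 z2 c d (k + 1) (n - 1).
Proof.
  intros. rewrite (kap_step z1 z2 c d k (n - 1)) by auto.
  replace (n - 1 + 1)%Z with n by lia. ring.
Qed.

(** x kappa_n(x) = kappa_(n-1)(x) - kappa_(n-1)(qx) telescopes, and only the value at x = 0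
    remains. *)
Lemma PQ_side_0 z1 z2 c d n : z1 <> 0 -> z2 <> 0 -> c <> 0 -> d <> 0 ->
  has_sumC (fun k => z1 * qz k * kap z1 z2 c d k n)
    (- (/ qpoch_inf q q * kapK z1 z2 c d (n - 1))).
Proof.
  intros H1 H2 Hc Hd.
  assert (Hs : forall m, summableC (fun k => z1 * qz k * kap z1 z2 c d k m)).
  { intros m. eapply summableC_ext; [|apply (xkap_summable z1 z2 c d 0 m H1 H2 Hc Hd)].
    intros k; simpl. ring. }
  assert (H := csum_spec _ (Hs n)).
  assert (E := H). apply (has_sumC_scal (-1)) in E.
  assert (E' : -1 * csum (fun k => z1 * qz k * kap z1 z2 c d k n) =
    / qpoch_inf q q * kapK z1 z2 c d (n - 1) - 0).
  { apply (has_sumC_telescope (fun k => kap z1 z2 c d k (n - 1))).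
    - eapply has_sumC_ext; [|apply E]. intros k; cbv beta. rewrite kap_step' by auto. ring.
    - now apply kap_lim.
    - apply (summable_terms_lim z1 (fun k => kap z1 z2 c d k (n - 1))); auto. }
  replace (- (/ qpoch_inf q q * kapK z1 z2 c d (n - 1))) with
    (csum (fun k => z1 * qz k * kap z1 z2 c d k n)); auto.
  replace (csum (fun k => z1 * qz k * kap z1 z2 c d k n)) with
    (-1 * (-1 * csum (fun k => z1 * qz k * kap z1 z2 c d k n))) by ring.
  rewrite E'. ring.
Qed.

(** Only the equality of the two halves matters, not the common value. The moment of order p + 2 at
    index n is 1 - q^(-(p+1)) times the moment of order p + 1 at index n - 1, by the step relation
    and a shift of k; this factor is the same on both halves. *)
Lemma PQ_moment z1 z2 c d (p : nat) : z1 <> 0 -> z2 <> 0 -> c <> 0 -> d <> 0 ->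
  forall n, exists V,
    has_sumC (fun k => (z1 * qz k) ^ S p * kap z1 z2 c d k n) V /\
    has_sumC (fun k => (z2 * qz k) ^ S p * kap z2 z1 c d k n) V.
Proof.
  intros H1 H2 Hc Hd. induction p as [|p IH]; intros n.
  - exists (- (/ qpoch_inf q q * kapK z1 z2 c d (n - 1))). split.
    + eapply has_sumC_ext; [|now apply PQ_side_0]. intros k; simpl; ring.
    + rewrite kapK_sym. eapply has_sumC_ext; [|now apply PQ_side_0]. intros k; simpl; ring.
  - destruct (IH (n - 1)%Z) as [V [V1 V2]].
    assert (Hstep : forall y1 y2 : C, y1 <> 0 -> y2 <> 0 ->
      has_sumC (fun k => (y1 * qz k) ^ S p * kap y1 y2 c d k (n - 1)) V ->
      has_sumC (fun k => (y1 * qz k) ^ S (S p) * kap y1 y2 c d k n)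
        (V - / qz (Z.of_nat (S p)) * V)).
    { intros y1 y2 G1 G2 G.
      assert (G' : has_sumC (fun k => (y1 * qz (k + 1)) ^ S p * kap y1 y2 c d (k + 1) (n - 1)) V).
      { apply (has_sumC_bij (fun k => k + 1)%Z (fun k => k - 1)%Z
          (fun k => (y1 * qz k) ^ S p * kap y1 y2 c d k (n - 1))); auto; intros; lia. }
      apply (has_sumC_scal (/ qz (Z.of_nat (S p)))) in G'.
      eapply has_sumC_ext; [|apply (has_sumC_minus _ _ _ _ G G')].
      intros k; cbv beta.
      change ((y1 * qz k) ^ S (S p)) with (y1 * qz k * (y1 * qz k) ^ S p).
      transitivity ((y1 * qz k) ^ S p * (y1 * qz k * kap y1 y2 c d k n)); [|ring].
      rewrite (kap_step' y1 y2 c d k n G1 G2 Hc Hd), qz_add, qz_1, qz_nat.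
      replace (y1 * (qz k * q)) with (y1 * qz k * q) by ring. rewrite (Cpow_mult (y1 * qz k) q).
      assert (RtoC q ^ S p <> 0) by (apply Cpow_neq0, q_neq0C). field. auto. }
    exists (V - / qz (Z.of_nat (S p)) * V). split; apply Hstep; auto.
Qed.

Lemma pn_poly c d x n : c <> 0 -> d <> 0 ->
  pn c d x (Z.of_nat n) =
  sum_n (fun l => ee (c * d) (Z.of_nat l) * rn c d (Z.of_nat n - Z.of_nat l) * x ^ l) n.
Proof.
  intros Hc Hd. rewrite pn_def, sN_def.
  rewrite (csum_unique _ _ (has_sumC_finite _ n (sN_support _ _ _ _))).
  apply sum_n_ext; intros l. match goal with |- ?a = ?b => change (@eq C a b) end.
  rewrite !ee_def, !ph_nat. replace (- (c * d * x)) with (- (c * d) * x) by ring.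
  rewrite Cpow_mult. ring.
Qed.

Lemma PQ_sum z1 z2 c d (p : nat) n : z1 <> 0 -> z2 <> 0 -> c <> 0 -> d <> 0 ->
  exists V,
    has_sumC (fun k => z1 * qz k * (pn c d (z1 * qz k) (Z.of_nat p) * kap z1 z2 c d k n)) V /\
    has_sumC (fun k => z2 * qz k * (pn c d (z2 * qz k) (Z.of_nat p) * kap z2 z1 c d k n)) V.
Proof.
  intros H1 H2 Hc Hd.
  destruct (ClassicalEpsilon.choice (fun (l : nat) V =>
    has_sumC (fun k => (z1 * qz k) ^ S l * kap z1 z2 c d k n) V /\
    has_sumC (fun k => (z2 * qz k) ^ S l * kap z2 z1 c d k n) V)
    (fun l => PQ_moment z1 z2 c d l H1 H2 Hc Hd n)) as [V HV].
  exists (sum_n (fun l => ee (c * d) (Z.of_nat l) * rn c d (Z.of_nat p - Z.of_nat l) * V l) p).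
  assert (Hside : forall y1 y2 : C, (forall l, has_sumC (fun k => (y1 * qz k) ^ S l * kap y1 y2 c d k n) (V l)) ->
    has_sumC (fun k => y1 * qz k * (pn c d (y1 * qz k) (Z.of_nat p) * kap y1 y2 c d k n))
     (sum_n (fun l => ee (c * d) (Z.of_nat l) * rn c d (Z.of_nat p - Z.of_nat l) * V l) p)).
  { intros y1 y2 Hy.
    apply has_sumC_ext with (fun k => sum_n (fun l => ee (c * d) (Z.of_nat l) *
      rn c d (Z.of_nat p - Z.of_nat l) * ((y1 * qz k) ^ S l * kap y1 y2 c d k n)) p).
    - intros k. rewrite pn_poly by auto.
      set (F := fun l : nat => ee (c * d) (Z.of_nat l) * rn c d (Z.of_nat p - Z.of_nat l) * (y1 * qz k) ^ l).
      transitivity ((y1 * qz k * kap y1 y2 c d k n) * sum_n F p); [|ring].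
      rewrite <- sum_n_scalC. apply sum_n_ext; intros l.
      match goal with |- ?a = ?b => change (@eq C a b) end. unfold F. simpl. ring.
    - apply has_sumC_sum_n; intros l _. now apply has_sumC_scal. }
  split; apply Hside; apply HV.
Qed.

(** Each new factor obeys |1 - u q^k| <= (1 + |u|) q^k for k <= 0. So the reciprocal weight grows at
    infinity at most like the inverse of a product of two [thR]. *)
Lemma qpi_bound_neg u : forall l : nat,
  (Cmod (qpoch_inf (u * qz (- Z.of_nat l)) q) * thR (1 + Cmod u) (- Z.of_nat l)
   <= Cmod (qpoch_inf u q))%R.
Proof.
  assert (P0 := Cmod_ge_0 u).
  induction l as [|l IH].
  - simpl. rewrite qz_0, Cmult_1_r, thR_def. change (tri 0) with 0%Z. simpl. lra.
  - eapply Rle_trans; [|apply IH].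
    set (k := (- Z.of_nat (S l))%Z).
    replace (- Z.of_nat l)%Z with (k + 1)%Z by lia.
    rewrite thR_S by lra. rewrite (qpi_step (u * qz k)), qz_add, qz_1, Cmult_assoc, Cmod_mult.
    set (X := Cmod (qpoch_inf (u * qz k * q) q)).
    assert (HX : (0 <= X)%R) by apply Cmod_ge_0.
    assert (HT := thR_pos (1 + Cmod u) k ltac:(lra)).
    assert (H : (Cmod (1 - u * qz k) <= (1 + Cmod u) * powerRZ q k)%R).
    { eapply Rle_trans; [apply Cmod_triangle|].
      rewrite Cmod_1, Cmod_opp, Cmod_mult, Cmod_qz.
      assert (1 <= powerRZ q k)%R; [|nra].
      unfold k. rewrite powerRZ_neg', <- pow_powerRZ, <- Rinv_1.
      apply Rinv_le_contravar; [apply pow_lt; lra|].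
      rewrite <- (pow1 (S l)). apply pow_incr; lra. }
    replace (X * ((1 + Cmod u) * powerRZ q k * thR (1 + Cmod u) k))%R with
      ((1 + Cmod u) * powerRZ q k * (X * thR (1 + Cmod u) k))%R by ring.
    rewrite Rmult_assoc. apply Rmult_le_compat_r; auto. apply Rmult_le_pos; lra.
Qed.

Lemma powerRZ_div (x y : R) k : y <> 0%R -> powerRZ (x / y) k = (powerRZ x k / powerRZ y k)%R.
Proof. intros. unfold Rdiv. now rewrite powerRZ_mult, powerRZ_inv'. Qed.

Definition winv z c d k : C := qpoch_inf (c * (z * qz k)) q * qpoch_inf (d * (z * qz k)) q.

Lemma winv_def z c d k :
  winv z c d k = qpoch_inf (c * (z * qz k)) q * qpoch_inf (d * (z * qz k)) q.
Proof. reflexivity. Qed.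

(** Q_n Q_m w is kappa_n kappa_m / w. At infinity each kappa brings two factors of type [thR], and
    the growth of 1/w uses up two of the four; a single one of the others suffices for
    convergence. *)
Lemma kap2_summable z1 z2 c d n m : z1 <> 0 -> z2 <> 0 -> c <> 0 -> d <> 0 ->
  summableC (fun k => z1 * qz k * (kap z1 z2 c d k n * kap z1 z2 c d k m * winv z1 c d k)).
Proof.
  intros H1 H2 Hc Hd.
  assert (P1 := Cmod_neq0 _ H1). assert (P2 := Cmod_neq0 _ H2).
  set (F := fun k => z1 * qz k * (kap z1 z2 c d k n * kap z1 z2 c d k m * winv z1 c d k)).
  apply summableC_le with (fun k => Cmod (F k)); [intros; apply Rle_refl|].
  apply summable_Z.
  - destruct (kap_nonneg_bounded z1 z2 c d n H1 H2 Hc Hd) as [M [HM0 HM]].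
    destruct (kap_nonneg_bounded z1 z2 c d m H1 H2 Hc Hd) as [M' [HM0' HM']].
    assert (Hw : has_limC (fun l => winv z1 c d (Z.of_nat l)) (qpoch_inf 0 q * qpoch_inf 0 q)).
    { apply has_limC_mult; apply has_limC_qpi;
        (eapply has_limC_ext; [|apply has_limC_qz_nat]); intros l; cbv beta; apply eq_sym, Cmult_assoc. }
    destruct (has_limC_bounded _ _ Hw) as [W HW].
    assert (HW0 : (0 <= W)%R) by (eapply Rle_trans; [apply Cmod_ge_0|apply (HW 0%nat)]).
    destruct (geom_pow_summable 1 ltac:(lia)) as [s Hs].
    apply summable_le with (fun l => Cmod z1 * (M * M' * W) * (q ^ l) ^ 1)%R;
      [|eexists; apply has_sum_scal, Hs].
    intros l. rewrite Rabs_pos_eq by apply Cmod_ge_0. unfold F.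
    rewrite !Cmod_mult, Cmod_qz, <- pow_powerRZ, pow_1.
    replace (Cmod z1 * (M * M' * W) * q ^ l)%R with (Cmod z1 * q ^ l * (M * M' * W))%R by ring.
    assert (0 < q ^ l)%R by (apply pow_lt; lra).
    apply Rmult_le_compat_l; [apply Rmult_le_pos; lra|].
    apply Rmult_le_compat; auto using Cmod_ge_0; [apply Rmult_le_pos; apply Cmod_ge_0|].
    apply Rmult_le_compat; auto using Cmod_ge_0.
  - destruct (kap_bound_neg z1 z2 c d n H1 H2 Hc Hd) as [K [HK0 HK]].
    destruct (kap_bound_neg z1 z2 c d m H1 H2 Hc Hd) as [K' [HK0' HK']].
    destruct (thR_bounded (Cmod z2) P2) as [T [HT0 HT]].
    set (a := (1 + Cmod (c * z1))%R). set (b := (1 + Cmod (d * z1))%R).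
    assert (Ha : (0 < a)%R) by (unfold a; pose proof (Cmod_ge_0 (c * z1)); lra).
    assert (Hb : (0 < b)%R) by (unfold b; pose proof (Cmod_ge_0 (d * z1)); lra).
    set (A := Cmod (qpoch_inf (c * z1) q)). set (B := Cmod (qpoch_inf (d * z1) q)).
    assert (HA : (0 <= A)%R) by apply Cmod_ge_0. assert (HB : (0 <= B)%R) by apply Cmod_ge_0.
    (* The quadratic exponents of [thR (Cmod z1) k] squared and of [thR a k * thR b k] cancel;
       together with q^k from the integral the quotient is exactly r^k. *)
    set (r := (q * (Cmod z1 * Cmod z1 / (a * b)))%R).
    assert (Hr : (0 < r)%R).
    { unfold r. apply Rmult_lt_0_compat; [lra|]. apply Rdiv_lt_0_compat; now apply Rmult_lt_0_compat. }
    destruct (thR_refl_summable (Cmod z2) r n P2 Hr) as [s Hs].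
    apply summable_half with (f := fun k => Cmod (F k))
      (g := (fun k => Cmod z1 * (K * K' * T * A * B) * (powerRZ r k * thR (Cmod z2) (- n - k)))%R);
      [|eexists; apply has_sum_scal, Hs].
    intros l. set (k := (- Z.of_nat l - 1)%Z). rewrite Rabs_pos_eq by apply Cmod_ge_0.
    specialize (HK k ltac:(lia)). specialize (HK' k ltac:(lia)). specialize (HT (- m - k)%Z).
    assert (Qc := qpi_bound_neg (c * z1) (S l)). assert (Qd := qpi_bound_neg (d * z1) (S l)).
    replace (- Z.of_nat (S l))%Z with k in Qc, Qd by lia.
    fold a in Qc. fold A in Qc. fold b in Qd. fold B in Qd.
    rewrite <- !Cmult_assoc in Qc, Qd.
    unfold F, winv. rewrite !Cmod_mult, Cmod_qz.
    assert (Ta := thR_pos a k Ha). assert (Tb := thR_pos b k Hb).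
    assert (T1 := thR_pos (Cmod z1) k P1). assert (T2 := thR_pos (Cmod z2) (- n - k) P2).
    assert (T3 := thR_pos (Cmod z2) (- m - k) P2).
    assert (Hqk : (0 < powerRZ q k)%R) by (apply powerRZ_lt; lra).
    assert (Er : (powerRZ r k = powerRZ q k * (thR (Cmod z1) k * thR (Cmod z1) k / (thR a k * thR b k)))%R).
    { unfold r. rewrite powerRZ_mult, powerRZ_div, !powerRZ_mult, !thR_def by
        (apply Rgt_not_eq, Rmult_lt_0_compat; auto).
      assert (powerRZ a k <> 0%R) by (apply powerRZ_NOR; lra).
      assert (powerRZ b k <> 0%R) by (apply powerRZ_NOR; lra).
      assert (powerRZ q (tri k) <> 0%R) by (apply powerRZ_NOR; lra).
      field. auto. }
    assert (Qc' : (Cmod (qpoch_inf (c * (z1 * qz k)) q) <= A / thR a k)%R).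
    { apply Rmult_le_reg_r with (thR a k); auto.
      replace (A / thR a k * thR a k)%R with A by (field; lra). exact Qc. }
    assert (Qd' : (Cmod (qpoch_inf (d * (z1 * qz k)) q) <= B / thR b k)%R).
    { apply Rmult_le_reg_r with (thR b k); auto.
      replace (B / thR b k * thR b k)%R with B by (field; lra). exact Qd. }
    rewrite Er.
    replace (Cmod z1 * (K * K' * T * A * B) * (powerRZ q k * (thR (Cmod z1) k * thR (Cmod z1) k
      / (thR a k * thR b k)) * thR (Cmod z2) (- n - k)))%R with
      (Cmod z1 * powerRZ q k * (K * (thR (Cmod z1) k * thR (Cmod z2) (- n - k)) *
        (K' * (thR (Cmod z1) k * T)) * (A / thR a k * (B / thR b k))))%R by (field; lra).
    assert (G1 : (0 <= thR (Cmod z1) k * thR (Cmod z2) (- m - k))%R) by (apply Rmult_le_pos; lra).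
    apply Rmult_le_compat_l; [apply Rmult_le_pos; lra|].
    apply Rmult_le_compat; auto using Cmod_ge_0;
      try (apply Rmult_le_pos; apply Cmod_ge_0).
    + apply Rmult_le_compat; auto using Cmod_ge_0.
      eapply Rle_trans; [apply HK'|]. apply Rmult_le_compat_l; auto. apply Rmult_le_compat_l; lra.
    + apply Rmult_le_compat; auto using Cmod_ge_0.
Qed.

Lemma winv_S z c d k :
  winv z c d k = (1 - c * (z * qz k)) * (1 - d * (z * qz k)) * winv z c d (k + 1).
Proof.
  unfold winv. rewrite (qpi_qz_step z c k), (qpi_qz_step z d k). ring.
Qed.

Lemma winv_lim z c d : has_limC (fun l => winv z c d (Z.of_nat l)) 1.
Proof.
  replace (RtoC 1) with (qpoch_inf 0 q * qpoch_inf 0 q).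
  - apply has_limC_mult; apply has_limC_qpi;
      (eapply has_limC_ext; [|apply has_limC_qz_nat]); intros l; cbv beta; apply eq_sym, Cmult_assoc.
  - rewrite qpi_EE, EE_0. ring.
Qed.

(* Casorati determinant in n: its increments in k are proportional to the summands of
   <Q_n, Q_m>, and its limit at k = oo is the same for both halves of the point set. *)
Definition UU z1 z2 c d n m k : C :=
  (kap z1 z2 c d k n * kap z1 z2 c d k (m + 1) - kap z1 z2 c d k (n + 1) * kap z1 z2 c d k m)
  * winv z1 c d k.

(** The step in k expresses the determinant at k + 1 by values at k, the recurrence brings the
    indices n + 2 and m + 2 back, and the quotient of the reciprocal weights is (1 - cx)(1 - dx); a
    polynomial identity remains. The summand appears at k + 1, which [QQ_side] undoes by a shift. *)
Lemma UU_diff z1 z2 c d n m k : z1 <> 0 -> z2 <> 0 -> c <> 0 -> d <> 0 ->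
  (qz (n + 1) - qz (m + 1)) / (z1 * z2) *
    (z1 * qz (k + 1) * (kap z1 z2 c d (k + 1) n * kap z1 z2 c d (k + 1) m * winv z1 c d (k + 1))) =
  UU z1 z2 c d n m (k + 1) - UU z1 z2 c d n m k.
Proof.
  intros H1 H2 Hc Hd. unfold UU. rewrite (winv_S z1 c d k).
  rewrite !(kap_step z1 z2 c d k) by auto.
  assert (Rn := kap_rec z1 z2 c d k (n + 1 + 1) H1 H2 Hc Hd).
  assert (Rm := kap_rec z1 z2 c d k (m + 1 + 1) H1 H2 Hc Hd).
  replace (n + 1 + 1 - 1)%Z with (n + 1)%Z in Rn by lia.
  replace (n + 1 + 1 - 2)%Z with n in Rn by lia.
  replace (m + 1 + 1 - 1)%Z with (m + 1)%Z in Rm by lia.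
  replace (m + 1 + 1 - 2)%Z with m in Rm by lia.
  rewrite Rn, Rm, !(qz_add _ 1), qz_1. field. auto.
Qed.

Lemma QQ_side z1 z2 c d n m : z1 <> 0 -> z2 <> 0 -> c <> 0 -> d <> 0 ->
  (qz (n + 1) - qz (m + 1)) / (z1 * z2) *
  csum (fun k => z1 * qz k * (kap z1 z2 c d k n * kap z1 z2 c d k m * winv z1 c d k)) =
  (/ qpoch_inf q q * kapK z1 z2 c d n) * (/ qpoch_inf q q * kapK z1 z2 c d (m + 1)) -
  (/ qpoch_inf q q * kapK z1 z2 c d (n + 1)) * (/ qpoch_inf q q * kapK z1 z2 c d m).
Proof.
  intros H1 H2 Hc Hd.
  assert (Hs := fun n m => kap2_summable z1 z2 c d n m H1 H2 Hc Hd).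
  assert (H := has_sumC_scal ((qz (n + 1) - qz (m + 1)) / (z1 * z2)) _ _ (csum_spec _ (Hs n m))).
  apply (has_sumC_bij (fun k => k + 1)%Z (fun k => k - 1)%Z) in H; [|intros; lia..].
  assert (Hl : forall p, has_limC (fun l => kap z1 z2 c d (Z.of_nat l) p) (/ qpoch_inf q q * kapK z1 z2 c d p))
    by (intros; now apply kap_lim).
  assert (Hneg : forall p r, has_limC (fun l => kap z1 z2 c d (- Z.of_nat l) p *
    kap z1 z2 c d (- Z.of_nat l) r * winv z1 c d (- Z.of_nat l)) 0).
  { intros p r. apply (summable_terms_lim z1 (fun k => kap z1 z2 c d k p * kap z1 z2 c d k r * winv z1 c d k));
      auto. }
  rewrite (has_sumC_telescope (UU z1 z2 c d n m)
    ((qz (n + 1) - qz (m + 1)) / (z1 * z2) *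
      csum (fun k => z1 * qz k * (kap z1 z2 c d k n * kap z1 z2 c d k m * winv z1 c d k)))
    (((/ qpoch_inf q q * kapK z1 z2 c d n) * (/ qpoch_inf q q * kapK z1 z2 c d (m + 1)) -
      (/ qpoch_inf q q * kapK z1 z2 c d (n + 1)) * (/ qpoch_inf q q * kapK z1 z2 c d m)) * 1) 0).
  - ring.
  - eapply has_sumC_ext; [|apply H]. intros k; cbv beta. now apply UU_diff.
  - unfold UU. apply has_limC_mult; [|apply winv_lim].
    apply has_limC_minus; apply has_limC_mult; auto.
  - replace (RtoC 0) with (0 - 0) by ring.
    eapply has_limC_ext; [|apply has_limC_minus; [apply (Hneg n (m + 1)%Z)|apply (Hneg (n + 1)%Z m)]].
    intros l; cbv beta. unfold UU. ring.
Qed.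

Definition QQS z1 z2 c d n m : C :=
  csum (fun k => z1 * qz k * (kap z1 z2 c d k n * kap z1 z2 c d k m * winv z1 c d k)).

Lemma QQS_def z1 z2 c d n m : QQS z1 z2 c d n m =
  csum (fun k => z1 * qz k * (kap z1 z2 c d k n * kap z1 z2 c d k m * winv z1 c d k)).
Proof. reflexivity. Qed.

Lemma QQ_orth z1 z2 c d n m : z1 <> 0 -> z2 <> 0 -> c <> 0 -> d <> 0 -> n <> m ->
  QQS z1 z2 c d n m - QQS z2 z1 c d n m = 0.
Proof.
  intros H1 H2 Hc Hd Hnm.
  assert (Euler1 := QQ_side z1 z2 c d n m H1 H2 Hc Hd).
  assert (E2 := QQ_side z2 z1 c d n m H2 H1 Hc Hd).
  rewrite !(kapK_sym z2 z1) in E2. rewrite <- Euler1 in E2.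
  unfold QQS.
  assert (Hq : qz (n + 1) - qz (m + 1) <> 0).
  { intros E. apply Hnm. assert (E' : qz (n - m) = 1).
    { replace (n - m)%Z with ((n + 1) - (m + 1))%Z by lia. rewrite qz_sub.
      replace (qz (n + 1)) with (qz (m + 1) + (qz (n + 1) - qz (m + 1))) by ring.
      rewrite E. field. apply qz_neq0. }
    apply qz_inj in E'. lia. }
  apply (Cmult_reg_l ((qz (n + 1) - qz (m + 1)) / (z1 * z2))).
  2:{ apply Cdiv_neq0; auto. now apply Cmult_neq_0. }
  rewrite (Cmult_comm z2 z1) in E2.
  match goal with |- ?A * (?X - ?Y) = _ => transitivity (A * X - A * Y); [ring|] end.
  rewrite E2. ring.
Qed.

(** The inner product of x Q_n with Q_(n-1) is computed in two ways: from the recurrence raising n -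
    1 and from the one raising n. They carry q^n x and q^(n+1) x, whence the factor q. Orthogonality
    deletes all mixed terms, but only after the difference of the two halves is taken. *)
Lemma QQ_norm_rec z1 z2 c d n : z1 <> 0 -> z2 <> 0 -> c <> 0 -> d <> 0 ->
  q * (QQS z1 z2 c d n n - QQS z2 z1 c d n n) =
  (c * d - qz (n + 1) / (z1 * z2)) *
  (QQS z1 z2 c d (n - 1) (n - 1) - QQS z2 z1 c d (n - 1) (n - 1)).
Proof.
  intros H1 H2 Hc Hd.
  assert (Hside : forall y1 y2 : C, y1 <> 0 -> y2 <> 0 -> y1 * y2 = z1 * z2 ->
    q * ((c + d) * QQS y1 y2 c d (n - 1) n - (c * d - qz n / (z1 * z2)) * QQS y1 y2 c d (n - 2) n
      - QQS y1 y2 c d n n) =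
    (c + d) * QQS y1 y2 c d n (n - 1) - (c * d - qz (n + 1) / (z1 * z2)) * QQS y1 y2 c d (n - 1) (n - 1)
      - QQS y1 y2 c d (n + 1) (n - 1)).
  { intros y1 y2 G1 G2 Gy.
    assert (Hs := fun p r => csum_spec _ (kap2_summable y1 y2 c d p r G1 G2 Hc Hd)).
    fold (QQS y1 y2 c d) in Hs.
    assert (L : has_sumC (fun k => q * ((c + d) * (y1 * qz k * (kap y1 y2 c d k (n - 1) * kap y1 y2 c d k n * winv y1 c d k))
       - (c * d - qz n / (z1 * z2)) * (y1 * qz k * (kap y1 y2 c d k (n - 2) * kap y1 y2 c d k n * winv y1 c d k))
       - (y1 * qz k * (kap y1 y2 c d k n * kap y1 y2 c d k n * winv y1 c d k))))
      (q * ((c + d) * QQS y1 y2 c d (n - 1) n - (c * d - qz n / (z1 * z2)) * QQS y1 y2 c d (n - 2) n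
      - QQS y1 y2 c d n n))).
    { apply has_sumC_scal, has_sumC_minus; [apply has_sumC_minus; apply has_sumC_scal|]; apply Hs. }
    assert (R : has_sumC (fun k => (c + d) * (y1 * qz k * (kap y1 y2 c d k n * kap y1 y2 c d k (n - 1) * winv y1 c d k))
       - (c * d - qz (n + 1) / (z1 * z2)) * (y1 * qz k * (kap y1 y2 c d k (n - 1) * kap y1 y2 c d k (n - 1) * winv y1 c d k))
       - (y1 * qz k * (kap y1 y2 c d k (n + 1) * kap y1 y2 c d k (n - 1) * winv y1 c d k)))
      ((c + d) * QQS y1 y2 c d n (n - 1) - (c * d - qz (n + 1) / (z1 * z2)) * QQS y1 y2 c d (n - 1) (n - 1)
      - QQS y1 y2 c d (n + 1) (n - 1))).
    { apply has_sumC_minus; [apply has_sumC_minus; apply has_sumC_scal|]; apply Hs. }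
    eapply has_sumC_unique; [apply L|]. eapply has_sumC_ext; [|apply R].
    intros k; cbv beta.
    assert (Rn := kap_rec y1 y2 c d k n G1 G2 Hc Hd).
    assert (Rn1 := kap_rec y1 y2 c d k (n + 1) G1 G2 Hc Hd).
    replace (n + 1 - 1)%Z with n in Rn1 by lia. replace (n + 1 - 2)%Z with (n - 1)%Z in Rn1 by lia.
    rewrite Gy in Rn, Rn1. rewrite Rn1.
    set (A := kap y1 y2 c d k n) in *.
    transitivity (y1 * qz k * A * winv y1 c d k * (q * ((c + d) * kap y1 y2 c d k (n - 1)
      - (c * d - qz n / (z1 * z2)) * kap y1 y2 c d k (n - 2) - A))).
    - rewrite qz_add, qz_1.
      replace ((c + d) * kap y1 y2 c d k (n - 1) - (c * d - qz n / (z1 * z2)) * kap y1 y2 c d k (n - 2) - A)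
        with (qz n * (y1 * qz k) / (z1 * z2) * kap y1 y2 c d k (n - 1)).
      + field. auto.
      + rewrite Rn. ring.
    - ring. }
  assert (Euler1 := Hside z1 z2 H1 H2 eq_refl).
  assert (E2 := Hside z2 z1 H2 H1 (Cmult_comm z2 z1)).
  assert (O1 := QQ_orth z1 z2 c d (n - 1) n H1 H2 Hc Hd ltac:(lia)).
  assert (O2 := QQ_orth z1 z2 c d (n - 2) n H1 H2 Hc Hd ltac:(lia)).
  assert (O3 := QQ_orth z1 z2 c d n (n - 1) H1 H2 Hc Hd ltac:(lia)).
  assert (O4 := QQ_orth z1 z2 c d (n + 1) (n - 1) H1 H2 Hc Hd ltac:(lia)).
  match type of Euler1 with ?L1 = ?R1 => match type of E2 with ?L2 = ?R2 =>
    assert (E : L1 - L2 = R1 - R2) by (rewrite Euler1, E2; reflexivity) end end.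
  set (g := c * d - qz n / (z1 * z2)) in *. set (g1 := c * d - qz (n + 1) / (z1 * z2)) in *.
  transitivity (- (q * ((c + d) * QQS z1 z2 c d (n - 1) n - g * QQS z1 z2 c d (n - 2) n - QQS z1 z2 c d n n) -
    q * ((c + d) * QQS z2 z1 c d (n - 1) n - g * QQS z2 z1 c d (n - 2) n - QQS z2 z1 c d n n))
    + q * ((c + d) * (QQS z1 z2 c d (n - 1) n - QQS z2 z1 c d (n - 1) n)
        - g * (QQS z1 z2 c d (n - 2) n - QQS z2 z1 c d (n - 2) n))); [ring|].
  rewrite E, O1, O2.
  transitivity (- ((c + d) * (QQS z1 z2 c d n (n - 1) - QQS z2 z1 c d n (n - 1))
    - g1 * (QQS z1 z2 c d (n - 1) (n - 1) - QQS z2 z1 c d (n - 1) (n - 1))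
    - (QQS z1 z2 c d (n + 1) (n - 1) - QQS z2 z1 c d (n + 1) (n - 1)))); [ring|].
  rewrite O3, O4. ring.
Qed.

End KappaSums.

Lemma has_limC_partial (g h : nat -> C) :
  (forall n, g (S n) = g n + h n) -> summableC h -> exists l, has_limC g l.
Proof.
  intros Hg [s [H1 H2]].
  apply has_sum_is_series in H1. apply has_sum_is_series in H2.
  exists (g 0%nat + s). apply has_limC_incr.
  apply has_limC_ext with (fun n => g 0%nat + sum_n h n).
  - intros n. induction n as [|n IH]; [now rewrite sum_O, Hg|].
    rewrite sum_Sn, (Hg (S n)), <- IH. unfold plus; simpl. ring.
  - apply has_limC_plus; [apply has_limC_const|]. split.
    + eapply is_lim_seq_ext; [intros n; symmetry; apply (sum_n_C h n)|exact H1].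
    + eapply is_lim_seq_ext; [intros n; symmetry; apply (sum_n_C h n)|exact H2].
Qed.

(** * Dual orthogonality *)

Section Asymptotics.
Implicit Types (c d u v w z x t : C) (i j k m : Z).
Local Hint Extern 0 (q <> 0%R) => exact q0 : core.

(* The difference r_n - d r_(n-1) removes the part of r_n that grows like d^n. *)
Definition rho c d m : C := (rn c d m - d * rn c d (m - 1)) / Cpowz c m.

(** Subtracting d r_(m-1) multiplies the i-th term of r_m by q^i, so the ratio of the growths
    becomes dq/c; the series has a limit under q|d| < |c|, not only for |d| < |c|. The factor
    [qpz 0 i] is 1 for i >= 0. *)
Lemma rho_sum c d m : c <> 0 -> d <> 0 ->
  rho c d m = csum (fun i => enA (d * q / c) i * (qpz 0 i * iq (m - i))) /\
  summableC (fun i => enA (d * q / c) i * (qpz 0 i * iq (m - i))).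
Proof.
  intros Hc Hd. assert (Hq := q_neq0C).
  assert (Hcm := Cpowz_neq0 c m Hc).
  assert (Hterm : forall i, enA (d * q / c) i * (qpz 0 i * iq (m - i)) =
    / Cpowz c m * (qz i * (tnA 0 d i * enA c (m - i)))).
  { intros i. rewrite tnA_def, !enA_def. unfold Z.sub. rewrite Cpowz_add, Cpowz_opp by auto.
    unfold Cdiv. rewrite !Cpowz_mult, Cpowz_inv by auto using Cinv_neq0, Cmult_neq_0.
    rewrite <- qz_1, Cpowz_qz, Z.mul_1_l. field. split; auto. now apply Cpowz_neq0. }
  split.
  - rewrite (csum_ext _ _ Hterm), csum_scal by apply tn_summable'.
    unfold rho. unfold Cdiv. rewrite Cmult_comm. f_equal.
    rewrite (rn_def c d m), (rn_def c d (m - 1)), (tn_def 0 c d m), (tn_def 0 c d (m - 1)).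
    rewrite <- csum_scal by apply tn_summable.
    rewrite <- (csum_Zshift (-1) (fun i => d * (tnA 0 d i * enA c (m - 1 - i)))).
    rewrite <- csum_minus.
    + apply csum_ext; intros i. replace (i + -1)%Z with (i - 1)%Z by lia.
      replace (m - 1 - (i - 1))%Z with (m - i)%Z by lia.
      assert (E := tnA_rec 0 d i Hd).
      replace (d * (tnA 0 d (i - 1) * enA c (m - i))) with
        ((1 - 0 * qz (i - 1)) * d * tnA 0 d (i - 1) * enA c (m - i)) by ring.
      rewrite <- E. ring.
    + apply tn_summable.
    + apply (summableC_inj (fun i => i + -1)%Z ltac:(intros ? ?; cbv beta; lia)
        (fun i => d * (tnA 0 d i * enA c (m - 1 - i)))). apply summableC_scal, tn_summable.
  - eapply summableC_ext; [intros i; symmetry; apply Hterm|].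
    apply summableC_scal, tn_summable'.
Qed.

Lemma rho_lim c d : c <> 0 -> d <> 0 -> (q * Cmod d < Cmod c)%R ->
  exists L B, has_limC (fun n => rho c d (Z.of_nat n)) L /\
    (0 <= B)%R /\ forall m, (Cmod (rho c d m) <= B)%R.
Proof.
  intros Hc Hd Hlt. assert (Hq := q_neq0C).
  assert (Pc := Cmod_neq0 _ Hc). assert (Pd := Cmod_neq0 _ Hd).
  set (y := d * q / c).
  assert (Hy0 : y <> 0) by (apply Cdiv_neq0; auto; now apply Cmult_neq_0).
  assert (Hy : (Cmod y < 1)%R).
  { unfold y. rewrite Cmod_div, Cmod_mult, Cmod_R, Rabs_pos_eq by (auto; lra).
    apply Rmult_lt_reg_r with (Cmod c); auto. field_simplify; lra. }
  destruct iq_bounded as [B [HB HBm]].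
  destruct (qpoch_bounded 0) as [B' [HB' HBm']].
  destruct (summableC_Cmod _ (proj1 (enA_summable y Hy0 Hy))) as [S HS].
  assert (Hbound : forall m i, (Cmod (enA y i * (qpz 0 i * iq (m - i))) <= B' * B * Cmod (enA y i))%R).
  { intros m i. rewrite !Cmod_mult, Rmult_comm. apply Rmult_le_compat_r; [apply Cmod_ge_0|].
    apply Rmult_le_compat; auto using Cmod_ge_0. }
  assert (Hg : has_sum (fun i => B' * B * Cmod (enA y i))%R (B' * B * S)) by now apply has_sum_scal.
  assert (HF : summableC (fun i => enA y i * (qpz 0 i * / qpoch_inf q q))).
  { eapply summableC_ext with (f := fun i => / qpoch_inf q q * (enA y i * qpz 0 i)); [intros; ring|].
    apply summableC_scal. apply summableC_le with (fun i => B' * Cmod (enA y i))%R.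
    - intros i. rewrite Cmod_mult, Rmult_comm. apply Rmult_le_compat_r; auto. apply Cmod_ge_0.
    - eexists; apply has_sum_scal, HS. }
  exists (csum (fun i => enA y i * (qpz 0 i * / qpoch_inf q q))), (2 * (B' * B * S))%R.
  split; [|split].
  - apply has_sumC_tannery with (f := fun n i => enA y i * (qpz 0 i * iq (Z.of_nat n - i)))
      (g := (fun i => B' * B * Cmod (enA y i))%R) (F := fun i => enA y i * (qpz 0 i * / qpoch_inf q q)).
    + intros n i. apply Hbound.
    + eexists; apply Hg.
    + intros i. apply has_limC_mult; [apply has_limC_const|].
      apply has_limC_mult; [apply has_limC_const|]. apply (has_limC_Z iq _ (- i)), iq_lim.
    + intros n. destruct (rho_sum c d (Z.of_nat n) Hc Hd) as [-> Hs]. now apply csum_spec.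
    + now apply csum_spec.
  - apply Rmult_le_pos; [lra|]. eapply (has_sum_le (fun _ => 0%R)); [|apply has_sum_zero|apply Hg].
    intros i; cbv beta. apply Rmult_le_pos; [|apply Cmod_ge_0]. apply Rmult_le_pos; lra.
  - intros m. destruct (rho_sum c d m Hc Hd) as [-> Hs].
    eapply has_sumC_bound; [|apply csum_spec, Hs|apply Hg]. apply Hbound.
Qed.

(** P_n and kappa_n are both of the form sum of b_a r_(n - s_a); the coefficient of c^n is then L
    times the sum of b_a c^(-s_a), by dominated convergence. *)
Lemma asym1 {A : Type} (b : A -> C) (s : A -> Z) c d (L : C) : c <> 0 -> d <> 0 ->
  (q * Cmod d < Cmod c)%R -> has_limC (fun n => rho c d (Z.of_nat n)) L ->
  summable (fun a => Cmod (b a * Cpowz c (- s a))) ->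
  (forall m, summableC (fun a => b a * rn c d (m - s a))) ->
  has_limC (fun n => (csum (fun a => b a * rn c d (Z.of_nat n - s a)) -
      d * csum (fun a => b a * rn c d (Z.of_nat n - 1 - s a))) / Cpowz c (Z.of_nat n))
    (L * csum (fun a => b a * Cpowz c (- s a))).
Proof.
  intros Hc Hd Hlt HL Hb Hs.
  destruct (rho_lim c d Hc Hd Hlt) as [L' [B [HL' [HB0 HB]]]].
  assert (Hbs : summableC (fun a => b a * Cpowz c (- s a))).
  { eapply summableC_le; [intros; apply Rle_refl|]. exact Hb. }
  rewrite <- csum_scal by auto.
  apply has_sumC_tannery with (f := fun n a => rho c d (Z.of_nat n - s a) * (b a * Cpowz c (- s a)))
    (F := fun a => L * (b a * Cpowz c (- s a)))
    (g := (fun a => B * Cmod (b a * Cpowz c (- s a)))%R).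
  - intros n a. rewrite (Cmod_mult (rho _ _ _)). apply Rmult_le_compat_r; auto. apply Cmod_ge_0.
  - destruct Hb as [S HS]. eexists; apply has_sum_scal, HS.
  - intros a. apply has_limC_mult; [|apply has_limC_const].
    apply (has_limC_Z (rho c d) _ (- s a)%Z HL).
  - intros n. set (N := Z.of_nat n).
    assert (HcN := Cpowz_neq0 c N Hc).
    assert (H1 := csum_spec _ (Hs N)). assert (H2 := csum_spec _ (Hs (N - 1)%Z)).
    assert (H := has_sumC_scal (/ Cpowz c N) _ _
      (has_sumC_minus _ _ _ _ H1 (has_sumC_scal d _ _ H2))).
    unfold Cdiv. rewrite (Cmult_comm _ (/ Cpowz c N)).
    eapply has_sumC_ext; [|apply H]. intros a; cbv beta. unfold rho.
    replace (N - 1 - s a)%Z with (N - s a - 1)%Z by lia.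
    unfold Z.sub. rewrite Cpowz_add, Cpowz_opp by auto.
    assert (Hsa := Cpowz_neq0 c (s a) Hc). field. auto.
  - apply csum_spec. now apply summableC_scal.
Qed.

(* For c = d the growth is n c^n; the linear part is carried by [rho]. *)
Definition log_corr c m : C := rn c c m / Cpowz c m - RtoC (IZR m) * rho c c m.

Lemma gg_neg c m : (m < 0)%Z -> log_corr c m = 0.
Proof. intros Hm. unfold log_corr, rho. rewrite !rn_neg by lia. unfold Cdiv. ring. Qed.

Lemma npow_summable : summable (fun n => (INR n + 1) * (INR n + 1) * q ^ n)%R.
Proof.
  apply summable_ratio with q; [|lra|].
  - intros n. apply Rmult_lt_0_compat; [|apply pow_lt; lra].
    pose proof (pos_INR n). apply Rmult_lt_0_compat; lra.
  - apply is_lim_seq_ext with (fun n => (1 + / (INR n + 1)) * (1 + / (INR n + 1)) * q)%R.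
    + intros n. rewrite S_INR. simpl pow. pose proof (pos_INR n).
      assert (q ^ n <> 0)%R by (apply pow_nonzero; auto). field. split; lra.
    + replace (Finite q) with (Finite ((1 + 0) * (1 + 0) * q)%R) by (f_equal; ring).
      assert (Hl : is_lim_seq (fun n => (1 + / (INR n + 1))%R) (1 + 0)%R).
      { apply is_lim_seq_plus'; [apply is_lim_seq_const|].
        apply (is_lim_seq_inv _ p_infty); [|discriminate].
        eapply is_lim_seq_plus; [apply is_lim_seq_INR|apply is_lim_seq_const|reflexivity]. }
      apply is_lim_seq_mult'; [|apply is_lim_seq_const]. now apply is_lim_seq_mult'.
Qed.

(** The increment of [log_corr] is -(m-1) q^m r_m / c^m by the recurrence with double root, and r_m
    / c^m grows at most linearly since [rho] is bounded; the increments are therefore summable. *)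
Lemma gg_lim c : c <> 0 ->
  exists Y B, has_limC (fun n => log_corr c (Z.of_nat n)) Y /\
    (0 <= B)%R /\ forall m, (Cmod (log_corr c m) <= B)%R.
Proof.
  intros Hc. assert (Pc := Cmod_neq0 _ Hc).
  destruct (rho_lim c c Hc Hc ltac:(nra)) as [L [B [HL [HB0 HB]]]].
  assert (Hr : forall n : nat, (Cmod (rn c c (Z.of_nat n) / Cpowz c (Z.of_nat n)) <= (INR n + 1) * B)%R).
  { induction n as [|n IH].
    - simpl Z.of_nat. specialize (HB 0%Z). unfold rho in HB. rewrite (rn_neg c c (0 - 1)) in HB by lia.
      replace (rn c c 0 / Cpowz c 0) with ((rn c c 0 - c * 0) / Cpowz c 0).
      + simpl INR. lra.
      + f_equal. ring.
    - specialize (HB (Z.of_nat (S n))). unfold rho in HB.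
      replace (Z.of_nat (S n) - 1)%Z with (Z.of_nat n) in HB by lia.
      replace (rn c c (Z.of_nat (S n)) / Cpowz c (Z.of_nat (S n))) with
        ((rn c c (Z.of_nat (S n)) - c * rn c c (Z.of_nat n)) / Cpowz c (Z.of_nat (S n))
         + rn c c (Z.of_nat n) / Cpowz c (Z.of_nat n)).
      + eapply Rle_trans; [apply Cmod_triangle|]. rewrite S_INR. lra.
      + replace (Z.of_nat (S n)) with (Z.of_nat n + 1)%Z by lia. rewrite Cpowz_S by auto.
        field. split; auto. now apply Cpowz_neq0. }
  assert (Hstep : forall m, log_corr c m - log_corr c (m - 1) =
    - RtoC (IZR (m - 1)) * (qz m * (rn c c m / Cpowz c m))).
  { intros m.
    assert (E := rn_rec c c m Hc Hc).
    assert (E' : qz m * rn c c m = rn c c m - (c + c) * rn c c (m - 1) + c * c * rn c c (m - 2)).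
    { replace (c * c * rn c c (m - 2)) with ((c + c) * rn c c (m - 1) - (1 - qz m) * rn c c m)
        by (rewrite E; ring). ring. }
    replace (qz m * (rn c c m / Cpowz c m)) with ((qz m * rn c c m) / Cpowz c m)
      by (unfold Cdiv; ring).
    rewrite E'. unfold log_corr, rho.
    assert (Hcm := Cpowz_neq0 c (m - 1) Hc).
    replace (Cpowz c m) with (c * Cpowz c (m - 1)) by
      (rewrite <- Cpowz_S by auto; f_equal; lia).
    replace (m - 1 - 1)%Z with (m - 2)%Z by lia.
    rewrite minus_IZR, RtoC_minus. field. auto. }
  destruct (has_limC_partial (fun n => log_corr c (Z.of_nat n))
    (fun n => - RtoC (IZR (Z.of_nat n)) * (qz (Z.of_nat (S n)) *
      (rn c c (Z.of_nat (S n)) / Cpowz c (Z.of_nat (S n)))))) as [Y HY].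
  - intros n. assert (E := Hstep (Z.of_nat (S n))).
    replace (Z.of_nat (S n) - 1)%Z with (Z.of_nat n) in E by lia. rewrite <- E. ring.
  - destruct npow_summable as [s0 HS].
    apply summableC_le with (fun n => 2 * B * ((INR n + 1) * (INR n + 1) * q ^ n))%R;
      [|eexists; apply has_sum_scal, HS].
    intros n. rewrite !Cmod_mult, Cmod_opp, Cmod_R, Cmod_qz, <- pow_powerRZ.
    rewrite <- INR_IZR_INZ, Rabs_pos_eq by apply pos_INR.
    specialize (Hr (S n)). rewrite S_INR in Hr.
    assert (P := pos_INR n). assert (Pq : (0 < q ^ n)%R) by (apply pow_lt; lra).
    assert (H1 := Cmod_ge_0 (rn c c (Z.of_nat (S n)) / Cpowz c (Z.of_nat (S n)))).
    set (X := Cmod (rn c c (Z.of_nat (S n)) / Cpowz c (Z.of_nat (S n)))) in *.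
    simpl pow. 
    assert (H2 : (q * q ^ n * X <= q ^ n * ((INR n + 1 + 1) * B))%R).
    { apply Rmult_le_compat; try nra. }
    apply Rle_trans with (INR n * (q ^ n * ((INR n + 1 + 1) * B)))%R.
    + apply Rmult_le_compat_l; auto.
    + replace (2 * B * ((INR n + 1) * (INR n + 1) * q ^ n))%R with
        (q ^ n * B * (2 * ((INR n + 1) * (INR n + 1))))%R by ring.
      replace (INR n * (q ^ n * ((INR n + 1 + 1) * B)))%R with
        (q ^ n * B * (INR n * (INR n + 1 + 1)))%R by ring.
      apply Rmult_le_compat_l; [apply Rmult_le_pos; lra|]. nra.
  - destruct (has_limC_bounded _ _ HY) as [M HM].
    exists Y, (Rabs M). split; [auto|split; [apply Rabs_pos|]]. intros m.
    destruct (Z_lt_le_dec m 0).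
    + rewrite gg_neg, Cmod_0 by auto. apply Rabs_pos.
    + replace m with (Z.of_nat (Z.to_nat m)) by lia.
      eapply Rle_trans; [apply HM|apply Rle_abs].
Qed.

(** The analogue of [asym1] for c = d: n times the leading coefficient is subtracted, and the shift
    of n by s_a leaves the additional sum weighted by s_a. *)
Lemma asym2 {A : Type} (b : A -> C) (s : A -> Z) c (L Y : C) : c <> 0 ->
  has_limC (fun n => rho c c (Z.of_nat n)) L ->
  has_limC (fun n => log_corr c (Z.of_nat n)) Y ->
  summable (fun a => (1 + Rabs (IZR (s a))) * Cmod (b a * Cpowz c (- s a)))%R ->
  (forall m, summableC (fun a => b a * rn c c (m - s a))) ->
  has_limC (fun n => csum (fun a => b a * rn c c (Z.of_nat n - s a)) / Cpowz c (Z.of_nat n) -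
      RtoC (INR n) * ((csum (fun a => b a * rn c c (Z.of_nat n - s a)) -
      c * csum (fun a => b a * rn c c (Z.of_nat n - 1 - s a))) / Cpowz c (Z.of_nat n)))
    (Y * csum (fun a => b a * Cpowz c (- s a)) -
     L * csum (fun a => RtoC (IZR (s a)) * (b a * Cpowz c (- s a)))).
Proof.
  intros Hc HL HY Hb Hs. assert (Pc := Cmod_neq0 _ Hc).
  destruct (rho_lim c c Hc Hc ltac:(nra)) as [L' [B [HL' [HB0 HB]]]].
  destruct (gg_lim c Hc) as [Y' [B' [HY' [HB0' HB']]]].
  assert (Hbs : summableC (fun a => b a * Cpowz c (- s a))).
  { eapply summableC_le; [|exact Hb]. intros a; cbv beta.
    pose proof (Cmod_ge_0 (b a * Cpowz c (- s a))). pose proof (Rabs_pos (IZR (s a))). nra. }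
  assert (Hbs1 : summableC (fun a => RtoC (IZR (s a)) * (b a * Cpowz c (- s a)))).
  { eapply summableC_le; [|exact Hb]. intros a; cbv beta. rewrite Cmod_mult, Cmod_R.
    pose proof (Cmod_ge_0 (b a * Cpowz c (- s a))). pose proof (Rabs_pos (IZR (s a))). nra. }
  apply has_sumC_tannery with
    (f := fun n a => log_corr c (Z.of_nat n - s a) * (b a * Cpowz c (- s a)) -
       rho c c (Z.of_nat n - s a) * (RtoC (IZR (s a)) * (b a * Cpowz c (- s a))))
    (F := fun a => Y * (b a * Cpowz c (- s a)) - L * (RtoC (IZR (s a)) * (b a * Cpowz c (- s a))))
    (g := (fun a => (B + B') * ((1 + Rabs (IZR (s a))) * Cmod (b a * Cpowz c (- s a))))%R).
  - intros n a. eapply Rle_trans; [apply Cmod_triangle|].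
    rewrite Cmod_opp, (Cmod_mult (log_corr _ _)), (Cmod_mult (rho _ _ _)), (Cmod_mult (RtoC _)), Cmod_R.
    assert (H1 := HB (Z.of_nat n - s a)%Z). assert (H2 := HB' (Z.of_nat n - s a)%Z).
    pose proof (Cmod_ge_0 (log_corr c (Z.of_nat n - s a))). pose proof (Cmod_ge_0 (rho c c (Z.of_nat n - s a))).
    set (X := Cmod (b a * Cpowz c (- s a))). assert (HX : (0 <= X)%R) by apply Cmod_ge_0.
    set (S := Rabs (IZR (s a))). assert (HS : (0 <= S)%R) by apply Rabs_pos.
    assert (HSX : (0 <= S * X)%R) by now apply Rmult_le_pos.
    assert (Cmod (log_corr c (Z.of_nat n - s a)) * X <= B' * X)%R by now apply Rmult_le_compat_r.
    assert (Cmod (rho c c (Z.of_nat n - s a)) * (S * X) <= B * (S * X))%R by now apply Rmult_le_compat_r.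
    assert (0 <= B * X)%R by now apply Rmult_le_pos.
    assert (0 <= B' * (S * X))%R by now apply Rmult_le_pos. nra.
  - destruct Hb as [S HS]. eexists; apply has_sum_scal, HS.
  - intros a. apply has_limC_minus; (apply has_limC_mult; [|apply has_limC_const]).
    + apply (has_limC_Z (log_corr c) _ (- s a)%Z HY).
    + apply (has_limC_Z (rho c c) _ (- s a)%Z HL).
  - intros n. set (N := Z.of_nat n).
    assert (HcN := Cpowz_neq0 c N Hc).
    assert (H1 := csum_spec _ (Hs N)). assert (H2 := csum_spec _ (Hs (N - 1)%Z)).
    assert (H := has_sumC_minus _ _ _ _ (has_sumC_scal (/ Cpowz c N) _ _ H1)
      (has_sumC_scal (RtoC (INR n) * / Cpowz c N) _ _
        (has_sumC_minus _ _ _ _ H1 (has_sumC_scal c _ _ H2)))).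
    match goal with |- has_sumC _ ?X => match type of H with has_sumC _ ?Y =>
      replace X with Y by (field; auto) end end.
    eapply has_sumC_ext; [|apply H]. intros a; cbv beta. unfold log_corr, rho.
    replace (N - 1 - s a)%Z with (N - s a - 1)%Z by lia.
    rewrite minus_IZR, RtoC_minus. replace (IZR N) with (INR n) by apply INR_IZR_INZ.
    replace (Cpowz c (N - s a)) with (Cpowz c N * / Cpowz c (s a)).
    2:{ unfold Z.sub. now rewrite Cpowz_add, Cpowz_opp. }
    rewrite Cpowz_opp by auto.
    assert (Hsa := Cpowz_neq0 c (s a) Hc). field. auto.
  - apply has_sumC_minus; apply has_sumC_scal; now apply csum_spec.
Qed.

End Asymptotics.

(** Lets a theta series with linear weights be dominated by theta series with the argument doubled
    and halved. *)
Lemma one_plus_abs_le k : (1 + Rabs (IZR k) <= powerRZ 2 k + powerRZ 2 (- k))%R.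
Proof.
  assert (H : forall n : nat, (1 + INR n <= 2 ^ n)%R).
  { induction n as [|n IH]; [simpl; lra|]. rewrite S_INR. simpl. pose proof (pos_INR n). lra. }
  assert (Hp : forall j, (0 < powerRZ 2 j)%R) by (intros; apply powerRZ_lt; lra).
  destruct (Z_le_gt_dec 0 k).
  - specialize (H (Z.to_nat k)). rewrite INR_IZR_INZ, pow_powerRZ, Z2Nat.id in H by lia.
    rewrite Rabs_pos_eq by (apply IZR_le; lia). specialize (Hp (- k)%Z). lra.
  - specialize (H (Z.to_nat (- k))). rewrite INR_IZR_INZ, pow_powerRZ, Z2Nat.id, opp_IZR in H by lia.
    rewrite Rabs_left by (apply IZR_lt; lia). specialize (Hp k). lra.
Qed.

(** The determinant of the combinations f_n - d f_(n-1) and f_n - c f_(n-1), and likewise for g, is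
    d - c times the Casorati determinant of f and g. *)
Lemma casorati_limit_ne (f g : Z -> C) (c d vf vf' vg vg' : C) : c <> 0 -> d <> 0 -> c <> d ->
  has_limC (fun n => (f (Z.of_nat n) - d * f (Z.of_nat n - 1)%Z) / Cpowz c (Z.of_nat n)) vf ->
  has_limC (fun n => (f (Z.of_nat n) - c * f (Z.of_nat n - 1)%Z) / Cpowz d (Z.of_nat n)) vf' ->
  has_limC (fun n => (g (Z.of_nat n) - d * g (Z.of_nat n - 1)%Z) / Cpowz c (Z.of_nat n)) vg ->
  has_limC (fun n => (g (Z.of_nat n) - c * g (Z.of_nat n - 1)%Z) / Cpowz d (Z.of_nat n)) vg' ->
  has_limC (fun n => (f (Z.of_nat n) * g (Z.of_nat n - 1)%Z - f (Z.of_nat n - 1)%Z * g (Z.of_nat n))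
     / Cpowz (c * d) (Z.of_nat n)) ((vf * vg' - vf' * vg) / (d - c)).
Proof.
  intros Hc Hd Hne H1 H2 H3 H4.
  assert (Hdc : d - c <> 0).
  { intros E. apply Hne. replace d with (c + (d - c)) by ring. rewrite E; ring. }
  eapply has_limC_ext.
  2:{ apply has_limC_mult with (v := fun _ => / (d - c)); [|apply has_limC_const].
      apply has_limC_minus; apply has_limC_mult; [apply H1|apply H4|apply H2|apply H3]. }
  intros n; cbv beta. rewrite Cpowz_mult by auto.
  assert (A := Cpowz_neq0 c (Z.of_nat n) Hc). assert (B := Cpowz_neq0 d (Z.of_nat n) Hd).
  field. auto.
Qed.

(** In the combination vf yg - yf vg the terms with the factor n cancel before the limit is
    taken. *)
Lemma casorati_limit_eq (f g : Z -> C) (c vf yf vg yg : C) : c <> 0 ->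
  has_limC (fun n => (f (Z.of_nat n) - c * f (Z.of_nat n - 1)%Z) / Cpowz c (Z.of_nat n)) vf ->
  has_limC (fun n => f (Z.of_nat n) / Cpowz c (Z.of_nat n) - RtoC (INR n) *
    ((f (Z.of_nat n) - c * f (Z.of_nat n - 1)%Z) / Cpowz c (Z.of_nat n))) yf ->
  has_limC (fun n => (g (Z.of_nat n) - c * g (Z.of_nat n - 1)%Z) / Cpowz c (Z.of_nat n)) vg ->
  has_limC (fun n => g (Z.of_nat n) / Cpowz c (Z.of_nat n) - RtoC (INR n) *
    ((g (Z.of_nat n) - c * g (Z.of_nat n - 1)%Z) / Cpowz c (Z.of_nat n))) yg ->
  has_limC (fun n => (f (Z.of_nat n) * g (Z.of_nat n - 1)%Z - f (Z.of_nat n - 1)%Z * g (Z.of_nat n))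
     / Cpowz (c * c) (Z.of_nat n)) ((vf * yg - yf * vg) / c).
Proof.
  intros Hc H1 H2 H3 H4.
  eapply has_limC_ext.
  2:{ apply has_limC_mult with (v := fun _ => / c); [|apply has_limC_const].
      apply has_limC_minus; apply has_limC_mult; [apply H1|apply H4|apply H2|apply H3]. }
  intros n; cbv beta. rewrite Cpowz_mult by auto.
  assert (A := Cpowz_neq0 c (Z.of_nat n) Hc). field. auto.
Qed.

(** * Asymptotics of P_n and Q_n as n tends to infinity *)

Section Columns.
Implicit Types (c d u v w z x t : C) (i j k m : Z).
Local Hint Extern 0 (q <> 0%R) => exact q0 : core.

Lemma ee_mulz u c j : c <> 0 -> ee u j * Cpowz c (- j) = ee (u / c) j.
Proof.
  intros Hc. destruct (Z_lt_le_dec j 0); [rewrite !ee_neg by auto; ring|].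
  rewrite !ee_def, Cpowz_opp by auto. replace j with (Z.of_nat (Z.to_nat j)) by lia.
  set (n := Z.to_nat j). rewrite !ph_nat, Cpowz_nat.
  replace ((- (u / c)) ^ n) with ((- u) ^ n * / c ^ n); [ring|].
  replace (- (u / c)) with (- u * / c) by (unfold Cdiv; ring).
  rewrite Cpow_mult, <- (Cpowz_nat (/ c)), Cpowz_inv, Cpowz_nat by auto. reflexivity.
Qed.

Lemma weighted_thR (a : R) : (0 < a)%R ->
  summable (fun k => (1 + Rabs (IZR k)) * thR a k)%R.
Proof.
  intros Ha.
  destruct (thR_summable (a * 2)) as [s Hs]; [lra|].
  destruct (thR_summable (a * / 2)) as [t Ht]; [lra|].
  apply summable_le with (fun k => thR (a * 2) k + thR (a * / 2) k)%R;
    [|eexists; apply has_sum_plus; eauto].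
  intros k. rewrite <- !thR_scal by lra.
  assert (H := one_plus_abs_le k). rewrite powerRZ_neg', <- powerRZ_inv' in H.
  assert (HT := thR_pos a k Ha).
  rewrite Rabs_pos_eq; [nra|]. apply Rmult_le_pos; [|lra].
  pose proof (Rabs_pos (IZR k)); lra.
Qed.

Lemma weighted_ee u : summable (fun j => (1 + Rabs (IZR j)) * Cmod (ee u j))%R.
Proof.
  destruct iq_bounded as [B [HB HBm]].
  assert (P := Cmod_ge_0 u).
  destruct (weighted_thR (Cmod u + 1)) as [s Hs]; [lra|].
  apply summable_le with (fun j => B * ((1 + Rabs (IZR j)) * thR (Cmod u + 1) j))%R;
    [|eexists; apply has_sum_scal, Hs].
  intros j. assert (P1 := Rabs_pos (IZR j)). assert (P2 := Cmod_ge_0 (ee u j)).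
  rewrite Rabs_pos_eq by (apply Rmult_le_pos; lra).
  assert (H := Cmod_ee_le u (Cmod u + 1) j ltac:(lra)). rewrite eeR_def in H.
  specialize (HBm j). rewrite Cmod_iq in HBm.
  assert (HT := thR_pos (Cmod u + 1) j ltac:(lra)).
  replace (B * ((1 + Rabs (IZR j)) * thR (Cmod u + 1) j))%R with
    ((1 + Rabs (IZR j)) * (thR (Cmod u + 1) j * B))%R by ring.
  apply Rmult_le_compat_l; [lra|]. eapply Rle_trans; [apply H|]. apply Rmult_le_compat_l; lra.
Qed.

Lemma pn_csum c d x n : pn c d x n = csum (fun j => ee (c * d * x) j * rn c d (n - j)).
Proof. now rewrite pn_def, sN_def. Qed.

Lemma pn_asym c d x (L : C) : c <> 0 -> d <> 0 -> (q * Cmod d < Cmod c)%R ->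
  has_limC (fun n => rho c d (Z.of_nat n)) L ->
  has_limC (fun n => (pn c d x (Z.of_nat n) - d * pn c d x (Z.of_nat n - 1)) / Cpowz c (Z.of_nat n))
    (L * qpoch_inf (d * x) q).
Proof.
  intros Hc Hd Hlt HL.
  replace (qpoch_inf (d * x) q) with
    (csum (fun j => ee (c * d * x) j * Cpowz c (- j))).
  - eapply has_limC_ext; [|apply (asym1 (ee (c * d * x)) (fun j => j) c d L Hc Hd Hlt HL)].
    + intros n; cbv beta. now rewrite !pn_csum.
    + eapply summable_le; [|apply (weighted_ee (d * x))].
      intros j. rewrite ee_mulz by auto. rewrite Rabs_pos_eq by apply Cmod_ge_0.
      replace (c * d * x / c) with (d * x) by (field; auto).
      pose proof (Rabs_pos (IZR j)). pose proof (Cmod_ge_0 (ee (d * x) j)). nra.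
    + intros m. apply sN_summable.
  - rewrite qpi_EE, EE_def. apply csum_ext; intros j. rewrite ee_mulz by auto.
    f_equal. field. auto.
Qed.

(** With the shift [ks] this writes kappa_n in the form required by [asym1] and [asym2]. *)
Definition kb z1 z2 k (p : Z * Z) : C := ph z1 (fst p) * iq (k - fst p) * ph z2 (snd p).
Definition ks (p : Z * Z) : Z := (- (fst p + snd p))%Z.
Lemma ks_def (p : Z * Z) : ks p = (- (fst p + snd p))%Z.
Proof. reflexivity. Qed.

Lemma kap_csum z1 z2 c d k n :
  kap z1 z2 c d k n = csum (fun p => kb z1 z2 k p * rn c d (n - ks p)).
Proof.
  rewrite kap_def. apply csum_ext; intros [i j]. rewrite kt_def. unfold kb, ks; simpl fst; simpl snd.
  replace (n - - (i + j))%Z with (n + i + j)%Z by lia. ring.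
Qed.

Lemma kb_summable z1 z2 c d k n : z1 <> 0 -> z2 <> 0 -> c <> 0 -> d <> 0 ->
  summableC (fun p => kb z1 z2 k p * rn c d (n - ks p)).
Proof.
  intros. eapply summableC_ext; [|now apply (kt_summable z1 z2 c d k n)].
  intros [i j]. rewrite kt_def. unfold kb, ks; simpl fst; simpl snd.
  replace (n - - (i + j))%Z with (n + i + j)%Z by lia. ring.
Qed.

Lemma kb_mulz z1 z2 c k p : z1 <> 0 -> z2 <> 0 -> c <> 0 ->
  kb z1 z2 k p * Cpowz c (- ks p) =
  (ph (z1 * c) (fst p) * iq (k - fst p)) * ph (z2 * c) (snd p).
Proof.
  intros. unfold kb, ks. rewrite Z.opp_involutive, Cpowz_add, !ph_mul by auto. ring.
Qed.

Lemma weighted_ph u : u <> 0 -> summable (fun k => (1 + Rabs (IZR k)) * Cmod (ph u k))%R.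
Proof.
  intros Hu. eapply summable_le; [|apply (weighted_thR (Cmod u)), Cmod_neq0, Hu].
  intros k. rewrite Cmod_ph by auto. rewrite Rabs_pos_eq; [lra|].
  apply Rmult_le_pos; [|now apply Rlt_le, thR_pos, Cmod_neq0].
  pose proof (Rabs_pos (IZR k)); lra.
Qed.

Lemma kb_weighted z1 z2 c k : z1 <> 0 -> z2 <> 0 -> c <> 0 ->
  summable (fun p => (1 + Rabs (IZR (ks p))) * Cmod (kb z1 z2 k p * Cpowz c (- ks p)))%R.
Proof.
  intros H1 H2 Hc.
  assert (U1 : z1 * c <> 0) by now apply Cmult_neq_0.
  assert (U2 : z2 * c <> 0) by now apply Cmult_neq_0.
  destruct iq_bounded as [B [HB HBm]].
  destruct (weighted_ph _ U1) as [s Hs]. destruct (weighted_ph _ U2) as [t Ht].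
  apply summable_le with (fun p : Z * Z => B * (((1 + Rabs (IZR (fst p))) * Cmod (ph (z1 * c) (fst p))) *
    ((1 + Rabs (IZR (snd p))) * Cmod (ph (z2 * c) (snd p)))))%R;
    [|eexists; apply has_sum_scal; apply (has_sum_prod (fun i => ((1 + Rabs (IZR i)) * Cmod (ph (z1 * c) i))%R)
        (fun j => ((1 + Rabs (IZR j)) * Cmod (ph (z2 * c) j))%R)); eauto].
  intros [i j]. rewrite kb_mulz by auto. unfold ks; simpl fst; simpl snd.
  specialize (HBm (k - i)%Z).
  assert (P0 := Rabs_pos (IZR (- (i + j)))).
  assert (P1 := Rabs_pos (IZR i)). assert (P2 := Rabs_pos (IZR j)).
  assert (P3 := Cmod_ge_0 (ph (z1 * c) i)). assert (P4 := Cmod_ge_0 (ph (z2 * c) j)).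
  assert (P5 := Cmod_ge_0 (iq (k - i))).
  rewrite Rabs_pos_eq by (apply Rmult_le_pos; [lra|apply Cmod_ge_0]).
  rewrite !Cmod_mult.
  assert (Hij : (1 + Rabs (IZR (- (i + j))) <= (1 + Rabs (IZR i)) * (1 + Rabs (IZR j)))%R).
  { rewrite opp_IZR, Rabs_Ropp, plus_IZR. pose proof (Rabs_triang (IZR i) (IZR j)). nra. }
  set (X := Cmod (ph (z1 * c) i)) in *. set (Y := Cmod (ph (z2 * c) j)) in *.
  assert (PXY : (0 <= X * Y)%R) by now apply Rmult_le_pos.
  replace ((1 + Rabs (IZR (- (i + j)))) * (X * Cmod (iq (k - i)) * Y))%R with
    ((1 + Rabs (IZR (- (i + j)))) * Cmod (iq (k - i)) * (X * Y))%R by ring.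
  replace (B * ((1 + Rabs (IZR i)) * X * ((1 + Rabs (IZR j)) * Y)))%R with
    ((1 + Rabs (IZR i)) * (1 + Rabs (IZR j)) * B * (X * Y))%R by ring.
  apply Rmult_le_compat_r; auto. apply Rmult_le_compat; lra.
Qed.

Definition Th u : C := csum (ph u).
Lemma Th_def u : Th u = csum (ph u).
Proof. reflexivity. Qed.
Definition Tr u k : C := csum (fun i => ph u i * iq (k - i)).
Lemma Tr_def u k : Tr u k = csum (fun i => ph u i * iq (k - i)).
Proof. reflexivity. Qed.

Lemma kb_value z1 z2 c k : z1 <> 0 -> z2 <> 0 -> c <> 0 ->
  csum (fun p => kb z1 z2 k p * Cpowz c (- ks p)) = Tr (z1 * c) k * Th (z2 * c).
Proof.
  intros H1 H2 Hc.
  rewrite (csum_ext _ _ (fun p => kb_mulz z1 z2 c k p H1 H2 Hc)).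
  unfold Tr, Th. symmetry. apply (csum_mult (fun i => ph (z1 * c) i * iq (k - i)) (ph (z2 * c))).
  - apply ph_iq_summable. now apply Cmult_neq_0.
  - apply ph_summable. now apply Cmult_neq_0.
Qed.

Definition ef z1 z2 c d k n : C := winv z1 c d k * kap z1 z2 c d k n.
Lemma ef_def z1 z2 c d k n : ef z1 z2 c d k n = winv z1 c d k * kap z1 z2 c d k n.
Proof. reflexivity. Qed.

(** By [trunc_theta] the truncated series contributes 1/(cx;q)_oo, which the reciprocal weight
    cancels. What is left depends on x only through (dx;q)_oo, exactly as for P_n in [pn_asym]. *)
Lemma ef_asym z1 z2 c d k (L : C) : z2 <> 0 -> admissible z1 c -> admissible z1 d ->
  (q * Cmod d < Cmod c)%R ->
  has_limC (fun n => rho c d (Z.of_nat n)) L ->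
  has_limC (fun n => (ef z1 z2 c d k (Z.of_nat n) - d * ef z1 z2 c d k (Z.of_nat n - 1)) / Cpowz c (Z.of_nat n))
    (Th (z1 * c) * Th (z2 * c) / qpoch_inf q q * (L * qpoch_inf (d * (z1 * qz k)) q)).
Proof.
  intros H2 Ac Ad Hlt HL.
  assert (H1 : z1 <> 0) by apply Ac. assert (Hc : c <> 0) by apply Ac. assert (Hd : d <> 0) by apply Ad.
  assert (G := asym1 (kb z1 z2 k) ks c d L Hc Hd Hlt HL).
  assert (G' := G ltac:(eapply summable_le; [|apply (kb_weighted z1 z2 c k H1 H2 Hc)];
    intros p; rewrite Rabs_pos_eq by apply Cmod_ge_0;
    pose proof (Rabs_pos (IZR (ks p))); pose proof (Cmod_ge_0 (kb z1 z2 k p * Cpowz c (- ks p))); nra)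
    (fun m => kb_summable z1 z2 c d k m H1 H2 Hc Hd)).
  rewrite kb_value in G' by auto.
  assert (U1 : z1 * c <> 0) by now apply Cmult_neq_0.
  assert (E := trunc_theta (z1 * c) k U1). fold (Tr (z1 * c) k) in E. fold (Th (z1 * c)) in E.
  apply (has_limC_mult (fun _ => winv z1 c d k) _ _ _ (has_limC_const _)) in G'.
  assert (Hq := qpi_q_neq0).
  replace (Th (z1 * c) * Th (z2 * c) / qpoch_inf q q * (L * qpoch_inf (d * (z1 * qz k)) q))
    with (winv z1 c d k * (L * (Tr (z1 * c) k * Th (z2 * c)))).
  - eapply has_limC_ext; [|apply G']. intros n; cbv beta. unfold ef. rewrite !kap_csum.
    unfold Cdiv. ring.
  - rewrite <- E, winv_def. replace (z1 * c * qz k) with (c * (z1 * qz k)) by ring. field. auto.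
Qed.

(** [Euler1], [Th1] and [Tr1] are u d/du of [EE], [Th] and [Tr]; they enter through the n c^n growth
    when c = d. *)
Definition Euler1 u : C := csum (fun j => RtoC (IZR j) * ee u j).
Lemma E1_def u : Euler1 u = csum (fun j => RtoC (IZR j) * ee u j).
Proof. reflexivity. Qed.
Definition Th1 u : C := csum (fun j => RtoC (IZR j) * ph u j).
Lemma Th1_def u : Th1 u = csum (fun j => RtoC (IZR j) * ph u j).
Proof. reflexivity. Qed.
Definition Tr1 u k : C := csum (fun i => RtoC (IZR i) * (ph u i * iq (k - i))).
Lemma Tr1_def u k : Tr1 u k = csum (fun i => RtoC (IZR i) * (ph u i * iq (k - i))).
Proof. reflexivity. Qed.

Lemma weighted_summable {A : Type} (f : A -> C) (s : A -> Z) :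
  summable (fun p => (1 + Rabs (IZR (s p))) * Cmod (f p))%R ->
  summableC (fun p => RtoC (IZR (s p)) * f p).
Proof.
  intros H. eapply summableC_le; [|apply H]. intros p; cbv beta.
  rewrite Cmod_mult, Cmod_R. pose proof (Cmod_ge_0 (f p)). nra.
Qed.

Lemma weighted_ph_iq u k : u <> 0 ->
  summable (fun i => (1 + Rabs (IZR i)) * Cmod (ph u i * iq (k - i)))%R.
Proof.
  intros Hu. destruct iq_bounded as [B [HB HBm]].
  destruct (weighted_ph u Hu) as [s Hs].
  apply summable_le with (fun i => B * ((1 + Rabs (IZR i)) * Cmod (ph u i)))%R;
    [|eexists; apply has_sum_scal, Hs].
  intros i. pose proof (Rabs_pos (IZR i)). pose proof (Cmod_ge_0 (ph u i)).
  rewrite Rabs_pos_eq by (apply Rmult_le_pos; [lra|apply Cmod_ge_0]).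
  rewrite Cmod_mult. specialize (HBm (k - i)%Z).
  replace (B * ((1 + Rabs (IZR i)) * Cmod (ph u i)))%R with
    ((1 + Rabs (IZR i)) * (Cmod (ph u i) * B))%R by ring.
  apply Rmult_le_compat_l; [lra|]. apply Rmult_le_compat_l; lra.
Qed.

(* Derivative, with respect to log u, of the identity trunc_theta. *)
Lemma trunc_theta_deriv u k : u <> 0 ->
  Th1 u / qpoch_inf q q = Tr1 u k * qpoch_inf (u * qz k) q + Tr u k * Euler1 (u * qz k).
Proof.
  intros Hu.
  assert (W1 := weighted_ph_iq u k Hu). assert (W2 := weighted_ee (u * qz k)).
  assert (S1 := weighted_summable _ (fun i => i) W1). assert (S2 := weighted_summable _ (fun i => i) W2).
  assert (S3 := ph_iq_summable u k Hu). assert (S4 := ee_summable (u * qz k)).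
  rewrite (qpi_EE (u * qz k)), EE_def. unfold Tr1, Tr, Euler1.
  assert (K1 := has_sumC_conv _ _ S1 S4). assert (K2 := has_sumC_conv _ _ S3 S2).
  cbv beta in K1, K2.
  assert (K := has_sumC_plus _ _ _ _ K1 K2).
  assert (W := weighted_summable _ (fun i => i) (weighted_ph u Hu)). cbv beta in W.
  apply csum_spec in W. fold (Th1 u) in W.
  apply (has_sumC_scal (/ qpoch_inf q q)) in W.
  unfold Cdiv. rewrite (Cmult_comm (Th1 u)).
  eapply has_sumC_unique; [apply W|]. eapply has_sumC_ext; [|apply K]. intros i; cbv beta.
  assert (C1 := conv_bij _ _ S1 S4). assert (C2 := conv_bij _ _ S3 S2).
  apply (summableC_row _ i) in C1. apply (summableC_row _ i) in C2. cbn [fst snd] in C1, C2.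
  rewrite <- csum_plus by auto.
  (* The weights i - j and j of the two products add up to i, and the sum over j is Cauchy's sum
     again. *)
  transitivity (csum (fun j => RtoC (IZR i) * (ph u i * cauchyt (k - i) j))).
  - apply csum_ext; intros j. rewrite cauchyt_def, ee_def, ph_qz by auto.
    replace (ph u i) with (ph u (i - j) * ph u j * qz ((i - j) * j)).
    2:{ rewrite <- ph_add by auto. f_equal; lia. }
    replace (j * j + (k - i) * j)%Z with (k * j - (i - j) * j)%Z by ring.
    rewrite qz_sub. replace (k - (i - j))%Z with (j + (k - i))%Z by lia.
    rewrite minus_IZR, RtoC_minus. field. apply qz_neq0.
  - assert (Hct : summableC (cauchyt (k - i))).
    { assert (Hz := ph_neq0 u i Hu).
      assert (C3 := conv_bij _ _ S3 S4). apply (summableC_row _ i) in C3. cbn [fst snd] in C3.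
      apply (summableC_scal (/ ph u i)) in C3.
      eapply summableC_ext; [|apply C3]. intros j; cbv beta.
      rewrite cauchyt_def, ee_def, ph_qz by auto.
      replace (/ ph u i) with (/ (ph u (i - j) * ph u j * qz ((i - j) * j))).
      2:{ rewrite <- ph_add by auto. do 2 f_equal; lia. }
      replace (j * j + (k - i) * j)%Z with (k * j - (i - j) * j)%Z by ring.
      rewrite qz_sub. replace (k - (i - j))%Z with (j + (k - i))%Z by lia.
      field. repeat split; try apply qz_neq0; now apply ph_neq0. }
    rewrite csum_scal by now apply summableC_scal. rewrite csum_scal by auto.
    rewrite <- cauchyS_def, cauchyS_val. ring.
Qed.

End Columns.

Section ColumnLimits.
Implicit Types (c d u v w z x t : C) (i j k m : Z).
Local Hint Extern 0 (q <> 0%R) => exact q0 : core.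

Lemma pn_asym2 c x (L Y : C) : c <> 0 ->
  has_limC (fun n => rho c c (Z.of_nat n)) L ->
  has_limC (fun n => log_corr c (Z.of_nat n)) Y ->
  has_limC (fun n => pn c c x (Z.of_nat n) / Cpowz c (Z.of_nat n) - RtoC (INR n) *
      ((pn c c x (Z.of_nat n) - c * pn c c x (Z.of_nat n - 1)) / Cpowz c (Z.of_nat n)))
    (Y * qpoch_inf (c * x) q - L * Euler1 (c * x)).
Proof.
  intros Hc HL HY.
  replace (qpoch_inf (c * x) q) with (csum (fun j => ee (c * c * x) j * Cpowz c (- j))).
  2:{ rewrite qpi_EE, EE_def. apply csum_ext; intros j. rewrite ee_mulz by auto.
    f_equal. field. auto. }
  replace (Euler1 (c * x)) with (csum (fun j => RtoC (IZR j) * (ee (c * c * x) j * Cpowz c (- j)))).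
  2:{ rewrite E1_def. apply csum_ext; intros j. rewrite ee_mulz by auto.
    do 2 f_equal. field. auto. }
  eapply has_limC_ext; [|apply (asym2 (ee (c * c * x)) (fun j => j) c L Y Hc HL HY)].
  - intros n; cbv beta. now rewrite !pn_csum.
  - eapply summable_le; [|apply (weighted_ee (c * x))].
    intros j. rewrite ee_mulz by auto.
    replace (c * c * x / c) with (c * x) by (field; auto).
    rewrite Rabs_pos_eq; [lra|]. apply Rmult_le_pos; [|apply Cmod_ge_0].
    pose proof (Rabs_pos (IZR j)); lra.
  - intros m. apply sN_summable.
Qed.

(** The factor, independent of the point, between the leading coefficients of Q_n and of P_n; [Phi1]
    is its derivative c d/dc. *)
Definition Phi z1 z2 c : C := Th (z1 * c) * Th (z2 * c) / qpoch_inf q q.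
Definition Phi1 z1 z2 c : C :=
  (Th1 (z1 * c) * Th (z2 * c) + Th (z1 * c) * Th1 (z2 * c)) / qpoch_inf q q.

Lemma kb_value1 z1 z2 c k : z1 <> 0 -> z2 <> 0 -> c <> 0 ->
  csum (fun p => RtoC (IZR (ks p)) * (kb z1 z2 k p * Cpowz c (- ks p))) =
  - (Tr1 (z1 * c) k * Th (z2 * c) + Tr (z1 * c) k * Th1 (z2 * c)).
Proof.
  intros H1 H2 Hc.
  assert (U1 : z1 * c <> 0) by now apply Cmult_neq_0.
  assert (U2 : z2 * c <> 0) by now apply Cmult_neq_0.
  assert (A1 := weighted_summable _ (fun i => i) (weighted_ph_iq _ k U1)).
  assert (A2 := weighted_summable _ (fun i => i) (weighted_ph _ U2)).
  assert (A3 := ph_iq_summable _ k U1). assert (A4 := ph_summable _ U2).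
  assert (M1 := summableC_mult _ _ A1 A4). assert (M2 := summableC_mult _ _ A3 A2).
  rewrite Tr1_def, Tr_def, Th_def, Th1_def.
  rewrite (csum_mult _ _ A1 A4), (csum_mult _ _ A3 A2).
  rewrite <- csum_plus by auto.
  match goal with |- _ = - ?X => replace (- X) with ((-1) * X) by ring end.
  rewrite <- csum_scal by now apply summableC_plus.
  apply csum_ext; intros p. rewrite kb_mulz by auto. rewrite ks_def, opp_IZR, plus_IZR, RtoC_opp, RtoC_plus.
  ring.
Qed.

(** The second coefficient is [Phi] times the one of P_n, plus [Phi1] times the leading one of P_n;
    the latter part cancels in the determinants of [col_limit]. *)
Lemma ef_asym2 z1 z2 c k (L Y : C) : z2 <> 0 -> admissible z1 c ->
  has_limC (fun n => rho c c (Z.of_nat n)) L ->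
  has_limC (fun n => log_corr c (Z.of_nat n)) Y ->
  has_limC (fun n => ef z1 z2 c c k (Z.of_nat n) / Cpowz c (Z.of_nat n) - RtoC (INR n) *
      ((ef z1 z2 c c k (Z.of_nat n) - c * ef z1 z2 c c k (Z.of_nat n - 1)) / Cpowz c (Z.of_nat n)))
    (Phi z1 z2 c * (Y * qpoch_inf (c * (z1 * qz k)) q - L * Euler1 (c * (z1 * qz k))) +
     Phi1 z1 z2 c * (L * qpoch_inf (c * (z1 * qz k)) q)).
Proof.
  intros H2 Ac HL HY.
  assert (H1 : z1 <> 0) by apply Ac. assert (Hc : c <> 0) by apply Ac.
  assert (U1 : z1 * c <> 0) by now apply Cmult_neq_0.
  assert (G := asym2 (kb z1 z2 k) ks c L Y Hc HL HY (kb_weighted z1 z2 c k H1 H2 Hc)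
    (fun m => kb_summable z1 z2 c c k m H1 H2 Hc Hc)).
  rewrite kb_value, kb_value1 in G by auto.
  apply (has_limC_mult (fun _ => winv z1 c c k) _ _ _ (has_limC_const _)) in G.
  match goal with |- has_limC _ ?X => match type of G with has_limC _ ?Y => replace X with Y end end.
  - eapply has_limC_ext; [|apply G]. intros n; cbv beta. rewrite !ef_def, !kap_csum.
    unfold Cdiv. ring.
  - assert (T := trunc_theta (z1 * c) k U1). rewrite <- Tr_def, <- Th_def in T.
    assert (T1 := trunc_theta_deriv (z1 * c) k U1).
    replace (z1 * c * qz k) with (c * (z1 * qz k)) in T, T1 by ring.
    assert (Hq := qpi_q_neq0).
    unfold Phi, Phi1. rewrite winv_def.
    set (b := qpoch_inf (c * (z1 * qz k)) q) in *. set (b1 := Euler1 (c * (z1 * qz k))) in *.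
    replace (Th1 (z1 * c)) with (qpoch_inf q q * (Tr1 (z1 * c) k * b + Tr (z1 * c) k * b1)).
    2:{ rewrite <- T1. field. auto. }
    rewrite <- T. field. auto.
Qed.

Lemma kap_cd_sym z1 z2 c d k n : c <> 0 -> d <> 0 -> kap z1 z2 c d k n = kap z1 z2 d c k n.
Proof.
  intros Hc Hd. rewrite !kap_csum. apply csum_ext; intros p. now rewrite (rn_sym c d).
Qed.

Lemma winv_cd_sym z c d k : winv z c d k = winv z d c k.
Proof. rewrite !winv_def. ring. Qed.

Lemma ef_cd_sym z1 z2 c d k n : c <> 0 -> d <> 0 -> ef z1 z2 c d k n = ef z1 z2 d c k n.
Proof. intros. rewrite !ef_def, winv_cd_sym, kap_cd_sym by auto. reflexivity. Qed.

Lemma Phi_sym z1 z2 c : Phi z1 z2 c = Phi z2 z1 c.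
Proof. unfold Phi. f_equal. ring. Qed.

Lemma Phi1_sym z1 z2 c : Phi1 z1 z2 c = Phi1 z2 z1 c.
Proof. unfold Phi1. f_equal. ring. Qed.

(* The points x = z1 q^k and y = y1 q^l lie on the same half or on opposite halves of R_q. *)
Definition sides z1 z2 y1 y2 : Prop := (y1 = z1 /\ y2 = z2) \/ (y1 = z2 /\ y2 = z1).

(** The same e serves both determinants: for the Q_n it acquires the factor Phi(c) Phi(d), also when
    x and y lie on opposite halves, since [Phi] is symmetric in z1 and z2. *)
Lemma col_limit z1 z2 y1 y2 c d k (l : Z) : sides z1 z2 y1 y2 ->
  admissible z1 c -> admissible z2 c -> admissible z1 d -> admissible z2 d ->
  (q * Cmod d < Cmod c)%R -> (q * Cmod c < Cmod d)%R ->
  exists e, has_limC (fun n =>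
      (pn c d (z1 * qz k) (Z.of_nat n) * pn c d (y1 * qz l) (Z.of_nat n - 1) -
       pn c d (z1 * qz k) (Z.of_nat n - 1) * pn c d (y1 * qz l) (Z.of_nat n)) /
      Cpowz (c * d) (Z.of_nat n)) e /\
    has_limC (fun n =>
      (ef z1 z2 c d k (Z.of_nat n) * ef y1 y2 c d l (Z.of_nat n - 1) -
       ef z1 z2 c d k (Z.of_nat n - 1) * ef y1 y2 c d l (Z.of_nat n)) /
      Cpowz (c * d) (Z.of_nat n)) (Phi z1 z2 c * Phi z1 z2 d * e).
Proof.
  intros Hs A1 A2 B1 B2 Hcd Hdc.
  assert (H1 : z1 <> 0) by apply A1. assert (H2 : z2 <> 0) by apply A2.
  assert (Hc : c <> 0) by apply A1. assert (Hd : d <> 0) by apply B1.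
  assert (Hy : admissible y1 c /\ admissible y1 d /\ y2 <> 0 /\
    (forall u, Phi y1 y2 u = Phi z1 z2 u) /\ (forall u, Phi1 y1 y2 u = Phi1 z1 z2 u)).
  { destruct Hs as [[-> ->]|[-> ->]]; repeat split; auto; intros; auto using Phi_sym, Phi1_sym;
    try apply A1; try apply A2; try apply B1; try apply B2. }
  destruct Hy as (C1 & D1 & H2' & HP & HP1).
  destruct (rho_lim c d Hc Hd Hcd) as [L [_ [HL _]]].
  destruct (classic (c = d)) as [<-|Hne].
  - destruct (gg_lim c Hc) as [Y [_ [HY _]]].
    eexists; split.
    + apply (casorati_limit_eq (pn c c (z1 * qz k)) (pn c c (y1 * qz l)) c); auto.
      * apply pn_asym; eauto.
      * apply pn_asym2; eauto.
      * apply pn_asym; eauto.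
      * apply pn_asym2; eauto.
    + assert (G := casorati_limit_eq (ef z1 z2 c c k) (ef y1 y2 c c l) c _ _ _ _ Hc
        (ef_asym z1 z2 c c k L H2 A1 A1 Hcd HL) (ef_asym2 z1 z2 c k L Y H2 A1 HL HY)
        (ef_asym y1 y2 c c l L H2' C1 C1 Hcd HL) (ef_asym2 y1 y2 c l L Y H2' C1 HL HY)).
      match goal with |- has_limC _ ?X => match type of G with has_limC _ ?Y => replace X with Y; [exact G|] end end.
      fold (Phi z1 z2 c). fold (Phi y1 y2 c). rewrite HP, HP1. field. auto.
  - destruct (rho_lim d c Hd Hc Hdc) as [L' [_ [HL' _]]].
    assert (Hdc' : d - c <> 0).
    { intros E. apply Hne. replace d with (c + (d - c)) by ring. rewrite E; ring. }
    eexists; split.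
    + apply (casorati_limit_ne (pn c d (z1 * qz k)) (pn c d (y1 * qz l)) c d); auto.
      * apply pn_asym; eauto.
      * eapply has_limC_ext; [|apply pn_asym; [exact Hd|exact Hc|exact Hdc|exact HL']].
        intros n; cbv beta. now rewrite !(pn_sym d c).
      * apply pn_asym; eauto.
      * eapply has_limC_ext; [|apply pn_asym; [exact Hd|exact Hc|exact Hdc|exact HL']].
        intros n; cbv beta. now rewrite !(pn_sym d c).
    + assert (G1 := ef_asym z1 z2 c d k L H2 A1 B1 Hcd HL).
      assert (G2 := ef_asym y1 y2 c d l L H2' C1 D1 Hcd HL).
      assert (G3 := ef_asym z1 z2 d c k L' H2 B1 A1 Hdc HL').
      assert (G4 := ef_asym y1 y2 d c l L' H2' D1 C1 Hdc HL').
      apply (has_limC_ext _ (fun n => (ef z1 z2 c d k (Z.of_nat n) - c * ef z1 z2 c d k (Z.of_nat n - 1)) / Cpowz d (Z.of_nat n))) in G3;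
        [|intros n; now rewrite !(ef_cd_sym z1 z2 d c)].
      apply (has_limC_ext _ (fun n => (ef y1 y2 c d l (Z.of_nat n) - c * ef y1 y2 c d l (Z.of_nat n - 1)) / Cpowz d (Z.of_nat n))) in G4;
        [|intros n; now rewrite !(ef_cd_sym y1 y2 d c)].
      assert (G := casorati_limit_ne _ _ c d _ _ _ _ Hc Hd Hne G1 G3 G2 G4).
      match goal with |- has_limC _ ?X => match type of G with has_limC _ ?Y => replace X with Y; [exact G|] end end.
      fold (Phi z1 z2 c) (Phi z1 z2 d) (Phi y1 y2 c) (Phi y1 y2 d). rewrite !HP. field. auto.
Qed.

End ColumnLimits.

(** * Christoffel-Darboux sums for both families *)

Lemma has_sumC_telescope_nat (a : nat -> C) (s A : C) :
  has_sumC (fun n => a n - a (S n)) s -> has_limC a A -> s = a 0%nat - A.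
Proof.
  intros Hs HA.
  apply has_sumC_series in Hs. destruct Hs as [Hs _]. apply is_series_C_iff in Hs.
  assert (E : forall n, sum_n (fun n => a n - a (S n)) n = a 0%nat - a (S n)).
  { induction n as [|n IH].
    - now rewrite sum_O.
    - rewrite sum_Sn, IH. unfold plus; simpl. match goal with |- ?a = ?b => change (@eq C a b) end. ring. }
  destruct Hs as [H1 H2].
  eapply has_limC_unique with (u := fun n => sum_n (fun n => a n - a (S n)) n).
  - split.
    + eapply is_lim_seq_ext; [|apply H1]. intros n. symmetry. apply sum_n_C.
    + eapply is_lim_seq_ext; [|apply H2]. intros n. symmetry. apply sum_n_C.
  - eapply has_limC_ext; [intros n; symmetry; apply E|].
    apply has_limC_minus; [apply has_limC_const|]. now apply -> has_limC_incr.
Qed.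

Section ColumnSums.
Implicit Types (c d u v w z x y t : C) (i j k m : Z).
Local Hint Extern 0 (q <> 0%R) => exact q0 : core.

Lemma pn_rec c d x n : c <> 0 -> d <> 0 ->
  (1 - qz n) * pn c d x n =
  (c + d - c * d * x * qz (n - 1)) * pn c d x (n - 1) - c * d * pn c d x (n - 2).
Proof. intros. rewrite !pn_def. now rewrite sN_rec. Qed.

Lemma pn_neg c d x n : (n < 0)%Z -> pn c d x n = 0.
Proof. intros. rewrite pn_def. now apply sN_neg. Qed.

Lemma qpoch_q_S n : qpoch q q (S n) = qpoch q q n * (1 - qz (Z.of_nat n + 1)).
Proof.
  simpl qpoch. rewrite qz_add, qz_nat, qz_1. f_equal. ring.
Qed.

(** The Christoffel-Darboux formula with summation factor (q;q)_n / (cd)^n; the lower boundary term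
    vanishes because p_(-1) = 0. *)
Lemma col_P c d x y (e s : C) : c <> 0 -> d <> 0 ->
  has_limC (fun n => (pn c d x (Z.of_nat n) * pn c d y (Z.of_nat n - 1) -
       pn c d x (Z.of_nat n - 1) * pn c d y (Z.of_nat n)) / Cpowz (c * d) (Z.of_nat n)) e ->
  has_sumC (fun n => qpoch q q n * qz (Z.of_nat n) / Cpowz (c * d) (Z.of_nat n) *
      (pn c d x (Z.of_nat n) * pn c d y (Z.of_nat n))) s ->
  (x - y) * s = - (qpoch_inf q q * e).
Proof.
  intros Hc Hd He Hs.
  set (a := fun n : nat => qpoch q q n * ((pn c d x (Z.of_nat n) * pn c d y (Z.of_nat n - 1) -
       pn c d x (Z.of_nat n - 1) * pn c d y (Z.of_nat n)) / Cpowz (c * d) (Z.of_nat n))).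
  assert (Hcd : c * d <> 0) by now apply Cmult_neq_0.
  assert (HA : has_limC a (qpoch_inf q q * e)).
  { apply has_limC_mult; auto. rewrite qpi_EE. apply qpoch_lim. }
  assert (T : has_sumC (fun n => a n - a (S n)) ((x - y) * s)).
  { eapply has_sumC_ext; [|apply has_sumC_scal, Hs]. intros n; cbv beta. unfold a.
    rewrite qpoch_q_S. replace (Z.of_nat (S n)) with (Z.of_nat n + 1)%Z by lia.
    set (N := Z.of_nat n). replace (N + 1 - 1)%Z with N by lia.
    rewrite Cpowz_S by auto.
    assert (R1 := pn_rec c d x (N + 1) Hc Hd). assert (R2 := pn_rec c d y (N + 1) Hc Hd).
    replace (N + 1 - 1)%Z with N in R1, R2 by lia. replace (N + 1 - 2)%Z with (N - 1)%Z in R1, R2 by lia.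
    assert (HN := Cpowz_neq0 (c * d) N Hcd).
    set (X1 := pn c d x (N + 1)) in *. set (X0 := pn c d x N) in *. set (X := pn c d x (N - 1)) in *.
    set (Y1 := pn c d y (N + 1)) in *. set (Y0 := pn c d y N) in *. set (Y := pn c d y (N - 1)) in *.
    replace (qpoch q q n * (1 - qz (N + 1)) * ((X1 * Y0 - X0 * Y1) / (c * d * Cpowz (c * d) N)))
      with (qpoch q q n * (((1 - qz (N + 1)) * X1 * Y0 - X0 * ((1 - qz (N + 1)) * Y1)) / (c * d * Cpowz (c * d) N)))
      by (unfold Cdiv; ring).
    rewrite R1, R2. field. auto. }
  rewrite (has_sumC_telescope_nat a _ _ T HA). unfold a.
  rewrite !(pn_neg _ _ _ (Z.of_nat 0 - 1)) by lia. unfold Cdiv. ring.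
Qed.

Lemma kap_bound_fixed z1 z2 c d k j : z1 <> 0 -> z2 <> 0 -> c <> 0 -> d <> 0 -> (j <= 0)%Z ->
  exists K A, (0 <= K)%R /\ (0 < A)%R /\ forall n : nat,
    (Cmod (kap z1 z2 c d k (j - Z.of_nat n)) <= K * thR A (Z.of_nat n))%R.
Proof.
  intros H1 H2 Hc Hd Hj.
  assert (P2 := Cmod_neq0 _ H2).
  destruct (kap_bound z1 z2 c d (Cmod (q / (z1 * qz k))) (Z.max 0 k) H1 H2 Hc Hd) as [K [HK B]].
  { apply Cmod_neq0, Cdiv_neq0; [apply q_neq0C|]. apply Cmult_neq_0; auto. apply qz_neq0. }
  { lia. }
  exists (K * (Cmod (ph z1 k) * thR (Cmod z2) (- j - k)))%R, (Cmod z2 * powerRZ q (- j - k))%R.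
  assert (Pq : (0 < powerRZ q (- j - k))%R) by (apply powerRZ_lt; lra).
  assert (PT := thR_pos (Cmod z2) (- j - k) P2).
  split; [|split].
  - apply Rmult_le_pos; auto. apply Rmult_le_pos; [apply Cmod_ge_0|lra].
  - now apply Rmult_lt_0_compat.
  - intros n. eapply Rle_trans; [apply B; [lra|lia]|].
    rewrite (Cmod_ph z2) by auto.
    replace (- (j - Z.of_nat n) - k)%Z with ((- j - k) + Z.of_nat n)%Z by lia.
    rewrite thR_add by auto. rewrite <- thR_scal by auto.
    rewrite powerRZ_exp_mul by auto. right. ring.
Qed.

(** One of two factors of type [thR] can be traded against the growth of [mu], and the other still
    tends to 0. *)
Lemma thR_ratio (A B D : R) n : (0 < A)%R -> (0 < B)%R -> (0 < D)%R ->
  (thR A n * thR B n = thR (A * B / D) n * thR D n)%R.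
Proof.
  intros. assert (D <> 0)%R by lra. rewrite !thR_def. rewrite powerRZ_div, powerRZ_mult by auto.
  field. now apply powerRZ_NOR.
Qed.

Lemma thR_nat_lim (A : R) : (0 < A)%R -> is_lim_seq (fun n => thR A (Z.of_nat n)) 0%R.
Proof.
  intros HA. destruct (summable_nat_inv _ (thR_summable A HA)) as [[s Hs] _].
  apply has_sum_is_series in Hs. apply ex_series_lim_0. now exists s.
Qed.

(* The summation factor that turns the recurrence of [Dk] into a telescoping sum. *)
Definition mu (z c d : C) n : C := qpoch_inf (qz (n + 1) / (c * d * z)) q / Cpowz (c * d) n.

Lemma mu_def (z c d : C) n : mu z c d n = qpoch_inf (qz (n + 1) / (c * d * z)) q / Cpowz (c * d) n.
Proof. reflexivity. Qed.

Lemma mu_rec (z c d : C) n : z <> 0 -> c <> 0 -> d <> 0 ->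
  mu z c d (n - 1) = mu z c d n * (c * d - qz n / z).
Proof.
  intros Hz Hc Hd. rewrite !mu_def. replace (n - 1 + 1)%Z with n by lia.
  assert (Hcd : c * d <> 0) by now apply Cmult_neq_0.
  assert (H0 := Cpowz_neq0 (c * d) (n - 1) Hcd).
  assert (E : Cpowz (c * d) n = c * d * Cpowz (c * d) (n - 1)).
  { rewrite <- Cpowz_S by auto. f_equal. lia. }
  rewrite E, (qpi_step (qz n / (c * d * z))), qz_add, qz_1.
  replace (qz n / (c * d * z) * q) with (qz n * q / (c * d * z)) by (field; auto).
  field. auto.
Qed.

(** At -oo the infinite product runs through ever larger arguments, and [qpi_bound_neg] limits its
    growth; D also takes in the power of cd. *)
Lemma mu_neg_bound (z c d : C) : z <> 0 -> c <> 0 -> d <> 0 ->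
  exists M D, (0 <= M)%R /\ (0 < D)%R /\ forall n : nat,
    (Cmod (mu z c d (- Z.of_nat n)) * thR D (Z.of_nat n) <= M)%R.
Proof.
  intros Hz Hc Hd. assert (Hcd : c * d <> 0) by now apply Cmult_neq_0.
  assert (Pcd := Cmod_neq0 _ Hcd).
  set (u := q / (c * d * z)).
  assert (H := qpi_bound_neg u).
  assert (P1 : (0 < 1 + Cmod u)%R) by (pose proof (Cmod_ge_0 u); lra).
  exists (Cmod (qpoch_inf u q)), (q / (1 + Cmod u) / Cmod (c * d))%R.
  assert (PD : (0 < q / (1 + Cmod u))%R) by (apply Rdiv_lt_0_compat; lra).
  split; [apply Cmod_ge_0|split; [apply Rdiv_lt_0_compat; auto|]].
  intros n. specialize (H n). rewrite thR_opp in H by auto.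
  rewrite mu_def, Cmod_div, Cmod_Cpowz by (auto; now apply Cpowz_neq0).
  assert (E := thR_scal (q / (1 + Cmod u)) (/ Cmod (c * d)) (Z.of_nat n) PD ltac:(now apply Rinv_0_lt_compat)).
  unfold Rdiv at 2. rewrite <- E, powerRZ_inv', powerRZ_neg' .
  replace (qz (- Z.of_nat n + 1) / (c * d * z)) with (u * qz (- Z.of_nat n)).
  2:{ unfold u. rewrite qz_add, qz_1. field. auto. }
  assert (PP : (0 < powerRZ (Cmod (c * d)) (Z.of_nat n))%R) by now apply powerRZ_lt.
  eapply Rle_trans; [|apply H]. right. field. lra.
Qed.

Definition Dk z1 z2 y1 y2 c d k (l : Z) n : C :=
  kap z1 z2 c d k n * kap y1 y2 c d l (n - 1) - kap z1 z2 c d k (n - 1) * kap y1 y2 c d l n.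

Lemma kap_rec_sides z1 z2 y1 y2 c d (l : Z) n : sides z1 z2 y1 y2 ->
  z1 <> 0 -> z2 <> 0 -> c <> 0 -> d <> 0 ->
  kap y1 y2 c d l n = (c + d - qz n * (y1 * qz l) / (z1 * z2)) * kap y1 y2 c d l (n - 1)
  - (c * d - qz n / (z1 * z2)) * kap y1 y2 c d l (n - 2).
Proof.
  intros [[-> ->]|[-> ->]] H1 H2 Hc Hd; rewrite kap_rec at 1 by auto; [reflexivity|].
  now rewrite (Cmult_comm z2 z1).
Qed.

Lemma Dk_rec z1 z2 y1 y2 c d k (l : Z) n : sides z1 z2 y1 y2 ->
  z1 <> 0 -> z2 <> 0 -> c <> 0 -> d <> 0 ->
  (z1 * qz k - y1 * qz l) * (qz n / (z1 * z2) * mu (z1 * z2) c d n *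
    (kap z1 z2 c d k (n - 1) * kap y1 y2 c d l (n - 1))) =
  Dk z1 z2 y1 y2 c d k l (n - 1) * mu (z1 * z2) c d (n - 1) -
  Dk z1 z2 y1 y2 c d k l n * mu (z1 * z2) c d n.
Proof.
  intros Hs H1 H2 Hc Hd.
  rewrite mu_rec by (auto; now apply Cmult_neq_0). unfold Dk.
  rewrite (kap_rec_sides z1 z2 z1 z2 c d k n (or_introl (conj eq_refl eq_refl))) by auto.
  rewrite (kap_rec_sides z1 z2 y1 y2 c d l n Hs) by auto.
  replace (n - 1 - 1)%Z with (n - 2)%Z by lia. field. auto.
Qed.

Lemma Dk_mu_lim z1 z2 y1 y2 c d k (l : Z) : z1 <> 0 -> z2 <> 0 -> y1 <> 0 -> y2 <> 0 ->
  c <> 0 -> d <> 0 ->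
  has_limC (fun n => Dk z1 z2 y1 y2 c d k l (- Z.of_nat n) * mu (z1 * z2) c d (- Z.of_nat n)) 0.
Proof.
  intros H1 H2 G1 G2 Hc Hd.
  destruct (kap_bound_fixed z1 z2 c d k 0 H1 H2 Hc Hd ltac:(lia)) as [K0 [A0 [HK0 [HA0 B0]]]].
  destruct (kap_bound_fixed z1 z2 c d k (-1) H1 H2 Hc Hd ltac:(lia)) as [K1 [A1 [HK1 [HA1 B1]]]].
  destruct (kap_bound_fixed y1 y2 c d l 0 G1 G2 Hc Hd ltac:(lia)) as [K2 [A2 [HK2 [HA2 B2]]]].
  destruct (kap_bound_fixed y1 y2 c d l (-1) G1 G2 Hc Hd ltac:(lia)) as [K3 [A3 [HK3 [HA3 B3]]]].
  destruct (mu_neg_bound (z1 * z2) c d) as [M [D [HM [HD BM]]]]; auto using Cmult_neq_0.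
  apply has_limC_le with (e := (fun n : nat => K0 * K3 * M * thR (A0 * A3 / D) (Z.of_nat n) +
     K1 * K2 * M * thR (A1 * A2 / D) (Z.of_nat n))%R).
  - intros n.
    specialize (B0 n). specialize (B1 n). specialize (B2 n). specialize (B3 n). specialize (BM n).
    replace (0 - Z.of_nat n)%Z with (- Z.of_nat n)%Z in B0, B2 by lia.
    replace (-1 - Z.of_nat n)%Z with (- Z.of_nat n - 1)%Z in B1, B3 by lia.
    unfold Dk.
    cbv beta. match goal with |- (Cmod ?y <= _)%R => match y with (?x - _) => replace y with x by ring end end.
    rewrite Cmod_mult.
    set (N := Z.of_nat n) in *.
    assert (Pm := Cmod_ge_0 (mu (z1 * z2) c d (- N))).
    assert (Hterm : forall (a b : C) (K A K' A' : R), (0 <= K)%R -> (0 <= K')%R -> (0 < A)%R -> (0 < A')%R ->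
      (Cmod a <= K * thR A N)%R -> (Cmod b <= K' * thR A' N)%R ->
      (Cmod (a * b) * Cmod (mu (z1 * z2) c d (- N)) <= K * K' * M * thR (A * A' / D) N)%R).
    { intros a b K A K' A' HK HK' HA HA' Ha Hb. rewrite Cmod_mult.
      assert (PR := thR_pos (A * A' / D) N ltac:(apply Rdiv_lt_0_compat; auto; now apply Rmult_lt_0_compat)).
      apply Rle_trans with (K * thR A N * (K' * thR A' N) * Cmod (mu (z1 * z2) c d (- N)))%R.
      - apply Rmult_le_compat_r; auto. apply Rmult_le_compat; auto using Cmod_ge_0.
      - replace (K * thR A N * (K' * thR A' N) * Cmod (mu (z1 * z2) c d (- N)))%R with
          (K * K' * (thR A N * thR A' N) * Cmod (mu (z1 * z2) c d (- N)))%R by ring.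
        rewrite (thR_ratio A A' D) by auto.
        replace (K * K' * (thR (A * A' / D) N * thR D N) * Cmod (mu (z1 * z2) c d (- N)))%R with
          (K * K' * thR (A * A' / D) N * (Cmod (mu (z1 * z2) c d (- N)) * thR D N))%R by ring.
        replace (K * K' * M * thR (A * A' / D) N)%R with (K * K' * thR (A * A' / D) N * M)%R by ring.
        apply Rmult_le_compat_l; auto. apply Rmult_le_pos; [now apply Rmult_le_pos|lra]. }
    eapply Rle_trans; [apply Rmult_le_compat_r; [apply Pm|apply Cmod_triangle]|].
    rewrite Cmod_opp, Rmult_plus_distr_r. apply Rplus_le_compat; apply Hterm; auto.
  - replace (Finite 0) with (Finite (K0 * K3 * M * 0 + K1 * K2 * M * 0)%R) by (f_equal; ring).
    apply is_lim_seq_plus'; (apply is_lim_seq_mult'; [apply is_lim_seq_const|apply thR_nat_lim]);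
      (apply Rdiv_lt_0_compat; auto; now apply Rmult_lt_0_compat).
Qed.

Lemma mu_lim (z c d : C) :
  c <> 0 -> d <> 0 -> has_limC (fun n => mu z c d (Z.of_nat n) * Cpowz (c * d) (Z.of_nat n)) 1.
Proof.
  intros Hc Hd. assert (Hcd : c * d <> 0) by now apply Cmult_neq_0.
  apply has_limC_ext with (fun n => qpoch_inf (q / (c * d * z) * qz (Z.of_nat n)) q).
  - intros n. rewrite mu_def, qz_add, qz_1.
    replace (qz (Z.of_nat n) * q / (c * d * z)) with (q / (c * d * z) * qz (Z.of_nat n)) by (unfold Cdiv; ring).
    field. now apply Cpowz_neq0.
  - replace (RtoC 1) with (qpoch_inf 0 q) by (rewrite qpi_EE; apply EE_0).
    apply has_limC_qpi, has_limC_qz_nat.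
Qed.

(** Here n runs over Z: the boundary term at -oo vanishes by the decay of kappa_n, and at oo [mu]
    behaves like (cd)^(-n), which gives e. *)
Lemma col_Q z1 z2 y1 y2 c d k (l : Z) (e s : C) : sides z1 z2 y1 y2 ->
  z1 <> 0 -> z2 <> 0 -> c <> 0 -> d <> 0 ->
  has_limC (fun n =>
      (ef z1 z2 c d k (Z.of_nat n) * ef y1 y2 c d l (Z.of_nat n - 1) -
       ef z1 z2 c d k (Z.of_nat n - 1) * ef y1 y2 c d l (Z.of_nat n)) /
      Cpowz (c * d) (Z.of_nat n)) e ->
  has_sumC (fun m => qz (m + 1) / (z1 * z2) * mu (z1 * z2) c d (m + 1) *
     (ef z1 z2 c d k m * ef y1 y2 c d l m)) s ->
  (z1 * qz k - y1 * qz l) * s = - e.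
Proof.
  intros Hs H1 H2 Hc Hd He Hsum.
  assert (Hy : y1 <> 0 /\ y2 <> 0) by (destruct Hs as [[-> ->]|[-> ->]]; auto). destruct Hy as [G1 G2].
  assert (Hcd : c * d <> 0) by now apply Cmult_neq_0.
  set (W := winv z1 c d k * winv y1 c d l).
  set (a := fun n => - (W * (Dk z1 z2 y1 y2 c d k l n * mu (z1 * z2) c d n))).
  assert (T : has_sumC (fun m => a (m + 1)%Z - a m) ((z1 * qz k - y1 * qz l) * s)).
  { eapply has_sumC_ext; [|apply has_sumC_scal, Hsum]. intros m; cbv beta.
    assert (E := Dk_rec z1 z2 y1 y2 c d k l (m + 1) Hs H1 H2 Hc Hd).
    replace (m + 1 - 1)%Z with m in E by lia. unfold a.
    replace (- (W * (Dk z1 z2 y1 y2 c d k l (m + 1) * mu (z1 * z2) c d (m + 1))) -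
       - (W * (Dk z1 z2 y1 y2 c d k l m * mu (z1 * z2) c d m))) with
      (W * (Dk z1 z2 y1 y2 c d k l m * mu (z1 * z2) c d m -
        Dk z1 z2 y1 y2 c d k l (m + 1) * mu (z1 * z2) c d (m + 1))) by ring.
    rewrite <- E, !ef_def. unfold W. ring. }
  rewrite (has_sumC_telescope a _ (- e) (- (W * 0)) T); [ring| |].
  - replace (- e) with (- (e * 1)) by ring. apply has_limC_opp.
    eapply has_limC_ext; [|apply has_limC_mult; [apply He|apply (mu_lim (z1 * z2) c d Hc Hd)]].
    intros n; cbv beta. rewrite !ef_def. unfold Dk, W. field. now apply Cpowz_neq0.
  - apply has_limC_opp, has_limC_mult; [apply has_limC_const|]. now apply Dk_mu_lim.
Qed.

(** [col_P] and [col_Q] share the limit e of [col_limit], and x - y may be divided out. The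
    proportionality dictates the relative weight of the two families in [dualC]. *)
Lemma col_total z1 z2 y1 y2 c d k (l : Z) (s t : C) : sides z1 z2 y1 y2 ->
  admissible z1 c -> admissible z2 c -> admissible z1 d -> admissible z2 d ->
  (q * Cmod d < Cmod c)%R -> (q * Cmod c < Cmod d)%R ->
  z1 * qz k <> y1 * qz l ->
  has_sumC (fun n => qpoch q q n * qz (Z.of_nat n) / Cpowz (c * d) (Z.of_nat n) *
      (pn c d (z1 * qz k) (Z.of_nat n) * pn c d (y1 * qz l) (Z.of_nat n))) s ->
  has_sumC (fun m => qz (m + 1) / (z1 * z2) * mu (z1 * z2) c d (m + 1) *
     (ef z1 z2 c d k m * ef y1 y2 c d l m)) t ->
  Phi z1 z2 c * Phi z1 z2 d * s = qpoch_inf q q * t.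
Proof.
  intros Hs A1 A2 B1 B2 Hcd Hdc Hne HP HQ.
  destruct (col_limit z1 z2 y1 y2 c d k l Hs A1 A2 B1 B2 Hcd Hdc) as [e [Euler1 E2]].
  assert (H1 : z1 <> 0) by apply A1. assert (H2 : z2 <> 0) by apply A2.
  assert (Hc : c <> 0) by apply A1. assert (Hd : d <> 0) by apply B1.
  assert (F1 := col_P c d _ _ e s Hc Hd Euler1 HP).
  assert (F2 := col_Q z1 z2 y1 y2 c d k l _ t Hs H1 H2 Hc Hd E2 HQ).
  assert (Hxy : z1 * qz k - y1 * qz l <> 0).
  { intros E. apply Hne. replace (z1 * qz k) with (y1 * qz l + (z1 * qz k - y1 * qz l)) by ring.
    rewrite E. ring. }
  apply (Cmult_reg_l (z1 * qz k - y1 * qz l)); auto.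
  replace ((z1 * qz k - y1 * qz l) * (Phi z1 z2 c * Phi z1 z2 d * s)) with
    (Phi z1 z2 c * Phi z1 z2 d * ((z1 * qz k - y1 * qz l) * s)) by ring.
  replace ((z1 * qz k - y1 * qz l) * (qpoch_inf q q * t)) with
    (qpoch_inf q q * ((z1 * qz k - y1 * qz l) * t)) by ring.
  rewrite F1, F2. ring.
Qed.

End ColumnSums.

(** * Reality, and the consequences of the positivity conditions *)

Definition isR (z : C) : Prop := Im z = 0%R.

Lemma isR_RtoC (r : R) : isR r.
Proof. reflexivity. Qed.

Lemma isR_eq z : isR z -> z = RtoC (Re z).
Proof. intros H. apply C_ext; [reflexivity|apply H]. Qed.

Lemma isR_plus (x y : C) : isR x -> isR y -> isR (x + y).
Proof. intros Hx Hy. rewrite (isR_eq x Hx), (isR_eq y Hy), <- RtoC_plus. apply isR_RtoC. Qed.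

Lemma isR_mult (x y : C) : isR x -> isR y -> isR (x * y).
Proof. intros Hx Hy. rewrite (isR_eq x Hx), (isR_eq y Hy), <- RtoC_mult. apply isR_RtoC. Qed.

Lemma isR_opp (x : C) : isR x -> isR (- x).
Proof. intros Hx. rewrite (isR_eq x Hx), <- RtoC_opp. apply isR_RtoC. Qed.

Lemma isR_minus (x y : C) : isR x -> isR y -> isR (x - y).
Proof. intros Hx Hy. unfold Cminus. auto using isR_plus, isR_opp. Qed.

Lemma isR_inv (x : C) : isR x -> isR (/ x).
Proof. intros Hx. rewrite (isR_eq x Hx). unfold isR, Cinv, Im; simpl. unfold Rdiv. ring. Qed.

Lemma isR_div (x y : C) : isR x -> isR y -> isR (x / y).
Proof. intros. unfold Cdiv. auto using isR_mult, isR_inv. Qed.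

Lemma isR_pow (x : C) (n : nat) : isR x -> isR (x ^ n).
Proof.
  intros Hx. induction n; [apply isR_RtoC|]. simpl. now apply isR_mult.
Qed.

Lemma isR_Cpowz (x : C) (n : Z) : isR x -> isR (Cpowz x n).
Proof.
  intros Hx. destruct n; simpl; [apply isR_RtoC|now apply isR_pow|now apply isR_inv, isR_pow].
Qed.

Lemma isR_lim (u : nat -> C) l : has_limC u l -> (forall n, isR (u n)) -> isR l.
Proof.
  intros [_ H] Hu. apply is_lim_seq_unique in H.
  rewrite (Lim_seq_ext _ (fun _ => 0%R)) in H by apply Hu. rewrite Lim_seq_const in H. unfold isR. congruence.
Qed.

Lemma isR_csum {I : Type} (f : I -> C) : summableC f -> (forall i, isR (f i)) -> isR (csum f).
Proof.
  intros Hf Hr. apply csum_spec in Hf. destruct Hf as [_ H].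
  eapply has_sum_unique; [apply H|]. eapply has_sum_ext; [|apply has_sum_zero].
  intros i; cbv beta. symmetry. apply Hr.
Qed.

Lemma isR_conj (x : C) : isR x -> Cconj x = x.
Proof. intros H. rewrite (isR_eq x H). apply C_ext; simpl; [reflexivity|ring]. Qed.

Create HintDb isR.
#[local] Hint Resolve isR_RtoC isR_plus isR_mult isR_opp isR_minus isR_inv isR_div isR_pow isR_Cpowz : isR.

(** * The basis of the Hilbert space *)

Section Reality.
Implicit Types (c d u v w z x y t : C) (i j k m : Z).
Local Hint Extern 0 (q <> 0%R) => exact q0 : core.

Lemma isR_qz k : isR (qz k).
Proof. apply isR_RtoC. Qed.

Lemma isR_iq k : isR (iq k).
Proof. rewrite iq_iqR. apply isR_RtoC. Qed.

Lemma isR_ph u k : isR u -> isR (ph u k).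
Proof. intros. rewrite ph_def. auto using isR_qz with isR. Qed.

Lemma isR_qpoch x n : isR x -> isR (qpoch x q n).
Proof.
  intros Hx. induction n as [|n IH]; [apply isR_RtoC|]. simpl. auto 8 with isR.
Qed.

Lemma isR_qpi x : isR x -> isR (qpoch_inf x q).
Proof.
  intros Hx. rewrite qpi_EE. eapply isR_lim; [apply qpoch_lim|]. intros n. now apply isR_qpoch.
Qed.

(** Covers a conjugate pair as well as two real numbers: the product of the j-th factors is 1 -
    (u+v) q^j + uv q^(2j). *)
Lemma isR_qpi2 u v : isR (u + v) -> isR (u * v) -> isR (qpoch_inf u q * qpoch_inf v q).
Proof.
  intros Hs Hp. rewrite !qpi_EE.
  eapply isR_lim; [apply has_limC_mult; apply qpoch_lim|]. intros n; cbv beta.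
  induction n as [|n IH]; [apply isR_mult; apply isR_RtoC|]. simpl qpoch.
  replace (qpoch u q n * (1 - u * q ^ n) * (qpoch v q n * (1 - v * q ^ n))) with
    (qpoch u q n * qpoch v q n * (1 - (u + v) * q ^ n + u * v * (q ^ n * q ^ n))) by ring.
  auto 10 with isR.
Qed.

Lemma isR_theta2 u v : u <> 0 -> v <> 0 -> isR (u + v) -> isR (u * v) -> isR (theta u q * theta v q).
Proof.
  intros Hu Hv Hs Hp. unfold theta.
  replace (qpoch_inf u q * qpoch_inf (q / u) q * (qpoch_inf v q * qpoch_inf (q / v) q)) with
    ((qpoch_inf u q * qpoch_inf v q) * (qpoch_inf (q / u) q * qpoch_inf (q / v) q)) by ring.
  apply isR_mult; apply isR_qpi2; auto.
  - replace (q / u + q / v) with (q * (u + v) / (u * v)) by (field; auto). auto with isR.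
  - replace (q / u * (q / v)) with (q * q / (u * v)) by (field; auto). auto with isR.
Qed.

Lemma one_minus_qz_neq0 n : (0 < n)%Z -> 1 - qz n <> 0.
Proof.
  intros Hn E. assert (n = 0%Z); [|lia]. apply qz_inj.
  replace (qz n) with (1 - (1 - qz n)) by ring. rewrite E. ring.
Qed.

Lemma isR_rec (A B f : Z -> C) : (forall n, isR (A n)) -> (forall n, isR (B n)) ->
  (forall n, (n < 0)%Z -> f n = 0) -> isR (f 0%Z) ->
  (forall n, (1 - qz n) * f n = A n * f (n - 1)%Z - B n * f (n - 2)%Z) -> forall n, isR (f n).
Proof.
  intros HA HB Hn H0 Hrec.
  assert (H : forall n : nat, isR (f (Z.of_nat n)) /\ isR (f (Z.of_nat n - 1)%Z)).
  { induction n as [|n [IH1 IH2]].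
    - split; auto. rewrite Hn by lia. apply isR_RtoC.
    - replace (Z.of_nat (S n) - 1)%Z with (Z.of_nat n) by lia. split; auto.
      assert (E := Hrec (Z.of_nat (S n))).
      replace (Z.of_nat (S n) - 1)%Z with (Z.of_nat n) in E by lia.
      replace (Z.of_nat (S n) - 2)%Z with (Z.of_nat n - 1)%Z in E by lia.
      assert (H1 := one_minus_qz_neq0 (Z.of_nat (S n)) ltac:(lia)).
      replace (f (Z.of_nat (S n))) with ((1 - qz (Z.of_nat (S n))) * f (Z.of_nat (S n)) / (1 - qz (Z.of_nat (S n))))
        by (field; auto).
      rewrite E. auto 8 using isR_qz with isR. }
  intros n. destruct (Z_lt_le_dec n 0); [rewrite Hn by auto; apply isR_RtoC|].
  replace n with (Z.of_nat (Z.to_nat n)) by lia. apply H.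
Qed.

Lemma isR_rn c d n : c <> 0 -> d <> 0 -> isR (c + d) -> isR (c * d) -> isR (rn c d n).
Proof.
  intros Hc Hd Hs Hp.
  apply (isR_rec (fun _ => c + d) (fun _ => c * d)); auto.
  - intros. now apply rn_neg.
  - rewrite rn_0. apply isR_RtoC.
  - intros. now apply rn_rec.
Qed.

Lemma isR_pn c d x n : c <> 0 -> d <> 0 -> isR (c + d) -> isR (c * d) -> isR x -> isR (pn c d x n).
Proof.
  intros Hc Hd Hs Hp Hx.
  apply (isR_rec (fun n => c + d - c * d * x * qz (n - 1)) (fun _ => c * d)).
  - intros; auto 8 using isR_qz with isR.
  - auto.
  - intros. now apply pn_neg.
  - rewrite pn_def, sN_0. apply isR_RtoC.
  - intros. now apply pn_rec.
Qed.

Lemma isR_kap z1 z2 c d k n : z1 <> 0 -> z2 <> 0 -> c <> 0 -> d <> 0 ->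
  isR z1 -> isR z2 -> isR (c + d) -> isR (c * d) -> isR (kap z1 z2 c d k n).
Proof.
  intros. rewrite kap_def. apply isR_csum; [now apply kt_summable|].
  intros p. rewrite kt_def. auto 8 using isR_ph, isR_iq, isR_rn with isR.
Qed.

Lemma isR_winv z c d k : isR z -> isR (c + d) -> isR (c * d) -> isR (winv z c d k).
Proof.
  intros Hz Hs Hp. rewrite winv_def. apply isR_qpi2.
  - replace (c * (z * qz k) + d * (z * qz k)) with ((c + d) * (z * qz k)) by ring. auto using isR_qz with isR.
  - replace (c * (z * qz k) * (d * (z * qz k))) with ((c * d) * ((z * qz k) * (z * qz k))) by ring.
    auto 8 using isR_qz with isR.
Qed.

Definition posR (z : C) : Prop := isR z /\ (0 < Re z)%R.

Lemma posR_mult x y : posR x -> posR y -> posR (x * y).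
Proof.
  intros [Hx Px] [Hy Py]. split; [now apply isR_mult|].
  rewrite (isR_eq x Hx), (isR_eq y Hy), <- RtoC_mult. simpl. now apply Rmult_lt_0_compat.
Qed.

Lemma posR_neq0 x : posR x -> x <> 0.
Proof. intros [_ H] ->. simpl in H. lra. Qed.

Lemma posR_inv x : posR x -> posR (/ x).
Proof.
  intros [Hx Px]. rewrite (isR_eq x Hx), <- RtoC_inv by now apply Rgt_not_eq.
  split; [apply isR_RtoC|]. simpl. now apply Rinv_0_lt_compat.
Qed.

(* The weight tends to 1 at 0, and its successive quotients are positive. *)
Lemma winv_pos z c d : (forall k, posR ((1 - c * (z * qz k)) * (1 - d * (z * qz k)))) ->
  isR z -> isR (c + d) -> isR (c * d) -> forall k, posR (winv z c d k).
Proof.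
  intros Hf Hz Hs Hp.
  destruct (winv_lim z c d) as [HL _].
  apply is_lim_seq_spec in HL. destruct (HL (mkposreal (1 / 2) ltac:(lra))) as [n0 Hn0].
  specialize (Hn0 n0 (Nat.le_refl _)). cbn [pos] in Hn0. change (Re 1) with 1%R in Hn0. apply Rabs_def2 in Hn0.
  assert (H0 : posR (winv z c d (Z.of_nat n0))) by (split; [now apply isR_winv|lra]).
  assert (Hiff : forall k, posR (winv z c d k) <-> posR (winv z c d (k + 1))).
  { intros k. rewrite (winv_S z c d k). split; intros H.
    - replace (winv z c d (k + 1)) with
        (/ ((1 - c * (z * qz k)) * (1 - d * (z * qz k))) *
         ((1 - c * (z * qz k)) * (1 - d * (z * qz k)) * winv z c d (k + 1))).
      + apply posR_mult; auto. now apply posR_inv.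
      + assert (E := posR_neq0 _ (Hf k)). rewrite Cmult_assoc, Cinv_l, Cmult_1_l by auto. reflexivity.
    - now apply posR_mult. }
  intros k. replace k with ((k - Z.of_nat n0) + Z.of_nat n0)%Z by lia.
  apply (Z_two_sided_ind (fun k => posR (winv z c d (k + Z.of_nat n0)))); [exact H0|].
  intros j. replace (j + 1 + Z.of_nat n0)%Z with (j + Z.of_nat n0 + 1)%Z by lia. apply Hiff.
Qed.

Lemma notqz_neg (r : R) : (r < 0)%R -> notqz r.
Proof.
  intros Hr k E. apply RtoC_inj in E. assert (0 < powerRZ q k)%R by (apply powerRZ_lt; lra). lra.
Qed.

Lemma notqz_im u : Im u <> 0%R -> notqz u.
Proof. intros H k ->. apply H. reflexivity. Qed.

Lemma powerRZ_q_mono j k : (j <= k)%Z -> (powerRZ q k <= powerRZ q j)%R.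
Proof.
  intros H. replace k with (j + (k - j))%Z by lia. rewrite powerRZ_add by auto.
  assert (P := powerRZ_q_le1 (k - j) ltac:(lia)). assert (0 < powerRZ q j)%R by (apply powerRZ_lt; lra). nra.
Qed.

Lemma notqz_between (r : R) k : (powerRZ q k < r < powerRZ q (k - 1))%R -> notqz r.
Proof.
  intros H j E. apply RtoC_inj in E. subst r.
  destruct (Z_le_gt_dec k j).
  - assert (P := powerRZ_q_mono k j ltac:(lia)). lra.
  - assert (P := powerRZ_q_mono j (k - 1) ltac:(lia)). lra.
Qed.

(** The common content of the three positivity cases, in the form used afterwards. [good_cd] and
    [good_dc] are the conditions of the asymptotics in n; [good_wp] and [good_wm] carry the sign of
    the weight from one point to the next. *)
Record admissible_pair (zm zp : R) c d : Prop := {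
  good_zpc : admissible zp c; good_zmc : admissible zm c;
  good_zpd : admissible zp d; good_zmd : admissible zm d;
  good_cd : (q * Cmod d < Cmod c)%R; good_dc : (q * Cmod c < Cmod d)%R;
  good_sum : isR (c + d); good_prod : posR (c * d);
  good_wp : forall k, posR ((1 - c * (zp * qz k)) * (1 - d * (zp * qz k)));
  good_wm : forall k, posR ((1 - c * (zm * qz k)) * (1 - d * (zm * qz k))) }.

Lemma same_side (u v : R) : (u < 1 /\ v < 1)%R \/ (1 < u /\ 1 < v)%R ->
  posR ((1 - u) * (1 - v)).
Proof.
  intros H. rewrite <- !RtoC_minus, <- RtoC_mult. split; [apply isR_RtoC|]. simpl.
  destruct H as [[]|[]]; [apply Rmult_lt_0_compat; lra|]. nra.
Qed.

(** z1 is the endpoint with the sign of c' and d', so that both real cases are covered. Since z1 c'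
    and z1 d' lie between the same neighbouring powers of q, 1 - c'x and 1 - d'x have equal signs on
    z1 q^Z and c'/d' lies between q and 1/q; on z2 q^Z both factors exceed 1. *)
Lemma admissible_pair_real (z1 z2 c' d' : R) k : (0 < z1 * c')%R -> (z2 * z1 < 0)%R -> (0 < c' * d')%R ->
  (powerRZ q k < z1 * c' < powerRZ q (k - 1))%R ->
  (powerRZ q k < z1 * d' < powerRZ q (k - 1))%R ->
  admissible z1 c' /\ admissible z2 c' /\ admissible z1 d' /\ admissible z2 d' /\
  (q * Cmod d' < Cmod c')%R /\ (q * Cmod c' < Cmod d')%R /\
  isR (c' + d') /\ posR (c' * d') /\
  (forall k, posR ((1 - c' * (z1 * qz k)) * (1 - d' * (z1 * qz k)))) /\
  (forall k, posR ((1 - c' * (z2 * qz k)) * (1 - d' * (z2 * qz k)))).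
Proof.
  intros Hzc Hz Hcd Hc Hd.
  assert (P : forall j, (0 < powerRZ q j)%R) by (intros; apply powerRZ_lt; lra).
  assert (Hzd : (0 < z1 * d')%R) by (specialize (P k); lra).
  assert (N1 : z1 <> 0%R) by (intros ->; lra). assert (N2 : z2 <> 0%R) by (intros ->; lra).
  assert (Nc : c' <> 0%R) by (intros ->; lra). assert (Nd : d' <> 0%R) by (intros ->; lra).
  assert (L1 : (z2 * c' < 0)%R).
  { assert (0 < z1 * z1)%R by (destruct (Rtotal_order z1 0) as [|[|]]; nra).
    assert ((z2 * c') * (z1 * z1) < 0)%R by nra. nra. }
  assert (L2 : (z2 * d' < 0)%R).
  { assert (0 < z1 * z1)%R by (destruct (Rtotal_order z1 0) as [|[|]]; nra).
    assert ((z2 * d') * (z1 * z1) < 0)%R by nra. nra. }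
  assert (Hk : (powerRZ q k = q * powerRZ q (k - 1))%R).
  { replace k with (1 + (k - 1))%Z at 1 by lia. rewrite powerRZ_add by auto. simpl. ring. }
  assert (HRC : forall r : R, r <> 0%R -> RtoC r <> 0) by (intros r Hr E; apply Hr, RtoC_inj, E).
  assert (A1 : (q * (z1 * d') < z1 * c')%R) by nra.
  assert (A2 : (q * (z1 * c') < z1 * d')%R) by nra.
  assert (S1 : forall k, posR ((1 - c' * (z1 * qz k)) * (1 - d' * (z1 * qz k)))).
  { intros j. change (qz j) with (RtoC (powerRZ q j)). rewrite <- !RtoC_mult. apply same_side.
    replace (c' * (z1 * powerRZ q j))%R with (z1 * c' * powerRZ q j)%R by ring.
    replace (d' * (z1 * powerRZ q j))%R with (z1 * d' * powerRZ q j)%R by ring.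
    assert (Pj := P j).
    assert (Euler1 : (powerRZ q k * powerRZ q j = powerRZ q (k + j))%R) by now rewrite powerRZ_add.
    assert (E2 : (powerRZ q (k - 1) * powerRZ q j = powerRZ q (k - 1 + j))%R) by now rewrite powerRZ_add.
    assert (T : forall u v w : R, (u < v < w)%R -> (u * powerRZ q j < v * powerRZ q j < w * powerRZ q j)%R).
    { intros u v w [H1 H2]. split; now apply Rmult_lt_compat_r. }
    apply T in Hc. apply T in Hd. rewrite Euler1, E2 in Hc, Hd.
    destruct (Z_le_gt_dec 0 (k - 1 + j)) as [Hle|Hgt].
    - left. assert (B := powerRZ_q_mono 0 (k - 1 + j) Hle). simpl in B. lra.
    - right. assert (B := powerRZ_q_mono (k + j) 0 ltac:(lia)). simpl in B. lra. }
  assert (S2 : forall k, posR ((1 - c' * (z2 * qz k)) * (1 - d' * (z2 * qz k)))).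
  { intros j. change (qz j) with (RtoC (powerRZ q j)). rewrite <- !RtoC_mult. apply same_side. left. assert (Pj := P j). split; nra. }
  unfold admissible.
  repeat match goal with |- _ /\ _ => split end; auto.
  - rewrite <- RtoC_mult, Rmult_comm. now apply (notqz_between _ k).
  - rewrite <- RtoC_mult, Rmult_comm. now apply notqz_neg.
  - rewrite <- RtoC_mult, Rmult_comm. now apply (notqz_between _ k).
  - rewrite <- RtoC_mult, Rmult_comm. now apply notqz_neg.
  - rewrite !Cmod_R. apply Rmult_lt_reg_l with (Rabs z1); [now apply Rabs_pos_lt|].
    rewrite <- Rabs_mult. replace (Rabs z1 * (q * Rabs d'))%R with (q * Rabs (z1 * d'))%R by (rewrite Rabs_mult; ring).
    rewrite !Rabs_pos_eq; lra.
  - rewrite !Cmod_R. apply Rmult_lt_reg_l with (Rabs z1); [now apply Rabs_pos_lt|].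
    rewrite <- Rabs_mult. replace (Rabs z1 * (q * Rabs c'))%R with (q * Rabs (z1 * c'))%R by (rewrite Rabs_mult; ring).
    rewrite !Rabs_pos_eq; lra.
  - auto with isR.
  - rewrite <- RtoC_mult. split; [apply isR_RtoC|exact Hcd].
Qed.

(** At real x the product of the two factors is |1 - dx|^2, and d x is not real. *)
Lemma admissible_conj (z : R) d : Im d <> 0%R -> z <> 0%R ->
  admissible z (Cconj d) /\ admissible z d /\
  forall k, posR ((1 - Cconj d * (z * qz k)) * (1 - d * (z * qz k))).
Proof.
  intros Hd Hz.
  assert (HRC : RtoC z <> 0) by (intros E; apply Hz, RtoC_inj, E).
  assert (Hd0 : d <> 0) by (intros ->; apply Hd; reflexivity).
  assert (Hd0' : Cconj d <> 0).
  { intros E. apply Hd0. apply C_ext; [apply (f_equal Re) in E; exact E|].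
    apply (f_equal Im) in E. change (- Im d = 0)%R in E. change (Im d = 0)%R. lra. }
  assert (Im1 : forall r : R, r <> 0%R -> Im (d * r) <> 0%R).
  { intros r Hr. simpl. rewrite Rmult_0_r, Rplus_0_l. apply Rmult_integral_contrapositive. now split. }
  assert (Im2 : forall r : R, r <> 0%R -> Im (Cconj d * r) <> 0%R).
  { intros r Hr. simpl. rewrite Rmult_0_r, Rplus_0_l. apply Rmult_integral_contrapositive. split; auto.
    now apply Ropp_neq_0_compat. }
  split; [|split].
  - repeat split; auto. apply notqz_im. auto.
  - repeat split; auto. apply notqz_im. auto.
  - intros k. change (qz k) with (RtoC (powerRZ q k)). rewrite <- RtoC_mult. set (r := (z * powerRZ q k)%R).
    assert (Hr : r <> 0%R).
    { unfold r. apply Rmult_integral_contrapositive. split; auto. now apply powerRZ_NOR. }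
    split; [unfold isR; simpl; ring|].
    assert (HI : (snd d * r <> 0)%R) by (apply Rmult_integral_contrapositive; now split).
    assert (Hsq : (0 < (snd d * r) * (snd d * r))%R).
    { destruct (Rtotal_order (snd d * r) 0) as [|[|]]; nra. }
    simpl.
    assert (Hs2 := Rle_0_sqr (1 - fst d * r)). unfold Rsqr in Hs2.
    lra.
Qed.

Lemma positivity_admissible (zm zp : R) c d : (zm < 0)%R -> (0 < zp)%R ->
  positivity q zm zp c d -> admissible_pair zm zp c d.
Proof.
  intros Hm Hp [[Hc Ec]|[(c' & d' & -> & -> & Hc & Hd & k & H1 & H2)|(c' & d' & -> & -> & Hc & Hd & k & H1 & H2)]].
  - subst c. assert (Hd : Im d <> 0%R) by (intros E; apply Hc; change (- Im d = 0)%R; lra).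
    destruct (admissible_conj zp d Hd ltac:(lra)) as (A1 & A2 & A3).
    destruct (admissible_conj zm d Hd ltac:(lra)) as (B1 & B2 & B3).
    assert (P := Cmod_neq0 d ltac:(apply A2)).
    split; auto.
    + rewrite Cmod_conj. nra.
    + rewrite Cmod_conj. nra.
    + unfold isR; simpl; ring.
    + split; [unfold isR; simpl; ring|]. simpl.
      assert (0 < snd d * snd d)%R by (change (snd d) with (Im d); destruct (Rtotal_order (Im d) 0) as [|[|]]; nra).
      assert (P2 := Rle_0_sqr (fst d)). unfold Rsqr in P2. lra.
  - destruct (admissible_pair_real zp zm c' d' k) as (A1 & A2 & A3 & A4 & A5 & A6 & A7 & A8 & A9 & A10); try nra.
    now split.
  - destruct (admissible_pair_real zm zp c' d' k) as (A1 & A2 & A3 & A4 & A5 & A6 & A7 & A8 & A9 & A10); try nra.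
    now split.
Qed.

End Reality.

(** * Gram matrix, dual weights and norms *)

Lemma has_sumC_sum_split {I J : Type} (f : I + J -> C) s : has_sumC f s ->
  exists s1 s2, has_sumC (fun i => f (inl i)) s1 /\ has_sumC (fun j => f (inr j)) s2 /\ s = s1 + s2.
Proof.
  intros H.
  assert (Hs : summableC f) by now exists s.
  destruct (summableC_inj inl ltac:(intros ? ? E; now injection E) f Hs) as [s1 H1].
  destruct (summableC_inj inr ltac:(intros ? ? E; now injection E) f Hs) as [s2 H2].
  exists s1, s2. repeat split; try apply H1; try apply H2.
  eapply has_sumC_unique; [apply H|]. now apply has_sumC_sum.
Qed.

Section Final.
Local Hint Extern 0 (q <> 0%R) => exact q0 : core.
Local Hint Resolve isR_RtoC isR_plus isR_mult isR_opp isR_minus isR_inv isR_div isR_pow isR_Cpowz : isR.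

Variables (zm zp : R) (c d : C).
Hypothesis hzm : (zm < 0)%R.
Hypothesis hzp : (0 < zp)%R.
Hypothesis hadm : admissible_pair zm zp c d.

(* [inl k] stands for zp q^k and [inr k] for zm q^k. *)
Definition s1 (x : Z + Z) : R := match x with inl _ => zp | inr _ => zm end.
Definition s2 (x : Z + Z) : R := match x with inl _ => zm | inr _ => zp end.
Definition kk (x : Z + Z) : Z := match x with inl k => k | inr k => k end.
Definition pt (x : Z + Z) : R := (s1 x * powerRZ q (kk x))%R.

(** P_n and Q_n without the scalars [scale]; the values are real, see [isR_basis]. *)
Definition basis (i : nat + Z) (x : Z + Z) : C :=
  match i with
  | inl n => pn c d (s1 x * qz (kk x)) (Z.of_nat n)
  | inr m => ef (s1 x) (s2 x) c d (kk x) m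
  end.

Definition scale (i : nat + Z) : C :=
  match i with
  | inl n => (-1) ^ n * qz (- tri (Z.of_nat n)) * qpoch q q n
  | inr m => Cpowz (-1) m * qz (- tri (m + 1))
  end.

Definition wtx (x : Z + Z) : C := wt (s1 x) c d (kk x).

Lemma pt_C x : RtoC (pt x) = s1 x * qz (kk x).
Proof. unfold pt. now rewrite RtoC_mult. Qed.

Lemma c0 : c <> 0. Proof. destruct hadm as [[_ [H _]]]. exact H. Qed.
Lemma d0 : d <> 0. Proof. destruct hadm as [_ _ [_ [H _]]]. exact H. Qed.
Lemma zp0 : RtoC zp <> 0. Proof. destruct hadm as [[H _]]. exact H. Qed.
Lemma zm0 : RtoC zm <> 0. Proof. destruct hadm as [_ [H _]]. exact H. Qed.
Local Hint Resolve c0 d0 zp0 zm0 : core.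

Lemma adm_zpc : admissible zp c. Proof. now destruct hadm. Qed.
Lemma adm_zmc : admissible zm c. Proof. now destruct hadm. Qed.
Lemma adm_zpd : admissible zp d. Proof. now destruct hadm. Qed.
Lemma adm_zmd : admissible zm d. Proof. now destruct hadm. Qed.
Local Hint Resolve adm_zpc adm_zmc adm_zpd adm_zmd : core.

Lemma s1_0 x : RtoC (s1 x) <> 0. Proof. destruct x; simpl; auto. Qed.
Lemma s2_0 x : RtoC (s2 x) <> 0. Proof. destruct x; simpl; auto. Qed.
Lemma adm_c x : admissible (s1 x) c. Proof. destruct x; simpl; now destruct hadm. Qed.
Lemma adm_d x : admissible (s1 x) d. Proof. destruct x; simpl; now destruct hadm. Qed.
Lemma adm_c2 x : admissible (s2 x) c. Proof. destruct x; simpl; now destruct hadm. Qed.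
Lemma adm_d2 x : admissible (s2 x) d. Proof. destruct x; simpl; now destruct hadm. Qed.
Local Hint Resolve s1_0 s2_0 adm_c adm_d adm_c2 adm_d2 : core.

Lemma isR_cd : isR (c * d). Proof. destruct hadm as [_ _ _ _ _ _ _ [H _]]. exact H. Qed.
Lemma isR_cpd : isR (c + d). Proof. now destruct hadm. Qed.
Local Hint Resolve isR_cd isR_cpd : core.

Lemma winv_posR x : posR (winv (s1 x) c d (kk x)).
Proof.
  apply winv_pos; auto; [|apply isR_RtoC].
  destruct x; simpl; [now destruct hadm|now destruct hadm].
Qed.

Lemma wtx_winv x : wtx x * winv (s1 x) c d (kk x) = 1.
Proof.
  unfold wtx. rewrite wt_def, <- winv_def. apply Cinv_l. apply posR_neq0, winv_posR.
Qed.

Lemma wtx_posR x : posR (wtx x).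
Proof. unfold wtx. rewrite wt_def, <- winv_def. apply posR_inv, winv_posR. Qed.

Lemma weight_wtx x : weight q c d (pt x) = wtx x.
Proof. unfold weight, wtx. rewrite wt_def, pt_C. unfold Cdiv. ring. Qed.

Lemma PQ_scale i x : PQ q zm zp c d i (pt x) = scale i * basis i x.
Proof.
  destruct i as [n|m]; simpl.
  - rewrite P_pn, pt_C by auto. ring.
  - assert (Hp : notqz (d * zp)) by (destruct hadm as [_ _ [_ [_ H]]]; exact H).
    assert (Hm : notqz (d * zm)) by (destruct hadm as [_ _ _ [_ [_ H]]]; exact H).
    destruct x as [k|k]; unfold pt; simpl.
    + rewrite Q_swap, Q_kap by auto. rewrite ef_def, winv_def, RtoC_mult. fold (qz k). ring.
    + rewrite Q_kap by auto. rewrite ef_def, winv_def, RtoC_mult. fold (qz k). ring.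
Qed.

Lemma isR_basis i x : isR (basis i x).
Proof.
  destruct i as [n|m]; simpl.
  - apply isR_pn; auto using isR_qz with isR.
  - rewrite ef_def. apply isR_mult; [apply isR_winv|apply isR_kap]; auto with isR.
Qed.

Lemma isR_scale i : isR (scale i).
Proof.
  destruct i; simpl.
  - apply isR_mult; [apply isR_mult; [apply isR_pow, isR_RtoC|apply isR_RtoC]|apply isR_qpoch, isR_RtoC].
  - apply isR_mult; [|apply isR_RtoC]. apply isR_Cpowz, isR_RtoC.
Qed.

Lemma m1_neq0 : RtoC (-1) <> 0.
Proof. intros E. apply RtoC_inj in E. lra. Qed.

Lemma scale_neq0 i : scale i <> 0.
Proof.
  destruct i; simpl.
  - apply Cmult_neq_0; [|apply qpoch_q_neq0]. apply Cmult_neq_0; [|apply qz_neq0].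
    apply Cpow_neq0, m1_neq0.
  - apply Cmult_neq_0; [|apply qz_neq0]. apply Cpowz_neq0, m1_neq0.
Qed.

Lemma abs_pt_inl k : RtoC (Rabs (pt (inl k))) = zp * qz k.
Proof.
  unfold pt; simpl. assert (0 < powerRZ q k)%R by (apply powerRZ_lt; lra).
  rewrite Rabs_pos_eq, RtoC_mult; [reflexivity|]. apply Rlt_le, Rmult_lt_0_compat; auto.
Qed.

Lemma abs_pt_inr k : RtoC (Rabs (pt (inr k))) = - (zm * qz k).
Proof.
  unfold pt; simpl. assert (0 < powerRZ q k)%R by (apply powerRZ_lt; lra).
  rewrite Rabs_left, RtoC_opp, RtoC_mult; [reflexivity|]. nra.
Qed.

Lemma abs_pt_pos x : (0 < Rabs (pt x))%R.
Proof.
  apply Rabs_pos_lt. unfold pt. apply Rmult_integral_contrapositive. split; [|now apply powerRZ_NOR].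
  destruct x; simpl; lra.
Qed.

(** Since zm < 0 < zp, the minus sign in the Jackson integral turns it into a sum with positive
    masses |x| over all points. *)
Lemma jackson_sum (F : R -> C) s : has_sumC (fun x => RtoC (Rabs (pt x)) * F (pt x)) s ->
  ex_jackson q zm zp F /\ jackson q zm zp F = (1 - q) * s.
Proof.
  intros H. apply has_sumC_sum_split in H. destruct H as (a & b & Ha & Hb & ->).
  assert (H := has_sumC_plus _ _ _ _ Ha Hb). cbv beta in H.
  assert (HJ : has_sumC (jackson_term q zm zp F) (a + b)).
  { eapply has_sumC_ext; [|apply H]. intros k; cbv beta. rewrite abs_pt_inl, abs_pt_inr.
    unfold jackson_term, pt; simpl. rewrite !RtoC_mult. fold (qz k). ring. }
  assert (HS : summableC (jackson_term q zm zp F)) by now exists (a + b).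
  destruct (summableC_inj (fun n : nat => Z.of_nat n) ltac:(intros ? ? E0; cbv beta in E0; lia) _ HS) as [u Hu].
  destruct (summableC_inj (fun n : nat => - Z.of_nat n - 1)%Z ltac:(intros ? ? E0; cbv beta in E0; lia) _ HS) as [v Hv].
  assert (E : a + b = u + v).
  { eapply has_sumC_unique; [apply HJ|]. now apply has_sumC_Z. }
  apply has_sumC_series in Hu. apply has_sumC_series in Hv.
  destruct Hu as [Hu1 Hu2]. destruct Hv as [Hv1 Hv2].
  split.
  - split; [now exists u|now exists v].
  - unfold jackson. rewrite Hu2, Hv2, E. reflexivity.
Qed.

(** The Jackson terms combine the points zp q^k and zm q^k; for nonnegative values their convergence
    controls each of the two separately. *)
Lemma jackson_summable (F : R -> C) (g : Z + Z -> R) : (forall x, F (pt x) = RtoC (g x)) ->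
  (forall x, 0 <= g x)%R -> ex_jackson q zm zp F -> summable (fun x => Rabs (pt x) * g x)%R.
Proof.
  intros HF Hg [[u Hu] [v Hv]].
  set (T := fun k : Z => (Rabs (pt (inl k)) * g (inl k) + Rabs (pt (inr k)) * g (inr k))%R).
  assert (P : forall x, (0 <= Rabs (pt x) * g x)%R).
  { intros x. apply Rmult_le_pos; auto. apply Rabs_pos. }
  assert (HT : forall k, jackson_term q zm zp F k = RtoC (T k)).
  { intros k. unfold T. rewrite RtoC_plus, !RtoC_mult, abs_pt_inl, abs_pt_inr, <- !HF.
    unfold jackson_term, pt; simpl. rewrite !RtoC_mult. fold (qz k). ring. }
  assert (P1 := fun k => P (inl k)). assert (P2 := fun k => P (inr k)). cbv beta in P1, P2.
  assert (HZ : summable T).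
  { apply is_series_C_iff in Hu. apply is_series_C_iff in Hv.
    assert (Hpos : forall k, (Rabs (T k) = T k)%R).
    { intros k. apply Rabs_pos_eq. unfold T. specialize (P1 k). specialize (P2 k). lra. }
    assert (G : forall (f : nat -> Z) (l : C),
      is_series (fun k : nat => Re (jackson_term q zm zp F (f k))) (Re l) -> summable (fun n => T (f n))).
    { intros f l Hl. exists (Re l).
      assert (Hl' : is_series (fun n => T (f n)) (Re l)).
      { eapply is_series_ext; [|apply Hl]. intros n; cbv beta. now rewrite HT. }
      apply is_series_has_sum; auto. exists (Re l). eapply is_series_ext; [|apply Hl'].
      intros n. now rewrite Hpos. }
    apply summable_Z; [apply (G (fun n : nat => Z.of_nat n) u), Hu|apply (G (fun n : nat => - Z.of_nat n - 1)%Z v), Hv]. }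
  destruct (summable_le (fun k => Rabs (pt (inl k)) * g (inl k))%R T) as [a Ha]; auto.
  { intros k. rewrite Rabs_pos_eq by auto. unfold T. specialize (P2 k). lra. }
  destruct (summable_le (fun k => Rabs (pt (inr k)) * g (inr k))%R T) as [b Hb]; auto.
  { intros k. rewrite Rabs_pos_eq by auto. unfold T. specialize (P1 k). lra. }
  exists (a + b)%R. now apply has_sum_sum.
Qed.

Definition I0 : C := Iab zp zm c d.

Definition normC (i : nat + Z) : C :=
  match i with
  | inl n => I0 * ((c * d) ^ n * qz (- Z.of_nat n) * iq (Z.of_nat n))
  | inr m => QQS zp zm c d m m - QQS zm zp c d m m
  end.

Lemma sides_sum (f : Z + Z -> C) (a b : C) :
  has_sumC (fun k => zp * qz k * f (inl k)) a -> has_sumC (fun k => zm * qz k * f (inr k)) b ->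
  has_sumC (fun x => RtoC (Rabs (pt x)) * f x) (a - b).
Proof.
  intros Ha Hb. apply (has_sumC_scal (-1)) in Hb.
  replace (a - b) with (a + (-1) * b) by ring. apply has_sumC_sum.
  - eapply has_sumC_ext; [|apply Ha]. intros k; cbv beta. now rewrite abs_pt_inl.
  - eapply has_sumC_ext; [|apply Hb]. intros k; cbv beta. rewrite abs_pt_inr. ring.
Qed.

(** The expansion in [PP_total] treats n and m differently and shows the vanishing only for m < n;
    symmetry supplies the rest. *)
Lemma gram_PP_le (n m : nat) : (m <= n)%nat ->
  has_sumC (fun x => RtoC (Rabs (pt x)) * (basis (inl n) x * basis (inl m) x * wtx x))
    (if Nat.eq_dec n m then normC (inl n) else 0).
Proof.
  intros Hle.
  assert (H := sides_sum (fun x => basis (inl n) x * basis (inl m) x * wtx x) _ _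
    (PP_side zp c d n m adm_zpc adm_zpd) (PP_side zm c d n m adm_zmc adm_zmd)).
  rewrite PP_total in H by auto.
  destruct (Nat.eq_dec n m) as [<-|Hne].
  - simpl normC. unfold I0. rewrite PP_norm in H by auto. exact H.
  - rewrite PP_orth_lt in H by (auto || lia). exact H.
Qed.

Lemma gram_PP (n m : nat) :
  has_sumC (fun x => RtoC (Rabs (pt x)) * (basis (inl n) x * basis (inl m) x * wtx x))
    (if Nat.eq_dec n m then normC (inl n) else 0).
Proof.
  destruct (Nat.le_ge_cases m n) as [H|H]; [now apply gram_PP_le|].
  assert (G := gram_PP_le m n H).
  replace (if Nat.eq_dec n m then normC (inl n) else 0) with (if Nat.eq_dec m n then normC (inl m) else 0).
  - eapply has_sumC_ext; [|apply G]. intros x; cbv beta. ring.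
  - destruct (Nat.eq_dec m n) as [E|E], (Nat.eq_dec n m) as [E'|E']; congruence.
Qed.

Lemma basis_Q_wtx m x : basis (inr m) x * wtx x = kap (s1 x) (s2 x) c d (kk x) m.
Proof.
  simpl. rewrite ef_def.
  replace (winv (s1 x) c d (kk x) * kap (s1 x) (s2 x) c d (kk x) m * wtx x) with
    (wtx x * winv (s1 x) c d (kk x) * kap (s1 x) (s2 x) c d (kk x) m) by ring.
  rewrite wtx_winv. ring.
Qed.

Lemma gram_PQ (n : nat) (m : Z) :
  has_sumC (fun x => RtoC (Rabs (pt x)) * (basis (inl n) x * basis (inr m) x * wtx x)) 0.
Proof.
  destruct (PQ_sum zp zm c d n m) as [V [H1 H2]]; auto.
  replace (RtoC 0) with (V - V) by ring.
  eapply has_sumC_ext; [|apply (sides_sum (fun x => basis (inl n) x * kap (s1 x) (s2 x) c d (kk x) m) V V H1 H2)].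
  intros x; cbv beta. rewrite <- basis_Q_wtx. ring.
Qed.

Lemma gram_QQ (n m : Z) :
  has_sumC (fun x => RtoC (Rabs (pt x)) * (basis (inr n) x * basis (inr m) x * wtx x))
    (if Z.eq_dec n m then normC (inr n) else 0).
Proof.
  assert (H1 := csum_spec _ (kap2_summable zp zm c d n m zp0 zm0 c0 d0)).
  assert (H2 := csum_spec _ (kap2_summable zm zp c d n m zm0 zp0 c0 d0)).
  rewrite <- QQS_def in H1, H2.
  assert (H := sides_sum (fun x => kap (s1 x) (s2 x) c d (kk x) n * kap (s1 x) (s2 x) c d (kk x) m *
    winv (s1 x) c d (kk x)) _ _ H1 H2).
  replace (if Z.eq_dec n m then normC (inr n) else 0) with (QQS zp zm c d n m - QQS zm zp c d n m).
  - eapply has_sumC_ext; [|apply H]. intros x; cbv beta. rewrite <- !basis_Q_wtx.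
    replace (basis (inr n) x * wtx x * (basis (inr m) x * wtx x) * winv (s1 x) c d (kk x)) with
      (basis (inr n) x * basis (inr m) x * wtx x * (wtx x * winv (s1 x) c d (kk x))) by ring.
    rewrite wtx_winv. ring.
  - destruct (Z.eq_dec n m) as [<-|Hne]; [reflexivity|]. now apply QQ_orth.
Qed.

Lemma gram i j : has_sumC (fun x => RtoC (Rabs (pt x)) * (basis i x * basis j x * wtx x))
    (if cdec i j then normC i else 0).
Proof.
  destruct i as [n|n], j as [m|m].
  - assert (H := gram_PP n m). destruct (Nat.eq_dec n m) as [E|E], (cdec (@inl nat Z n) (inl m)) as [E'|E']; congruence.
  - destruct (cdec (@inl nat Z n) (inr m)); [discriminate|]. apply gram_PQ.
  - destruct (cdec (@inr nat Z n) (inl m)); [discriminate|].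
    eapply has_sumC_ext; [|apply (gram_PQ m n)]. intros x; cbv beta. ring.
  - assert (H := gram_QQ n m). destruct (Z.eq_dec n m) as [E|E], (cdec (@inr nat Z n) (inr m)) as [E'|E']; congruence.
Qed.

Definition PhiPhi : C := Phi zp zm c * Phi zp zm d.

Lemma cd0 : c * d <> 0.
Proof. apply Cmult_neq_0; auto. Qed.
Local Hint Resolve cd0 : core.

Lemma Th_theta (u : C) : u <> 0 -> Th u = qpoch_inf q q * theta u q.
Proof. intros. rewrite Th_def. now apply theta_sum. Qed.

Lemma PhiPhi_theta : PhiPhi = qpoch_inf q q * qpoch_inf q q *
  (theta (c * zm) q * theta (d * zm) q * theta (c * zp) q * theta (d * zp) q).
Proof.
  unfold PhiPhi, Phi. rewrite !Th_theta by (apply Cmult_neq_0; auto).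
  rewrite !(Cmult_comm zp), !(Cmult_comm zm). field. apply qpi_q_neq0.
Qed.

Lemma theta_cz_neq0 (z : R) (a : C) : admissible z a -> theta (a * z) q <> 0.
Proof. intros (H1 & H2 & H3). apply theta_neq0; auto. now apply Cmult_neq_0. Qed.

Lemma PhiPhi_neq0 : PhiPhi <> 0.
Proof.
  rewrite PhiPhi_theta. assert (H := qpi_q_neq0).
  apply Cmult_neq_0; [now apply Cmult_neq_0|].
  do 3 (apply Cmult_neq_0; [|now apply theta_cz_neq0]). now apply theta_cz_neq0.
Qed.

Lemma isR_PhiPhi : isR PhiPhi.
Proof.
  rewrite PhiPhi_theta.
  replace (theta (c * zm) q * theta (d * zm) q * theta (c * zp) q * theta (d * zp) q) with
    ((theta (c * zm) q * theta (d * zm) q) * (theta (c * zp) q * theta (d * zp) q)) by ring.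
  assert (H : isR (qpoch_inf q q)) by (apply isR_qpi, isR_RtoC).
  apply isR_mult; [auto with isR|].
  apply isR_mult; apply isR_theta2; try (apply Cmult_neq_0; auto).
  - rewrite <- Cmult_plus_distr_r. auto with isR.
  - replace (c * zm * (d * zm)) with (c * d * (zm * zm)) by ring. auto with isR.
  - rewrite <- Cmult_plus_distr_r. auto with isR.
  - replace (c * zp * (d * zp)) with (c * d * (zp * zp)) by ring. auto with isR.
Qed.

(** A negative number is not a power of q: this keeps theta(c d zm zp) and all values of [mu] away
    from 0. *)
Lemma cdz_neg : exists r : R, (r < 0)%R /\ c * d * (zp * zm) = RtoC r.
Proof.
  destruct hadm as [_ _ _ _ _ _ _ [H1 H2] _ _].
  exists (Re (c * d) * (zp * zm))%R. split; [clear H1; revert H2; generalize (Re (c * d)); intros t Ht; assert (0 < t * zp)%R by (now apply Rmult_lt_0_compat); nra|].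
  rewrite (isR_eq _ H1) at 1. now rewrite <- !RtoC_mult.
Qed.

Lemma mu_neq0 n : mu (zp * zm) c d n <> 0.
Proof.
  destruct cdz_neg as [r [Hr E]]. rewrite mu_def, E. apply Cdiv_neq0; [|apply Cpowz_neq0; auto].
  apply qpi_neq0'. change (qz (n + 1)) with (RtoC (powerRZ q (n + 1))).
  rewrite <- RtoC_div by lra. apply notqz_neg.
  assert (P : (0 < powerRZ q (n + 1))%R) by (apply powerRZ_lt; lra).
  unfold Rdiv. assert (/ r < 0)%R by now apply Rinv_lt_0_compat. nra.
Qed.

Lemma isR_mu n : isR (mu (zp * zm) c d n).
Proof.
  rewrite mu_def. apply isR_div; [|apply isR_Cpowz; auto]. apply isR_qpi.
  apply isR_div; [apply isR_qz|]. auto with isR.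
Qed.

(* The norms up to a common factor, as they come out of the column sums. *)
Definition dualC (i : nat + Z) : C :=
  match i with
  | inl n => (c * d) ^ n * qz (- Z.of_nat n) * iq (Z.of_nat n)
  | inr m => - (PhiPhi / (qpoch_inf q q * (qz (m + 1) / (zp * zm) * mu (zp * zm) c d (m + 1))))
  end.

Lemma isR_dualC i : isR (dualC i).
Proof.
  assert (H := isR_PhiPhi). assert (H1 : isR (qpoch_inf q q)) by (apply isR_qpi, isR_RtoC).
  destruct i as [n|m]; simpl.
  - apply isR_mult; [|apply isR_iq]. apply isR_mult; [|apply isR_qz]. apply isR_pow; auto.
  - apply isR_opp, isR_div; auto. apply isR_mult; auto. apply isR_mult; [|apply isR_mu].
    apply isR_div; [apply isR_qz|]. auto with isR.
Qed.

Lemma zpzm0 : RtoC zp * RtoC zm <> 0.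
Proof. apply Cmult_neq_0; auto. Qed.
Local Hint Resolve zpzm0 : core.

Lemma dualC_neq0 i : dualC i <> 0.
Proof.
  destruct i as [n|m]; simpl.
  - apply Cmult_neq_0; [apply Cmult_neq_0|].
    + now apply Cpow_neq0.
    + apply qz_neq0.
    + rewrite iq_nat. apply Cinv_neq0, qpoch_q_neq0.
  - apply Copp_neq0, Cdiv_neq0; [apply PhiPhi_neq0|].
    apply Cmult_neq_0; [apply qpi_q_neq0|]. apply Cmult_neq_0; [|apply mu_neq0].
    apply Cdiv_neq0; auto. apply qz_neq0.
Qed.

Lemma I0_neq0 : I0 <> 0.
Proof.
  unfold I0. rewrite Iab_val by auto.
  assert (H := qpi_q_neq0).
  apply Cdiv_neq0;
    [|do 3 (apply Cmult_neq_0; [|now apply theta_cz_neq0]); now apply theta_cz_neq0].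
  apply Cmult_neq_0; [apply Cmult_neq_0; auto|]. apply Cmult_neq_0.
  - apply theta_neq0; [now apply Cdiv_neq0|]. rewrite <- RtoC_div by lra. apply notqz_neg.
    unfold Rdiv. assert (0 < / zp)%R by now apply Rinv_0_lt_compat. nra.
  - destruct cdz_neg as [r [Hr E]]. replace (c * d * zm * zp) with (c * d * (zp * zm)) by ring.
    rewrite E. apply theta_neq0; [|now apply notqz_neg]. intros E'. apply RtoC_inj in E'. lra.
Qed.

Lemma normC_ratio_P n : normC (inl n) = I0 * dualC (inl n).
Proof. reflexivity. Qed.

(** The recurrence of the norms and that of [mu] have the same coefficient, so their product [rr] is
    constant. Its value is not known at this stage. *)
Lemma normC_ratio_Q : exists r, forall m, normC (inr m) = r * dualC (inr m).
Proof.
  set (rr := fun m => normC (inr m) * (qz (m + 1) * mu (zp * zm) c d (m + 1))).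
  assert (Hrr : forall m, rr m = rr 0%Z).
  { apply Z_two_sided_ind; [reflexivity|]. intros k.
    assert (E : rr (k + 1)%Z = rr k); [|now rewrite E].
    unfold rr. simpl normC.
    assert (R := QQ_norm_rec zp zm c d (k + 1) zp0 zm0 c0 d0).
    assert (M := mu_rec (zp * zm) c d (k + 1 + 1) zpzm0 c0 d0).
    replace (k + 1 + 1 - 1)%Z with (k + 1)%Z in M by lia. replace (k + 1 - 1)%Z with k in R by lia.
    set (G1 := QQS zp zm c d (k + 1) (k + 1) - QQS zm zp c d (k + 1) (k + 1)) in *.
    set (G := QQS zp zm c d k k - QQS zm zp c d k k) in *.
    rewrite M. rewrite (qz_add (k + 1) 1), qz_1.
    replace (G1 * (qz (k + 1) * q * mu (zp * zm) c d (k + 1 + 1))) with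
      ((q * G1) * (qz (k + 1) * mu (zp * zm) c d (k + 1 + 1))) by ring.
    rewrite R. rewrite (qz_add (k + 1) 1), qz_1. ring. }
  exists (- (rr 0%Z * qpoch_inf q q / (PhiPhi * (zp * zm)))). intros m.
  rewrite <- (Hrr m). unfold rr. simpl dualC.
  assert (H1 := mu_neq0 (m + 1)). assert (H2 := qz_neq0 (m + 1)). assert (H3 := PhiPhi_neq0).
  assert (H4 := qpi_q_neq0). field. repeat split; auto.
Qed.

Lemma isR_normC i : isR (normC i).
Proof.
  assert (H := gram i i). destruct (cdec i i) as [_|]; [|congruence].
  rewrite <- (csum_unique _ _ H). apply isR_csum; [now exists (normC i)|].
  intros x. apply isR_mult; [apply isR_RtoC|].
  apply isR_mult; [apply isR_mult; apply isR_basis|apply wtx_posR].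
Qed.

(** If one Q_m had norm 0, then r = 0 and all would; as the masses are positive, every kappa_n would
    vanish at every point, against [kap_nonzero]. *)
Lemma normC_neq0 i : normC i <> 0.
Proof.
  destruct i as [n|m].
  - rewrite normC_ratio_P. apply Cmult_neq_0; [apply I0_neq0|apply dualC_neq0].
  - intros E.
    destruct normC_ratio_Q as [r Hr].
    assert (r = 0).
    { apply (Cmult_reg_l (dualC (inr m))); [|apply dualC_neq0]. rewrite Cmult_comm, <- Hr, E. ring. }
    subst r.
    destruct (kap_nonzero zp zm c d 0 zp0 zm0 c0 d0) as [n Hn].
    assert (H := gram (inr n) (inr n)). destruct (cdec (@inr nat Z n) (inr n)) as [_|]; [|congruence].
    rewrite Hr, Cmult_0_l in H.
    destruct H as [H _].
    set (f := fun x => Re (RtoC (Rabs (pt x)) * (basis (inr n) x * basis (inr n) x * wtx x))) in H.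
    assert (Hf : forall x, f x = (Rabs (pt x) * (Re (basis (inr n) x) * Re (basis (inr n) x) * Re (wtx x)))%R).
    { intros x. unfold f. rewrite (isR_eq _ (isR_basis (inr n) x)), (isR_eq _ (proj1 (wtx_posR x))).
      rewrite <- !RtoC_mult. reflexivity. }
    assert (Hpos : forall x, (0 <= f x)%R).
    { intros x. rewrite Hf. apply Rmult_le_pos; [apply Rabs_pos|].
      apply Rmult_le_pos; [apply Rle_0_sqr|apply Rlt_le, wtx_posR]. }
    assert (L := lsum_le_has_sum f _ (inl 0%Z :: nil) Hpos H ltac:(constructor; [intros []|constructor])).
    unfold lsum in L; cbn [fold_right] in L. change (Re 0) with 0%R in L.
    specialize (Hpos (inl 0%Z)). assert (F0 : f (inl 0%Z) = 0%R) by lra.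
    rewrite Hf in F0.
    assert (P1 := abs_pt_pos (inl 0%Z)). assert (P2 := proj2 (wtx_posR (inl 0%Z))).
    assert (E0 : Re (basis (inr n) (inl 0%Z)) = 0%R).
    { apply Rmult_integral in F0. destruct F0 as [F0|F0]; [lra|].
      apply Rmult_integral in F0. destruct F0 as [F0|F0]; [|lra].
      apply Rmult_integral in F0. tauto. }
    apply Hn. assert (Euler1 := isR_eq _ (isR_basis (inr n) (inl 0%Z))). rewrite E0 in Euler1.
    assert (K := basis_Q_wtx n (inl 0%Z)). rewrite Euler1, Cmult_0_l in K. symmetry. exact K.
Qed.

Lemma sides_s (x y : Z + Z) : sides (s1 x) (s2 x) (s1 y) (s2 y).
Proof. destruct x, y; simpl; [left|right|right|left]; split; reflexivity. Qed.

Lemma powerRZ_q_inj j k : powerRZ q j = powerRZ q k -> j = k.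
Proof.
  intros E. assert (j - k = 0)%Z; [|lia]. apply qz_inj. rewrite qz_sub.
  change (qz j) with (RtoC (powerRZ q j)). rewrite E. apply Cinv_r, qz_neq0.
Qed.

Lemma pt_inj x y : pt x = pt y -> x = y.
Proof.
  unfold pt. intros E.
  assert (P1 : (0 < powerRZ q (kk x))%R) by (apply powerRZ_lt; lra).
  assert (P2 : (0 < powerRZ q (kk y))%R) by (apply powerRZ_lt; lra).
  destruct x as [j|j], y as [k|k]; simpl in *; try nra;
    f_equal; apply powerRZ_q_inj; eapply Rmult_eq_reg_l; try exact E; lra.
Qed.

(* The boundary terms at n = oo of the sum over P_n and of the sum over Q_n cancel. *)
Lemma columns x y s : x <> y ->
  has_sumC (fun i => basis i x * basis i y / dualC i) s -> s = 0.
Proof.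
  intros Hxy H. apply has_sumC_sum_split in H. destruct H as (a & b & Ha & Hb & ->).
  assert (H4 := qpi_q_neq0). assert (H3 := PhiPhi_neq0).
  assert (Ha' : has_sumC (fun n => qpoch q q n * qz (Z.of_nat n) / Cpowz (c * d) (Z.of_nat n) *
      (pn c d (s1 x * qz (kk x)) (Z.of_nat n) * pn c d (s1 y * qz (kk y)) (Z.of_nat n))) a).
  { eapply has_sumC_ext; [|apply Ha]. intros n; cbv beta. simpl basis. simpl dualC.
    rewrite qz_opp, iq_nat, Cpowz_nat.
    assert (T1 := qz_neq0 (Z.of_nat n)). assert (T2 := qpoch_q_neq0 n).
    assert (T3 := Cpow_neq0 (c * d) n cd0). field. auto. }
  assert (Hzz : RtoC (s1 x) * s2 x = zp * zm) by (destruct x; simpl; ring).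
  assert (HPhi : Phi (s1 x) (s2 x) c * Phi (s1 x) (s2 x) d = PhiPhi).
  { unfold PhiPhi. destruct x; simpl; [reflexivity|]. now rewrite !(Phi_sym zm zp). }
  apply (has_sumC_scal (- (PhiPhi / qpoch_inf q q))) in Hb.
  assert (Hb' : has_sumC (fun m => qz (m + 1) / (s1 x * s2 x) * mu (s1 x * s2 x) c d (m + 1) *
     (ef (s1 x) (s2 x) c d (kk x) m * ef (s1 y) (s2 y) c d (kk y) m)) (- (PhiPhi / qpoch_inf q q) * b)).
  { eapply has_sumC_ext; [|apply Hb]. intros m; cbv beta. rewrite Hzz. simpl basis. simpl dualC.
    assert (T1 := mu_neq0 (m + 1)). assert (T2 := qz_neq0 (m + 1)). field. repeat split; auto. }
  assert (Hne : RtoC (s1 x) * qz (kk x) <> s1 y * qz (kk y)).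
  { rewrite <- !pt_C. intros E. apply RtoC_inj in E. now apply Hxy, pt_inj. }
  assert (K := col_total (s1 x) (s2 x) (s1 y) (s2 y) c d (kk x) (kk y) _ _ (sides_s x y)
    (adm_c x) (adm_c2 x) (adm_d x) (adm_d2 x) ltac:(now destruct hadm) ltac:(now destruct hadm) Hne Ha' Hb').
  rewrite HPhi in K. apply (Cmult_reg_l PhiPhi); auto.
  rewrite Cmult_plus_distr_l, K. field. auto.
Qed.

(** The point masses of the measure divided by 1 - q, which is W in the completeness argument. *)
Definition mass (x : Z + Z) : R := (Rabs (pt x) * Re (wtx x))%R.
Definition basisR (i : nat + Z) (x : Z + Z) : R := Re (basis i x).
Definition normR (i : nat + Z) : R := Re (normC i).
Definition dualR (i : nat + Z) : R := Re (dualC i).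

Lemma basis_R i x : basis i x = RtoC (basisR i x).
Proof. apply isR_eq, isR_basis. Qed.

Lemma wtx_R x : wtx x = RtoC (Re (wtx x)).
Proof. apply isR_eq, wtx_posR. Qed.

Lemma normC_R i : normC i = RtoC (normR i).
Proof. apply isR_eq, isR_normC. Qed.

Lemma dualC_R i : dualC i = RtoC (dualR i).
Proof. apply isR_eq, isR_dualC. Qed.

Lemma mass_pos x : (0 < mass x)%R.
Proof. apply Rmult_lt_0_compat; [apply abs_pt_pos|apply wtx_posR]. Qed.

Lemma normR_neq0 i : normR i <> 0%R.
Proof. intros E. apply (normC_neq0 i). now rewrite normC_R, E. Qed.

Lemma dualR_neq0 i : dualR i <> 0%R.
Proof. intros E. apply (dualC_neq0 i). now rewrite dualC_R, E. Qed.

Lemma gram_R i j : has_sum (fun x => mass x * (basisR i x * basisR j x))%R (if cdec i j then normR i else 0%R).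
Proof.
  destruct (gram i j) as [H _].
  replace (if cdec i j then normR i else 0%R) with (Re (if cdec i j then normC i else 0))
    by (destruct (cdec i j); reflexivity).
  eapply has_sum_ext; [|apply H]. intros x; cbv beta. rewrite !basis_R, (wtx_R x), <- !RtoC_mult.
  unfold mass. match goal with |- Re (RtoC ?a) = _ => change (Re (RtoC a)) with a end. ring.
Qed.

Lemma gram_R_orth i j : i <> j -> has_sum (fun x => mass x * (basisR i x * basisR j x))%R 0%R.
Proof. intros Hne. assert (H := gram_R i j). now destruct (cdec i j). Qed.

Lemma gram_R_norm i : has_sum (fun x => mass x * (basisR i x * basisR i x))%R (normR i).
Proof. assert (H := gram_R i i). now destruct (cdec i i). Qed.

Lemma ratio_R_bounded : exists B, forall i, (Rabs (normR i / dualR i) <= B)%R.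
Proof.
  destruct normC_ratio_Q as [r Hr]. exists (Cmod I0 + Cmod r)%R. intros i.
  assert (P1 := Cmod_ge_0 I0). assert (P2 := Cmod_ge_0 r).
  rewrite <- Cmod_R, RtoC_div, <- normC_R, <- dualC_R by apply dualR_neq0.
  assert (H := dualC_neq0 i).
  destruct i as [n|m].
  - rewrite normC_ratio_P. replace (I0 * dualC (inl n) / dualC (inl n)) with I0 by (field; auto). lra.
  - rewrite Hr. replace (r * dualC (inr m) / dualC (inr m)) with r by (field; auto). lra.
Qed.

Lemma columns_R x y s : x <> y -> has_sum (fun i => basisR i x * basisR i y / dualR i)%R s -> s = 0%R.
Proof.
  intros Hxy H. apply has_sumC_RtoC in H. apply RtoC_inj, (columns x y _ Hxy).
  eapply has_sumC_ext; [|apply H]. intros i; cbv beta.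
  rewrite !basis_R, dualC_R, RtoC_div, RtoC_mult by apply dualR_neq0. reflexivity.
Qed.

Lemma basisR_0 x : basisR (inl 0%nat) x <> 0%R.
Proof. unfold basisR. simpl basis. rewrite pn_def, sN_0. simpl. lra. Qed.

(* The norm of Q_n is not summed directly: it is forced by the completeness argument. *)
Lemma normC_val i : normC i = I0 * dualC i.
Proof.
  destruct ratio_R_bounded as [B HB].
  assert (H := norm_ratio mass basisR normR dualR B mass_pos normR_neq0 dualR_neq0 gram_R_orth gram_R_norm HB columns_R _ basisR_0 i).
  rewrite normC_R, H, dualC_R, RtoC_mult. f_equal. rewrite ratio_def.
  rewrite RtoC_div, <- normC_R, <- dualC_R by apply dualR_neq0. rewrite normC_ratio_P. field. apply dualC_neq0.
Qed.

Lemma PQ_jackson i j :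
  let g := fun x : R => PQ q zm zp c d i x * PQ q zm zp c d j x * weight q c d x in
  ex_jackson q zm zp g /\
  jackson q zm zp g = (1 - q) * (scale i * scale j * (if cdec i j then normC i else 0)).
Proof.
  intros g. apply jackson_sum.
  eapply has_sumC_ext; [|apply has_sumC_scal, (gram i j)].
  intros x; cbv beta. unfold g. rewrite !PQ_scale, weight_wtx. ring.
Qed.

Lemma one_minus_q_neq0 : RtoC 1 - q <> 0.
Proof. rewrite <- RtoC_minus. intros E. apply RtoC_inj in E. lra. Qed.

Lemma PQ_orthogonality i j (K : C) : (i = j -> scale i * scale i * normC i = K) ->
  let g := fun x : R => PQ q zm zp c d i x * PQ q zm zp c d j x * weight q c d x in
  ex_jackson q zm zp g /\
  1 / (1 - q) * jackson q zm zp g = (if cdec i j then K else 0).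
Proof.
  intros HK g. destruct (PQ_jackson i j) as [H1 H2]. split; auto.
  unfold g. rewrite H2. assert (H := one_minus_q_neq0).
  destruct (cdec i j) as [<-|].
  - rewrite HK by auto. field. auto.
  - field. auto.
Qed.

Lemma tri_opp_double n : (- tri n + - tri n = - (n * (n - 1)))%Z.
Proof. assert (H := tri_double n). lia. Qed.

Lemma m1_sq (n : nat) : RtoC (-1) ^ n * RtoC (-1) ^ n = 1.
Proof. rewrite <- Cpow_mult. replace (RtoC (-1) * RtoC (-1)) with (RtoC 1).
  - induction n; simpl; [reflexivity|]. rewrite IHn. ring.
  - rewrite <- RtoC_mult. f_equal. ring.
Qed.

Lemma norm_P n : scale (inl n) * scale (inl n) * normC (inl n) =
  qpoch q q n * (c * d) ^ n * powerRZ q (- (Z.of_nat n ^ 2)) *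
  (zp * qpoch_inf q q * (theta (zm / zp) q * theta (c * d * zm * zp) q)
          / (theta (c * zm) q * theta (d * zm) q * theta (c * zp) q * theta (d * zp) q)).
Proof.
  rewrite normC_ratio_P. unfold I0. rewrite Iab_val by auto. simpl scale. simpl dualC.
  set (X := zp * qpoch_inf q q * (theta (zm / zp) q * theta (c * d * zm * zp) q)
          / (theta (c * zm) q * theta (d * zm) q * theta (c * zp) q * theta (d * zp) q)).
  replace ((-1) ^ n * qz (- tri (Z.of_nat n)) * qpoch q q n * ((-1) ^ n * qz (- tri (Z.of_nat n)) * qpoch q q n) *
    (X * ((c * d) ^ n * qz (- Z.of_nat n) * iq (Z.of_nat n)))) with
    (((-1) ^ n * (-1) ^ n) * (qz (- tri (Z.of_nat n)) * qz (- tri (Z.of_nat n)) * qz (- Z.of_nat n)) *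
      (qpoch q q n * qpoch q q n * iq (Z.of_nat n)) * (c * d) ^ n * X) by ring.
  rewrite m1_sq, <- !qz_add, tri_opp_double, iq_nat.
  change (RtoC (powerRZ q (- (Z.of_nat n ^ 2)))) with (qz (- (Z.of_nat n ^ 2))).
  replace (- (Z.of_nat n * (Z.of_nat n - 1)) + - Z.of_nat n)%Z with (- (Z.of_nat n ^ 2))%Z by ring.
  assert (H := qpoch_q_neq0 n). 
  replace (qpoch q q n * qpoch q q n * / qpoch q q n) with (qpoch q q n) by (field; auto). ring.
Qed.

Lemma mzz0 : - RtoC zm * zp <> 0.
Proof. apply Cmult_neq_0; auto. now apply Copp_neq0. Qed.

Lemma m1z_sq (n : Z) : Cpowz (-1) n * Cpowz (-1) n = 1.
Proof.
  rewrite <- Cpowz_mult by apply m1_neq0.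
  replace (RtoC (-1) * RtoC (-1)) with (RtoC 1) by (rewrite <- RtoC_mult; f_equal; ring).
  rewrite Cpowz_RtoC by lra. f_equal. 
  destruct n; simpl; [reflexivity| |]; rewrite pow1; field.
Qed.

(** Trades the infinite product in [mu], which stands in the denominator of the dual weight, for the
    one in the numerator of the norm of Q_n; the theta function itself reduces to theta(c d zm zp)
    from the total mass. *)
Lemma theta_split n : theta (c * d * zm * zp * qz (- n - 1)) q =
  qpoch_inf (c * d * zm * zp * qz (- n - 1)) q * qpoch_inf (qz (n + 1 + 1) / (c * d * (zp * zm))) q.
Proof.
  unfold theta. do 2 f_equal. rewrite (qz_add (n + 1)), qz_1.
  replace (- n - 1)%Z with (- (n + 1))%Z by lia. rewrite qz_opp. field.
  repeat split; auto. apply qz_neq0.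
Qed.

Lemma norm_Q n : scale (inr n) * scale (inr n) * normC (inr n) =
  qpoch_inf (c * d * zm * zp * powerRZ q (- n - 1)) q
          / (Cpowz (- zm * zp) n * powerRZ q (n * (n + 1) / 2)) *
  (zp * qpoch_inf q q ^ 2 * theta (zm / zp) q).
Proof.
  (* The four theta functions in the denominator of the total mass cancel against those in
     [PhiPhi]. *)
  rewrite normC_val. unfold I0. rewrite Iab_val by auto. simpl scale. simpl dualC.
  rewrite PhiPhi_theta, mu_def.
  change (RtoC (powerRZ q (- n - 1))) with (qz (- n - 1)).
  replace (n * (n + 1) / 2)%Z with (tri (n + 1)) by (unfold tri; f_equal; ring).
  change (RtoC (powerRZ q (tri (n + 1)))) with (qz (tri (n + 1))).
  assert (U0 : c * d * zm * zp <> 0).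
  { replace (c * d * zm * zp) with (c * d * (zp * zm)) by ring. apply Cmult_neq_0; auto. }
  assert (HT := theta_qz (c * d * zm * zp * qz (- n - 1)) (n + 1)).
  rewrite theta_split in HT.
  replace (c * d * zm * zp * qz (- n - 1) * qz (n + 1)) with (c * d * zm * zp) in HT.
  2:{ transitivity (c * d * zm * zp * (qz (- n - 1) * qz (n + 1))); [|ring].
      rewrite <- qz_add. replace (- n - 1 + (n + 1))%Z with 0%Z by lia. rewrite qz_0. ring. }
  specialize (HT ltac:(apply Cmult_neq_0; auto; apply qz_neq0)).
  rewrite ph_qz in HT by auto.
  set (A := qpoch_inf (c * d * zm * zp * qz (- n - 1)) q) in *.
  assert (HB := mu_neq0 (n + 1)). rewrite mu_def in HB.
  set (Bq := qpoch_inf (qz (n + 1 + 1) / (c * d * (zp * zm))) q) in *.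
  assert (HB0 : Bq <> 0) by (intros E; apply HB; rewrite E; unfold Cdiv; ring).
  replace (ph (c * d * zm * zp) (n + 1)) with
    (Cpowz (c * d) (n + 1) * ((- zm * zp) * Cpowz (- zm * zp) n) * qz (tri (n + 1))) in HT.
  2:{ rewrite <- Cpowz_S by apply mzz0. rewrite <- Cpowz_mult by auto using mzz0.
      rewrite ph_def. do 2 f_equal. ring. }
  set (T0 := theta (c * d * zm * zp) q) in *.
  replace A with (T0 * (Cpowz (c * d) (n + 1) * (- zm * zp * Cpowz (- zm * zp) n) * qz (tri (n + 1)) *
     qz ((- n - 1) * (n + 1))) / Bq) by (rewrite HT; field; auto).
  replace (Cpowz (-1) n * qz (- tri (n + 1)) * (Cpowz (-1) n * qz (- tri (n + 1)))) with
    (qz (- tri (n + 1)) * qz (- tri (n + 1))).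
  2:{ transitivity (Cpowz (-1) n * Cpowz (-1) n * (qz (- tri (n + 1)) * qz (- tri (n + 1)))); [rewrite m1z_sq|]; ring. }
  rewrite <- qz_add, tri_opp_double.
  replace ((- n - 1) * (n + 1))%Z with (- ((n + 1) * (n + 1 - 1)) + - (n + 1))%Z by ring.
  rewrite (qz_add _ (- (n + 1))), (qz_opp (n + 1)).
  assert (N1 := qz_neq0 (n + 1)). assert (N2 := qz_neq0 (tri (n + 1))).
  assert (N3 := Cpowz_neq0 _ n mzz0). assert (N4 := Cpowz_neq0 _ (n + 1) cd0).
  assert (N5 := qpi_q_neq0).
  assert (M1 := theta_cz_neq0 _ _ adm_zpc). assert (M2 := theta_cz_neq0 _ _ adm_zmc).
  assert (M3 := theta_cz_neq0 _ _ adm_zpd). assert (M4 := theta_cz_neq0 _ _ adm_zmd).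
  simpl Cpow.
  set (th := theta (zm / zp) q).
  field. repeat split; auto.
Qed.

Lemma inner_PQ i j : inner q zm zp c d (PQ q zm zp c d i) (PQ q zm zp c d j) =
  (1 - q) * (scale i * scale j * (if cdec i j then normC i else 0)).
Proof.
  unfold inner. apply jackson_sum.
  eapply has_sumC_ext; [|apply has_sumC_scal, (gram i j)].
  intros x; cbv beta. rewrite !PQ_scale, weight_wtx.
  rewrite (isR_conj (scale j * basis j x)) by (apply isR_mult; [apply isR_scale|apply isR_basis]). ring.
Qed.

Lemma lincomb_app {I : Type} (f : I -> R -> C) l m x :
  lincomb f (l ++ m) x = lincomb f l x + lincomb f m x.
Proof.
  induction l as [|p l IH]; simpl; [ring|]. unfold lincomb in *. rewrite IH. ring.
Qed.

(** a is 1 or the imaginary unit: real and imaginary parts are approximated by separate real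
    combinations. *)
Lemma lincomb_PQ (a : C) (l : list (R * (nat + Z))) x :
  lincomb (PQ q zm zp c d) (map (fun p : R * (nat + Z) => (a * fst p / scale (snd p), snd p)) l) (pt x) =
  a * RtoC (rcomb basisR l x).
Proof.
  induction l as [|[r i] l IH].
  - unfold lincomb, rcomb; simpl. ring.
  - change (lincomb (PQ q zm zp c d) (map (fun p : R * (nat + Z) => (a * fst p / scale (snd p), snd p)) ((r, i) :: l)) (pt x))
      with (a * r / scale i * PQ q zm zp c d i (pt x) +
        lincomb (PQ q zm zp c d) (map (fun p : R * (nat + Z) => (a * fst p / scale (snd p), snd p)) l) (pt x)).
    change (rcomb basisR ((r, i) :: l) x) with (r * basisR i x + rcomb basisR l x)%R.
    rewrite IH, PQ_scale, basis_R, RtoC_plus, RtoC_mult. assert (H := scale_neq0 i). field. auto.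
Qed.

(** The squared norm is (1 - q) s, and 0 < 1 - q < 1. *)
Lemma normH_lt (f : R -> C) (g : Z + Z -> R) s eps :
  (forall x, f (pt x) * Cconj (f (pt x)) = RtoC (g x)) ->
  has_sum (fun x => mass x * g x)%R s -> (0 <= s)%R -> (s < eps * eps)%R -> (0 < eps)%R ->
  (normH q zm zp c d f < eps)%R.
Proof.
  intros Hf Hs Hs0 Hse He. unfold normH, inner.
  assert (H : jackson q zm zp (fun x => f x * Cconj (f x) * weight q c d x) = (1 - q) * RtoC s).
  { apply jackson_sum. eapply has_sumC_ext; [|apply has_sumC_RtoC, Hs].
    intros x; cbv beta. rewrite Hf, weight_wtx, (wtx_R x), <- !RtoC_mult. f_equal. unfold mass. ring. }
  rewrite H, <- RtoC_minus, <- RtoC_mult.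
  match goal with |- context [Re (RtoC ?a)] => change (Re (RtoC a)) with a end.
  rewrite <- (sqrt_square eps) by lra. apply sqrt_lt_1_alt. split.
  - apply Rmult_le_pos; lra.
  - apply Rle_lt_trans with s; auto. nra.
Qed.

Lemma Cmod2 (z : C) : z * Cconj z = RtoC (Re z * Re z + Im z * Im z).
Proof. destruct z as [a b]. apply C_ext; simpl; ring. Qed.

Lemma inH_summable f : inH q zm zp c d f ->
  summable (fun x => mass x * (Re (f (pt x)) * Re (f (pt x))))%R /\
  summable (fun x => mass x * (Im (f (pt x)) * Im (f (pt x))))%R.
Proof.
  intros Hf.
  assert (P : forall x, (0 < Re (wtx x))%R) by (intros; apply wtx_posR).
  destruct (jackson_summable (fun x => f x * Cconj (f x) * weight q c d x)
    (fun x => (Re (f (pt x)) * Re (f (pt x)) + Im (f (pt x)) * Im (f (pt x))) * Re (wtx x))%R) as [s Hs].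
  - intros x. rewrite Cmod2, weight_wtx, (wtx_R x) at 1. now rewrite <- RtoC_mult.
  - intros x. specialize (P x). apply Rmult_le_pos; [|lra].
    assert (H1 := Rle_0_sqr (Re (f (pt x)))). assert (H2 := Rle_0_sqr (Im (f (pt x)))). unfold Rsqr in *. lra.
  - exact Hf.
  - assert (G : forall a b w : R, (0 <= w -> Rabs (w * (a * a)) <= w * (a * a + b * b))%R).
    { intros a b w Hw. assert (H1 := Rle_0_sqr a). assert (H2 := Rle_0_sqr b). unfold Rsqr in *.
      rewrite Rabs_pos_eq by now apply Rmult_le_pos. apply Rmult_le_compat_l; lra. }
    split; (eapply summable_le; [|exists s; apply Hs]); intros x; cbv beta;
      (eapply Rle_trans; [apply G; apply Rlt_le, mass_pos|]).
    + right. unfold mass. instantiate (1 := Im (f (pt x))). ring.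
    + right. unfold mass. instantiate (1 := Re (f (pt x))). ring.
Qed.

Lemma PQ_dense f eps : inH q zm zp c d f -> (0 < eps)%R -> exists l,
  (normH q zm zp c d (fun x => (f x - lincomb (PQ q zm zp c d) l x)%C) < eps)%R.
Proof.
  intros Hf He. destruct (inH_summable f Hf) as [Hu Hv].
  destruct ratio_R_bounded as [B HB].
  (* Half of the squared tolerance for each of the two parts of f. *)
  assert (He2 : (0 < eps * eps / 2)%R) by nra.
  destruct (dense mass basisR normR dualR B mass_pos normR_neq0 dualR_neq0 gram_R_orth gram_R_norm HB columns_R _ basisR_0
    (fun x => Re (f (pt x))) _ Hu He2) as (l1 & a & Ha & Hae).
  destruct (dense mass basisR normR dualR B mass_pos normR_neq0 dualR_neq0 gram_R_orth gram_R_norm HB columns_R _ basisR_0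
    (fun x => Im (f (pt x))) _ Hv He2) as (l2 & b & Hb & Hbe).
  exists (map (fun p : R * (nat + Z) => (1 * fst p / scale (snd p), snd p)) l1 ++ map (fun p : R * (nat + Z) => (Ci * fst p / scale (snd p), snd p)) l2).
  assert (Hab := has_sum_plus _ _ _ _ Ha Hb). cbv beta in Hab.
  eapply normH_lt with (s := (a + b)%R)
    (g := fun x => ((Re (f (pt x)) - rcomb basisR l1 x) * (Re (f (pt x)) - rcomb basisR l1 x) +
                    (Im (f (pt x)) - rcomb basisR l2 x) * (Im (f (pt x)) - rcomb basisR l2 x))%R); auto.
  - intros x. rewrite lincomb_app, !lincomb_PQ, Cmod2. f_equal.
    generalize (rcomb basisR l1 x) (rcomb basisR l2 x). destruct (f (pt x)) as [u v]. intros r1 r2. simpl. ring.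
  - eapply has_sum_ext; [|apply Hab]. intros x; cbv beta. ring.
  - eapply (has_sum_le (fun _ => 0%R)); [|apply has_sum_zero|apply Hab].
    intros x; cbv beta. assert (P := mass_pos x).
    apply Rplus_le_le_0_compat; (apply Rmult_le_pos; [lra|apply Rle_0_sqr]).
  - lra.
Qed.

Lemma PQ_basis : orthogonal_basis q zm zp c d (PQ q zm zp c d).
Proof.
  split; [|split; [|split]].
  - intros i. unfold inH. eapply jackson_sum with (s := scale i * scale i * normC i).
    assert (G := gram i i). destruct (cdec i i) as [_|]; [|congruence].
    eapply has_sumC_ext; [|apply has_sumC_scal, G].
    intros x; cbv beta. rewrite !PQ_scale, weight_wtx.
    rewrite (isR_conj (scale i * basis i x)) by (apply isR_mult; [apply isR_scale|apply isR_basis]). ring.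
  - intros i. rewrite inner_PQ. destruct (cdec i i) as [_|]; [|congruence].
    apply Cmult_neq_0; [apply one_minus_q_neq0|].
    apply Cmult_neq_0; [apply Cmult_neq_0; apply scale_neq0|apply normC_neq0].
  - intros i j Hne. rewrite inner_PQ. destruct (cdec i j); [contradiction|ring].
  - intros f Hf eps He. now apply PQ_dense.
Qed.

End Final.

End QAnalysis.

Theorem theorem3p18 (q zm zp : R) (c d : C)
    (hq : (0 < q < 1)%R) (hzm : (zm < 0)%R) (hzp : (0 < zp)%R)
    (hcd : positivity q zm zp c d) :
  orthogonal_basis q zm zp c d (PQ q zm zp c d) /\
  (forall m n : nat,
     let g := fun x : R => P q c d m x * P q c d n x * weight q c d x in
     ex_jackson q zm zp g /\
     1 / (1 - q) * jackson q zm zp g =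
       (if Nat.eq_dec m n then 1 else 0)
       * (qpoch q q n * (c * d) ^ n * powerRZ q (- (Z.of_nat n ^ 2)))
       * (zp * qpoch_inf q q * (theta (zm / zp) q * theta (c * d * zm * zp) q)
          / (theta (c * zm) q * theta (d * zm) q
             * theta (c * zp) q * theta (d * zp) q))) /\
  (forall m n : Z,
     let g := fun x : R =>
       Q q zm zp c d m x * Q q zm zp c d n x * weight q c d x in
     ex_jackson q zm zp g /\
     1 / (1 - q) * jackson q zm zp g =
       (if Z.eq_dec m n then 1 else 0)
       * (qpoch_inf (c * d * zm * zp * powerRZ q (- n - 1)) q
          / (Cpowz (- zm * zp) n * powerRZ q (n * (n + 1) / 2)))
       * (zp * qpoch_inf q q ^ 2 * theta (zm / zp) q)) /\
  (forall (m : nat) (n : Z),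
     let g := fun x : R =>
       P q c d m x * Q q zm zp c d n x * weight q c d x in
     ex_jackson q zm zp g /\
     1 / (1 - q) * jackson q zm zp g = 0).
Proof.
  assert (hadm := positivity_admissible q hq zm zp c d hzm hzp hcd).
  split; [|split; [|split]].
  - now apply PQ_basis.
  - intros m n g.
    assert (H := PQ_orthogonality q hq zm zp c d hzm hzp hadm (inl m) (inl n) _
      (fun _ => norm_P q hq zm zp c d hadm m)).
    destruct H as [H1 H2]. split; [exact H1|].
    etransitivity; [exact H2|].
    destruct (cdec (@inl nat Z m) (inl n)) as [E|E], (Nat.eq_dec m n) as [E'|E']; try congruence.
    + subst m. ring.
    + ring.
  - intros m n g.
    assert (H := PQ_orthogonality q hq zm zp c d hzm hzp hadm (inr m) (inr n) _
      (fun _ => norm_Q q hq zm zp c d hzm hzp hadm m)).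
    destruct H as [H1 H2]. split; [exact H1|].
    etransitivity; [exact H2|].
    destruct (cdec (@inr nat Z m) (inr n)) as [E|E], (Z.eq_dec m n) as [E'|E']; try congruence.
    + subst m. ring.
    + ring.
  - intros m n g.
    assert (H := PQ_orthogonality q hq zm zp c d hzm hzp hadm (inl m) (inr n) 0 ltac:(discriminate)).
    destruct H as [H1 H2]. split; [exact H1|].
    etransitivity; [exact H2|]. now destruct (cdec (@inl nat Z m) (inr n)).
Qed.
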